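(* Let $d>0$ and let $w$ be a weight function on $\mathcal{D}_d$ satisfying Assumptions (W1)–(W3) of the context. Suppose that for each positive integer $N$ the sampling points $a_{-N},\dots,a_N$ are obtained by the procedure described in the context, and that there are constants $c>0$ and $\lambda>0$, independent of $N$, such that the function $\tilde\nu_N$ obtained in that procedure satisfies $$\max_{x\in[-\tilde\alpha_N^\ast,\tilde\alpha_N^\ast]}|\tilde\nu_N(x)|\le c\,N^{\lambda}.$$ Then there are constants $C$ and $c'$, independent of $f$ and $N$, such that for all sufficiently large $N$ and every $f\in\boldsymbol{H}^\infty(\mathcal{D}_d,w)$, the approximation $\tilde f_N$ of $f$ defined in the context satisfies $$\sup_{x\in\mathbf{R}}|f(x)-\tilde f_N(x)|\le C\,\|f\|\,N^{c'}\exp(-\tilde K_N^\ast).$$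
   Context: $\mathcal{D}_d=\{z\in\mathbf{C}: |\operatorname{Im}z|<d\}$. $B(\mathcal{D}_d)$ is the set of functions $\zeta$ analytic in $\mathcal{D}_d$ with $\lim_{x\to\pm\infty}\int_{-d}^{d}|\zeta(x+\mathrm{i}y)|\,dy=0$ and $\lim_{y\to d-0}\int_{-\infty}^{\infty}(|\zeta(x+\mathrm{i}y)|+|\zeta(x-\mathrm{i}y)|)\,dx<\infty$. Assumptions on $w:\mathcal{D}_d\to\mathbf{C}$: (W1) $w\in B(\mathcal{D}_d)$, $w$ has no zero in $\mathcal{D}_d$, and $w$ takes positive real values on $\mathbf{R}$; (W2) $w$ is even on $\mathbf{R}$; (W3) $\log w$ is concave on $\mathbf{R}$. $\boldsymbol{H}^\infty(\mathcal{D}_d,w)$ is the space of functions $f$ analytic in $\mathcal{D}_d$ with $\|f\|:=\sup_{z\in\mathcal{D}_d}|f(z)/w(z)|<\infty$. The procedure, for given $d$, $w$, $N$: (1) $\tilde\alpha_N^\ast>0$ is the unique solution $\alpha$ of $$-\frac{1}{\pi d}\int_{-\alpha}^{\alpha}\frac{x\,w'(x)}{w(x)}\,dx-\frac{4(\pi\alpha+2d)}{\pi^3}\frac{w'(\alpha)}{w(\alpha)}=2(N+1),$$ and $$\tilde K_N^\ast=-\log w(\tilde\alpha_N^\ast)-\frac{2d}{\pi}\frac{w'(\tilde\alpha_N^\ast)}{w(\tilde\alpha_N^\ast)}.$$ (2) $\tilde\nu_N$ is the inverse Fourier transform (convention $\mathcal{F}[f](\omega)=\int_{-\infty}^\infty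 f(x)e^{-\mathrm{i}\omega x}dx$; $\tilde\nu_N$ is identified with its continuous representative) of the function given, with $\alpha=\tilde\alpha_N^\ast$, by $$\mathcal{F}[\tilde\nu_N](\omega)=\frac{1}{\mathrm{i}\pi\tanh(d\omega)}\int_{-\alpha}^{\alpha}\frac{w'(x)}{w(x)}e^{-\mathrm{i}\omega x}\,dx-\frac{4d}{\pi}\frac{w'(\alpha)}{w(\alpha)}\,\frac{\pi\sin(\alpha\omega)+2d\,\omega\cos(\alpha\omega)}{(\pi^2+4d^2\omega^2)\tanh(d\omega)}.$$ (3) $I[\tilde\nu_N](x)=\int_0^x\tilde\nu_N(t)\,dt$ for $x\in[-\tilde\alpha_N^\ast,\tilde\alpha_N^\ast]$. That the procedure can be carried out means that $I[\tilde\nu_N]$ is strictly increasing on $[-\tilde\alpha_N^\ast,\tilde\alpha_N^\ast]$ and its range contains $-N,\dots,N$. (4) $a_i=I[\tilde\nu_N]^{-1}(i)$ for $i=-N,\dots,N$. (5) The approximation of $f$ is $$\tilde f_N(x)=\sum_{j=-N}^{N}f(a_j)\,\frac{w(x)\prod_{-N\le i\le N,\,i\ne j}\tanh\left(\frac{\pi}{4d}(x-a_i)\right)}{w(a_j)\prod_{-N\le i\le N,\,i\ne j}\tanh\left(\frac{\pi}{4d}(a_j-a_i)\right)}\,\operatorname{sech}^2\left(\frac{\pi}{4d}(a_j-x)\right).$$ *)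

(* Defs.v *)
From HB Require Import structures.
From mathcomp Require Import all_boot all_order all_algebra.
From mathcomp Require Import all_classical all_reals all_analysis.
From mathcomp.real_closed Require Import complex.

Set Implicit Arguments.
Unset Strict Implicit.
Unset Printing Implicit Defensive.

Import Order.TTheory GRing.Theory Num.Theory.
Import numFieldNormedType.Exports.

Local Open Scope classical_set_scope.
Local Open Scope ring_scope.
Local Open Scope complex_scope.

(* The modulus with values in R; the norm of the numeric field R[i] is itself
   valued in R[i]. *)
Definition cabs (R : realType) (z : R[i]) : R := Normc.normc z.

Definition expi (R : realType) (t : R) : R[i] := cos t +i* sin t.

Definition tanh (R : realType) (x : R) : R :=
  (expR x - expR (- x)) / (expR x + expR (- x)).

Definition sech (R : realType) (x : R) : R := 2 / (expR x + expR (- x)).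

Definition Cintegral (R : realType) (D : set R) (f : R -> R[i]) : R[i] :=
  (\int[lebesgue_measure]_(x in D) complex.Re (f x))
  +i* (\int[lebesgue_measure]_(x in D) complex.Im (f x)).

(* The convention is F[f](omega) = \int f(x) exp(-i omega x) dx.  When g is
   integrable this is the continuous representative of its inverse Fourier
   transform. *)
Definition inv_fourier (R : realType) (g : R -> R[i]) (x : R) : R[i] :=
  ((2 * pi)^-1)%:C * Cintegral setT (fun omega => g omega * expi (omega * x)).

Definition primitive0 (R : realType) (f : R -> R) (x : R) : R :=
  if 0 <= x then \int[lebesgue_measure]_(t in `[0, x]) f t
  else - \int[lebesgue_measure]_(t in `[x, 0]) f t.

Definition strip (R : realType) (d : R) : set R[i] :=
  [set z | `|complex.Im z| < d].

(* R[i]^o is the complex line as a normed space over R[i], so that derivable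
   means complex differentiable. *)
Definition analytic_on (R : realType) (D : set R[i]) (f : R[i] -> R[i]) :
    Prop :=
  forall z, D z -> derivable (f : R[i]^o -> R[i]^o) z 1.

Definition class_B (R : realType) (d : R) (zeta : R[i] -> R[i]) : Prop :=
  let vertical x :=
    (\int[lebesgue_measure]_(y in `](- d)%R, d[)
       (cabs (zeta (x +i* y)%C))%:E)%E in
  let horizontal y :=
    (\int[lebesgue_measure]_x
       (cabs (zeta (x +i* y)%C) + cabs (zeta (x -i* y)%C))%:E)%E in
  [/\ analytic_on (strip d) zeta,
      vertical x @[x --> +oo%R] --> 0%E,
      vertical x @[x --> -oo%R] --> 0%E
    & exists l : R, horizontal y @[y --> d^'-] --> l%:E].

(* A weight is positive, hence real, on the real line (see weightP). *)
Definition realw (R : realType) (w : R[i] -> R[i]) (x : R) : R :=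
  complex.Re (w x%:C).

Definition dlog (R : realType) (w : R[i] -> R[i]) (x : R) : R :=
  derive1 (realw w) x / realw w x.

Definition weight (R : realType) (d : R) (w : R[i] -> R[i]) : Prop :=
  [/\ [/\ class_B d w, forall z, strip d z -> w z != 0
        & forall x : R, 0 < w x%:C],
      forall x : R, w (- x)%:C = w x%:C
    & convex_function [set: R^o] (fun x : R^o => - ln (realw w x))].

Lemma weightP (R : realType) (d : R) (w : R[i] -> R[i]) (x : R) :
  weight d w -> w x%:C = (realw w x)%:C /\ 0 < realw w x.
Proof.
move=> [[_ _ /(_ x) w_gt0] _ _]; rewrite /realw.
by case: (w _) w_gt0 => u v /andP[/eqP/= -> u_gt0].
Qed.

Definition hardy_norm (R : realType) (d : R) (w f : R[i] -> R[i]) : \bar R :=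
  ereal_sup [set (cabs (f z / w z))%:E | z in strip d].

Definition hardy_space (R : realType) (d : R) (w f : R[i] -> R[i]) : Prop :=
  analytic_on (strip d) f /\ (hardy_norm d w f < +oo)%E.

Definition alpha_equation (R : realType) (d : R) (w : R[i] -> R[i]) (N : nat)
    (alpha : R) : Prop :=
  - (pi * d)^-1 * (\int[lebesgue_measure]_(x in `[- alpha, alpha])
                     (x * dlog w x))
  - 4 * (pi * alpha + 2 * d) / pi ^+ 3 * dlog w alpha = 2 * N.+1%:R.

Definition Kstar (R : realType) (d : R) (w : R[i] -> R[i]) (alpha : R) : R :=
  - ln (realw w alpha) - 2 * d / pi * dlog w alpha.

Definition nu_hat (R : realType) (d : R) (w : R[i] -> R[i]) (alpha : R)
    (omega : R) : R[i] :=
  ('i%C * (pi * tanh (d * omega))%:C)^-1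
    * Cintegral `[- alpha, alpha]
        (fun x => (dlog w x)%:C * expi (- (omega * x)))
  - (4 * d / pi * dlog w alpha
     * ((pi * sin (alpha * omega) + 2 * d * omega * cos (alpha * omega))
        / ((pi ^+ 2 + 4 * d ^+ 2 * omega ^+ 2) * tanh (d * omega))))%:C.

(* The procedure can be carried out for N and yields alpha, nu and the
   sampling points a (-N), ..., a N.  The other values of a are irrelevant. *)
Record procedure (R : realType) (d : R) (w : R[i] -> R[i]) (N : nat)
    (alpha : R) (nu : R -> R) (a : int -> R) : Prop := Procedure {
  proc_alpha : unique (fun b => 0 < b /\ alpha_equation d w N b) alpha;
  proc_nu : forall x, (nu x)%:C = inv_fourier (nu_hat d w alpha) x;
  proc_incr : {in `[- alpha, alpha] &, {homo primitive0 nu : x y / x < y}};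
  proc_range : forall i : int, - N%:Z <= i <= N%:Z ->
    exists2 x, x \in `[- alpha, alpha] & primitive0 nu x = i%:~R;
  proc_points : forall i : int, - N%:Z <= i <= N%:Z ->
    a i \in `[- alpha, alpha] /\ primitive0 nu (a i) = i%:~R }.

(* Indices j in -N .. N are encoded as k - N with k in 'I_(2 N + 1). *)
Definition sampling_point (R : realType) (N : nat) (a : int -> R)
    (k : 'I_(N.*2.+1)) : R := a (k%:Z - N%:Z).

Definition approximant (R : realType) (d : R) (w : R[i] -> R[i]) (N : nat)
    (a : int -> R) (f : R[i] -> R[i]) (x : R) : R[i] :=
  \sum_(j < N.*2.+1)
    f (sampling_point a j)%:C
    * ((w x%:C * (\prod_(i < N.*2.+1 | i != j)
                    tanh (pi / (4 * d) * (x - sampling_point a i)))%:C)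
       / (w (sampling_point a j)%:C
          * (\prod_(i < N.*2.+1 | i != j)
               tanh (pi / (4 * d)
                     * (sampling_point a j - sampling_point a i)))%:C))
    * (sech (pi / (4 * d) * (sampling_point a j - x)) ^+ 2)%:C.

(* Main.v *)
Require Import Defs.
From mathcomp Require Import all_boot all_order all_algebra.
From mathcomp Require Import all_classical all_reals all_analysis.
From mathcomp.real_closed Require Import complex.
From mathcomp Require Import measurable_realfun.
From mathcomp Require Import ring lra zify.

(* Put q = - ln w on R, a = pi / (2 d), and let u be q(alpha) - q + B on
   [- alpha, alpha], continued by B exp (- a (|x| - alpha)), where
   B = q'(alpha) / a; by convexity u + q >= Kstar everywhere.  The function nu is
   the charge whose potential for the kernel - ln |tanh (a x / 2)| is u: this
   follows from its Fourier transform and the transforms of 1 / sinh (a x) and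
   1 / sinh (a x) ^ 2.  The second gives nu as an integral of second differences
   of u, which shows that 0 <= nu <= nu (alpha) off [- alpha, alpha]; and
   alpha_equation says that the total mass of nu is 2 (N + 1).  Since a_i is the
   point where the primitive of nu is i, an interval of nu-mass m contains at
   least m - 1 nodes, hence u (x) exceeds the potential of the nodes by at most
   2 c + O (log N).  On the other hand f / w minus its interpolant, divided by
   b = prod_i tanh (a (x - a_i) / 2), agrees on R with a harmonic function on the
   strip whose boundary values have modulus at most ||f||: there |b| = 1, and the
   interpolant contributes nothing.  So the error is at most
   ||f|| w |b| = ||f|| exp (- q - potential of the nodes). *)

Set Implicit Arguments.
Unset Strict Implicit.
Unset Printing Implicit Defensive.
Import Order.TTheory GRing.Theory Num.Theory.
Import numFieldNormedType.Exports.
Local Open Scope classical_set_scope.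
Local Open Scope ring_scope.
Local Open Scope complex_scope.

Arguments cabs : simpl never.
Arguments Cintegral : simpl never.

(** * Complex derivatives *)

Section Cabs.
Variable R : realType.
Implicit Types z w h : R[i].

(** The kernel [- ln |tanh (a x / 2)|] is the trace on R of the Green function of the strip. This
    dictates the rate of the tail of u: since [a d = pi / 2], the real part of [exp (- a (x + i y))]
    is harmonic and vanishes on the boundary. The value of B makes u continuously differentiable at
    alpha, so its transform is [O(omega ^ -3)] and all inversions converge absolutely, even after
    multiplication by [omega / tanh (d omega)]. The hypothesis bounds nu on [[- alpha, alpha]] only,
    whereas nodes and charge are compared in windows around any x; hence the need for the sign and
    size of nu outside. The potential is integrated by parts, so that only masses of windows
    [[x - s, x + s]], weighted by [1 / sinh (a s)], are compared. This weight is not integrable at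
    0, where the one missing node is replaced by the bound on nu; a cut at [N ^ - lambda] makes this
    cost bounded and the remaining one O(log N). Near the boundary f / w need not have limits: the
    harmonic function is bounded on rectangles inside the strip, and the maximum principle is
    replaced by a Cauchy estimate for [exp (m A)] whose constant does not depend on m. *)

Lemma cabs_norm z : `|z| = (cabs z)%:C.
Proof. by rewrite normc_def /cabs; case: z. Qed.

Lemma cabs0 : cabs (0 : R[i]) = 0. Proof. by rewrite /cabs Normc.normc0. Qed.

Lemma cabs1 : cabs (1 : R[i]) = 1. Proof. by rewrite /cabs Normc.normc1. Qed.

Lemma cabs_ge0 z : 0 <= cabs z.
Proof. by rewrite -ler0c -cabs_norm. Qed.

Lemma cabsM z w : cabs (z * w) = cabs z * cabs w.
Proof. exact: Normc.normcM. Qed.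

Lemma cabsX z n : cabs (z ^+ n) = cabs z ^+ n.
Proof. by elim: n => [|n IH]; rewrite ?cabs1// !exprS cabsM IH. Qed.

Lemma cabsV z : cabs z^-1 = (cabs z)^-1.
Proof. exact: Normc.normcV. Qed.

Lemma cabsN z : cabs (- z) = cabs z.
Proof. exact: normcN. Qed.

Lemma cabsB z w : cabs (z - w) = cabs (w - z).
Proof. by rewrite -cabsN opprB. Qed.

Lemma cabsD z w : cabs (z + w) <= cabs z + cabs w.
Proof. exact: le_normcD. Qed.

Lemma cabsBD z w : cabs (z - w) <= cabs z + cabs w.
Proof. by rewrite -(cabsN w) cabsD. Qed.

Lemma cabs_sub z w : cabs z - cabs w <= cabs (z - w).
Proof. by rewrite lerBlDr -{1}(subrK w z) cabsD. Qed.

Lemma cabs_dist z w : `|cabs z - cabs w| <= cabs (z - w).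
Proof. by rewrite ler_norml cabs_sub andbT lerNl opprB cabsB cabs_sub. Qed.

Lemma cabs_eq0 z : (cabs z == 0) = (z == 0).
Proof. apply/idP/idP => [/eqP/Normc.eq0_normc ->//|/eqP ->].
by apply/eqP; exact: cabs0. Qed.

Lemma cabs_gt0 z : (0 < cabs z) = (z != 0).
Proof. by rewrite lt_def cabs_ge0 andbT cabs_eq0. Qed.

Lemma cabs_real (x : R) : cabs x%:C = `|x|.
Proof. by rewrite /cabs/= expr0n/= addr0 sqrtr_sqr. Qed.

Lemma cabs_nat n : cabs (n%:R : R[i]) = n%:R.
Proof. by rewrite -(rmorph_nat (real_complex R)) cabs_real normr_nat. Qed.

Lemma cabs_i : cabs ('i%C : R[i]) = 1.
Proof. by rewrite /cabs/= expr0n/= add0r expr1n sqrtr1. Qed.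

Lemma sqr_cabs z : cabs z ^+ 2 = complex.Re z ^+ 2 + complex.Im z ^+ 2.
Proof. by case: z => x y; rewrite /cabs sqr_sqrtr// addr_ge0 ?sqr_ge0. Qed.

Lemma le_Re_cabs z : `|complex.Re z| <= cabs z.
Proof.
rewrite -(@ler_pXn2r _ 2)// ?nnegrE ?cabs_ge0// sqr_cabs real_normK ?num_real//.
by rewrite lerDl sqr_ge0.
Qed.

Lemma le_Im_cabs z : `|complex.Im z| <= cabs z.
Proof.
rewrite -(@ler_pXn2r _ 2)// ?nnegrE ?cabs_ge0// sqr_cabs real_normK ?num_real//.
by rewrite lerDr sqr_ge0.
Qed.

Lemma cabs_le z : cabs z <= `|complex.Re z| + `|complex.Im z|.
Proof.
rewrite -(@ler_pXn2r _ 2)// ?nnegrE ?cabs_ge0 ?addr_ge0//.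
rewrite sqr_cabs sqrrD !real_normK ?num_real//.
by rewrite -addrA lerD2l lerDr mulrn_wge0 ?mulr_ge0.
Qed.

Lemma Re_mulc z w : complex.Re (z * w) =
  complex.Re z * complex.Re w - complex.Im z * complex.Im w.
Proof. by case: z => a b; case: w. Qed.

Lemma Im_mulc z w : complex.Im (z * w) =
  complex.Re z * complex.Im w + complex.Im z * complex.Re w.
Proof. by case: z => a b; case: w. Qed.

Lemma Re_realM (x : R) z : complex.Re (x%:C * z) = x * complex.Re z.
Proof. by rewrite Re_mulc mul0r subr0. Qed.

Lemma Im_realM (x : R) z : complex.Im (x%:C * z) = x * complex.Im z.
Proof. by rewrite Im_mulc mul0r addr0. Qed.

Lemma Re_addc z w : complex.Re (z + w) = complex.Re z + complex.Re w.
Proof. by case: z => a b; case: w. Qed.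

Lemma Im_addc z w : complex.Im (z + w) = complex.Im z + complex.Im w.
Proof. by case: z => a b; case: w. Qed.

Lemma Re_oppc z : complex.Re (- z) = - complex.Re z.
Proof. by case: z. Qed.

Lemma Im_oppc z : complex.Im (- z) = - complex.Im z.
Proof. by case: z. Qed.

Lemma complex_ext z w : complex.Re z = complex.Re w -> complex.Im z = complex.Im w ->
  z = w.
Proof. by case: z => a b; case: w => c e /= -> ->. Qed.

End Cabs.

Section Holomorphic.
Variable R : realType.
Local Notation C := (R[i]^o).

(** An explicit epsilon-delta form, because the norm of [R[i]] takes complex values whereas all
    estimates are made with the real modulus [cabs]. *)
Definition ccont (f : R[i] -> R[i]) (z : R[i]) : Prop :=
  forall e : R, 0 < e -> exists2 del : R, 0 < del &
    forall w, cabs (w - z) < del -> cabs (f w - f z) < e.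

Lemma ccont_cst k z : ccont (fun=> k) z.
Proof. by move=> e e0; exists 1 => // w _; rewrite subrr cabs0. Qed.

Lemma ccont_id z : ccont id z.
Proof. by move=> e e0; exists e. Qed.

Lemma ccont2 f g z e e' : 0 < e -> 0 < e' -> ccont f z -> ccont g z ->
  exists2 del : R, 0 < del & forall w, cabs (w - z) < del ->
    cabs (f w - f z) < e /\ cabs (g w - g z) < e'.
Proof.
move=> e0 e'0 /(_ e e0)[d1 d10 H1] /(_ e' e'0)[d2 d20 H2].
exists (Num.min d1 d2); first by rewrite lt_min d10.
by move=> w; rewrite lt_min => /andP[/H1 ? /H2 ?].
Qed.

Lemma ccontD f g z : ccont f z -> ccont g z -> ccont (fun w => f w + g w) z.
Proof.
move=> cf cg e e0; have e2 : 0 < e / 2 by rewrite divr_gt0.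
have [d d0 H] := ccont2 e2 e2 cf cg; exists d => // w /H[h1 h2].
have -> : f w + g w - (f z + g z) = (f w - f z) + (g w - g z) by ring.
by apply: le_lt_trans (cabsD _ _) _; lra.
Qed.

Lemma ccontM f g z : ccont f z -> ccont g z -> ccont (fun w => f w * g w) z.
Proof.
move=> cf cg e e0.
set A := cabs (f z); set B := cabs (g z).
have A0 : 0 <= A := cabs_ge0 _; have B0 : 0 <= B := cabs_ge0 _.
have k0 : 0 < Num.min 1 (e / (2 + A + B)).
  by rewrite lt_min ltr01 divr_gt0//; lra.
have [d d0 H] := ccont2 k0 k0 cf cg; exists d => // w /H[].
rewrite !lt_min => /andP[h1 h2] /andP[h3 h4].
have -> : f w * g w - f z * g z =
  (f w - f z) * (g w - g z) + (f z * (g w - g z) + (f w - f z) * g z) by ring.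
apply: le_lt_trans (cabsD _ _) _.
apply: le_lt_trans (lerD (lexx _) (cabsD _ _)) _; rewrite !cabsM -/A -/B.
have := cabs_ge0 (f w - f z); have := cabs_ge0 (g w - g z).
move: h1 h2 h3 h4; set u := cabs _; set v := cabs _ => h1 h2 h3 h4 v0 u0.
set k := e / _ in h2 h4; have ke : k * (2 + A + B) = e.
  by rewrite /k mulfVK// gt_eqF//; lra.
have k00 : 0 < k by rewrite divr_gt0//; lra.
have h5 : u * v <= k.
  by apply: le_trans (ltW h4); rewrite ler_piMl// ltW.
have h6 : A * v <= A * k by rewrite ler_wpM2l// ltW.
have h7 : u * B <= k * B by rewrite ler_wpM2r// ltW.
nra.
Qed.

Lemma ccontV f z : f z != 0 -> ccont f z -> ccont (fun w => (f w)^-1) z.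
Proof.
move=> fz0 cf e e0.
have A0 : 0 < cabs (f z) by rewrite cabs_gt0.
set A := cabs (f z) in A0.
have A2 : 0 < A / 2 by rewrite divr_gt0.
have k0 : 0 < e * A * A / 2 by rewrite divr_gt0// !mulr_gt0.
have [d d0 H] := ccont2 k0 A2 cf cf; exists d => // w /H[h1 h2].
have h3 : A / 2 < cabs (f w).
  have := cabs_sub (f z) (f w); rewrite cabsB -/A => h.
  by have := le_lt_trans h h2; lra.
have fw0 : f w != 0 by rewrite -cabs_gt0; apply: lt_trans h3.
have -> : (f w)^-1 - (f z)^-1 = - ((f w - f z) * (f w * f z)^-1).
  by field; rewrite fz0.
rewrite cabsN cabsM cabsV cabsM -/A ltr_pdivrMr; last by rewrite mulr_gt0// (lt_trans A2).
apply: lt_le_trans h1 _; rewrite -mulrA -(mulrA e); apply: ler_wpM2l; first exact: ltW.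
rewrite [in leRHS]mulrC; apply: ler_wpM2l; [exact: ltW|exact: ltW].
Qed.

Lemma ccont_comp f g z : ccont f z -> ccont g (f z) -> ccont (fun w => g (f w)) z.
Proof.
move=> cf cg e /cg[d1 d10 H1]; have [d d0 H] := cf _ d10.
by exists d => // w /H /H1.
Qed.

(* Caratheodory's form of "f has complex derivative l at z" *)
Definition hder (f : R[i] -> R[i]) (z l : R[i]) : Prop :=
  exists phi, [/\ forall w, f w = f z + phi w * (w - z), phi z = l &
    ccont phi z].

Lemma hder_cont f z l : hder f z l -> ccont f z.
Proof.
case=> phi [fE _ cphi].
have -> : f = (fun w => f z + phi w * (w - z)) by apply/funext => w; exact: fE.
apply: ccontD; first exact: ccont_cst.
apply: ccontM => //; apply: ccontD; [exact: ccont_id|exact: ccont_cst].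
Qed.

Lemma hderP f z l : hder f z l <->
  forall e : R, 0 < e -> exists2 del : R, 0 < del &
    forall w, cabs (w - z) < del ->
      cabs (f w - f z - l * (w - z)) <= e * cabs (w - z).
Proof.
split=> [[phi [fE pz cphi]] e e0|H].
  have [del del0 Hd] := cphi e e0.
  exists del => // w hw;
  have -> : f w - f z - l * (w - z) = (phi w - phi z) * (w - z).
    by rewrite fE pz; ring.
  by rewrite cabsM ler_wpM2r ?cabs_ge0// ltW// Hd.
exists (fun w => if w == z then l else (f w - f z) / (w - z)); split.
- move=> w; case: eqVneq => [->|wz]; first by rewrite subrr mulr0 addr0.
  by rewrite mulfVK ?subr_eq0// addrC subrK.
- by rewrite eqxx.
- move=> e e0; have [|del del0 Hd] := H (e / 2); first by rewrite divr_gt0.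
  exists del => // w hw; rewrite eqxx; case: eqVneq => [_|wz].
    by rewrite subrr cabs0.
  have wz' : w - z != 0 by rewrite subr_eq0.
  have -> : (f w - f z) / (w - z) - l = (f w - f z - l * (w - z)) / (w - z).
    by field.
  rewrite cabsM cabsV ltr_pdivrMr ?cabs_gt0//.
  apply: le_lt_trans (Hd _ hw) _.
  rewrite ltr_pM2r ?cabs_gt0//; lra.
Qed.

Lemma derivable_hder (f : R[i] -> R[i]) z :
  derivable (f : C -> C) z 1 -> exists l, hder f z l.
Proof.
move=> /cvg_ex[/= l] /cvgrPdist_le Hl; exists l; apply/hderP => e e0.
have e0' : 0 < e%:C by rewrite ltcR.
have /nbhs_ballP[/= -[d d'] /=] := Hl _ e0'.
rewrite ltcE/= => /andP[/eqP -> d0] Hd; exists d => // w hw.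
case: (eqVneq w z) => [->|wz]; first by rewrite !subrr mulr0 subr0 cabs0 mulr0.
have wz' : w - z != 0 by rewrite subr_eq0.
have := Hd (w - z); rewrite /ball/= sub0r normrN cabs_norm ltcR => /(_ hw wz').
rewrite /GRing.scale/= mulr1 subrK cabs_norm lecR.
have -> : l - (w - z)^-1 * (f w - f z) =
  - ((f w - f z - l * (w - z)) / (w - z)) by field.
by rewrite cabsN cabsM cabsV ler_pdivrMr// cabs_gt0.
Qed.

Lemma hder_cst k z : hder (fun=> k) z 0.
Proof. by exists (fun=> 0); split=> // [w|]; [rewrite mul0r addr0|exact: ccont_cst]. Qed.

Lemma hder_id z : hder id z 1.
Proof.
exists (fun=> 1); split=> // [w|]; last exact: ccont_cst.
by rewrite mul1r addrC subrK.
Qed.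

Lemma hder_eq f z l l' : hder f z l -> l = l' -> hder f z l'.
Proof. by move=> h <-. Qed.

Lemma hderD f g z a b : hder f z a -> hder g z b ->
  hder (fun w => f w + g w) z (a + b).
Proof.
move=> [p [fE pz cp]] [q [gE qz cq]]; exists (fun w => p w + q w); split.
- by move=> w; rewrite fE gE; ring.
- by rewrite pz qz.
- exact: ccontD.
Qed.

Lemma hderM f g z a b : hder f z a -> hder g z b ->
  hder (fun w => f w * g w) z (a * g z + f z * b).
Proof.
move=> hf [q [gE qz cq]]; have cf := hder_cont hf; case: hf => p [fE pz cp].
exists (fun w => p w * g z + f w * q w); split.
- by move=> w; rewrite gE mulrDr {1}fE; ring.
- by rewrite pz qz.
- by apply: ccontD; apply: ccontM => //; exact: ccont_cst.
Qed.

Lemma hderV f z a : f z != 0 -> hder f z a ->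
  hder (fun w => (f w)^-1) z (- a / f z ^+ 2).
Proof.
move=> fz0 hf; have cf := hder_cont hf; case: hf => p [fE pz cp].
(* Caratheodory's factorization must hold for every w, including the zeros of f, where [(f w)^-1] is
   the default value 0; the first branch is the bare difference quotient there and is never met near
   z. *)
pose q w := if f w == 0 then ((f w)^-1 - (f z)^-1) / (w - z)
            else - p w * ((f w)^-1 * (f z)^-1).
exists q; split.
- move=> w; rewrite /q; case: eqVneq => [fw0|fw0].
    have wz : w != z by apply: contraNneq fz0 => <-; rewrite fw0.
    by rewrite mulfVK ?subr_eq0// addrC subrK.
  have -> : - p w * ((f w)^-1 / f z) * (w - z) =
    - (f z + p w * (w - z) - f z) * ((f w)^-1 / f z) by ring.
  by rewrite -fE; field; rewrite fw0 fz0.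
- by rewrite /q (negbTE fz0) pz; field.
- have c1 : ccont (fun w => - p w * ((f w)^-1 * (f z)^-1)) z.
    apply: ccontM.
      have -> : (fun w => - p w) = (fun w => -1 * p w).
        by apply/funext => w; rewrite mulN1r.
      by apply: ccontM => //; exact: ccont_cst.
    by apply: ccontM; [exact: ccontV|exact: ccont_cst].
  move=> e e0; have [d1 d10 H1] := c1 e e0.
  have fz1 : 0 < cabs (f z) by rewrite cabs_gt0.
  have [d2 d20 H2] := cf _ fz1.
  exists (Num.min d1 d2); first by rewrite lt_min d10.
  move=> w; rewrite lt_min => /andP[w1 w2]; rewrite /q (negbTE fz0).
  have fw0 : f w != 0.
    apply/eqP => fw0; have := H2 _ w2.
    by rewrite fw0 sub0r cabsN ltxx.
  by rewrite (negbTE fw0); exact: H1.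
Qed.

Lemma hder_comp f g z a b : hder f z a -> hder g (f z) b ->
  hder (fun w => g (f w)) z (b * a).
Proof.
move=> hf [q [gE qz cq]]; have cf := hder_cont hf; case: hf => p [fE pz cp].
exists (fun w => q (f w) * p w); split.
- by move=> w; rewrite gE [in X in _ * X]fE; ring.
- by rewrite pz qz.
- by apply: ccontM => //; exact: (ccont_comp cf cq).
Qed.

Lemma hderZ k f z a : hder f z a -> hder (fun w => k * f w) z (k * a).
Proof.
by move=> hf; apply: hder_eq (hderM (hder_cst k z) hf) _; rewrite mul0r add0r.
Qed.

Lemma hderN f z a : hder f z a -> hder (fun w => - f w) z (- a).
Proof.
move=> /(hderZ (-1)); rewrite mulN1r.
by have -> : (fun w => -1 * f w) = (fun w => - f w)
  by apply/funext => w; rewrite mulN1r.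
Qed.

Lemma hderB f g z a b : hder f z a -> hder g z b ->
  hder (fun w => f w - g w) z (a - b).
Proof. by move=> hf hg; apply: hderD => //; exact: hderN. Qed.

Lemma hderX f z a n : hder f z a ->
  hder (fun w => f w ^+ n) z (n%:R * f z ^+ n.-1 * a).
Proof.
move=> hf; elim: n => [|n IH]; first by rewrite !mul0r; exact: hder_cst.
have -> : (fun w => f w ^+ n.+1) = (fun w => f w * f w ^+ n).
  by apply/funext => w; rewrite exprS.
apply: hder_eq (hderM hf IH) _; case: n {IH} => [|n] /=.
  by rewrite !expr0; ring.
by rewrite [in RHS]exprS -[n.+2]addn1 natrD exprS; ring.
Qed.

Lemma near_hder f g z a (del : R) : 0 < del ->
  (forall w, cabs (w - z) < del -> f w = g w) -> hder f z a -> hder g z a.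
Proof.
move=> del0 fg /hderP H; apply/hderP => e e0; have [d d0 Hd] := H e e0.
exists (Num.min d del); first by rewrite lt_min d0.
move=> w; rewrite lt_min => /andP[w1 w2]; rewrite -!fg ?subrr ?cabs0//.
exact: Hd.
Qed.

End Holomorphic.

(** * Contour integrals *)

Section ComplexIntegral.
Variable R : realType.
Local Notation mu := (@lebesgue_measure R).
Implicit Types (a b c : R) (g h : R -> R[i]) (D : set R).

Definition cintegrable D g : Prop :=
  mu.-integrable D (EFin \o (fun x => complex.Re (g x))) /\
  mu.-integrable D (EFin \o (fun x => complex.Im (g x))).

Lemma eq_Cintegral D g h : (forall x, D x -> g x = h x) ->
  Cintegral D g = Cintegral D h.
Proof.
by move=> gh; rewrite /Cintegral; congr (_ +i* _); apply: eq_Rintegral => x;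
  rewrite inE => /gh ->.
Qed.

Lemma cintegrableD D g h : measurable D -> cintegrable D g -> cintegrable D h ->
  cintegrable D (fun x => g x + h x).
Proof.
move=> mD [g1 g2] [h1 h2]; split.
  have -> : (EFin \o (fun x => complex.Re (g x + h x))) =
    (fun x => (EFin \o (fun x => complex.Re (g x))) x +
              (EFin \o (fun x => complex.Re (h x))) x)%E.
    by apply/funext => x /=; rewrite Re_addc.
  exact: integrableD.
have -> : (EFin \o (fun x => complex.Im (g x + h x))) =
  (fun x => (EFin \o (fun x => complex.Im (g x))) x +
            (EFin \o (fun x => complex.Im (h x))) x)%E.
  by apply/funext => x /=; rewrite Im_addc.
exact: integrableD.
Qed.

Lemma integrable_lin2 D (k l : R) (u v : R -> R) : measurable D ->
  mu.-integrable D (EFin \o u) -> mu.-integrable D (EFin \o v) ->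
  mu.-integrable D (EFin \o (fun x => k * u x + l * v x)).
Proof.
move=> mD iu iv.
have -> : EFin \o (fun x => k * u x + l * v x) =
  (fun x => k%:E * (EFin \o u) x + l%:E * (EFin \o v) x)%E.
  by apply/funext => x.
by apply: integrableD => //; exact: integrableZl.
Qed.

Lemma Rintegral_lin2 D (k l : R) (u v : R -> R) : measurable D ->
  mu.-integrable D (EFin \o u) -> mu.-integrable D (EFin \o v) ->
  \int[mu]_(x in D) (k * u x + l * v x) =
  k * \int[mu]_(x in D) u x + l * \int[mu]_(x in D) v x.
Proof.
move=> mD iu iv.
have iku : mu.-integrable D (EFin \o (fun x => k * u x)).
  have -> : EFin \o (fun x => k * u x) = (fun x => k%:E * (EFin \o u) x)%E.
    by apply/funext => x.
  exact: integrableZl.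
have ilv : mu.-integrable D (EFin \o (fun x => l * v x)).
  have -> : EFin \o (fun x => l * v x) = (fun x => l%:E * (EFin \o v) x)%E.
    by apply/funext => x.
  exact: integrableZl.
by rewrite RintegralD// !RintegralZl.
Qed.

Lemma CintegralD D g h : measurable D -> cintegrable D g -> cintegrable D h ->
  Cintegral D (fun x => g x + h x) = Cintegral D g + Cintegral D h.
Proof.
move=> mD [g1 g2] [h1 h2]; rewrite /Cintegral; apply: complex_ext => /=.
  by rewrite -RintegralD//; apply: eq_Rintegral => x _; rewrite Re_addc.
by rewrite -RintegralD//; apply: eq_Rintegral => x _; rewrite Im_addc.
Qed.

Lemma cintegrableZ D (k : R[i]) g : measurable D -> cintegrable D g ->
  cintegrable D (fun x => k * g x).
Proof.
move=> mD [g1 g2]; split.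
  have := integrable_lin2 (complex.Re k) (- complex.Im k) mD g1 g2.
  by under eq_fun do rewrite mulNr -Re_mulc.
have := integrable_lin2 (complex.Re k) (complex.Im k) mD g2 g1.
by under eq_fun do rewrite -Im_mulc.
Qed.

Lemma CintegralZ D (k : R[i]) g : measurable D -> cintegrable D g ->
  Cintegral D (fun x => k * g x) = k * Cintegral D g.
Proof.
move=> mD [g1 g2]; rewrite /Cintegral; apply: complex_ext => /=.
  under eq_Rintegral do rewrite Re_mulc -mulNr.
  by rewrite Rintegral_lin2//= Re_mulc/= mulNr.
under eq_Rintegral do rewrite Im_mulc.
by rewrite Rintegral_lin2//= Im_mulc/=.
Qed.

Lemma Rintegral_cat (u : R -> R) a b c : a <= c -> c <= b ->
  mu.-integrable `[a, b] (EFin \o u) ->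
  \int[mu]_(x in `[a, b]) u x =
  \int[mu]_(x in `[a, c]) u x + \int[mu]_(x in `[c, b]) u x.
Proof.
move=> ac cb iu; have := @Rintegral_itvB _ u (BLeft a) (BRight b) c iu.
rewrite !bnd_simp => /(_ ac cb) /eqP; rewrite subr_eq => /eqP ->.
rewrite addrC; congr (_ + _); rewrite Rintegral_itv_obnd_cbnd//.
apply: integrableS iu => //.
move=> x /=; rewrite !in_itv/= => /andP[cx ->].
by rewrite (ltW (le_lt_trans ac cx)).
Qed.

Lemma Cintegral_cat a b c g : a <= c -> c <= b -> cintegrable `[a, b] g ->
  Cintegral `[a, b] g = Cintegral `[a, c] g + Cintegral `[c, b] g.
Proof.
by move=> ac cb [g1 g2]; rewrite /Cintegral; apply: complex_ext => /=;
  exact: Rintegral_cat.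
Qed.

Lemma Rintegral_cst_segment a b (k : R) : a <= b ->
  \int[mu]_(x in `[a, b]) k = k * (b - a).
Proof.
move=> ab; rewrite Rintegral_cst//= lebesgue_measure_itv/= lte_fin.
by case: ltgtP ab => // ->; rewrite subrr mulr0.
Qed.

Lemma abs_Rintegral_le a b (u : R -> R) M : a <= b ->
  mu.-integrable `[a, b] (EFin \o u) ->
  (forall x, a <= x <= b -> `|u x| <= M) ->
  `|\int[mu]_(x in `[a, b]) u x| <= M * (b - a).
Proof.
move=> ab iu uM; apply: le_trans (le_normr_Rintegral _ iu) _ => //.
have icst : mu.-integrable `[a, b] (EFin \o (fun=> M)).
  apply: continuous_compact_integrable; first exact: segment_compact.
  by move=> x; exact: cvg_cst.
have -> : M * (b - a) = \int[mu]_(x in `[a, b]) M.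
  by rewrite Rintegral_cst_segment.
apply: le_Rintegral => //.
have -> : (EFin \o (fun t => `|u t|)) = abse \o (EFin \o u) by [].
exact: integrable_abse.
Qed.

(** The factor 2 comes from bounding real and imaginary parts separately; sharp constants never
    matter for contour integrals here. *)
Lemma cabs_Cintegral_le a b g M : a <= b -> cintegrable `[a, b] g ->
  (forall x, a <= x <= b -> cabs (g x) <= M) ->
  cabs (Cintegral `[a, b] g) <= 2 * M * (b - a).
Proof.
move=> ab [g1 g2] gM; apply: le_trans (cabs_le _) _.
rewrite /Cintegral /= -mulrA mulr2n mulrDl !mul1r.
by apply: lerD; apply: abs_Rintegral_le => // x xab; apply: le_trans (gM _ xab);
  [exact: le_Re_cabs|exact: le_Im_cabs].
Qed.

Lemma continuous_integrable a b (u : R -> R) :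
  (forall x, a <= x <= b -> {for x, continuous u}) ->
  mu.-integrable `[a, b] (EFin \o u).
Proof.
move=> cu; apply: continuous_compact_integrable; first exact: segment_compact.
apply: continuous_in_subspaceT => x; rewrite inE /= in_itv /= => xab.
exact: cu.
Qed.

Lemma is_derive_continuous (F : R -> R) (x l : R) :
  is_derive x 1 F l -> {for x, continuous F}.
Proof.
by case=> dF _; apply: differentiable_continuous; exact/derivable1_diffP.
Qed.

Lemma Rintegral_FTC (f F : R -> R) a b : a <= b ->
  (forall x, a <= x <= b -> {for x, continuous f}) ->
  (forall x, a <= x <= b -> is_derive x 1 F (f x)) ->
  \int[mu]_(x in `[a, b]) f x = F b - F a.
Proof.
rewrite le_eqVlt => /predU1P[->|ab] cf dF.
  by rewrite set_itv1 Rintegral_set1 subrr.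
have cF x : a <= x <= b -> {for x, continuous F}.
  by move=> /dF; exact: is_derive_continuous.
rewrite /Rintegral (@continuous_FTC2 _ _ F)//.
- apply: continuous_in_subspaceT => x; rewrite inE /= in_itv /= => xab.
  exact: cf.
- split.
  + move=> x; rewrite in_itv /= => /andP[ax xb].
    by have [] := dF x; rewrite ?(ltW ax) ?(ltW xb).
  + by apply: cvg_at_right_filter; apply: cF; rewrite lexx ltW.
  + by apply: cvg_at_left_filter; apply: cF; rewrite lexx ltW.
- move=> x; rewrite in_itv /= => /andP[ax xb].
  rewrite derive1E; have dFx : is_derive x 1 F (f x) by apply: dF; rewrite !ltW.
  exact: derive_val.
Qed.

Lemma Rintegral_id a b : a <= b ->
  \int[mu]_(x in `[a, b]) x = (b ^+ 2 - a ^+ 2) / 2.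
Proof.
move=> ab; apply: etrans (@Rintegral_FTC _ (fun x => 2^-1 * x ^+ 2) _ _ ab _ _) _.
- by move=> x _; exact: cvg_id.
- by move=> x _; apply: is_derive_eq; rewrite /GRing.scale/=; field.
- by field.
Qed.

Lemma cintegrable_cst a b k : cintegrable `[a, b] (fun=> k).
Proof. by split; apply: continuous_integrable => x _; exact: cvg_cst. Qed.

Lemma cintegrable_id a b : cintegrable `[a, b] (fun x => x%:C).
Proof.
by split; apply: continuous_integrable => x _ /=; [exact: cvg_id|exact: cvg_cst].
Qed.

Lemma Cintegral_cst a b k : a <= b -> Cintegral `[a, b] (fun=> k) = k * (b - a)%:C.
Proof.
move=> ab; rewrite /Cintegral !Rintegral_cst_segment//.
by case: k => k1 k2; apply: complex_ext => /=; rewrite ?mulr0 ?subr0 ?add0r.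
Qed.

Lemma Cintegral_affine a b k l : a <= b ->
  Cintegral `[a, b] (fun x => k + l * x%:C) =
  k * (b - a)%:C + l * ((b ^+ 2 - a ^+ 2) / 2)%:C.
Proof.
move=> ab; rewrite CintegralD//; last 2 first.
- exact: cintegrable_cst.
- by apply: cintegrableZ => //; exact: cintegrable_id.
rewrite Cintegral_cst// CintegralZ//; last exact: cintegrable_id.
congr (_ + _ * _); rewrite /Cintegral/= Rintegral_id//.
by rewrite Rintegral_cst// mul0r.
Qed.

Lemma ccont_path (f : R[i] -> R[i]) (p : R -> R[i]) t0 :
  (forall t, cabs (p t - p t0) <= `|t - t0|) -> ccont f (p t0) ->
  {for t0, continuous (fun t => complex.Re (f (p t)))} /\
  {for t0, continuous (fun t => complex.Im (f (p t)))}.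
Proof.
move=> hp cf; split; apply/cvgrPdist_lt => e e0; have [d d0 H] := cf e e0.
- apply: filterS (nbhsx_ballx t0 d d0) => t t0d.
  rewrite -Re_oppc -Re_addc (le_lt_trans (le_Re_cabs _))// cabsB H//.
  by rewrite (le_lt_trans (hp _))// distrC.
- apply: filterS (nbhsx_ballx t0 d d0) => t t0d.
  rewrite -Im_oppc -Im_addc (le_lt_trans (le_Im_cabs _))// cabsB H//.
  by rewrite (le_lt_trans (hp _))// distrC.
Qed.

Lemma cintegrable_path (f : R[i] -> R[i]) (p : R -> R[i]) a b :
  (forall t s, cabs (p t - p s) <= `|t - s|) ->
  (forall t, a <= t <= b -> ccont f (p t)) ->
  cintegrable `[a, b] (fun t => f (p t)).
Proof.
move=> hp cf.
have H t tab := ccont_path (fun s => hp s t) (cf t tab).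
by split; apply: continuous_integrable => t /H[].
Qed.

Lemma hpath (y t s : R) : cabs ((t +i* y)%C - (s +i* y)%C) <= `|t - s|.
Proof.
by apply: le_trans (cabs_le _) _ => /=; rewrite subrr normr0 addr0.
Qed.

Lemma vpath (x t s : R) : cabs ((x +i* t)%C - (x +i* s)%C) <= `|t - s|.
Proof.
by apply: le_trans (cabs_le _) _ => /=; rewrite subrr normr0 add0r.
Qed.

End ComplexIntegral.

(** * Goursat's theorem on rectangles *)

Section Goursat.
Variable R : realType.
Local Notation mu := (@lebesgue_measure R).
Implicit Types (f g : R[i] -> R[i]) (x y : R).

(** The integral of f along the boundary of [[x1, x2] x [y1, y2]], run counterclockwise. *)
Definition rint f x1 x2 y1 y2 : R[i] :=
  Cintegral `[x1, x2] (fun x => f (x +i* y1)%C)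
  - Cintegral `[x1, x2] (fun x => f (x +i* y2)%C)
  + 'i%C * (Cintegral `[y1, y2] (fun y => f (x2 +i* y)%C)
            - Cintegral `[y1, y2] (fun y => f (x1 +i* y)%C)).

Definition edges f x1 x2 y1 y2 : Prop :=
  [/\ cintegrable `[x1, x2] (fun x => f (x +i* y1)%C),
      cintegrable `[x1, x2] (fun x => f (x +i* y2)%C),
      cintegrable `[y1, y2] (fun y => f (x2 +i* y)%C)
    & cintegrable `[y1, y2] (fun y => f (x1 +i* y)%C)].

Lemma edges_cont f x1 x2 y1 y2 : x1 <= x2 -> y1 <= y2 ->
  (forall x y, x1 <= x <= x2 -> y1 <= y <= y2 ->
     (x = x1 \/ x = x2 \/ y = y1 \/ y = y2) -> ccont f (x +i* y)%C) ->
  edges f x1 x2 y1 y2.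
Proof.
move=> hx hy cf; split.
- apply: (@cintegrable_path _ f (fun x => x +i* y1)%C) => [t s|t tx].
    exact: hpath.
  by apply: cf; rewrite ?lexx//; tauto.
- apply: (@cintegrable_path _ f (fun x => x +i* y2)%C) => [t s|t tx].
    exact: hpath.
  by apply: cf; rewrite ?lexx ?hy//; tauto.
- apply: (@cintegrable_path _ f (fun y => x2 +i* y)%C) => [t s|t tx].
    exact: vpath.
  by apply: cf; rewrite ?lexx ?hx//; tauto.
- apply: (@cintegrable_path _ f (fun y => x1 +i* y)%C) => [t s|t tx].
    exact: vpath.
  by apply: cf; rewrite ?lexx ?hx//; tauto.
Qed.

Lemma rint_splitx f x1 c x2 y1 y2 : x1 <= c -> c <= x2 ->
  cintegrable `[x1, x2] (fun x => f (x +i* y1)%C) ->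
  cintegrable `[x1, x2] (fun x => f (x +i* y2)%C) ->
  rint f x1 x2 y1 y2 = rint f x1 c y1 y2 + rint f c x2 y1 y2.
Proof.
move=> h1 h2 i1 i2; rewrite /rint (Cintegral_cat h1 h2 i1).
by rewrite (Cintegral_cat h1 h2 i2); ring.
Qed.

Lemma rint_splity f x1 x2 y1 c y2 : y1 <= c -> c <= y2 ->
  cintegrable `[y1, y2] (fun y => f (x1 +i* y)%C) ->
  cintegrable `[y1, y2] (fun y => f (x2 +i* y)%C) ->
  rint f x1 x2 y1 y2 = rint f x1 x2 y1 c + rint f x1 x2 c y2.
Proof.
move=> h1 h2 i1 i2; rewrite /rint (Cintegral_cat h1 h2 i1).
by rewrite (Cintegral_cat h1 h2 i2); ring.
Qed.

Lemma rintD f g x1 x2 y1 y2 : edges f x1 x2 y1 y2 -> edges g x1 x2 y1 y2 ->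
  rint (fun z => f z + g z) x1 x2 y1 y2 =
  rint f x1 x2 y1 y2 + rint g x1 x2 y1 y2.
Proof.
by move=> [f1 f2 f3 f4] [g1 g2 g3 g4]; rewrite /rint !CintegralD//; ring.
Qed.

Lemma rintZ k f x1 x2 y1 y2 : edges f x1 x2 y1 y2 ->
  rint (fun z => k * f z) x1 x2 y1 y2 = k * rint f x1 x2 y1 y2.
Proof. by move=> [f1 f2 f3 f4]; rewrite /rint !CintegralZ//; ring. Qed.

Lemma eq_rint f g x1 x2 y1 y2 : x1 <= x2 -> y1 <= y2 ->
  (forall x y, x1 <= x <= x2 -> y1 <= y <= y2 ->
     (x = x1 \/ x = x2 \/ y = y1 \/ y = y2) -> f (x +i* y)%C = g (x +i* y)%C) ->
  rint f x1 x2 y1 y2 = rint g x1 x2 y1 y2.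
Proof.
move=> hx hy fg; rewrite /rint; congr (_ - _ + _ * (_ - _));
  apply: eq_Cintegral => t; rewrite /= in_itv/= => ht; apply: fg;
  rewrite ?lexx ?hx ?hy//; tauto.
Qed.

Lemma cpair x y : (x +i* y)%C = x%:C + 'i%C * y%:C :> R[i].
Proof. by apply: complex_ext => /=; ring. Qed.

Lemma rint_affine (k l : R[i]) x1 x2 y1 y2 : x1 <= x2 -> y1 <= y2 ->
  rint (fun z => k + l * z) x1 x2 y1 y2 = 0.
Proof.
move=> hx hy; rewrite /rint.
have H y : Cintegral `[x1, x2] (fun x => k + l * (x +i* y)%C) =
   (k + l * ('i%C * y%:C)) * (x2 - x1)%:C + l * ((x2 ^+ 2 - x1 ^+ 2) / 2)%:C.
  by rewrite -Cintegral_affine//; apply: eq_Cintegral => x _; rewrite cpair; ring.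
have V x : Cintegral `[y1, y2] (fun y => k + l * (x +i* y)%C) =
   (k + l * x%:C) * (y2 - y1)%:C
   + (l * 'i%C) * ((y2 ^+ 2 - y1 ^+ 2) / 2)%:C.
  by rewrite -Cintegral_affine//; apply: eq_Cintegral => y _; rewrite cpair; ring.
by rewrite !H !V !rmorphB/=; ring.
Qed.

Lemma cabs_rint_le f x1 x2 y1 y2 M : x1 <= x2 -> y1 <= y2 ->
  edges f x1 x2 y1 y2 ->
  (forall x y, x1 <= x <= x2 -> y1 <= y <= y2 ->
     (x = x1 \/ x = x2 \/ y = y1 \/ y = y2) -> cabs (f (x +i* y)%C) <= M) ->
  cabs (rint f x1 x2 y1 y2) <= 4 * M * ((x2 - x1) + (y2 - y1)).
Proof.
move=> hx hy [f1 f2 f3 f4] fM; rewrite /rint.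
apply: le_trans (cabsD _ _) _; rewrite cabsM cabs_i mul1r.
apply: le_trans (lerD (cabsBD _ _) (cabsBD _ _)) _.
have := cabs_Cintegral_le hx f1 (M := M); have := cabs_Cintegral_le hx f2 (M := M).
have := cabs_Cintegral_le hy f3 (M := M); have := cabs_Cintegral_le hy f4 (M := M).
set A := cabs _; set B := cabs _; set C := cabs _; set D := cabs _ => h1 h2 h3 h4.
have {}h1 : A <= 2 * M * (y2 - y1).
  by apply: h1 => t ht; apply: fM; rewrite ?lexx ?hx ?hy//; tauto.
have {}h2 : B <= 2 * M * (y2 - y1).
  by apply: h2 => t ht; apply: fM; rewrite ?lexx ?hx ?hy//; tauto.
have {}h3 : C <= 2 * M * (x2 - x1).
  by apply: h3 => t ht; apply: fM; rewrite ?lexx ?hx ?hy//; tauto.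
have {}h4 : D <= 2 * M * (x2 - x1).
  by apply: h4 => t ht; apply: fM; rewrite ?lexx ?hx ?hy//; tauto.
lra.
Qed.

(** [P n] speaks of the lower left corner of a rectangle with sides [X / 2 ^+ n] and [Y / 2 ^+ n]. A
    dependent choice fixes one nested sequence, and the suprema of the corner coordinates give its
    common point. *)
Lemma bisection (P : nat -> R -> R -> Prop) (X Y x0 y0 : R) :
  0 <= X -> 0 <= Y -> P 0%N x0 y0 ->
  (forall n x y, P n x y -> exists x' y',
     [/\ P n.+1 x' y', x' = x \/ x' = x + X / 2 ^+ n.+1
       & y' = y \/ y' = y + Y / 2 ^+ n.+1]) ->
  exists px py, forall n, exists x y, [/\ P n x y,
     x <= px <= x + X / 2 ^+ n & y <= py <= y + Y / 2 ^+ n].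
Proof.
move=> X0 Y0 P0 step.
pose T n := {p : R * R | P n p.1 p.2}.
have next n (t : T n) : {s : T n.+1 |
    ((sval s).1 = (sval t).1 \/ (sval s).1 = (sval t).1 + X / 2 ^+ n.+1) /\
    ((sval s).2 = (sval t).2 \/ (sval s).2 = (sval t).2 + Y / 2 ^+ n.+1)}.
  apply: cid; case: t => -[x y] /= /step[x' [y' [Pxy hx hy]]].
  by exists (exist _ (x', y') Pxy).
pose s := fix s n : T n := if n is n'.+1 then sval (next n' (s n'))
                           else exist _ (x0, y0) P0.
have main (u : nat -> R) (L : R) : 0 <= L ->
    (forall n, u n.+1 = u n \/ u n.+1 = u n + L / 2 ^+ n.+1) ->
    exists p, forall n, u n <= p <= u n + L / 2 ^+ n.
  move=> L0 hu.
  have pw n : 0 <= L / 2 ^+ n by rewrite divr_ge0// exprn_ge0.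
  have half n : L / 2 ^+ n = L / 2 ^+ n.+1 + L / 2 ^+ n.+1.
    by rewrite exprS; field; rewrite expf_neq0.
  have inc n : u n <= u n.+1.
    by case: (hu n) => ->; rewrite ?lerDl.
  have dec n : u n.+1 + L / 2 ^+ n.+1 <= u n + L / 2 ^+ n.
    by rewrite (half n); have := pw n.+1; case: (hu n) => -> ?; lra.
  have incn n m : u n <= u (n + m)%N.
    by elim: m => [|m IH]; rewrite ?addn0// addnS (le_trans IH).
  have decn n m : u (n + m)%N + L / 2 ^+ (n + m) <= u n + L / 2 ^+ n.
    by elim: m => [|m IH]; rewrite ?addn0// addnS (le_trans (dec _)).
  have ub n m : u m <= u n + L / 2 ^+ n.
    have h1 := incn m n; have h2 := decn n m; have := pw (n + m)%N.
    by rewrite addnC in h1; lra.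
  exists (sup (range u)) => n; apply/andP; split.
    apply: ub_le_sup; last by exists n.
    by exists (u 0 + L / 2 ^+ 0) => _ [m _ <-].
  apply: ge_sup; first by exists (u 0%N); exists 0%N.
  by move=> _ [m _ <-].
have [px hpx] := main (fun n => (sval (s n)).1) X X0
  (fun n => (svalP (next n (s n))).1).
have [py hpy] := main (fun n => (sval (s n)).2) Y Y0
  (fun n => (svalP (next n (s n))).2).
exists px, py => n; exists (sval (s n)).1, (sval (s n)).2; split=> //.
exact: svalP (s n).
Qed.

Lemma edges_sub f x1 x2 y1 y2 a b c e :
  (forall x y, x1 <= x <= x2 -> y1 <= y <= y2 -> ccont f (x +i* y)%C) ->
  x1 <= a -> a <= b -> b <= x2 -> y1 <= c -> c <= e -> e <= y2 ->
  edges f a b c e.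
Proof.
move=> cf h1 h2 h3 h4 h5 h6; apply: edges_cont => // u v /andP[u1 u2] /andP[v1 v2] _.
apply: cf; first by rewrite (le_trans h1 u1) (le_trans u2 h3).
by rewrite (le_trans h4 v1) (le_trans v2 h6).
Qed.

Lemma rint_quarters f x y h k : 0 <= h -> 0 <= k ->
  (forall u v, x <= u <= x + h + h -> y <= v <= y + k + k -> ccont f (u +i* v)%C) ->
  rint f x (x + h + h) y (y + k + k) =
    rint f x (x + h) y (y + k) + rint f x (x + h) (y + k) (y + k + k)
    + (rint f (x + h) (x + h + h) y (y + k)
       + rint f (x + h) (x + h + h) (y + k) (y + k + k)).
Proof.
move=> h0 k0 cf.
have xh : x <= x + h by rewrite lerDl.
have xhh : x + h <= x + h + h by rewrite lerDl.
have yk : y <= y + k by rewrite lerDl.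
have ykk : y + k <= y + k + k by rewrite lerDl.
have [e1 e2 _ _] : edges f x (x + h + h) y (y + k + k).
  by apply: edges_sub cf _ _ _ _ _ _; lra.
have [_ _ e3 e4] : edges f x (x + h) y (y + k + k).
  by apply: edges_sub cf _ _ _ _ _ _; lra.
have [_ _ e5 e6] : edges f (x + h) (x + h + h) y (y + k + k).
  by apply: edges_sub cf _ _ _ _ _ _; lra.
rewrite (rint_splitx xh xhh e1 e2).
by rewrite (rint_splity yk ykk e4 e3) (rint_splity yk ykk e6 e5).
Qed.

(** Affine functions have zero boundary integral, so f may be replaced by its first-order remainder
    at p, which is at most e times the distance to p. *)
Lemma rint_local f p l e : hder f p l -> 0 < e ->
  exists2 d : R, 0 < d & forall u v h k, 0 <= h -> 0 <= k -> h + k < d ->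
    u <= complex.Re p <= u + h -> v <= complex.Im p <= v + k ->
    (forall z1 z2, u <= z1 <= u + h -> v <= z2 <= v + k ->
       ccont f (z1 +i* z2)%C) ->
    cabs (rint f u (u + h) v (v + k)) <= 4 * e * (h + k) ^+ 2.
Proof.
move=> Hl e0; have [d d0 Hd] := (hderP _ _ _).1 Hl e e0.
exists d => // u v h k h0 k0 hkd /andP[u1 u2] /andP[v1 v2] cf.
pose aff z := (f p - l * p) + l * z.
pose g z := f z - aff z.
have uh : u <= u + h by rewrite lerDl.
have vk : v <= v + k by rewrite lerDl.
have caff z : ccont aff z.
  apply: ccontD; first exact: ccont_cst.
  by apply: ccontM; [exact: ccont_cst|exact: ccont_id].
have eaff : edges aff u (u + h) v (v + k) by apply: edges_cont.
have eg : edges g u (u + h) v (v + k).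
  apply: edges_cont => // z1 z2 h1 h2 _; apply: ccontD; first exact: cf.
  have -> : (fun w => - aff w) = (fun w => -1 * aff w).
    by apply/funext => w; rewrite mulN1r.
  by apply: ccontM => //; exact: ccont_cst.
have -> : rint f u (u + h) v (v + k) = rint g u (u + h) v (v + k).
  have -> : rint f u (u + h) v (v + k) =
      rint (fun z => aff z + g z) u (u + h) v (v + k).
    by apply: eq_rint => // x y _ _ _; rewrite /g addrC subrK.
  by rewrite rintD// rint_affine// add0r.
have gb z1 z2 : u <= z1 <= u + h -> v <= z2 <= v + k ->
    cabs (g (z1 +i* z2)%C) <= e * (h + k).
  move=> /andP[h1 h2] /andP[h3 h4].
  have hz : cabs ((z1 +i* z2)%C - p) <= h + k.
    apply: le_trans (cabs_le _) _; rewrite Re_addc Im_addc Re_oppc Im_oppc /=.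
    clear -h1 h2 h3 h4 u1 u2 v1 v2.
    by apply: lerD; rewrite ler_norml; apply/andP; split; lra.
  have -> : g (z1 +i* z2)%C = f (z1 +i* z2)%C - f p - l * ((z1 +i* z2)%C - p).
    by rewrite /g /aff; ring.
  apply: le_trans (Hd _ _) _; first by rewrite (le_lt_trans hz).
  by rewrite ler_wpM2l// ltW.
have := cabs_rint_le uh vk eg (fun a b ha hb _ => gb a b ha hb).
rewrite [u + h - u]addrAC subrr add0r [v + k - v]addrAC subrr add0r.
by move/le_trans; apply; rewrite expr2 !mulrA.
Qed.

(** One of the four quarters keeps at least a quarter of the modulus of the integral. Around the
    limit point [rint_local] bounds it by a small multiple of the squared size, which also shrinks
    by four at each step, so the multiple decides. *)
Theorem goursat f x1 x2 y1 y2 : x1 <= x2 -> y1 <= y2 ->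
  (forall x y, x1 <= x <= x2 -> y1 <= y <= y2 -> exists l, hder f (x +i* y)%C l) ->
  rint f x1 x2 y1 y2 = 0.
Proof.
move=> hx hy df.
have cf x y : x1 <= x <= x2 -> y1 <= y <= y2 -> ccont f (x +i* y)%C.
  by move=> xx yy; have [l /hder_cont] := df x y xx yy.
apply/eqP; rewrite -cabs_eq0 eq_le cabs_ge0 andbT leNgt; apply/negP.
set K := cabs _ => K0.
pose X := x2 - x1; pose Y := y2 - y1.
have X0 : 0 <= X by rewrite subr_ge0.
have Y0 : 0 <= Y by rewrite subr_ge0.
pose P n x y := [/\ x1 <= x, x + X / 2 ^+ n <= x2, y1 <= y,
  y + Y / 2 ^+ n <= y2 &
  K / 4 ^+ n <= cabs (rint f x (x + X / 2 ^+ n) y (y + Y / 2 ^+ n))].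
have P0 : P 0%N x1 y1.
  rewrite /P !expr0 !divr1 /X /Y ![_ + (_ - _)]addrC !subrK; split=> //.
have [|px [py Hp]] := bisection X0 Y0 P0.
  move=> n x y [ax bx ay by_ hK].
  pose h := X / 2 ^+ n.+1; pose k := Y / 2 ^+ n.+1.
  have hE : X / 2 ^+ n = h + h by rewrite /h exprS; field; rewrite expf_neq0.
  have kE : Y / 2 ^+ n = k + k by rewrite /k exprS; field; rewrite expf_neq0.
  have h0 : 0 <= h by rewrite divr_ge0// exprn_ge0.
  have k0 : 0 <= k by rewrite divr_ge0// exprn_ge0.
  rewrite hE in bx hK; rewrite kE in by_ hK; rewrite !addrA in bx by_ hK.
  have K4 : K / 4 ^+ n = 4 * (K / 4 ^+ n.+1).
    by rewrite exprS; field; rewrite expf_neq0.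
  rewrite K4 rint_quarters// in hK; last first.
    move=> u v /andP[u1 u2] /andP[v1 v2]; apply: cf.
      by rewrite (le_trans ax u1) (le_trans u2 bx).
    by rewrite (le_trans ay v1) (le_trans v2 by_).
  have := le_trans hK (le_trans (cabsD _ _) (lerD (cabsD _ _) (cabsD _ _))).
  rewrite /P -/h -/k; clear P P0 hK K4 df cf hE kE.
  set q := K / 4 ^+ n.+1; clearbody h k q.
  have sum4 (b1 b2 b3 b4 : R) : b1 < q -> b2 < q -> b3 < q -> b4 < q ->
    4 * q <= b1 + b2 + (b3 + b4) -> False by clear; move=> *; lra.
  case: (lerP q (cabs (rint f x (x + h) y (y + k)))) => [g _|g1].
    by exists x, y; split; [split=> //; clear g; lra|left|left].
  case: (lerP q (cabs (rint f x (x + h) (y + k) (y + k + k)))) => [g _|g2].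
    by exists x, (y + k); split; [split=> //; clear g g1; lra|left|right].
  case: (lerP q (cabs (rint f (x + h) (x + h + h) y (y + k)))) => [g _|g3].
    by exists (x + h), y; split; [split=> //; clear g g1 g2; lra|right|left].
  case: (lerP q (cabs (rint f (x + h) (x + h + h) (y + k) (y + k + k)))) => [g _|g4].
    by exists (x + h), (y + k); split; [split=> //; clear g g1 g2 g3; lra|right|right].
  by move=> g5; case: (sum4 _ _ _ _ g1 g2 g3 g4 g5).
have [x [y [[ax bx ay by_ _] /andP[xp px'] /andP[yp py']]]] := Hp 0%N.
have [l Hl] : exists l, hder f (px +i* py)%C l.
  apply: df; first by rewrite (le_trans ax xp) (le_trans px' bx).
  by rewrite (le_trans ay yp) (le_trans py' by_).
pose S := X + Y.
have S0 : 0 <= S by rewrite addr_ge0.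
have S1 : 0 < S ^+ 2 + 1 by rewrite ltr_wpDl// sqr_ge0.
(* With this e, [4 * e * S ^+ 2 < K]; the added 1 keeps the denominator positive for a degenerate
   rectangle. *)
have e0 : 0 < K / (8 * (S ^+ 2 + 1)) by rewrite divr_gt0// mulr_gt0.
have [d d0 Hd] := rint_local Hl e0; set e := K / _ in e0 Hd.
have [n Hn] : exists n, S / 2 ^+ n < d.
  have [n _ /(_ _ (leqnn _))] : \forall n \near \oo, S / 2 ^+ n < d.
    have : (fun n => S * 2^-1 ^+ n) @ \oo --> S * 0.
      apply: cvgMr; apply: cvg_expr; rewrite ger0_norm//; lra.
    rewrite mulr0 => /cvgrPdist_lt/(_ d d0); apply: filterS => n.
    rewrite sub0r normrN exprVn ger0_norm//.
    by rewrite mulr_ge0// invr_ge0 exprn_ge0.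
  by move=> h; exists n.
have [u [v [[au bu av bv hK] hu hv]]] := Hp n.
have := le_trans hK (Hd u v (X / 2 ^+ n) (Y / 2 ^+ n) _ _ _ hu hv _).
rewrite -mulrDl -/S => /(_ _ _ Hn).
rewrite !divr_ge0 ?exprn_ge0// => /(_ isT isT) H.
have {}H : K / 4 ^+ n <= 4 * e * (S / 2 ^+ n) ^+ 2.
  apply: H => z1 z2 /andP[u1 u2] /andP[v1 v2]; apply: cf.
    by rewrite (le_trans au u1) (le_trans u2 bu).
  by rewrite (le_trans av v1) (le_trans v2 bv).
move: H.
have -> : 4 * e * (S / 2 ^+ n) ^+ 2 = 4 * e * S ^+ 2 / 4 ^+ n.
  have -> : (4 : R) ^+ n = 2 ^+ n * 2 ^+ n by rewrite -exprMn; congr (_ ^+ _); ring.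
  by field; rewrite expf_neq0.
rewrite ler_pdivrMr ?exprn_gt0// mulfVK ?expf_neq0//.
have eE : e * (8 * (S ^+ 2 + 1)) = K.
  by rewrite /e mulfVK// gt_eqF// mulr_gt0.
move: (sqr_ge0 S) K0 e0 eE; clear; set T := S ^+ 2; clearbody T e => T0 K0 e0 eE.
by nra.
Qed.

End Goursat.

(** * Cauchy's formula and estimate on a rectangle *)

Section Cauchy.
Variable R : realType.
Local Notation mu := (@lebesgue_measure R).
Implicit Types (f g : R[i] -> R[i]) (x y : R).

Definition holo_rect f x1 x2 y1 y2 : Prop := forall x y,
  x1 <= x <= x2 -> y1 <= y <= y2 -> exists l, hder f (x +i* y)%C l.

Lemma le_Re_pair (x y : R) (p : R[i]) : `|x - complex.Re p| <= cabs ((x +i* y)%C - p).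
Proof. by have := le_Re_cabs ((x +i* y)%C - p); rewrite Re_addc Re_oppc. Qed.

Lemma le_Im_pair (x y : R) (p : R[i]) : `|y - complex.Im p| <= cabs ((x +i* y)%C - p).
Proof. by have := le_Im_cabs ((x +i* y)%C - p); rewrite Im_addc Im_oppc. Qed.

(** Cut out a square of half side e around the exceptional point: the four remaining rectangles
    contribute nothing by [goursat], and the boundedness of f makes the boundary of the square
    contribute O(e). *)
Lemma rint_punctured f x1 x2 y1 y2 px py :
  x1 < px < x2 -> y1 < py < y2 ->
  (forall x y, x1 <= x <= x2 -> y1 <= y <= y2 -> (x +i* y)%C != (px +i* py)%C ->
     exists l, hder f (x +i* y)%C l) ->
  (exists2 d : R, 0 < d & exists M, forall z, z != (px +i* py)%C ->
     cabs (z - (px +i* py)%C) < d -> cabs (f z) <= M) ->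
  rint f x1 x2 y1 y2 = 0.
Proof.
move=> /andP[xp px2] /andP[yp py2] df [d d0 [M fM]].
have M0 : 0 <= M.
  have ne : ((px + d / 2) +i* py)%C != (px +i* py)%C.
    rewrite eq_complex/= negb_and; apply/orP; left.
    by rewrite -subr_eq0 addrAC subrr add0r gt_eqF// divr_gt0.
  apply: le_trans (cabs_ge0 _) (fM _ ne _).
  rewrite (le_lt_trans (cabs_le _))//= subrr normr0 addr0.
  rewrite addrAC subrr add0r ger0_norm; lra.
have cf x y : x1 <= x <= x2 -> y1 <= y <= y2 -> (x != px) || (y != py) ->
    ccont f (x +i* y)%C.
  move=> xx yy xy; have [|l /hder_cont//] := df x y xx yy.
  by rewrite eq_complex/= negb_and.
have key e : 0 < e -> e + e < d -> x1 <= px - e -> px + e <= x2 -> y1 <= py - e ->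
    py + e <= y2 -> cabs (rint f x1 x2 y1 y2) <= 16 * M * e.
  move=> e0 ed h1 h2 h3 h4.
  have lx : px - e < px by rewrite gtrDl oppr_lt0.
  have ly : py - e < py by rewrite gtrDl oppr_lt0.
  have rx : px < px + e by rewrite ltrDl.
  have ry : py < py + e by rewrite ltrDl.
  have k1 : px - e <= px + e := ltW (lt_trans lx rx).
  have k2 : py - e <= py + e := ltW (lt_trans ly ry).
  have k3 : px - e <= x2 := le_trans k1 h2.
  have k4 : py - e <= y2 := le_trans k2 h4.
  have k5 : x1 <= px + e := le_trans h1 k1.
  have k6 : y1 <= py + e := le_trans h3 k2.
  have nx1 : px - e != px by rewrite lt_eqF.
  have nx2 : px + e != px by rewrite gt_eqF.
  have ny1 : py - e != py by rewrite lt_eqF.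
  have ny2 : py + e != py by rewrite gt_eqF.
  have [e1 e2 e3 e4] : edges f x1 x2 y1 y2.
    apply: edges_cont; rewrite ?(ltW (lt_trans xp px2)) ?(ltW (lt_trans yp py2))//.
    move=> x y xx yy Hxy; apply: cf => //.
    by case: Hxy => [->|[->|[->|->]]]; rewrite ?(lt_eqF xp) ?(gt_eqF px2)
      ?(lt_eqF yp) ?(gt_eqF py2) ?orbT.
  have [e5 e6 _ _] : edges f (px - e) x2 y1 y2.
    apply: edges_cont => //; first by rewrite (le_trans h3).
    move=> x y /andP[xx1 xx2] yy Hxy; apply: cf => //; first by rewrite xx2 (le_trans h1).
    by case: Hxy => [->|[->|[->|->]]]; rewrite ?nx1 ?(lt_eqF xp) ?(gt_eqF px2)
      ?(lt_eqF yp) ?(gt_eqF py2) ?orbT.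
  have [_ _ e7 e8] : edges f (px - e) (px + e) y1 y2.
    apply: edges_cont => //; first by rewrite (le_trans h3).
    move=> x y /andP[xx1 xx2] yy Hxy; apply: cf => //.
      by rewrite (le_trans h1)//= (le_trans xx2).
    by case: Hxy => [->|[->|[->|->]]]; rewrite ?nx1 ?nx2 ?(lt_eqF yp) ?(gt_eqF py2) ?orbT.
  have [_ _ e9 e10] : edges f (px - e) (px + e) (py - e) y2.
    apply: edges_cont => //.
    move=> x y /andP[xx1 xx2] /andP[yy1 yy2] Hxy; apply: cf => //.
    - by rewrite (le_trans h1)//= (le_trans xx2).
    - by rewrite (le_trans h3)//= (le_trans yy2).
    - by case: Hxy => [->|[->|[->|->]]]; rewrite ?nx1 ?nx2 ?ny1 ?(gt_eqF py2) ?orbT.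
  rewrite (rint_splitx h1 k3 e1 e2) (rint_splitx k1 h2 e5 e6).
  rewrite (rint_splity h3 k4 e8 e7) (rint_splity k2 h4 e10 e9).
  have z1 : rint f x1 (px - e) y1 y2 = 0.
    apply: goursat => //; first by rewrite (le_trans h3).
    move=> x y /andP[xx1 xx2] yy; apply: df => //.
      by rewrite xx1 (le_trans xx2).
    by rewrite eq_complex/= lt_eqF// (le_lt_trans xx2 lx).
  have z2 : rint f (px + e) x2 y1 y2 = 0.
    apply: goursat => //; first by rewrite (le_trans h3).
    move=> x y /andP[xx1 xx2] yy; apply: df => //.
      by rewrite xx2 (le_trans _ xx1).
    by rewrite eq_complex/= gt_eqF// (lt_le_trans rx xx1).
  have z3 : rint f (px - e) (px + e) y1 (py - e) = 0.
    apply: goursat => //.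
    move=> x y /andP[xx1 xx2] /andP[yy1 yy2]; apply: df => //.
    - by rewrite (le_trans h1)//= (le_trans xx2).
    - by rewrite yy1 (le_trans yy2).
    - by rewrite eq_complex/= [y == _]lt_eqF ?andbF// (le_lt_trans yy2 ly).
  have z4 : rint f (px - e) (px + e) (py + e) y2 = 0.
    apply: goursat => //.
    move=> x y /andP[xx1 xx2] /andP[yy1 yy2]; apply: df => //.
    - by rewrite (le_trans h1)//= (le_trans xx2).
    - by rewrite yy2 (le_trans _ yy1).
    - by rewrite eq_complex/= [y == _]gt_eqF ?andbF// (lt_le_trans ry yy1).
  rewrite z1 z2 z3 z4 add0r addr0 add0r addr0.
  have ec : edges f (px - e) (px + e) (py - e) (py + e).
    apply: edges_cont => //.
    move=> x y /andP[xx1 xx2] /andP[yy1 yy2] Hxy; apply: cf => //.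
    - by rewrite (le_trans h1)//= (le_trans xx2).
    - by rewrite (le_trans h3)//= (le_trans yy2).
    - by case: Hxy => [->|[->|[->|->]]]; rewrite ?nx1 ?nx2 ?ny1 ?ny2 ?orbT.
  apply: le_trans (cabs_rint_le (M := M) k1 k2 ec _) _; last first.
    by rewrite le_eqVlt; apply/orP; left; apply/eqP; ring.
  move=> x y /andP[xx1 xx2] /andP[yy1 yy2] Hxy; apply: fM.
    rewrite eq_complex/= negb_and.
    by case: Hxy => [->|[->|[->|->]]]; rewrite ?nx1 ?nx2 ?ny1 ?ny2 ?orbT.
  apply: le_lt_trans (cabs_le _) _ => /=.
  have hx : `|x - px| <= e by rewrite ler_distl xx1 xx2.
  have hy : `|y - py| <= e by rewrite ler_distl yy1 yy2.
  exact: le_lt_trans (lerD hx hy) ed.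
apply/eqP; rewrite -cabs_eq0 eq_le cabs_ge0 andbT leNgt; apply/negP => K0.
move: key K0; set K := cabs _ => key K0.
have q0 : 0 < K / (16 * (M + 1)) by rewrite divr_gt0//; lra.
pose e := Num.min (K / (16 * (M + 1))) (Num.min (d / 4)
  (Num.min (Num.min (px - x1) (x2 - px)) (Num.min (py - y1) (y2 - py)))).
have e0 : 0 < e by rewrite !lt_min q0 !subr_gt0 xp px2 yp py2 divr_gt0.
have : e <= e by [].
rewrite {2}/e !le_min => /andP[i1 /andP[i2 /andP[/andP[i3 i4] /andP[i5 i6]]]].
have M1 : 0 < 16 * (M + 1) by rewrite mulr_gt0// ltr_wpDl.
have : K <= 16 * M * e.
  apply: key; rewrite ?e0//.
  - by move: (e) i2 d0; clear; move=> e *; lra.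
  - by rewrite lerBrDr -lerBrDl.
  - by rewrite -lerBrDl.
  - by rewrite lerBrDr -lerBrDl.
  - by rewrite -lerBrDl.
have : e * (16 * (M + 1)) <= K by rewrite -ler_pdivlMr.
move: e0 M0; clear; clearbody e K; nra.
Qed.

(** The quotient of [f z - f p] by [z - p] is bounded near p, so [rint_punctured] applies to it. The
    winding integral stays as a factor and is never evaluated; its uses rest on its nonvanishing
    alone. *)
Lemma cauchy_rect f x1 x2 y1 y2 px py :
  x1 < px < x2 -> y1 < py < y2 -> holo_rect f x1 x2 y1 y2 ->
  rint (fun z => f z * (z - (px +i* py)%C)^-1) x1 x2 y1 y2 =
  f (px +i* py)%C * rint (fun z => (z - (px +i* py)%C)^-1) x1 x2 y1 y2.
Proof.
set p := (px +i* py)%C => hx hy df.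
have [/andP[hx1 hx2] /andP[hy1 hy2]] := (hx, hy).
have hxx : x1 <= x2 by apply: ltW (lt_trans hx1 hx2).
have hyy : y1 <= y2 by apply: ltW (lt_trans hy1 hy2).
have dsub z : hder (fun z => z - p) z 1.
  by apply: hder_eq (hderB (hder_id z) (hder_cst p z)) _; rewrite subr0.
have dinv z : z != p -> exists l, hder (fun z => (z - p)^-1) z l.
  by move=> zp; eexists; apply: hderV (dsub z); rewrite subr_eq0.
have bd x y : (x = x1 \/ x = x2 \/ y = y1 \/ y = y2) -> (x +i* y)%C != p.
  move=> Hxy; rewrite eq_complex/= negb_and.
  by case: Hxy => [->|[->|[->|->]]]; rewrite ?(lt_eqF hx1) ?(gt_eqF hx2)
      ?(lt_eqF hy1) ?(gt_eqF hy2) ?orbT.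
have ei : edges (fun z => (z - p)^-1) x1 x2 y1 y2.
  apply: edges_cont => // x y xx yy /bd Hxy.
  by have [l /hder_cont] := dinv _ Hxy.
have ef : edges (fun z => f z * (z - p)^-1) x1 x2 y1 y2.
  apply: edges_cont => // x y xx yy /bd Hxy.
  have [l1 /hder_cont c1] := dinv _ Hxy; have [l2 /hder_cont c2] := df _ _ xx yy.
  exact: ccontM.
have efp : edges (fun z => - f p * (z - p)^-1) x1 x2 y1 y2.
  apply: edges_cont => // x y xx yy /bd Hxy.
  have [l1 /hder_cont c1] := dinv _ Hxy.
  by apply: ccontM => //; exact: ccont_cst.
have : rint (fun z => f z * (z - p)^-1 + - f p * (z - p)^-1) x1 x2 y1 y2 = 0.
  apply: (@rint_punctured _ _ _ _ _ px py) => //.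
    move=> x y xx yy xyp; have [l1 h1] := dinv _ xyp.
    have [l2 h2] := df _ _ xx yy; eexists.
    exact: (hderD (hderM h2 h1) (hderM (hder_cst _ _) h1)).
  have [l [phi [fE _ cphi]]] : exists l, hder f p l.
    by apply: df; apply/andP; split; apply: ltW.
  have [d d0 Hd] := cphi 1 ltr01.
  exists d => //; exists (cabs (phi p) + 1) => z zp zd.
  have -> : f z / (z - p) + - f p / (z - p) = phi z.
    have zp0 : z - p != 0 by rewrite subr_eq0.
    by rewrite -mulrDl fE addrAC subrr add0r mulfK.
  have := Hd _ zd; have := cabsD (phi z - phi p) (phi p); rewrite subrK.
  by move=> h1 h2; apply: le_trans h1 _; rewrite addrC lerD2l ltW.
by rewrite rintD// rintZ// mulNr => /eqP; rewrite subr_eq0 => /eqP.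
Qed.

Lemma edges_winding x1 x2 y1 y2 px py : x1 < px < x2 -> y1 < py < y2 ->
  edges (fun z => (z - (px +i* py)%C)^-1) x1 x2 y1 y2.
Proof.
move=> /andP[hx1 hx2] /andP[hy1 hy2].
have hxx : x1 <= x2 by apply: ltW (lt_trans hx1 hx2).
have hyy : y1 <= y2 by apply: ltW (lt_trans hy1 hy2).
apply: edges_cont => // x y xx yy Hxy.
have zp : (x +i* y)%C - (px +i* py)%C != 0.
  rewrite subr_eq0 eq_complex/= negb_and.
  by case: Hxy => [->|[->|[->|->]]]; rewrite ?(lt_eqF hx1) ?(gt_eqF hx2)
      ?(lt_eqF hy1) ?(gt_eqF hy2) ?orbT.
apply: ccontV => //.
by apply: ccontD; [exact: ccont_id|exact: ccont_cst].
Qed.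

(* The imaginary part of the integrand of each of the four sides is positive. *)
Lemma winding_neq0 x1 x2 y1 y2 px py : x1 < px < x2 -> y1 < py < y2 ->
  rint (fun z => (z - (px +i* py)%C)^-1) x1 x2 y1 y2 != 0.
Proof.
move=> hx hy; have [e1 e2 e3 e4] := edges_winding hx hy.
have [/andP[hx1 hx2] /andP[hy1 hy2]] := (hx, hy).
have hxx : x1 <= x2 by apply: ltW (lt_trans hx1 hx2).
suff : 0 < complex.Im (rint (fun z => (z - (px +i* py)%C)^-1) x1 x2 y1 y2).
  by apply: contraTneq => ->; rewrite ltxx.
rewrite /rint Im_addc Im_mulc !Im_addc !Re_addc !Im_oppc !Re_oppc /= mul0r add0r mul1r.
have q0 x y : 0 <= (x - px) ^+ 2 + (y - py) ^+ 2 by rewrite addr_ge0 ?sqr_ge0.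
have t2 : 0 <= - \int[mu]_(x in `[x1, x2]) (- ((y2 - py) / ((x - px) ^+ 2 + (y2 - py) ^+ 2))).
  rewrite -mulN1r -RintegralZl//; last by case: e2.
  by apply: Rintegral_ge0 => x _; rewrite mulN1r opprK divr_ge0// subr_ge0 ltW.
have t3 : 0 <= \int[mu]_(y in `[y1, y2]) ((x2 - px) / ((x2 - px) ^+ 2 + (y - py) ^+ 2)).
  by apply: Rintegral_ge0 => x _; rewrite divr_ge0// subr_ge0 ltW.
have t4 : 0 <= - \int[mu]_(y in `[y1, y2]) ((x1 - px) / ((x1 - px) ^+ 2 + (y - py) ^+ 2)).
  rewrite -mulN1r -RintegralZl//; last by case: e4.
  apply: Rintegral_ge0 => x _; rewrite mulN1r -mulNr divr_ge0//.
  by rewrite opprB subr_ge0 ltW.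
suff t1 : 0 < \int[mu]_(x in `[x1, x2]) (- ((y1 - py) / ((x - px) ^+ 2 + (y1 - py) ^+ 2))).
  by rewrite -addrA ltr_pwDl// addr_ge0// addr_ge0.
pose c := (py - y1) / ((x2 - x1) ^+ 2 + (y1 - py) ^+ 2).
have D0 : 0 < (x2 - x1) ^+ 2 + (y1 - py) ^+ 2.
  by rewrite ltr_wpDr ?sqr_ge0// exprn_gt0// subr_gt0 (lt_trans hx1).
have c0 : 0 < c by rewrite divr_gt0// subr_gt0.
apply: lt_le_trans (_ : c * (x2 - x1) <= _).
  by rewrite mulr_gt0// subr_gt0 (lt_trans hx1).
rewrite -Rintegral_cst_segment//; apply: le_Rintegral => //.
- by case: (@cintegrable_cst R x1 x2 c%:C).
- by case: e1.
move=> x; rewrite /= in_itv /= => /andP[xx1 xx2].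
rewrite -mulNr opprB /c ler_pM2l ?subr_gt0//.
rewrite lef_pV2 ?posrE//; last first.
  by rewrite ltr_wpDl ?sqr_ge0// -sqrrN opprB exprn_gt0// subr_gt0.
rewrite lerD2r -[leLHS]real_normK ?num_real// -[leRHS]real_normK ?num_real//.
rewrite ler_pXn2r ?nnegrE//.
rewrite [leRHS]ger0_norm ?subr_ge0//.
by clear -xx1 xx2 hx1 hx2; rewrite ler_norml; apply/andP; split; lra.
Qed.

(** The point is that C depends on the rectangle and on the inner point but not on f: the estimate
    is applied to all the powers [exp (m A)] at once. *)
Lemma cauchy_estimate x1 x2 y1 y2 px py : x1 < px < x2 -> y1 < py < y2 ->
  exists2 C : R, 0 < C & forall f M, holo_rect f x1 x2 y1 y2 ->
    (forall x y, x1 <= x <= x2 -> y1 <= y <= y2 ->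
       (x = x1 \/ x = x2 \/ y = y1 \/ y = y2) -> cabs (f (x +i* y)%C) <= M) ->
    cabs (f (px +i* py)%C) <= C * M.
Proof.
move=> hx hy; have [/andP[hx1 hx2] /andP[hy1 hy2]] := (hx, hy).
have hxx : x1 <= x2 by apply: ltW (lt_trans hx1 hx2).
have hyy : y1 <= y2 by apply: ltW (lt_trans hy1 hy2).
set W := rint (fun z => (z - (px +i* py)%C)^-1) x1 x2 y1 y2.
have W0 : 0 < cabs W by rewrite cabs_gt0 winding_neq0.
pose eta := Num.min (Num.min (px - x1) (x2 - px)) (Num.min (py - y1) (y2 - py)).
have eta0 : 0 < eta by rewrite !lt_min !subr_gt0 hx1 hx2 hy1 hy2.
pose L := (x2 - x1) + (y2 - y1).
have L0 : 0 < L by rewrite ltr_pwDl// ?subr_gt0 ?(lt_trans hx1)// subr_ge0.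
exists (4 * eta^-1 * L / cabs W); first by rewrite divr_gt0// !mulr_gt0// invr_gt0.
move=> f M df fM; rewrite mulrAC ler_pdivlMr// -cabsM -cauchy_rect//.
have dist x y : x1 <= x <= x2 -> y1 <= y <= y2 ->
    (x = x1 \/ x = x2 \/ y = y1 \/ y = y2) -> eta <= cabs ((x +i* y)%C - (px +i* py)%C).
  move=> _ _ Hxy; have : eta <= eta by [].
  rewrite {2}/eta !le_min => /andP[/andP[i3 i4] /andP[i5 i6]].
  have := le_Re_pair x y (px +i* py)%C; have := le_Im_pair x y (px +i* py)%C => /=.
  move=> j1 j2; clear -i3 i4 i5 i6 j1 j2 Hxy.
  case: Hxy j1 j2 => [->|[->|[->|->]]] j1 j2.
  - by apply: le_trans j2; apply: le_trans i3 _; rewrite distrC ler_norm.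
  - by apply: le_trans j2; apply: le_trans i4 _; rewrite ler_norm.
  - by apply: le_trans j1; apply: le_trans i5 _; rewrite distrC ler_norm.
  - by apply: le_trans j1; apply: le_trans i6 _; rewrite ler_norm.
have ef : edges (fun z => f z * (z - (px +i* py)%C)^-1) x1 x2 y1 y2.
  apply: edges_cont => // x y xx yy Hxy; apply: ccontM.
    by have [l /hder_cont] := df _ _ xx yy.
  apply: ccontV; first by rewrite -cabs_gt0 (lt_le_trans eta0)// dist.
  by apply: ccontD; [exact: ccont_id|exact: ccont_cst].
apply: le_trans (cabs_rint_le (M := M * eta^-1) hxx hyy ef _) _; last first.
  by rewrite le_eqVlt; apply/orP; left; apply/eqP; rewrite -/L; ring.
move=> x y xx yy Hxy; rewrite cabsM cabsV.
apply: ler_pM; rewrite ?cabs_ge0 ?invr_ge0 ?cabs_ge0//; first exact: fM.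
rewrite lef_pV2 ?posrE//; first exact: dist.
by rewrite (lt_le_trans eta0)// dist.
Qed.

End Cauchy.

(** * Differentiability of the derivative *)

Section Derivative.
Variable R : realType.
Local Notation mu := (@lebesgue_measure R).
Implicit Types (f g : R[i] -> R[i]) (x y : R).

Lemma hder_unique f z l l' : hder f z l -> hder f z l' -> l = l'.
Proof.
move=> /hderP H /hderP H'; apply/eqP; rewrite -subr_eq0 -cabs_eq0 eq_le cabs_ge0 andbT.
rewrite leNgt; apply/negP => K0.
have e0 : 0 < cabs (l - l') / 4 by rewrite divr_gt0.
have [d d0 Hd] := H _ e0; have [d' d'0 Hd'] := H' _ e0.
pose t := Num.min d d' / 2.
have t0 : 0 < t by rewrite divr_gt0// lt_min d0.
have tm : t < Num.min d d' by rewrite /t ltr_pdivrMr// ltr_pMr ?ltr1n// lt_min d0.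
pose w := z + t%:C.
have wz : w - z = t%:C by rewrite /w addrAC subrr add0r.
have ct : cabs t%:C = t :> R by rewrite cabs_real gtr0_norm.
move: tm; rewrite lt_min => /andP[td td'].
have := Hd w; have := Hd' w; rewrite wz ct => /(_ td') h1 /(_ td) h2.
have E : (l - l') * t%:C =
    (f w - f z - l' * t%:C) - (f w - f z - l * t%:C) by ring.
have := cabsBD (f w - f z - l' * t%:C) (f w - f z - l * t%:C).
rewrite -E cabsM ct => h3.
have := le_trans h3 (lerD h1 h2); rewrite -mulrDl ler_pM2r//.
by move: K0; clear; lra.
Qed.

Lemma path_bounded f (p : R -> R[i]) a b : a <= b ->
  (forall t s, cabs (p t - p s) <= `|t - s|) ->
  (forall t, a <= t <= b -> ccont f (p t)) ->
  exists M, forall t, a <= t <= b -> cabs (f (p t)) <= M.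
Proof.
move=> ab hp cf.
have [|c _ Hc] := @EVT_max R (fun t => cabs (f (p t))) a b ab.
  apply: continuous_in_subspaceT => x; rewrite inE /= in_itv /= => xab.
  apply/cvgrPdist_lt => e e0; have [d d0 H] := cf x xab e e0.
  apply: filterS (nbhsx_ballx x d d0) => t xd.
  have h : cabs (f (p t) - f (p x)) < e.
    by apply: H; rewrite (le_lt_trans (hp _ _))// distrC.
  by apply: le_lt_trans h; rewrite distrC cabs_dist.
by exists (cabs (f (p c))) => t tab; apply: Hc; rewrite in_itv.
Qed.

Lemma rect_bounded f x1 x2 y1 y2 : x1 <= x2 -> y1 <= y2 ->
  (forall x y, x1 <= x <= x2 -> y1 <= y <= y2 ->
     (x = x1 \/ x = x2 \/ y = y1 \/ y = y2) -> ccont f (x +i* y)%C) ->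
  exists2 M, 0 <= M & forall x y, x1 <= x <= x2 -> y1 <= y <= y2 ->
     (x = x1 \/ x = x2 \/ y = y1 \/ y = y2) -> cabs (f (x +i* y)%C) <= M.
Proof.
move=> hx hy cf.
have [M1 H1] := path_bounded hy (vpath x1) (fun t ht =>
  cf x1 t (introT andP (conj (lexx _) hx)) ht (or_introl erefl)).
have [M2 H2] := path_bounded hy (vpath x2) (fun t ht =>
  cf x2 t (introT andP (conj hx (lexx _))) ht (or_intror (or_introl erefl))).
have [M3 H3] := path_bounded hx (hpath y1) (fun t ht =>
  cf t y1 ht (introT andP (conj (lexx _) hy))
     (or_intror (or_intror (or_introl erefl)))).
have [M4 H4] := path_bounded hx (hpath y2) (fun t ht =>
  cf t y2 ht (introT andP (conj hy (lexx _)))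
     (or_intror (or_intror (or_intror erefl)))).
exists (`|M1| + `|M2| + (`|M3| + `|M4|)); first by rewrite !addr_ge0.
move=> x y xx yy [->|[->|[->|->]]].
- apply: le_trans (H1 _ yy) _; apply: le_trans (ler_norm _) _.
  by rewrite -addrA lerDl !addr_ge0.
- apply: le_trans (H2 _ yy) _; apply: le_trans (ler_norm _) _.
  by rewrite -addrA addrCA lerDl !addr_ge0.
- apply: le_trans (H3 _ xx) _; apply: le_trans (ler_norm _) _.
  by rewrite addrCA lerDl !addr_ge0.
- apply: le_trans (H4 _ xx) _; apply: le_trans (ler_norm _) _.
  by rewrite addrA lerDr !addr_ge0.
Qed.

Section CauchyTransform.
Variables (x1 x2 y1 y2 : R) (f : R[i] -> R[i]).
Hypotheses (hx : x1 <= x2) (hy : y1 <= y2).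
Let onb x y := [/\ x1 <= x <= x2, y1 <= y <= y2 &
  (x = x1 \/ x = x2 \/ y = y1 \/ y = y2)].
Hypothesis cf : forall x y, onb x y -> ccont f (x +i* y)%C.

Lemma hder_rint (k k' : R[i] -> R[i] -> R[i]) (z : R[i]) (C d : R) : 0 < d ->
  (forall w x y, cabs (w - z) < d -> onb x y -> ccont (k w) (x +i* y)%C) ->
  (forall x y, onb x y -> ccont (k' z) (x +i* y)%C) ->
  (forall w x y, cabs (w - z) < d -> onb x y ->
    cabs (k w (x +i* y)%C - k z (x +i* y)%C - (w - z) * k' z (x +i* y)%C)
      <= C * cabs (w - z) ^+ 2) ->
  hder (fun w => rint (fun s => f s * k w s) x1 x2 y1 y2) z
       (rint (fun s => f s * k' z s) x1 x2 y1 y2).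
Proof.
move=> d0 ck ck' kC.
have [M M0 fM] : exists2 M, 0 <= M & forall x y, x1 <= x <= x2 -> y1 <= y <= y2 ->
     (x = x1 \/ x = x2 \/ y = y1 \/ y = y2) -> cabs (f (x +i* y)%C) <= M.
  by apply: rect_bounded => // x y xx yy Hxy; apply: cf.
have ek w : cabs (w - z) < d -> edges (fun s => f s * k w s) x1 x2 y1 y2.
  by move=> wd; apply: edges_cont => // x y xx yy Hxy; apply: ccontM; [exact: cf|exact: ck].
have ek' : edges (fun s => f s * k' z s) x1 x2 y1 y2.
  by apply: edges_cont => // x y xx yy Hxy; apply: ccontM; [exact: cf|exact: ck'].
have zd : cabs (z - z) < d by rewrite subrr cabs0.
apply/hderP => e e0.
pose B := 4 * (M * `|C|) * ((x2 - x1) + (y2 - y1)).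
have B0 : 0 <= B by rewrite !mulr_ge0// addr_ge0// subr_ge0.
exists (Num.min d (e / (B + 1))).
  by rewrite lt_min d0 divr_gt0// ltr_wpDl.
move=> w; rewrite lt_min => /andP[wd we].
have -> : rint (fun s => f s * k w s) x1 x2 y1 y2
   - rint (fun s => f s * k z s) x1 x2 y1 y2
   - rint (fun s => f s * k' z s) x1 x2 y1 y2 * (w - z)
   = rint (fun s => f s * k w s + (-1 * (f s * k z s)
            + (z - w) * (f s * k' z s))) x1 x2 y1 y2.
  have e1 : edges (fun s => -1 * (f s * k z s)) x1 x2 y1 y2.
    apply: edges_cont => // x y xx yy Hxy; apply: ccontM; first exact: ccont_cst.
    by apply: ccontM; [exact: cf|exact: ck].
  have e2 : edges (fun s => (z - w) * (f s * k' z s)) x1 x2 y1 y2.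
    apply: edges_cont => // x y xx yy Hxy; apply: ccontM; first exact: ccont_cst.
    by apply: ccontM; [exact: cf|exact: ck'].
  have e3 : edges (fun s => -1 * (f s * k z s) + (z - w) * (f s * k' z s)) x1 x2 y1 y2.
    case: e1 e2 => ? ? ? ? [? ? ? ?].
    by split; apply: cintegrableD.
  by rewrite (rintD (ek _ wd) e3) (rintD e1 e2) (rintZ _ (ek _ zd)) (rintZ _ ek'); ring.
apply: le_trans (cabs_rint_le (M := M * (`|C| * cabs (w - z) ^+ 2)) hx hy _ _) _.
- apply: edges_cont => // x y xx yy Hxy.
  have c1 : ccont (fun s => f s * k w s) (x +i* y)%C.
    by apply: ccontM; [exact: cf|exact: ck].
  apply: ccontD => //; apply: ccontD.
    apply: ccontM; first exact: ccont_cst.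
    by apply: ccontM; [exact: cf|exact: ck].
  apply: ccontM; first exact: ccont_cst.
  by apply: ccontM; [exact: cf|exact: ck'].
- move=> x y xx yy Hxy; set s := (x +i* y)%C.
  have -> : f s * k w s + (-1 * (f s * k z s) + (z - w) * (f s * k' z s))
    = f s * (k w s - k z s - (w - z) * k' z s) by ring.
  rewrite cabsM; apply: ler_pM; rewrite ?cabs_ge0//; first exact: fM.
  apply: le_trans (kC _ _ _ wd _) _; first by split.
  by rewrite ler_wpM2r ?sqr_ge0// ler_norm.
- have -> : 4 * (M * (`|C| * cabs (w - z) ^+ 2)) * (x2 - x1 + (y2 - y1)) =
    B * cabs (w - z) * cabs (w - z) by rewrite /B; ring.
  apply: ler_wpM2r; first exact: cabs_ge0.
  apply: le_trans (ler_wpM2l B0 (ltW we)) _.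
  rewrite mulrCA ler_piMr//; first exact: ltW.
  by rewrite ler_pdivrMr ?mul1r ?lerDl// ltr_wpDl.
Qed.

Hypothesis hx' : x1 < x2.

Lemma dist_boundary px py : x1 < px < x2 -> y1 < py < y2 ->
  exists2 e : R, 0 < e & forall w x y, cabs (w - (px +i* py)%C) < e -> onb x y ->
    e <= cabs ((x +i* y)%C - w).
Proof.
move=> /andP[hx1 hx2] /andP[hy1 hy2].
pose eta := Num.min (Num.min (px - x1) (x2 - px)) (Num.min (py - y1) (y2 - py)).
have eta0 : 0 < eta by rewrite !lt_min !subr_gt0 hx1 hx2 hy1 hy2.
have dist x y : x1 <= x <= x2 -> y1 <= y <= y2 ->
    (x = x1 \/ x = x2 \/ y = y1 \/ y = y2) -> eta <= cabs ((x +i* y)%C - (px +i* py)%C).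
  move=> _ _ Hxy; have : eta <= eta by [].
  rewrite {2}/eta !le_min => /andP[/andP[i3 i4] /andP[i5 i6]].
  have := le_Re_pair x y (px +i* py)%C; have := le_Im_pair x y (px +i* py)%C => /=.
  move=> j1 j2; clear -i3 i4 i5 i6 j1 j2 Hxy.
  case: Hxy j1 j2 => [->|[->|[->|->]]] j1 j2.
  - by apply: le_trans j2; apply: le_trans i3 _; rewrite distrC ler_norm.
  - by apply: le_trans j2; apply: le_trans i4 _; rewrite ler_norm.
  - by apply: le_trans j1; apply: le_trans i5 _; rewrite distrC ler_norm.
  - by apply: le_trans j1; apply: le_trans i6 _; rewrite ler_norm.
exists (eta / 2); first by rewrite divr_gt0.
move=> w x y we [xx yy Hxy].
have := dist _ _ xx yy Hxy.
have := cabsD ((x +i* y)%C - w) (w - (px +i* py)%C); rewrite addrA subrK.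
by move: we; clear; lra.
Qed.

Lemma cauchy_transform_der px py : x1 < px < x2 -> y1 < py < y2 ->
  hder (fun w => rint (fun s => f s * (s - w)^-1) x1 x2 y1 y2) (px +i* py)%C
    (rint (fun s => f s * (s - (px +i* py)%C)^-2) x1 x2 y1 y2) /\
  exists l, hder (fun w => rint (fun s => f s * (s - w)^-2) x1 x2 y1 y2)
    (px +i* py)%C l.
Proof.
move=> hpx hpy; have [e e0 He] := dist_boundary hpx hpy.
set z := (px +i* py)%C in He *.
have zz : cabs (z - z) < e by rewrite subrr cabs0.
have ne w x y : cabs (w - z) < e -> onb x y -> (x +i* y)%C - w != 0.
  by move=> we bxy; rewrite -cabs_gt0 (lt_le_trans e0)// He.
have csub w s : ccont (fun s => s - w) s.
  by apply: ccontD; [exact: ccont_id|exact: ccont_cst].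
have c1 w x y : cabs (w - z) < e -> onb x y -> ccont (fun s => (s - w)^-1) (x +i* y)%C.
  by move=> we bxy; apply: ccontV => //; exact: ne we bxy.
have c2 w x y : cabs (w - z) < e -> onb x y -> ccont (fun s => (s - w)^-2) (x +i* y)%C.
  move=> we bxy; have -> : (fun s => (s - w)^-2) = (fun s => (s - w)^-1 * (s - w)^-1).
    by apply/funext => s; rewrite -invfM.
  by apply: ccontM; apply: c1.
have inv_le w x y : cabs (w - z) < e -> onb x y -> cabs ((x +i* y)%C - w)^-1 <= e^-1.
  move=> we bxy; rewrite cabsV lef_pV2 ?posrE//; first exact: He.
  by rewrite (lt_le_trans e0)// He.
split.
  apply: (@hder_rint (fun w s => (s - w)^-1) (fun w s => (s - w)^-2) z (e^-1 ^+ 3) e) => //.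
    by move=> x y bxy; exact: c2.
  move=> w x y we bxy; set s := (x +i* y)%C.
  have sw : s - w != 0 := ne _ _ _ we bxy; have sz : s - z != 0 := ne _ _ _ zz bxy.
  have -> : (s - w)^-1 - (s - z)^-1 - (w - z) * (s - z) ^- 2 =
    ((s - w)^-1 * ((s - z)^-1 * (s - z)^-1)) * (w - z) ^+ 2.
    by field; rewrite sw sz.
  rewrite cabsM cabsX ler_wpM2r ?sqr_ge0// !cabsM exprS expr2.
  have iw := inv_le _ _ _ we bxy; have iz := inv_le _ _ _ zz bxy.
  by rewrite -/s in iw iz; rewrite !ler_pM ?mulr_ge0 ?cabs_ge0.
exists (rint (fun s => f s * (2 * ((s - z)^-1) ^+ 3)) x1 x2 y1 y2).
have c3 x y : onb x y -> ccont (fun s => 2 * ((s - z)^-1) ^+ 3) (x +i* y)%C.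
  move=> bxy; have -> : (fun s => 2 * ((s - z)^-1) ^+ 3) =
     (fun s => 2 * ((s - z)^-1 * (s - z)^-2)).
    by apply/funext => s; rewrite exprS -exprVn.
  by apply: ccontM; [exact: ccont_cst|apply: ccontM; [exact: c1|exact: c2]].
have [D D0 HD] : exists2 D, 0 <= D & forall x y, onb x y -> cabs ((x +i* y)%C - z) <= D.
  have [D D0 HD] : exists2 D, 0 <= D & forall x y, x1 <= x <= x2 -> y1 <= y <= y2 ->
     (x = x1 \/ x = x2 \/ y = y1 \/ y = y2) -> cabs ((x +i* y)%C - z) <= D.
    by apply: (@rect_bounded (fun s => s - z)).
  by exists D => // x y [xx yy Hxy]; apply: HD.
(* The constant bounds the factor of [(w - z) ^+ 2] in the exact remainder computed below: five
   inverse distances, each at most [e^-1], times the modulus of [3 * (s - z) - 2 * (w - z)]. *)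
apply: (@hder_rint (fun w s => (s - w)^-2) (fun w s => 2 * ((s - w)^-1) ^+ 3) z
  (e^-1 ^+ 5 * (3 * D + 2 * e)) e) => //.
move=> w x y we bxy; set s := (x +i* y)%C.
have sw : s - w != 0 := ne _ _ _ we bxy; have sz : s - z != 0 := ne _ _ _ zz bxy.
have -> : (s - w) ^- 2 - (s - z) ^- 2 - (w - z) * (2 * (s - z)^-1 ^+ 3) =
  ((s - w)^-1 ^+ 2 * (s - z)^-1 ^+ 3 * (3 * (s - z) - 2 * (w - z))) * (w - z) ^+ 2.
  by field; rewrite sw sz.
rewrite cabsM cabsX ler_wpM2r ?sqr_ge0// cabsM cabsM !cabsX.
have iw := inv_le _ _ _ we bxy; have iz := inv_le _ _ _ zz bxy.
rewrite -/s in iw iz.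
have e1 : 0 <= e^-1 by rewrite invr_ge0 ltW.
apply: ler_pM; rewrite ?mulr_ge0 ?exprn_ge0 ?cabs_ge0//.
  rewrite (_ : 5%N = (2 + 3)%N)// exprD; apply: ler_pM; rewrite ?exprn_ge0 ?cabs_ge0//.
  - by rewrite ler_pXn2r ?nnegrE ?cabs_ge0.
  - by rewrite ler_pXn2r ?nnegrE ?cabs_ge0.
apply: le_trans (cabsBD _ _) _; rewrite !cabsM !cabs_nat.
by apply: lerD; rewrite ler_wpM2l//; [exact: HD|exact: ltW].
Qed.

End CauchyTransform.

(** On a rectangle around z, f is the quotient of its Cauchy transform F by the transform W of the
    constant 1, and both can be differentiated twice under the integral. W appears because the
    winding integral has not been evaluated. *)
Lemma hder_deriv f f' (d : R) :
  (forall z, strip d z -> hder f z (f' z)) ->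
  forall z, strip d z -> exists l, hder f' z l.
Proof.
move=> df z zd.
have zd' : `|complex.Im z| < d := zd.
case: z zd zd' => px py /= zd; rewrite ltr_norml => /andP[py1 py2].
pose y1 := (py - d) / 2; pose y2 := (py + d) / 2.
pose x1 := px - 1; pose x2 := px + 1.
have hx : x1 < px < x2 by rewrite /x1 /x2 ltrDl ltr01 gtrBl ltr01.
have hy : y1 < py < y2 by rewrite /y1 /y2; apply/andP; split; lra.
have hxx : x1 <= x2 by rewrite /x1 /x2; lra.
have hyy : y1 <= y2 by rewrite /y1 /y2; lra.
have hxx' : x1 < x2 by rewrite /x1 /x2; lra.
have sd x y : y1 <= y <= y2 -> strip d (x +i* y)%C.
  rewrite /strip/= => /andP[h1 h2]; rewrite ltr_norml.
  by rewrite /y1 /y2 in h1 h2; apply/andP; split; lra.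
have hol : holo_rect f x1 x2 y1 y2.
  by move=> x y _ yy; exists (f' (x +i* y)%C); apply: df; exact: sd.
have cf x y : [/\ x1 <= x <= x2, y1 <= y <= y2 &
    (x = x1 \/ x = x2 \/ y = y1 \/ y = y2)] -> ccont f (x +i* y)%C.
  by move=> [xx yy _]; have [l /hder_cont] := hol _ _ xx yy.
pose one (_ : R[i]) : R[i] := 1.
have cone x y : [/\ x1 <= x <= x2, y1 <= y <= y2 &
    (x = x1 \/ x = x2 \/ y = y1 \/ y = y2)] -> ccont one (x +i* y)%C.
  by move=> _; exact: ccont_cst.
pose F w := rint (fun s => f s * (s - w)^-1) x1 x2 y1 y2.
pose F' w := rint (fun s => f s * (s - w)^-2) x1 x2 y1 y2.
pose W w := rint (fun s => one s * (s - w)^-1) x1 x2 y1 y2.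
pose W' w := rint (fun s => one s * (s - w)^-2) x1 x2 y1 y2.
pose inside (u v : R) := x1 < u < x2 /\ y1 < v < y2.
have dF u v : inside u v -> hder F (u +i* v)%C (F' (u +i* v)%C) /\
    exists l, hder F' (u +i* v)%C l.
  by move=> [? ?]; apply: cauchy_transform_der.
have dW u v : inside u v -> hder W (u +i* v)%C (W' (u +i* v)%C) /\
    exists l, hder W' (u +i* v)%C l.
  by move=> [? ?]; apply: cauchy_transform_der.
have WE w : W w = rint (fun s => (s - w)^-1) x1 x2 y1 y2.
  by apply: eq_rint => // x y _ _ _; rewrite mul1r.
have W0 u v : inside u v -> W (u +i* v)%C != 0.
  by move=> [? ?]; rewrite WE; exact: winding_neq0.
have fE u v : inside u v -> f (u +i* v)%C = F (u +i* v)%C * (W (u +i* v)%C)^-1.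
  move=> uv; have [uu vv] := uv.
  by rewrite /F cauchy_rect// -WE mulfK// W0.
have near_in u0 v0 : inside u0 v0 -> exists2 eps : R, 0 < eps &
    forall w, cabs (w - (u0 +i* v0)%C) < eps -> inside (complex.Re w) (complex.Im w).
  move=> [/andP[i1 i2] /andP[i3 i4]].
  exists (Num.min (Num.min (u0 - x1) (x2 - u0)) (Num.min (v0 - y1) (y2 - v0))).
    by rewrite !lt_min !subr_gt0 i1 i2 i3 i4.
  case=> u v; rewrite !lt_min => /andP[/andP[h1 h2] /andP[h3 h4]].
  have := le_Re_pair u v (u0 +i* v0)%C; have := le_Im_pair u v (u0 +i* v0)%C => /=.
  move=> j1 j2; have {}h1 := le_lt_trans j2 h1; have {}h2 := le_lt_trans j2 h2.
  have {}h3 := le_lt_trans j1 h3; have {}h4 := le_lt_trans j1 h4.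
  move: h1 h2 h3 h4; clear; rewrite /inside !ltr_norml.
  by move=> /andP[? ?] /andP[? ?] /andP[? ?] /andP[? ?]; split; apply/andP; split; lra.
pose G w := F' w * (W w)^-1 + F w * (- W' w / W w ^+ 2).
(* Inside the rectangle uniqueness of the derivative identifies f' with the derivative G of the
   quotient [F / W]; it is G that is differentiated again. *)
have f'E u v : inside u v -> f' (u +i* v)%C = G (u +i* v)%C.
  move=> uv; have [hF _] := dF _ _ uv; have [hW _] := dW _ _ uv.
  have [eps eps0 Heps] := near_in _ _ uv.
  apply: (hder_unique (f := f) (z := (u +i* v)%C)).
    apply: df; apply: sd; case: uv => _ /andP[? ?].
    by apply/andP; split; exact: ltW.
  apply: near_hder eps0 _ (hderM hF (hderV (W0 _ _ uv) hW)).
  by case=> u' v' /Heps /= u'v'; rewrite fE.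
have z_in : inside px py by [].
have [hF [F'' hF']] := dF _ _ z_in; have [hW [W'' hW']] := dW _ _ z_in.
have [eps eps0 Heps] := near_in _ _ z_in.
have hG : exists l, hder G (px +i* py)%C l.
  have hV := hderV (W0 _ _ z_in) hW.
  have hW2 := hderM hW hW.
  have W20 : W (px +i* py)%C * W (px +i* py)%C != 0 by rewrite mulf_neq0 ?W0.
  have -> : G = (fun w => F' w * (W w)^-1 + F w * (- W' w * (W w * W w)^-1)).
    by apply/funext => w; rewrite /G expr2.
  have hVV := @hderV _ (fun w => W w * W w) _ _ W20 hW2.
  have h1 := hderM hF' hV.
  have h2 := hderM hF (hderM (hderN hW') hVV).
  by eexists; exact: (hderD h1 h2).
have [l hl] := hG; exists l; apply: near_hder eps0 _ hl.
by case=> u v /Heps /= uv; rewrite f'E.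
Qed.

End Derivative.

(** * Fourier pairs by contour shifts *)

Section RealIntegrals.
Variable R : realType.
Local Notation mu := (@lebesgue_measure R).
Implicit Types (f g F : R -> R) (c x : R).

Lemma measurable_cont_except f c :
  (forall x, x != c -> {for x, continuous f}) -> measurable_fun setT f.
Proof.
move=> cf.
have -> : [set: R] = [set x | x != c] `|` [set c].
  by apply/seteqP; split => // x _; case: (eqVneq x c) => [->|]; [right|left].
have oc : open [set x : R | x != c].
  have -> : [set x : R | x != c] = ~` [set c].
    by apply/seteqP; split => x /= => [/eqP|xc]; [|apply/eqP].
  exact/closed_openC/closed_eq.
apply/measurable_funU => //; first exact: open_measurable.
split; last exact: measurable_fun_set1.
by apply: open_continuous_measurable_fun => // x; rewrite inE => /cf.
Qed.

Lemma integrable_measurable (D : set R) (f : R -> R) :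
  mu.-integrable D (EFin \o f) -> measurable_fun D f.
Proof. by move=> /measurable_int/measurable_EFinP. Qed.

Lemma integrable_scale (D : set R) (k : R) f : measurable D ->
  mu.-integrable D (EFin \o f) -> mu.-integrable D (EFin \o (fun x => k * f x)).
Proof.
move=> mD intf.
have -> : EFin \o (fun x => k * f x) = (fun x => k%:E * (EFin \o f) x)%E.
  by apply/funext.
exact: integrableZl.
Qed.

Lemma integrable_addr (D : set R) f g : measurable D ->
  mu.-integrable D (EFin \o f) -> mu.-integrable D (EFin \o g) ->
  mu.-integrable D (EFin \o (fun x => f x + g x)).
Proof.
move=> mD i1 i2.
have -> : EFin \o (fun x => f x + g x) = ((EFin \o f) \+ (EFin \o g))%E.
  by apply/funext => x; rewrite /= EFinD.
exact: integrableD.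
Qed.

Lemma integrable_subr (D : set R) f g : measurable D ->
  mu.-integrable D (EFin \o f) -> mu.-integrable D (EFin \o g) ->
  mu.-integrable D (EFin \o (fun x => f x - g x)).
Proof.
move=> mD i1 i2.
have -> : EFin \o (fun x => f x - g x) = ((EFin \o f) \- (EFin \o g))%E.
  by apply/funext => x; rewrite /= EFinB.
exact: integrableB.
Qed.

(** Convergence may fail at one point c. This is used in [contour_shift_Re], whose integrands are
    quotients taking the default value of division at the origin. *)
Lemma Rintegral_dct (D : set R) (f_ : nat -> R -> R) f g c : measurable D ->
  (forall n, measurable_fun D (f_ n)) -> measurable_fun D f ->
  (forall x, D x -> x != c -> (fun n => f_ n x) @ \oo --> f x) ->
  (forall n x, D x -> `|f_ n x| <= g x) ->
  mu.-integrable D (EFin \o g) ->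
  mu.-integrable D (EFin \o f) /\
  (fun n => \int[mu]_(x in D) f_ n x) @ \oo --> \int[mu]_(x in D) f x.
Proof.
move=> mD mf_ mf ff fg ig.
have nc : mu.-negligible [set c].
  by exists [set c]; split => //; rewrite lebesgue_measure_set1.
have [|||||ifn _ cvg_] := @dominated_convergence _ _ _ mu D mD
  (fun n => EFin \o f_ n) (EFin \o f) (EFin \o g).
- by move=> n; apply/measurable_EFinP; exact: mf_.
- by apply/measurable_EFinP.
- apply: negligibleS nc => x /= H; apply: contrapT => xc; apply: H => Dx.
  by apply: cvg_EFin; [exact: nearW|apply: ff => //; apply/eqP].
- exact: ig.
- by apply: aeW => x /= n Dx; rewrite lee_fin fg.
split => //.
have -> : (fun n => \int[mu]_(x in D) f_ n x) =
  fine \o (fun n => \int[mu]_(x in D) (EFin \o f_ n) x)%E by [].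
apply: fine_cvg; rewrite /Rintegral fineK//.
exact: integrable_fin_num.
Qed.

Lemma even_FTC f F (l : R) : (forall x, 0 <= f x) -> continuous f ->
  (forall x, f (- x) = f x) -> (forall x, 0 < x -> is_derive x 1 F (f x)) ->
  F x @[x --> 0^'+] --> F 0 -> F x @[x --> +oo] --> l ->
  mu.-integrable setT (EFin \o f) /\ \int[mu]_x f x = 2 * (l - F 0).
Proof.
move=> f0 cf ef dF F0 Fl.
have E : (\int[mu]_x (f x)%:E = (2 * (l - F 0))%:E)%E.
  rewrite ge0_symfun_integralT//; last by move=> x /=; rewrite ef.
  rewrite -set_itvcy (@ge0_continuous_FTC2y _ f F 0 l)//.
  - exact: continuous_subspaceT.
  - by move=> x /dF[].
  - move=> x; rewrite in_itv/= andbT => /dF dFx.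
    by rewrite derive1E; exact: derive_val.
split; last by rewrite /Rintegral E.
apply/integrableP; split.
  by apply/measurable_EFinP; exact: continuous_measurable_fun.
rewrite (_ : (\int[mu]_x _)%E = (2 * (l - F 0))%:E) ?ltry//.
by rewrite -E; apply: eq_integral => x _ /=; rewrite ger0_norm.
Qed.

Lemma cvgr_at_right_continuous F (x : R) : {for x, continuous F} ->
  F y @[y --> x^'+] --> F x.
Proof. by move=> cF; exact: cvg_at_right_filter. Qed.

Lemma cvgryM (k : R) : 0 < k -> k * x @[x --> +oo] --> +oo.
Proof.
move=> k0; apply/cvgryPge => A; near=> x.
rewrite -ler_pdivrMl//; near: x; exact: nbhs_pinfty_ge.
Unshelve. all: by end_near. Qed.

Lemma integrable_oneDsqr (k : R) : 0 < k ->
  mu.-integrable setT (EFin \o (fun x => (1 + (k * x) ^+ 2)^-1)) /\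
  \int[mu]_x (1 + (k * x) ^+ 2)^-1 = pi / k.
Proof.
move=> k0.
have p0 x : 0 < 1 + (k * x) ^+ 2 by rewrite ltr_pwDl ?sqr_ge0.
have cx (x : R) : {for x, continuous (fun x => 1 + (k * x) ^+ 2)}.
  apply: is_derive_continuous; apply: is_derive_eq; exact: erefl.
have dA (x : R) : is_derive x 1 (fun x => k^-1 * atan (k * x)) (1 + (k * x) ^+ 2)^-1.
  by apply: is_derive_eq; rewrite /GRing.scale/=; field; rewrite !gt_eqF.
have [|||||i1 i2] := @even_FTC (fun x => (1 + (k * x) ^+ 2)^-1)
    (fun x => k^-1 * atan (k * x)) (k^-1 * (pi / 2)).
- by move=> x; rewrite invr_ge0 ltW.
- by move=> x; apply: cvgV; [rewrite gt_eqF|exact: cx].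
- by move=> x; rewrite mulrN sqrrN.
- by apply: cvgr_at_right_continuous; exact: is_derive_continuous (dA 0).
- apply: cvgMr; apply: (cvg_comp (fun x => k * x) atan (cvgryM k0)).
  exact: cvgy_atan.
split=> //; rewrite i2 mulr0 atan0; field.
by rewrite gt_eqF.
Qed.

Lemma integrable_truncate f : mu.-integrable setT (EFin \o f) ->
  (fun n : nat => \int[mu]_(x in `[- n%:R, n%:R]) f x) @ \oo --> \int[mu]_x f x.
Proof.
move=> intf; under eq_fun do rewrite Rintegral_mkcond.
have mf := integrable_measurable intf.
have inf : mu.-integrable setT (EFin \o (fun x => `|f x|)).
  exact: integrable_abse intf.
have [||||_ //] := @Rintegral_dct setT (fun n : nat => f \_ `[- n%:R, n%:R]) f
  (fun x => `|f x|) 0 measurableT _ _ _ _ inf.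
- by move=> n; apply/measurable_restrict => //; exact: measurable_funS mf.
- by [].
- move=> x _ _; apply: cvg_near_cst.
  near=> n; rewrite patchE ifT// inE /= in_itv/= -ler_norml.
  near: n; exact: nbhs_infty_ger.
- move=> n x _; rewrite patchE; by case: ifP => // _; rewrite normr0.
Unshelve. all: by end_near. Qed.

End RealIntegrals.

(** * The complex exponential *)

Section Cexp.
Variable R : realType.
Local Notation mu := (@lebesgue_measure R).
Implicit Types (x y : R) (z w : R[i]).

Lemma norm_sin_le x : `|sin x| <= `|x|.
Proof.
wlog x0 : x / 0 <= x => [H|].
  have [|x0] := lerP 0 x; first exact: H.
  by have := H (- x); rewrite sinN !normrN oppr_ge0 ltW//; exact.
have E : \int[mu]_(t in `[0, x]) cos t = sin x - sin 0.
  by apply: (Rintegral_FTC x0 _ (fun t _ => is_derive_sin t)) => t _; exact: continuous_cos.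
have := @abs_Rintegral_le R 0 x cos 1 x0.
rewrite E sin0 !subr0 mul1r [`|x|]ger0_norm//; apply.
- by apply: continuous_integrable => t _; exact: continuous_cos.
- by move=> t _; exact: cos_max.
Qed.

Lemma cos_sub1_le x : `|cos x - 1| <= `|x|.
Proof.
wlog x0 : x / 0 <= x => [H|].
  have [|x0] := lerP 0 x; first exact: H.
  by rewrite -(normrN x) -cosN; apply: H; rewrite oppr_ge0 ltW.
have E : \int[mu]_(t in `[0, x]) (- sin t) = cos x - cos 0.
  apply: (Rintegral_FTC x0 _ (fun t _ => is_derive_cos t)) => t _.
  by apply: cvgN; exact: continuous_sin.
have := @abs_Rintegral_le R 0 x (fun t => - sin t) 1 x0.
rewrite E cos0 subr0 mul1r [`|x|]ger0_norm//; apply.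
- by apply: continuous_integrable => t _; apply: cvgN; exact: continuous_sin.
- by move=> t _; rewrite normrN; exact: sin_max.
Qed.

Lemma cos_sub1_le2 x : `|cos x - 1| <= x ^+ 2.
Proof.
wlog x0 : x / 0 <= x => [H|].
  have [|x0] := lerP 0 x; first exact: H.
  by rewrite -sqrrN -cosN; apply: H; rewrite oppr_ge0 ltW.
have E : \int[mu]_(t in `[0, x]) (- sin t) = cos x - cos 0.
  apply: (Rintegral_FTC x0 _ (fun t _ => is_derive_cos t)) => t _.
  by apply: cvgN; exact: continuous_sin.
have := @abs_Rintegral_le R 0 x (fun t => - sin t) x x0.
rewrite E cos0 subr0 expr2; apply.
- by apply: continuous_integrable => t _; apply: cvgN; exact: continuous_sin.
- move=> t /andP[t0 tx]; rewrite normrN (le_trans (norm_sin_le _))//.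
  by rewrite ger0_norm.
Qed.

Lemma sin_sub_le2 x : `|sin x - x| <= x ^+ 2.
Proof.
wlog x0 : x / 0 <= x => [H|].
  have [|x0] := lerP 0 x; first exact: H.
  rewrite -sqrrN -normrN opprB addrC -sinN -[x in _ + x]opprK addrC.
  by rewrite [_ + sin _]addrC; apply: H; rewrite oppr_ge0 ltW.
have E : \int[mu]_(t in `[0, x]) (cos t - 1) = (sin x - x) - (sin 0 - 0).
  apply: (Rintegral_FTC (F := fun t => sin t - t)) => // t _.
  by apply: cvgB; [exact: continuous_cos|exact: cvg_cst].
have := @abs_Rintegral_le R 0 x (fun t => cos t - 1) x x0.
rewrite E sin0 !subr0 expr2; apply.
- by apply: continuous_integrable => t _; apply: cvgB;
    [exact: continuous_cos|exact: cvg_cst].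
- move=> t /andP[t0 tx]; rewrite (le_trans (cos_sub1_le _))//.
  by rewrite ger0_norm.
Qed.

Lemma expR_sub1_le x : `|expR x - 1| <= `|x| * expR `|x|.
Proof.
have E1 : 1 <= expR `|x| by rewrite -expR0 ler_expR.
have h1 := expR_ge1Dx x.
have h2 : expR x - 1 <= x * expR x.
  have := expR_ge1Dx (- x); rewrite expRN => h.
  have e0 := expR_gt0 x.
  have : (1 - x) * expR x <= 1.
    by rewrite -[leRHS](mulVf (lt0r_neq0 e0)) ler_wpM2r// ltW.
  by rewrite mulrBl mul1r; lra.
rewrite ler_norml; apply/andP; split.
  rewrite lerNl opprB; apply: le_trans (_ : - x <= _); first by lra.
  apply: le_trans (ler_norm _) _; rewrite normrN.
  by rewrite ler_peMr.
apply: le_trans h2 _; have [x0|x0] := lerP 0 x.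
  by rewrite ger0_norm.
apply: le_trans (_ : 0 <= _).
  by rewrite nmulr_rle0// expR_ge0.
by rewrite mulr_ge0// expR_ge0.
Qed.

Lemma expR_sub1_sub_le x : `|expR x - 1 - x| <= x ^+ 2 * expR `|x|.
Proof.
have h1 := expR_ge1Dx x.
rewrite ger0_norm; last by lra.
have h2 : expR x - 1 <= x * expR x.
  have := expR_ge1Dx (- x); rewrite expRN => h.
  have e0 := expR_gt0 x.
  have : (1 - x) * expR x <= 1.
    by rewrite -[leRHS](mulVf (lt0r_neq0 e0)) ler_wpM2r// ltW.
  by rewrite mulrBl mul1r; lra.
apply: le_trans (_ : x * (expR x - 1) <= _).
  by rewrite mulrBr mulr1; lra.
apply: le_trans (ler_norm _) _; rewrite normrM -real_normK ?num_real// expr2 -mulrA.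
by rewrite ler_wpM2l// expR_sub1_le.
Qed.

Definition cexp z : R[i] := (expR (complex.Re z))%:C * expi (complex.Im z).

Arguments cexp : simpl never.

Lemma expiD x y : expi (x + y) = expi x * expi y :> R[i].
Proof. by apply: complex_ext; rewrite /expi ?Re_mulc ?Im_mulc /= ?cosD ?sinD; ring. Qed.

Lemma cexpD z w : cexp (z + w) = cexp z * cexp w.
Proof.
by rewrite /cexp Re_addc Im_addc expRD expiD rmorphM/=; ring.
Qed.

Lemma cexp0 : cexp 0 = 1.
Proof. by apply: complex_ext => /=; rewrite expR0 cos0 sin0; ring. Qed.

Lemma cabs_expi x : cabs (expi x : R[i]) = 1.
Proof. by rewrite /cabs /expi/= cos2Dsin2 sqrtr1. Qed.

Lemma cabs_cexp z : cabs (cexp z) = expR (complex.Re z).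
Proof. by rewrite /cexp cabsM cabs_expi mulr1 cabs_real ger0_norm// expR_ge0. Qed.

Lemma Re_cexp z : complex.Re (cexp z) = expR (complex.Re z) * cos (complex.Im z).
Proof. by rewrite /cexp Re_mulc /=; ring. Qed.

Lemma Im_cexp z : complex.Im (cexp z) = expR (complex.Re z) * sin (complex.Im z).
Proof. by rewrite /cexp Im_mulc /=; ring. Qed.

Lemma cexp_sub1_le w :
  cabs (cexp w - 1) <= 3 * cabs w * expR `|complex.Re w|.
Proof.
apply: le_trans (cabs_le _) _.
rewrite Re_addc Im_addc Re_oppc Im_oppc Re_cexp Im_cexp /= oppr0 addr0.
set x := complex.Re w; set y := complex.Im w.
have hx : `|x| <= cabs w := le_Re_cabs w; have hy : `|y| <= cabs w := le_Im_cabs w.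
have Ex : expR x <= expR `|x| by rewrite ler_expR ler_norm.
have E0 := expR_ge0 x.
have h1 : `|expR x * cos y - 1| <= `|x| * expR `|x| + expR `|x| * `|y|.
  have -> : expR x * cos y - 1 = (expR x - 1) + expR x * (cos y - 1) by ring.
  apply: le_trans (ler_normD _ _) _; apply: lerD; first exact: expR_sub1_le.
  by rewrite normrM ger0_norm// ler_pM// cos_sub1_le.
have h2 : `|expR x * sin y| <= expR `|x| * `|y|.
  by rewrite normrM ger0_norm// ler_pM// norm_sin_le.
have EE := expR_ge0 `|x|.
nra.
Qed.

Lemma cexp_sub1_sub_le w :
  cabs (cexp w - 1 - w) <= 4 * cabs w ^+ 2 * expR `|complex.Re w|.
Proof.
apply: le_trans (cabs_le _) _.
rewrite !Re_addc !Im_addc !Re_oppc !Im_oppc Re_cexp Im_cexp /= oppr0 addr0.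
have Ew := sqr_cabs w.
set x := complex.Re w in Ew *; set y := complex.Im w in Ew *.
have Ex : expR x <= expR `|x| by rewrite ler_expR ler_norm.
have E0 := expR_ge0 x.
have h1 : `|expR x * cos y - 1 - x| <= x ^+ 2 * expR `|x| + expR `|x| * y ^+ 2.
  have -> : expR x * cos y - 1 - x = (expR x - 1 - x) + expR x * (cos y - 1) by ring.
  apply: le_trans (ler_normD _ _) _; apply: lerD; first exact: expR_sub1_sub_le.
  by rewrite normrM ger0_norm// ler_pM// cos_sub1_le2.
have h2 : `|expR x * sin y - y| <= expR `|x| * y ^+ 2 + `|x| * expR `|x| * `|y|.
  have -> : expR x * sin y - y = expR x * (sin y - y) + (expR x - 1) * y by ring.
  apply: le_trans (ler_normD _ _) _; rewrite !normrM (ger0_norm E0); apply: lerD.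
    by rewrite ler_pM// sin_sub_le2.
  by rewrite ler_wpM2r// expR_sub1_le.
have h3 : `|x| * `|y| * 2 <= x ^+ 2 + y ^+ 2.
  rewrite -(real_normK (num_real x)) -(real_normK (num_real y)).
  by have := sqr_ge0 (`|x| - `|y|); rewrite sqrrB; lra.
have EE := expR_ge0 `|x|.
have h4 : `|x| * expR `|x| * `|y| * 2 <= (x ^+ 2 + y ^+ 2) * expR `|x|.
  by have := ler_wpM2r EE h3; lra.
rewrite Ew; have := sqr_ge0 x; have := sqr_ge0 y; nra.
Qed.

Lemma hder_cexp z : hder cexp z (cexp z).
Proof.
apply/hderP => e e0.
have k0 : 0 < e / (4 * expR (complex.Re z) * expR 1 + 1).
  by rewrite divr_gt0// ltr_wpDl// !mulr_ge0 ?expR_ge0.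
exists (Num.min 1 (e / (4 * expR (complex.Re z) * expR 1 + 1))).
  by rewrite lt_min ltr01.
move=> w; rewrite lt_min => /andP[w1 w2].
have -> : cexp w - cexp z - cexp z * (w - z) = cexp z * (cexp (w - z) - 1 - (w - z)).
  by rewrite -{1}[w](subrK z) addrC cexpD; ring.
rewrite cabsM cabs_cexp.
set h := w - z in w1 w2 *.
have E1 : expR `|complex.Re h| <= expR 1.
  by rewrite ler_expR (le_trans (le_Re_cabs _))// ltW.
apply: le_trans (ler_wpM2l (expR_ge0 _) (cexp_sub1_sub_le _)) _.
have e1 := expR_ge0 (complex.Re z).
have c0 := cabs_ge0 h.
apply: le_trans (_ : 4 * expR (complex.Re z) * expR 1 * cabs h * cabs h <= _).
  rewrite [leLHS](_ : _ = 4 * expR (complex.Re z) * expR `|complex.Re h| * cabs h * cabs h); last by ring.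
  by rewrite !ler_wpM2r// ler_wpM2l// mulr_ge0.
rewrite ler_wpM2r//; move: w2; rewrite ltr_pdivlMr; last first.
  by rewrite ltr_wpDl// !mulr_ge0 ?expR_ge0.
by rewrite mulrDr mulr1; lra.
Qed.

End Cexp.

(** * Hyperbolic functions and contour shifts in a half strip *)

Section Contour.
Variable R : realType.
Local Notation mu := (@lebesgue_measure R).
Implicit Types (x y : R) (z w : R[i]).

Definition rsinh x : R := (expR x - expR (- x)) / 2.
Definition rcosh x : R := (expR x + expR (- x)) / 2.
Definition csinh z : R[i] := (2^-1)%:C * (cexp z - cexp (- z)).

Arguments csinh : simpl never.

Lemma rcosh_gt0 x : 0 < rcosh x.
Proof. by rewrite divr_gt0// addr_gt0 ?expR_gt0. Qed.

Lemma rcosh2 x : rcosh x ^+ 2 = 1 + rsinh x ^+ 2.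
Proof.
have : expR x * expR (- x) = 1 by rewrite -expRD subrr expR0.
by rewrite /rcosh /rsinh => h; field: h.
Qed.

Lemma rcosh_ge1 x : 1 <= rcosh x.
Proof.
rewrite -(@ler_pXn2r _ 2)// ?nnegrE ?(ltW (rcosh_gt0 x))//.
by rewrite expr1n rcosh2 lerDl sqr_ge0.
Qed.

Lemma rsinhN x : rsinh (- x) = - rsinh x.
Proof. by rewrite /rsinh opprK; ring. Qed.

Lemma rcoshN x : rcosh (- x) = rcosh x.
Proof. by rewrite /rcosh opprK; ring. Qed.

Lemma is_derive_rsinh x : is_derive x 1 rsinh (rcosh x).
Proof.
rewrite /rsinh /rcosh; apply: is_derive_eq; rewrite /GRing.scale/=; ring.
Qed.

Lemma is_derive_rcosh x : is_derive x 1 rcosh (rsinh x).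
Proof.
rewrite /rsinh /rcosh; apply: is_derive_eq; rewrite /GRing.scale/=; ring.
Qed.

(** A crude cubic bound suffices: it makes [x / sinh x] decay like [1 / (1 + x ^ 2)], the integrable
    majorant of all the contour shifts. *)
Lemma rsinh_ge x : 0 <= x -> (x + x ^+ 3) / 24 <= rsinh x.
Proof.
move=> x0; have h1 := expR_ge1Dx x; have h3 := expR_ge1Dxn 2 x0.
have h2 : expR (- x) <= 1 by rewrite -expR0 ler_expR oppr_le0.
have := exprn_ge0 3 x0.
rewrite (_ : 3`!%:R = 6) in h3; last by rewrite !factS fact0.
by rewrite /rsinh; lra.
Qed.

Lemma rsinh_sqr_ge x : (`|x| * (1 + x ^+ 2) / 24) ^+ 2 <= rsinh x ^+ 2.
Proof.
wlog x0 : x / 0 <= x => [H|].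
  have [|x0] := lerP 0 x; first exact: H.
  by have := H (- x); rewrite rsinhN !sqrrN normrN oppr_ge0 ltW//; exact.
have h := rsinh_ge x0; have p := exprn_ge0 3 x0.
rewrite ger0_norm// ler_pXn2r ?nnegrE//.
- by apply: le_trans h; rewrite ler_pM2r// le_eqVlt; apply/orP; left; apply/eqP; ring.
- by rewrite divr_ge0// mulr_ge0// addr_ge0// sqr_ge0.
- by apply: le_trans h; rewrite divr_ge0// addr_ge0.
Qed.

Lemma sin_ge y : 0 <= y <= pi / 2 -> y / 8 <= sin y.
Proof.
move=> /andP[y0 y1].
have small (t : R) : 0 <= t -> t <= 2^-1 -> t / 2 <= sin t.
  move=> t0 t1; have := sin_sub_le2 t; rewrite ler_norml => /andP[h _].
  by move: h; rewrite expr2; nra.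
have [y2|y2] := lerP y 2^-1; first by have := small _ y0 y2; lra.
have h : sin 2^-1 < sin y.
  rewrite ltr_sin//; rewrite in_itv/=; have := pihalf_ge1 R; lra.
have := small 2^-1; rewrite lexx => /(_ _ isT) h2.
have {}h2 : 2^-1 / 2 <= sin 2^-1 :> R by apply: h2; lra.
by have := pihalf_lt2 R; lra.
Qed.

Lemma Re_csinh z : complex.Re (csinh z) = rsinh (complex.Re z) * cos (complex.Im z).
Proof.
rewrite /csinh Re_realM Re_addc Re_oppc !Re_cexp Re_oppc Im_oppc cosN.
by rewrite /rsinh; field.
Qed.

Lemma Im_csinh z : complex.Im (csinh z) = rcosh (complex.Re z) * sin (complex.Im z).
Proof.
rewrite /csinh Im_realM Im_addc Im_oppc !Im_cexp Re_oppc Im_oppc sinN.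
by rewrite /rcosh; field.
Qed.

Lemma csinh_real x : csinh x%:C = (rsinh x)%:C.
Proof.
by apply: complex_ext; rewrite ?Re_csinh ?Im_csinh /= ?cos0 ?sin0 ?mulr1 ?mulr0.
Qed.

Lemma csinh_top x : csinh (x +i* (pi / 2))%C = 'i%C * (rcosh x)%:C.
Proof.
apply: complex_ext; rewrite ?Re_csinh ?Im_csinh ?Re_mulc ?Im_mulc /=.
  by rewrite cos_pihalf; ring.
by rewrite sin_pihalf; ring.
Qed.

Lemma sqr_cabs_csinh z : cabs (csinh z) ^+ 2 =
  rsinh (complex.Re z) ^+ 2 + sin (complex.Im z) ^+ 2.
Proof.
rewrite sqr_cabs Re_csinh Im_csinh (exprMn _ (rsinh _)) (exprMn _ (rcosh _)) rcosh2.
by rewrite [cos _ ^+ 2]cos2sin2; ring.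
Qed.

(** Rests on [|sinh w| ^ 2 = sinh ^ 2 (Re w) + sin ^ 2 (Im w)]; for [0 <= Im w <= pi / 2] the sine
    dominates a multiple of its argument. *)
Lemma cabs_csinh_ge w : 0 <= complex.Im w <= pi / 2 ->
  cabs w * (1 + complex.Re w ^+ 2) / 72 <= cabs (csinh w).
Proof.
have Ew := sqr_cabs w; have Es := sqr_cabs_csinh w; move: Ew Es.
set x := complex.Re w; set y := complex.Im w => Ew Es hy.
have h1 := rsinh_sqr_ge x; have h2 := sin_ge hy.
have /andP[y0 y1] := hy; have y2 : y <= 2 by have := pihalf_lt2 R; lra.
have X0 := sqr_ge0 x.
rewrite -(@ler_pXn2r _ 2)// ?nnegrE ?cabs_ge0//; last first.
  by rewrite divr_ge0// mulr_ge0 ?cabs_ge0// addr_ge0.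
rewrite Es 2!exprMn Ew.
apply: le_trans (lerD h1 (lexx _)).
have h3 : (y / 8) ^+ 2 <= sin y ^+ 2.
  by rewrite ler_pXn2r ?nnegrE ?divr_ge0//; apply: le_trans h2; rewrite divr_ge0.
apply: le_trans (lerD (lexx _) h3).
rewrite !exprMn real_normK ?num_real//.
move: X0; set X := x ^+ 2; move=> X0; set Y := y ^+ 2.
have Y0 : 0 <= Y := sqr_ge0 y.
have Y4 : Y <= 4 by rewrite /Y expr2; clear -y0 y2; nra.
have XY : 0 <= X * (4 - Y) by rewrite mulr_ge0// subr_ge0.
have XXY : 0 <= X * X * (4 - Y) by apply: mulr_ge0; [exact: mulr_ge0|rewrite subr_ge0].
have X2 : 0 <= X * X by rewrite mulr_ge0.
have X3 : 0 <= X * X * X by apply: mulr_ge0.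
clear -X0 Y0 Y4 XY XXY X2 X3.
rewrite [leLHS](_ : _ = (X + Y) * (1 + 2 * X + X * X) / 5184); last by field.
rewrite [leRHS](_ : _ = (X + 2 * (X * X) + X * X * X) / 576 + Y / 64); last by field.
lra.
Qed.

Lemma csinh_neq0 w : 0 <= complex.Im w <= pi / 2 -> w != 0 -> csinh w != 0.
Proof.
move=> hw w0; rewrite -cabs_gt0; apply: lt_le_trans (cabs_csinh_ge hw).
by rewrite divr_gt0// mulr_gt0 ?cabs_gt0// ltr_pwDl ?sqr_ge0.
Qed.

Lemma hder_csinh z : exists l, hder csinh z l.
Proof.
have h1 : hder (fun w => cexp w - cexp (- w)) z (cexp z - (cexp (- z) * -1)).
  exact: hderB (hder_cexp z) (hder_comp (hderN (hder_id z)) (hder_cexp _)).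
by eexists; exact: (hderZ _ h1).
Qed.

(** No continuity is assumed at the origin, where the integrands have the default value of a
    quotient by 0. So [goursat] is applied between the heights [d / (n + 1)] and d, and the lower
    row is brought down by dominated convergence. *)
Lemma contour_shift_Re (F : R[i] -> R[i]) (d k C : R) : 0 < d -> 0 < k ->
  (forall x y, 0 < y <= d -> exists l, hder F (x +i* y)%C l) ->
  (forall x, x != 0 -> ccont F (x +i* 0)%C) ->
  (forall x y, 0 <= y <= d -> cabs (F (x +i* y)%C) <= C * (1 + (k * x) ^+ 2)^-1) ->
  [/\ mu.-integrable setT (EFin \o (fun x => complex.Re (F (x +i* 0)%C))),
      mu.-integrable setT (EFin \o (fun x => complex.Re (F (x +i* d)%C)))
    & \int[mu]_x complex.Re (F (x +i* 0)%C) = \int[mu]_x complex.Re (F (x +i* d)%C)].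
Proof.
move=> d0 k0 dF cF0 FC.
pose g x := C * (1 + (k * x) ^+ 2)^-1.
have ig : mu.-integrable setT (EFin \o g).
  have [i1 _] := integrable_oneDsqr k0.
  exact: integrable_scale.
have cF x y : 0 < y <= d -> ccont F (x +i* y)%C.
  by move=> yd; have [l /hder_cont] := dF x y yd.
have crow y x : ccont F (x +i* y)%C -> {for x, continuous (fun x => complex.Re (F (x +i* y)%C))}.
  by move=> cc; have [] := ccont_path (fun t => hpath y t x) cc.
have mrow y : 0 <= y <= d -> measurable_fun setT (fun x => complex.Re (F (x +i* y)%C)).
  move=> /andP[y0 yd]; apply: (@measurable_cont_except _ _ 0) => x x0.
  apply: crow; move: y0; rewrite le_eqVlt => /predU1P[<-|y0]; first exact: cF0.
  by apply: cF; rewrite y0.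
pose e (n : nat) := d / n.+1%:R.
have e0 n : 0 < e n by rewrite divr_gt0.
have ed n : e n <= d.
  rewrite ler_pdivrMr//; apply: ler_peMr; [exact: ltW|by rewrite ler1n].
have row_lim (y_ : nat -> R) y : (forall n, 0 <= y_ n <= d) -> 0 <= y <= d ->
    y_ n @[n --> \oo] --> y ->
    mu.-integrable setT (EFin \o (fun x => complex.Re (F (x +i* y)%C))) /\
    \int[mu]_(x in `[- n%:R, n%:R]) complex.Re (F (x +i* y_ n)%C) @[n --> \oo] -->
      \int[mu]_x complex.Re (F (x +i* y)%C).
  move=> hy_ hy y_y.
  have -> : (fun n : nat => \int[mu]_(x in `[- n%:R, n%:R]) complex.Re (F (x +i* y_ n)%C)) =
      (fun n => \int[mu]_x ((fun x => complex.Re (F (x +i* y_ n)%C)) \_ `[- n%:R, n%:R]) x).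
    by apply/funext => n; rewrite Rintegral_mkcond.
  apply: (@Rintegral_dct R setT (fun n => (fun x => complex.Re (F (x +i* y_ n)%C)) \_ `[- n%:R, n%:R])
    (fun x => complex.Re (F (x +i* y)%C)) g 0) => //.
  - move=> n; apply/measurable_restrict => //; apply: measurable_funS (mrow _ (hy_ n)) => //.
  - exact: mrow.
  - move=> x _ x0.
    have cc : ccont F (x +i* y)%C.
      move: (hy) => /andP[]; rewrite le_eqVlt => /predU1P[<- _|y0 yd]; first exact: cF0.
      by apply: cF; rewrite y0.
    apply/cvgrPdist_lt => eps eps0; have [del del0 Hd] := cc _ eps0.
    have : \forall n \near \oo, `|y - y_ n| < del by move/cvgrPdist_lt : y_y; exact.
    have : \forall n \near \oo, `|x| <= n%:R by exact: nbhs_infty_ger.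
    apply: filterS2 => n xn yn.
    rewrite patchE ifT; last by rewrite inE /= in_itv/= -ler_norml.
    rewrite -Re_oppc -Re_addc (le_lt_trans (le_Re_cabs _))// cabsB Hd//.
    by rewrite (le_lt_trans (vpath x _ _))// distrC.
  - move=> n x _; rewrite patchE; case: ifP => _.
      by apply: le_trans (le_Re_cabs _) _; exact: FC.
    rewrite normr0; apply: le_trans (cabs_ge0 _) (FC x 0 _).
    by rewrite lexx ltW.
have e_lim : e n @[n --> \oo] --> (0 : R).
  rewrite /e -(mulr0 d); apply: cvgMr.
  exact: cvg_harmonic.
have [iA cA] := row_lim e 0 (fun n => introT andP (conj (ltW (e0 n)) (ed n)))
  (introT andP (conj (lexx _) (ltW d0))) e_lim.
have [iB cB] := row_lim (fun=> d) d (fun n => introT andP (conj (ltW d0) (lexx _)))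
  (introT andP (conj (ltW d0) (lexx _))) (cvg_cst _).
split=> //; apply/eqP; rewrite -subr_eq0; apply/eqP.
apply: (cvg_unique _ (cvgB cA cB)) => //.
have C0 : 0 <= C.
  have := FC 0 0; rewrite lexx (ltW d0) mulr0 expr0n/= addr0 invr1 mulr1.
  by move=> /(_ isT); apply: le_trans; exact: cabs_ge0.
(* Each vertical side at abscissa [n] or [- n] contributes at most [2 * d * g n]. *)
have glim : 4 * d * g n%:R @[n --> \oo] --> (0 : R).
  have : (4 * d * C) * (1 + (k * n%:R) ^+ 2)^-1 @[n --> \oo] --> (4 * d * C) * (0 : R).
    apply: cvgMr; apply/cvgrPdist_le => eps eps0; near=> n.
    have n0 : (0 : R) < n%:R by near: n; exact: nbhs_infty_gtr.
    have kn0 : 0 < k * n%:R by rewrite mulr_gt0.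
    have D0 : 0 < 1 + (k * n%:R) ^+ 2 by rewrite ltr_pwDl ?sqr_ge0.
    rewrite sub0r normrN ger0_norm ?invr_ge0 ?(ltW D0)//.
    rewrite invf_ple ?posrE//.
    have h1 : eps^-1 / k <= n%:R by near: n; exact: nbhs_infty_ger.
    rewrite ler_pdivrMr// in h1.
    have : 0 <= (k * n%:R - 1) ^+ 2 by exact: sqr_ge0.
    by rewrite sqrrB expr1n mulr1; rewrite [n%:R * k]mulrC in h1; nra.
  rewrite mulr0; have -> // : (fun n : nat => 4 * d * g n%:R) =
    (fun n => 4 * d * C * (1 + (k * n%:R) ^+ 2)^-1).
  by apply/funext => n; rewrite /g mulrA.
apply: (@squeeze_cvgr _ _ _ _ (fun n => - (4 * d * g n%:R)) (fun n => 4 * d * g n%:R)).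
- apply: nearW => n; rewrite -ler_norml.
  have nn : - n%:R <= n%:R :> R by apply: le_trans (_ : 0 <= _); rewrite ?oppr_le0.
  have G0 : rint F (- n%:R) n%:R (e n) d = 0.
    by apply: goursat => // x y _ /andP[y1 y2]; apply: dF; rewrite y2 (lt_le_trans (e0 n)).
  have ev u : cintegrable `[e n, d] (fun y => F (u +i* y)%C).
    apply: (@cintegrable_path _ F (fun y => u +i* y)%C) => [t s|t /andP[t1 t2]].
      exact: vpath.
    by apply: cF; rewrite t2 (lt_le_trans (e0 n)).
  have vb u : (u ^+ 2 = n%:R ^+ 2) -> cabs (Cintegral `[e n, d] (fun y => F (u +i* y)%C))
      <= 2 * g n%:R * d.
    move=> un; apply: le_trans (_ : 2 * g n%:R * (d - e n) <= _).
      apply: cabs_Cintegral_le => // y /andP[y1 y2].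
      have := FC u y; rewrite y2 (le_trans _ y1) ?(ltW (e0 n))// => /(_ isT).
      by rewrite exprMn un -exprMn.
    rewrite ler_wpM2l//; last by rewrite gerBl ltW.
    by rewrite !mulr_ge0// invr_ge0 addr_ge0// sqr_ge0.
  have E : Cintegral `[- n%:R, n%:R] (fun x => F (x +i* e n)%C)
     - Cintegral `[- n%:R, n%:R] (fun x => F (x +i* d)%C) =
     - ('i%C * (Cintegral `[e n, d] (fun y => F (n%:R +i* y)%C)
            - Cintegral `[e n, d] (fun y => F ((- n%:R) +i* y)%C))).
    by apply/eqP; rewrite -addr_eq0; apply/eqP; exact: G0.
  rewrite [X in `|X| <= _](_ : _ =
     complex.Re (Cintegral `[- n%:R, n%:R] (fun x => F (x +i* e n)%C)
     - Cintegral `[- n%:R, n%:R] (fun x => F (x +i* d)%C))); last first.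
    by rewrite Re_addc Re_oppc.
  rewrite E; apply: le_trans (le_Re_cabs _) _.
  rewrite cabsN cabsM cabs_i mul1r; apply: le_trans (cabsBD _ _) _.
  apply: le_trans (lerD (vb _ _) (vb _ _)) _; rewrite ?sqrrN//.
  by rewrite le_eqVlt; apply/orP; left; apply/eqP; ring.
- by rewrite -[X in _ --> X]oppr0; apply: cvgN.
- exact: glim.
Unshelve. all: by end_near. Qed.

Lemma contour_shift_Im (F : R[i] -> R[i]) (d k C : R) : 0 < d -> 0 < k ->
  (forall x y, 0 < y <= d -> exists l, hder F (x +i* y)%C l) ->
  (forall x, x != 0 -> ccont F (x +i* 0)%C) ->
  (forall x y, 0 <= y <= d -> cabs (F (x +i* y)%C) <= C * (1 + (k * x) ^+ 2)^-1) ->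
  [/\ mu.-integrable setT (EFin \o (fun x => complex.Im (F (x +i* 0)%C))),
      mu.-integrable setT (EFin \o (fun x => complex.Im (F (x +i* d)%C)))
    & \int[mu]_x complex.Im (F (x +i* 0)%C) = \int[mu]_x complex.Im (F (x +i* d)%C)].
Proof.
move=> d0 k0 dF cF0 FC.
have E z : complex.Re (- 'i%C * F z) = complex.Im (F z).
  by rewrite Re_mulc /=; ring.
have [|||] := @contour_shift_Re (fun z => - 'i%C * F z) d k C d0 k0.
- by move=> x y /(dF x)[l hl]; exists (- 'i%C * l); exact: hderZ.
- by move=> x /cF0 c; apply: ccontM => //; exact: ccont_cst.
- by move=> x y /(FC x) h; rewrite cabsM cabsN cabs_i mul1r.
have Ef y : (fun x => complex.Re (- 'i%C * F (x +i* y)%C)) =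
    (fun x => complex.Im (F (x +i* y)%C)).
  by apply/funext => x; exact: E.
by rewrite !Ef.
Qed.

(* Integrate over the boundary of [{0 <= Im z <= d}]: the two relations for
   [omega] and [- omega] determine the integrals on both edges. *)
Section FourierPairs.
Variable d : R.
Hypothesis d0 : 0 < d.
Let a := pi / (2 * d).

Let a0 : 0 < a. Proof. by rewrite divr_gt0 ?pi_gt0// mulr_gt0. Qed.

Let ad : a * d = pi / 2. Proof. by rewrite /a; field; rewrite gt_eqF. Qed.

Let scale_range x y : 0 <= y <= d ->
  0 <= complex.Im (a%:C * (x +i* y)%C) <= pi / 2.
Proof.
by rewrite Im_realM /= -ad => /andP[y0 yd]; rewrite mulr_ge0 ?(ltW a0)//= ler_pM2l.
Qed.

Lemma strip_csinh_ge z : 0 <= complex.Im z <= d ->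
  a / 72 * cabs z * (1 + (a * complex.Re z) ^+ 2) <= cabs (csinh (a%:C * z)).
Proof.
move=> yd; have := @cabs_csinh_ge (a%:C * z).
rewrite Im_realM Re_realM cabsM cabs_real ger0_norm ?(ltW a0)// -ad ler_pM2l//.
rewrite pmulr_rge0// => /(_ yd).
by apply: le_trans; rewrite le_eqVlt; apply/orP; left; apply/eqP; field.
Qed.

Lemma strip_csinh_neq0 z : 0 <= complex.Im z <= d -> z != 0 ->
  csinh (a%:C * z) != 0.
Proof.
case: z => x y yd z0; apply: csinh_neq0; first exact: scale_range.
by rewrite mulf_neq0// -cabs_gt0 cabs_real normr_gt0 gt_eqF.
Qed.

Lemma hder_scale (f : R[i] -> R[i]) k z : (forall w, exists l, hder f w l) ->
  exists l, hder (fun w => f (k * w)) z l.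
Proof.
move=> /(_ (k * z))[l hl]; eexists.
exact: (hder_comp (hderZ k (hder_id z)) hl).
Qed.

Lemma strip_top x : csinh (a%:C * (x +i* d)%C) = 'i%C * (rcosh (a * x))%:C.
Proof.
rewrite -csinh_top; congr csinh.
by apply: complex_ext; rewrite ?Re_realM ?Im_realM /= ?ad.
Qed.

Lemma strip_bottom x : csinh (a%:C * (x +i* 0)%C) = (rsinh (a * x))%:C.
Proof.
rewrite -csinh_real; congr csinh.
by apply: complex_ext; rewrite ?Re_realM ?Im_realM /= ?mulr0.
Qed.

Lemma Re_iM omega z : complex.Re ((0 +i* omega)%C * z) = - (omega * complex.Im z).
Proof. by rewrite Re_mulc /=; ring. Qed.

Lemma Im_iM omega z : complex.Im ((0 +i* omega)%C * z) = omega * complex.Re z.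
Proof. by rewrite Im_mulc /=; ring. Qed.

Lemma cabs_iM omega z : cabs ((0 +i* omega)%C * z) = `|omega| * cabs z.
Proof.
rewrite cabsM; congr (_ * _).
by rewrite /cabs /= expr0n /= add0r sqrtr_sqr.
Qed.

Lemma strip_expR_le omega y : 0 <= y <= d ->
  expR `|- (omega * y)| <= expR (`|omega| * d).
Proof.
move=> /andP[y0 yd]; rewrite ler_expR normrN normrM ler_wpM2l//.
by rewrite ger0_norm.
Qed.

(** Subtracting 1 removes the simple pole at 0, so no residue enters. The imaginary part on the
    lower edge is unaffected by the 1, and on the upper edge [sinh] has become [i cosh]. *)
Let F1 (omega : R) z := (cexp ((0 +i* omega)%C * z) - 1) * (csinh (a%:C * z))^-1.

Lemma F1_bound omega x y : 0 <= y <= d -> cabs (F1 omega (x +i* y)%C) <=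
  3 * `|omega| * expR (`|omega| * d) * (72 / a) * (1 + (a * x) ^+ 2)^-1.
Proof.
move=> yd; have D0 : 0 < 1 + (a * x) ^+ 2 by rewrite ltr_pwDl ?sqr_ge0.
have K0 : 0 <= 3 * `|omega| * expR (`|omega| * d) by rewrite !mulr_ge0 ?expR_ge0.
have RHS0 : 0 <= 3 * `|omega| * expR (`|omega| * d) * (72 / a) * (1 + (a * x) ^+ 2)^-1.
  by rewrite mulr_ge0 ?invr_ge0 ?(ltW D0)// mulr_ge0// divr_ge0// ltW.
have [z0|z0] := eqVneq (x +i* y)%C (0 : R[i]).
  rewrite /F1 z0 !mulr0 cexp0 subrr mul0r.
  by apply: le_trans RHS0; rewrite le_eqVlt; apply/orP; left; apply/eqP; exact: cabs0.
have zc : 0 < cabs (x +i* y)%C by rewrite cabs_gt0.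
have h1 := @cexp_sub1_le R ((0 +i* omega)%C * (x +i* y)%C).
rewrite cabs_iM Re_iM /= in h1.
have h2 := @strip_csinh_ge (x +i* y)%C yd; rewrite /= in h2.
have h3 := strip_expR_le omega yd.
have S0 : 0 < cabs (csinh (a%:C * (x +i* y)%C)).
  by rewrite cabs_gt0; exact: strip_csinh_neq0.
rewrite /F1 cabsM cabsV ler_pdivrMr//.
apply: le_trans h1 _.
apply: le_trans (_ : 3 * `|omega| * expR (`|omega| * d) * cabs (x +i* y)%C <= _).
  rewrite [leRHS]mulrAC; apply: ler_pM => //; rewrite ?expR_ge0//.
    by rewrite !mulr_ge0// ltW.
  by rewrite mulrA.
apply: le_trans (ler_wpM2l RHS0 h2).
rewrite le_eqVlt; apply/orP; left; apply/eqP; field.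
by rewrite !gt_eqF.
Qed.

Lemma F1_der omega x y : 0 <= y <= d -> (x +i* y)%C != 0 :> R[i] ->
  exists l, hder (F1 omega) (x +i* y)%C l.
Proof.
move=> yd z0.
have [l1 h1] := @hder_scale (@cexp R) (0 +i* omega)%C (x +i* y)%C (fun w => ex_intro _ _ (hder_cexp w)).
have [l2 h2] := @hder_scale csinh a%:C (x +i* y)%C (@hder_csinh).
have n0 := @strip_csinh_neq0 (x +i* y)%C yd z0.
have h3 := @hderV _ (fun w => csinh (a%:C * w)) _ _ n0 h2.
have h4 := hderM (hderB h1 (hder_cst 1 _)) h3.
by eexists; exact: h4.
Qed.

Lemma Im_NiM z : complex.Im (- 'i%C * z) = - complex.Re z.
Proof. by rewrite Im_mulc /=; ring. Qed.

Lemma invCi : ('i%C : R[i])^-1 = - 'i%C.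
Proof.
have i0 : 'i%C != 0 :> R[i] by rewrite -cabs_gt0 cabs_i.
by apply/eqP; rewrite -(inj_eq (mulfI i0)) divff// mulrN -expr2 sqr_i opprK.
Qed.

Lemma F1_shift omega :
  [/\ mu.-integrable setT (EFin \o (fun x => sin (omega * x) / rsinh (a * x))),
      mu.-integrable setT (EFin \o (fun x => (1 - expR (- (omega * d)) * cos (omega * x)) / rcosh (a * x)))
    & \int[mu]_x (sin (omega * x) / rsinh (a * x)) =
      \int[mu]_x ((1 - expR (- (omega * d)) * cos (omega * x)) / rcosh (a * x))].
Proof.
have B x : complex.Im (F1 omega (x +i* 0)%C) = sin (omega * x) / rsinh (a * x).
  rewrite /F1 strip_bottom -fmorphV mulrC Im_realM Im_addc Im_oppc Im_cexp.
  by rewrite Re_iM Im_iM /= mulr0 oppr0 expR0; ring.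
have T x : complex.Im (F1 omega (x +i* d)%C) =
    (1 - expR (- (omega * d)) * cos (omega * x)) / rcosh (a * x).
  rewrite /F1 strip_top invfM -fmorphV invCi mulrA mulrC Im_realM mulrC.
  rewrite [(_ - _) * _]mulrC Im_NiM Re_addc Re_oppc Re_cexp Re_iM Im_iM /=.
  by ring.
have [|||i1 i2 i3] := @contour_shift_Im (F1 omega) d a
  (3 * `|omega| * expR (`|omega| * d) * (72 / a)) d0 a0.
- move=> x y /andP[y0 yd]; apply: F1_der; first by rewrite (ltW y0).
  by rewrite eq_complex/= negb_and [y == 0]gt_eqF// orbT.
- move=> x x0; have [||l /hder_cont//] := @F1_der omega x 0; first by rewrite lexx ltW.
  by rewrite eq_complex/= negb_and x0.
- by move=> x y; exact: F1_bound.
move: i1 i2 i3.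
have -> : (fun x => complex.Im (F1 omega (x +i* 0)%C)) = (fun x => sin (omega * x) / rsinh (a * x)).
  by apply/funext.
have -> : (fun x => complex.Im (F1 omega (x +i* d)%C)) =
  (fun x => (1 - expR (- (omega * d)) * cos (omega * x)) / rcosh (a * x)).
  by apply/funext.
by split.
Qed.

(** A double pole requires removing the linear Taylor term as well. It is purely imaginary on the
    real line, hence invisible in the real part there, and only adds the constant [omega * d] to the
    numerator on the upper edge. *)
Let F2 (omega : R) z := - (cexp ((0 +i* omega)%C * z) - 1 - (0 +i* omega)%C * z)
  * (csinh (a%:C * z))^-1 ^+ 2.

Lemma F2_bound omega x y : 0 <= y <= d -> cabs (F2 omega (x +i* y)%C) <=
  4 * omega ^+ 2 * expR (`|omega| * d) * (72 / a) ^+ 2 * (1 + (a * x) ^+ 2)^-1.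
Proof.
move=> yd; have D1 : 1 <= 1 + (a * x) ^+ 2 by rewrite lerDl sqr_ge0.
have D0 : 0 < 1 + (a * x) ^+ 2 := lt_le_trans ltr01 D1.
have K0 : 0 <= 4 * omega ^+ 2 * expR (`|omega| * d).
  by rewrite mulr_ge0 ?expR_ge0// mulr_ge0 ?sqr_ge0.
have RHS0 : 0 <= 4 * omega ^+ 2 * expR (`|omega| * d) * (72 / a) ^+ 2 * (1 + (a * x) ^+ 2)^-1.
  by rewrite mulr_ge0 ?invr_ge0 ?(ltW D0)// mulr_ge0// sqr_ge0.
have [z0|z0] := eqVneq (x +i* y)%C (0 : R[i]).
  rewrite /F2 z0 !mulr0 cexp0 subrr subr0 oppr0 mul0r.
  by apply: le_trans RHS0; rewrite le_eqVlt; apply/orP; left; apply/eqP; exact: cabs0.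
have zc : 0 < cabs (x +i* y)%C by rewrite cabs_gt0.
have h1 := @cexp_sub1_sub_le R ((0 +i* omega)%C * (x +i* y)%C).
rewrite cabs_iM Re_iM /= exprMn real_normK ?num_real// in h1.
have h2 := @strip_csinh_ge (x +i* y)%C yd; rewrite /= in h2.
have h3 := strip_expR_le omega yd.
have S0 : 0 < cabs (csinh (a%:C * (x +i* y)%C)).
  by rewrite cabs_gt0; exact: strip_csinh_neq0.
rewrite /F2 cabsM cabsN cabsX cabsV exprVn ler_pdivrMr ?exprn_gt0//.
apply: le_trans h1 _.
apply: le_trans (_ : 4 * omega ^+ 2 * expR (`|omega| * d) * cabs (x +i* y)%C ^+ 2 <= _).
  rewrite [leRHS]mulrAC; apply: ler_pM => //; rewrite ?expR_ge0//.
    by rewrite mulr_ge0// mulr_ge0 ?sqr_ge0.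
  by rewrite mulrA.
have h4 : (a / 72 * cabs (x +i* y)%C * (1 + (a * x) ^+ 2)) ^+ 2 <=
    cabs (csinh (a%:C * (x +i* y)%C)) ^+ 2.
  rewrite ler_pXn2r ?nnegrE ?cabs_ge0// mulr_ge0 ?(ltW D0)// mulr_ge0 ?(ltW zc)//.
  by rewrite divr_ge0// ltW.
apply: le_trans (ler_wpM2l RHS0 h4).
rewrite [leRHS](_ : _ = 4 * omega ^+ 2 * expR (`|omega| * d) * cabs (x +i* y)%C ^+ 2
   * (1 + (a * x) ^+ 2)); last by field; rewrite !gt_eqF.
by rewrite ler_peMr// mulr_ge0// sqr_ge0.
Qed.

Lemma F2_der omega x y : 0 <= y <= d -> (x +i* y)%C != 0 :> R[i] ->
  exists l, hder (F2 omega) (x +i* y)%C l.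
Proof.
move=> yd z0.
have [l1 h1] := @hder_scale (@cexp R) (0 +i* omega)%C (x +i* y)%C (fun w => ex_intro _ _ (hder_cexp w)).
have [l2 h2] := @hder_scale csinh a%:C (x +i* y)%C (@hder_csinh).
have n0 := @strip_csinh_neq0 (x +i* y)%C yd z0.
have h3 := hderX 2 (@hderV _ (fun w => csinh (a%:C * w)) _ _ n0 h2).
have h4 := hderN (hderB (hderB h1 (hder_cst 1 _)) (hderZ (0 +i* omega)%C (hder_id _))).
have h5 := hderM h4 h3.
by eexists; exact: h5.
Qed.

Lemma F2_shift omega :
  [/\ mu.-integrable setT (EFin \o (fun x => (1 - cos (omega * x)) / rsinh (a * x) ^+ 2)),
      mu.-integrable setT (EFin \o (fun x => (expR (- (omega * d)) * cos (omega * x) - (1 - omega * d)) / rcosh (a * x) ^+ 2))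
    & \int[mu]_x ((1 - cos (omega * x)) / rsinh (a * x) ^+ 2) =
      \int[mu]_x ((expR (- (omega * d)) * cos (omega * x) - (1 - omega * d)) / rcosh (a * x) ^+ 2)].
Proof.
have num x y : complex.Re (- (cexp ((0 +i* omega)%C * (x +i* y)%C) - 1 -
    (0 +i* omega)%C * (x +i* y)%C)) =
    1 - omega * y - expR (- (omega * y)) * cos (omega * x).
  by rewrite Re_oppc !Re_addc !Re_oppc Re_cexp !Re_iM !Im_iM /=; ring.
have B x : complex.Re (F2 omega (x +i* 0)%C) = (1 - cos (omega * x)) / rsinh (a * x) ^+ 2.
  rewrite /F2 strip_bottom -fmorphV -rmorphXn mulrC Re_realM num.
  by rewrite mulr0 oppr0 expR0 exprVn; ring.
have T x : complex.Re (F2 omega (x +i* d)%C) =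
    (expR (- (omega * d)) * cos (omega * x) - (1 - omega * d)) / rcosh (a * x) ^+ 2.
  rewrite /F2 strip_top invfM -fmorphV invCi exprMn sqrrN sqr_i mulN1r -rmorphXn mulrN -mulNr.
  by rewrite mulrC Re_realM Re_oppc num exprVn; ring.
have [|||i1 i2 i3] := @contour_shift_Re (F2 omega) d a
  (4 * omega ^+ 2 * expR (`|omega| * d) * (72 / a) ^+ 2) d0 a0.
- move=> x y /andP[y0 yd]; apply: F2_der; first by rewrite (ltW y0).
  by rewrite eq_complex/= negb_and [y == 0]gt_eqF// orbT.
- move=> x x0; have [||l /hder_cont//] := @F2_der omega x 0; first by rewrite lexx ltW.
  by rewrite eq_complex/= negb_and x0.
- by move=> x y; exact: F2_bound.
move: i1 i2 i3.
have -> : (fun x => complex.Re (F2 omega (x +i* 0)%C)) = (fun x => (1 - cos (omega * x)) / rsinh (a * x) ^+ 2).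
  by apply/funext.
have -> : (fun x => complex.Re (F2 omega (x +i* d)%C)) =
  (fun x => (expR (- (omega * d)) * cos (omega * x) - (1 - omega * d)) / rcosh (a * x) ^+ 2).
  by apply/funext.
by split.
Qed.

Lemma continuous_rsinh : continuous rsinh.
Proof. by move=> x; apply: is_derive_continuous (is_derive_rsinh x). Qed.

Lemma continuous_rcosh : continuous rcosh.
Proof. by move=> x; apply: is_derive_continuous (is_derive_rcosh x). Qed.

Lemma is_derive_scale (f : R -> R) (k x l : R) : is_derive (k * x) 1 f l ->
  is_derive x 1 (fun x => f (k * x)) (l * k).
Proof.
move=> df; have dk : is_derive x (1 : R) (fun x => k * x) k.
  by apply: is_derive_eq; rewrite /GRing.scale/=; ring.
have := @is_derive1_comp R f (fun x => k * x) x l k df dk.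
by [].
Qed.

Lemma continuous_scale (f : R -> R) (k : R) : continuous f ->
  continuous (fun x => f (k * x)).
Proof.
move=> cf x; apply: (@continuous_comp _ _ _ (fun x => k * x) f); last exact: cf.
by apply: cvgMr; exact: cvg_id.
Qed.

Lemma rsinh_y : rsinh x @[x --> +oo] --> +oo.
Proof.
apply/cvgryPge => A; near=> x.
have x0 : 0 <= x by near: x; exact: nbhs_pinfty_ge.
have Ax : 24 * A <= x by near: x; apply: nbhs_pinfty_ge; rewrite num_real.
have := rsinh_ge x0; have := exprn_ge0 3 x0; lra.
Unshelve. all: by end_near. Qed.

Lemma integral_sech :
  mu.-integrable setT (EFin \o (fun x => (rcosh (a * x))^-1)) /\
  \int[mu]_x (rcosh (a * x))^-1 = pi / a.
Proof.
have dA (x : R) : is_derive x 1 (fun x => a^-1 * atan (rsinh (a * x))) (rcosh (a * x))^-1.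
  have := is_derive_scale (is_derive_rsinh (a * x)) => dr.
  have := @is_derive1_comp R (@atan R) (fun x => rsinh (a * x)) x _ _ (is_derive1_atan _) dr.
  move=> da; apply: is_derive_eq.
  by rewrite /GRing.scale/= -rcosh2; field; rewrite !gt_eqF// rcosh_gt0.
have [|||||i1 i2] := @even_FTC R (fun x => (rcosh (a * x))^-1)
    (fun x => a^-1 * atan (rsinh (a * x))) (a^-1 * (pi / 2)).
- by move=> x; rewrite invr_ge0 ltW// rcosh_gt0.
- move=> x; apply: cvgV; first by rewrite gt_eqF// rcosh_gt0.
  exact: (continuous_scale continuous_rcosh).
- by move=> x; rewrite mulrN rcoshN.
- by apply: cvgr_at_right_continuous; exact: is_derive_continuous (dA 0).
- have h : rsinh (a * x) @[x --> +oo] --> +oo.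
    exact: (cvg_comp (fun x => a * x) rsinh (cvgryM a0) rsinh_y).
  apply: cvgMr; exact: (cvg_comp (fun x => rsinh (a * x)) (@atan R) h (@cvgy_atan R)).
split=> //; rewrite i2 mulr0 (_ : rsinh 0 = 0) ?atan0; last by rewrite /rsinh oppr0 subrr mul0r.
by field; rewrite gt_eqF.
Qed.

End FourierPairs.
End Contour.

(** * Transforms of 1 / sinh and 1 / sinh ^ 2 *)

Section Pairs.
Variable R : realType.
Local Notation mu := (@lebesgue_measure R).
Implicit Types (x y : R).

Lemma tanhE x : tanh x = rsinh x / rcosh x.
Proof.
have := rcosh_gt0 x; rewrite /tanh /rsinh /rcosh => h; field.
by apply/eqP; move: h => /[swap] ->; rewrite mul0r ltxx.
Qed.

Lemma is_derive_tanh x : is_derive x 1 (@tanh R) (rcosh x ^- 2).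
Proof.
have -> : @tanh R = @rsinh R * (fun x => (rcosh x)^-1).
  by apply/funext => y; rewrite tanhE.
have c0 : rcosh x != 0 by rewrite gt_eqF// rcosh_gt0.
have d1 := is_derive_rsinh x.
have d2 : is_derive x 1 (fun x => (rcosh x)^-1) (- (rcosh x ^- 2) *: rsinh x).
  by apply: is_deriveV => //; exact: is_derive_rcosh.
apply: is_derive_eq; rewrite /GRing.scale/=.
have := rcosh2 x => h; field: h; exact: c0.
Qed.

Lemma tanh0 : tanh 0 = 0 :> R.
Proof. by rewrite /tanh oppr0 subrr mul0r. Qed.

Lemma tanhN x : tanh (- x) = - tanh x.
Proof. by rewrite !tanhE rsinhN rcoshN mulNr. Qed.

Lemma tanh_y : tanh x @[x --> +oo] --> (1 : R).
Proof.
have -> : @tanh R = (fun x => 1 - expR (- x) / rcosh x).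
  apply/funext => x; rewrite tanhE; have c0 := rcosh_gt0 x.
  move: c0; rewrite /rcosh /rsinh => c0; field.
  by apply/eqP; move: c0 => /[swap] ->; rewrite mul0r ltxx.
rewrite -[X in _ --> X]subr0; apply: cvgB; first exact: cvg_cst.
apply: (@squeeze_cvgr _ _ _ _ (fun=> 0) (fun x => expR (- x))).
- apply: nearW => x; have c1 := rcosh_ge1 x; rewrite divr_ge0 ?expR_ge0 ?(ltW (rcosh_gt0 _))//=.
  by rewrite ler_pdivrMr ?rcosh_gt0// ler_peMr// expR_ge0.
- exact: cvg_cst.
- exact: cvgr_expR.
Qed.

Variable d : R.
Hypothesis d0 : 0 < d.
Let a := pi / (2 * d).
Let a0 : 0 < a. Proof. by rewrite divr_gt0 ?pi_gt0// mulr_gt0. Qed.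

Lemma integral_sech2 :
  mu.-integrable setT (EFin \o (fun x => rcosh (a * x) ^- 2)) /\
  \int[mu]_x rcosh (a * x) ^- 2 = 2 / a.
Proof.
have dA (x : R) : is_derive x 1 (fun x => a^-1 * tanh (a * x)) (rcosh (a * x) ^- 2).
  have da := is_derive_scale (is_derive_tanh (a * x)).
  by apply: is_derive_eq; rewrite /GRing.scale/=; field; rewrite !gt_eqF// rcosh_gt0.
have [|||||i1 i2] := @even_FTC R (fun x => rcosh (a * x) ^- 2)
    (fun x => a^-1 * tanh (a * x)) (a^-1 * 1).
- by move=> x; rewrite invr_ge0 sqr_ge0.
- move=> x; apply: cvgV; first by rewrite gt_eqF// exprn_gt0// rcosh_gt0.
  by apply: cvgM; exact: (continuous_scale (@continuous_rcosh R)).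
- by move=> x; rewrite mulrN rcoshN.
- by apply: cvgr_at_right_continuous; exact: is_derive_continuous (dA 0).
- by apply: cvgMr; exact: (cvg_comp (fun x => a * x) (@tanh R) (cvgryM a0) tanh_y).
by split=> //; rewrite i2 mulr0 tanh0; field; rewrite gt_eqF.
Qed.

Lemma integrable_cosM (f : R -> R) omega :
  mu.-integrable setT (EFin \o f) ->
  mu.-integrable setT (EFin \o (fun x => cos (omega * x) * f x)).
Proof.
move=> intf; apply: (le_integrable _ _ _ intf) => //.
- apply/measurable_EFinP; apply: measurable_funM.
    apply: continuous_measurable_fun; apply: continuous_scale.
    exact: continuous_cos.
  exact: integrable_measurable intf.
- by move=> x _ /=; rewrite lee_fin normrM ler_piMl// cos_max.
Qed.

(** The derivative of [- ln |tanh (a x / 2)|] is [- a / sinh (a x)], so this computes, after one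
    integration by parts, the transform [pi tanh (d omega) / omega] of the logarithmic kernel. *)
Lemma integral_sin_csch omega :
  mu.-integrable setT (EFin \o (fun x => sin (omega * x) / rsinh (a * x))) /\
  \int[mu]_x (sin (omega * x) / rsinh (a * x)) = pi / a * tanh (d * omega).
Proof.
have [i1 _ E1] := @F1_shift R d d0 omega; split=> //.
have [_ _ E2] := @F1_shift R d d0 (- omega).
have [ic Ic] := @integral_sech R d d0; rewrite -/a in i1 E1 E2 ic Ic *.
have icos := integrable_cosM omega ic.
set C := \int[mu]_x (cos (omega * x) * (rcosh (a * x))^-1).
have T k : \int[mu]_x ((1 - k * cos (omega * x)) / rcosh (a * x)) = pi / a - k * C.
  rewrite -Ic -RintegralZl// -RintegralB//.
    by apply: eq_Rintegral => x _; ring.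
  exact: integrable_scale.
have N : \int[mu]_x (sin (- omega * x) / rsinh (a * x)) =
    - \int[mu]_x (sin (omega * x) / rsinh (a * x)).
  rewrite -[RHS]mulN1r -RintegralZl//; apply: eq_Rintegral => x _.
  by rewrite mulNr sinN; ring.
move: E2; rewrite N E1 T.
under eq_Rintegral do rewrite !mulNr cosN; rewrite T opprK.
rewrite tanhE /rsinh /rcosh [d * omega]mulrC => E2.
have p1 := expR_gt0 (omega * d); have p2 := expR_gt0 (- (omega * d)).
have : C * (expR (omega * d) + expR (- (omega * d))) = 2 * (pi / a) by lra.
move: p1 p2; set u := expR _; set v := expR _ => u0 v0 E3.
have uv : u + v != 0 by rewrite gt_eqF// addr_gt0.
have -> : C = 2 * (pi / a) / (u + v) by rewrite -E3 mulfK.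
by field; rewrite uv gt_eqF.
Qed.

(** The multiplier [d omega / tanh (d omega)], which sends the transform of u to [pi d] times that
    of its charge, is thereby 1 plus an integral of [1 - cos (omega s)], that is, of multipliers of
    second differences. *)
Lemma integral_cos_csch2 omega : omega != 0 ->
  mu.-integrable setT (EFin \o (fun x => (1 - cos (omega * x)) / rsinh (a * x) ^+ 2)) /\
  \int[mu]_x ((1 - cos (omega * x)) / rsinh (a * x) ^+ 2) =
    2 / a * (d * omega / tanh (d * omega) - 1).
Proof.
move=> w0; have [i1 _ E1] := @F2_shift R d d0 omega; split=> //.
have [_ _ E2] := @F2_shift R d d0 (- omega).
have [ic Ic] := integral_sech2; rewrite -/a in i1 E1 E2 *.
have icos := integrable_cosM omega ic.
set J := \int[mu]_x (cos (omega * x) * (rcosh (a * x) ^- 2)).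
have T k l : \int[mu]_x ((k * cos (omega * x) - l) / rcosh (a * x) ^+ 2) = k * J - l * (2 / a).
  rewrite -Ic -!RintegralZl// -RintegralB//.
  - by apply: eq_Rintegral => x _; ring.
  - exact: integrable_scale.
  - exact: integrable_scale.
move: E2.
under eq_Rintegral do rewrite mulNr cosN; under [in RHS]eq_Rintegral do rewrite !mulNr cosN.
rewrite E1 !T !opprK.
rewrite tanhE /rsinh /rcosh [d * omega]mulrC => E2.
have ne : expR (omega * d) - expR (- (omega * d)) != 0.
  rewrite subr_eq0 (inj_eq (@expR_inj R)) -subr_eq0 opprK -mulr2n mulrn_eq0/=.
  by rewrite mulf_neq0// gt_eqF.
have p1 := expR_gt0 (omega * d); have p2 := expR_gt0 (- (omega * d)).
have : J * (expR (omega * d) - expR (- (omega * d))) = 2 * (omega * d) * (2 / a) by lra.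
move: p1 p2 ne; set u := expR _; set v := expR _ => u0 v0 ne E3.
have uv : u + v != 0 by rewrite gt_eqF// addr_gt0.
have -> : J = 2 * (omega * d) * (2 / a) / (u - v) by rewrite -E3 mulfK.
have -> : v * (2 * (omega * d) * (2 / a) / (u - v)) - (1 - omega * d) * (2 / a) =
   2 / a * ((omega * d) * (u + v) / (u - v) - 1).
  by field; rewrite ne gt_eqF.
congr (_ * (_ - _)); field.
by rewrite ne uv.
Qed.

End Pairs.

(** * Cosine transforms *)

Section Fourier.
Variable R : realType.
Local Notation mu := (@lebesgue_measure R).
Implicit Types (f g : R -> R) (x y s t : R).

Lemma Rintegral_fubini (F : R -> R -> R) (G : R -> R) :
  measurable_fun setT (fun p : R * R => F p.1 p.2) ->
  (forall x, mu.-integrable setT (EFin \o F x)) ->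
  (forall y, mu.-integrable setT (EFin \o F^~ y)) ->
  mu.-integrable setT (EFin \o G) ->
  (forall y, \int[mu]_x `|F x y| <= G y) ->
  [/\ mu.-integrable setT (EFin \o (fun x => \int[mu]_y F x y)),
      mu.-integrable setT (EFin \o (fun y => \int[mu]_x F x y))
    & \int[mu]_x (\int[mu]_y F x y) = \int[mu]_y (\int[mu]_x F x y)].
Proof.
move=> mF F1 F2 iG FG.
pose f (p : R * R) := (F p.1 p.2)%:E.
have mf : measurable_fun setT f by apply/measurable_EFinP.
have int_prod : ((mu \x mu)%E).-integrable setT f.
  apply/integrable21ltyP => //.
  have [mG Goo] := integrableP _ _ _ iG.
  apply: le_lt_trans Goo; apply: ge0_le_integral => //.
  - by move=> y _; exact: integral_ge0.
  - apply: (@measurable_fun_fubini_tonelli_G _ _ _ _ R mu (abse \o f)) => //=.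
    exact: measurableT_comp.
  - exact: measurableT_comp.
  - move=> y _.
    have E : (\int[mu]_x `|f (x, y)| = (\int[mu]_x `|F x y|)%:E)%E.
      rewrite /Rintegral fineK//; apply: integrable_fin_num => //.
      exact: integrable_abse (F2 y).
    by rewrite E lee_fin (le_trans (FG y))// ler_norm.
have E1 x : (\int[mu]_y f (x, y) = (\int[mu]_y F x y)%:E)%E.
  by rewrite /Rintegral fineK//; exact: integrable_fin_num (F1 x).
have E2 y : (\int[mu]_x f (x, y) = (\int[mu]_x F x y)%:E)%E.
  by rewrite /Rintegral fineK//; exact: integrable_fin_num (F2 y).
have := Fubini int_prod.
under eq_integral do rewrite E1; under [in RHS]eq_integral do rewrite E2.
move=> H; split.
- have := integrable_fubini_F int_prod; rewrite /fubini_F.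
  by congr (mu.-integrable _ _); apply/funext => x; exact: E1.
- apply: (le_integrable _ _ _ iG) => //.
    have := @measurable_fubini_G _ _ _ _ R mu mu f int_prod; rewrite /fubini_G.
    by congr (measurable_fun _ _); apply/funext => x; exact: E2.
  move=> y _ /=; rewrite lee_fin (le_trans _ (ler_norm _))//.
  apply: le_trans (FG y); apply: le_normr_Rintegral => //; exact: F2.
- by rewrite /Rintegral H.
Qed.

Lemma integrable_boundM f g (k : R) : measurable_fun setT f ->
  (forall x, `|f x| <= k) -> mu.-integrable setT (EFin \o g) ->
  mu.-integrable setT (EFin \o (fun x => f x * g x)).
Proof.
move=> mf fk ig.
have k0 : 0 <= k := le_trans (normr_ge0 _) (fk 0).
apply: (le_integrable _ _ _ (integrable_scale k measurableT ig)) => //.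
- apply/measurable_EFinP; apply: measurable_funM => //.
  exact: integrable_measurable ig.
- by move=> x _ /=; rewrite lee_fin !normrM (ger0_norm k0) ler_wpM2r.
Qed.

Lemma measurable_cos_scale (k : R) : measurable_fun setT (fun x : R => cos (k * x)).
Proof.
by apply: continuous_measurable_fun; apply: continuous_scale; exact: continuous_cos.
Qed.

Lemma integrable_expR_abs (e : R) : 0 < e ->
  mu.-integrable setT (EFin \o (fun x => expR (- (e * `|x|)))).
Proof.
move=> e0.
have [||||||i1 _] := @even_FTC R (fun x => expR (- (e * `|x|)))
    (fun x => - (e^-1 * expR (- (e * x)))) (- (e^-1 * 0)).
- by move=> x; exact: expR_ge0.
- move=> x; apply: (@continuous_comp _ _ _ (fun x => - (e * `|x|)) expR).
    by apply: cvgN; apply: cvgMr; exact: norm_continuous.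
  exact: continuous_expR.
- by move=> x; rewrite normrN.
- move=> x x0; rewrite gtr0_norm//; apply: is_derive_eq.
  by rewrite /GRing.scale/=; field; rewrite gt_eqF.
- apply: cvgr_at_right_continuous.
  have dA : is_derive (0 : R) 1 (fun x => - (e^-1 * expR (- (e * x)))) 1.
    apply: is_derive_eq; rewrite /GRing.scale/= mulr0 oppr0 expR0.
    by field; rewrite gt_eqF.
  exact: is_derive_continuous dA.
- apply: cvgN; apply: cvgMr.
  exact: (cvg_comp (fun x => e * x) (fun x => expR (- x)) (cvgryM e0) (@cvgr_expR R)).
exact: i1.
Qed.

(** The Poisson kernel of the half-plane times [2 pi]. *)
Definition poisson (e s : R) : R := 2 * e / (e ^+ 2 + s ^+ 2).

Lemma poisson_den e s : 0 < e -> 0 < e ^+ 2 + s ^+ 2.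
Proof. by move=> e0; rewrite ltr_pwDl ?sqr_ge0 ?exprn_gt0. Qed.

Lemma poisson_ge0 e s : 0 < e -> 0 <= poisson e s.
Proof. by move=> e0; rewrite divr_ge0 ?(ltW (poisson_den s e0))// mulr_ge0// ltW. Qed.

Lemma continuous_poisson e x : 0 < e -> continuous (fun t => poisson e (t - x)).
Proof.
move=> e0 t; apply: cvgM; first exact: cvg_cst.
apply: cvgV; first by rewrite gt_eqF// poisson_den.
apply: cvgD; first exact: cvg_cst.
by apply: cvgM; (apply: cvgB; [exact: cvg_id|exact: cvg_cst]).
Qed.

Lemma poisson_le e s : 0 < e -> poisson e s <= 2 / e.
Proof.
move=> e0; rewrite /poisson ler_pdivrMr ?poisson_den// mulrAC ler_pdivlMr//.
by rewrite -mulrA -expr2 ler_pM2l// lerDl sqr_ge0.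
Qed.

Lemma poisson_FT e s : 0 < e ->
  mu.-integrable setT (EFin \o (fun x => expR (- (e * `|x|)) * cos (s * x))) /\
  \int[mu]_x (expR (- (e * `|x|)) * cos (s * x)) = poisson e s.
Proof.
move=> e0.
have int1 : mu.-integrable setT (EFin \o (fun x => expR (- (e * `|x|)) * cos (s * x))).
  have := @integrable_boundM (fun x => cos (s * x)) _ 1 (measurable_cos_scale s)
    (fun x => cos_max _) (integrable_expR_abs e0).
  by under eq_fun do rewrite mulrC.
split => //.
have D0 := poisson_den s e0.
pose Fm x := expR (e * x) * (e * cos (s * x) + s * sin (s * x)) / (e ^+ 2 + s ^+ 2).
pose Fp x := expR (- (e * x)) * (s * sin (s * x) - e * cos (s * x)) / (e ^+ 2 + s ^+ 2).
have cf (k : R) : continuous (fun x : R => expR (k * x) * cos (s * x)).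
  move=> x; apply: cvgM; apply: continuous_scale;
    [exact: continuous_expR|exact: continuous_cos].
have Em (n : R) : 0 <= n -> \int[mu]_(x in `[- n, 0]) (expR (- (e * `|x|)) * cos (s * x)) =
    Fm 0 - Fm (- n).
  move=> n0; rewrite (@eq_Rintegral _ _ R mu _ (fun x => expR (e * x) * cos (s * x))); last first.
    move=> x; rewrite inE /= in_itv/= => /andP[_ x0].
    by rewrite ler0_norm// mulrN opprK.
  apply: Rintegral_FTC; first by rewrite oppr_le0.
    by move=> x _; exact: cf.
  move=> x _; rewrite /Fm; apply: is_derive_eq; rewrite /GRing.scale/=.
  by field; rewrite gt_eqF.
have Ep (n : R) : 0 <= n -> \int[mu]_(x in `[0, n]) (expR (- (e * `|x|)) * cos (s * x)) =
    Fp n - Fp 0.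
  move=> n0; rewrite (@eq_Rintegral _ _ R mu _ (fun x => expR (- e * x) * cos (s * x))); last first.
    move=> x; rewrite inE /= in_itv/= => /andP[x0 _].
    by rewrite ger0_norm// mulNr.
  apply: Rintegral_FTC; [by []|by move=> x _; exact: cf|].
  move=> x _; rewrite /Fp; apply: is_derive_eq; rewrite /GRing.scale/= (mulNr e x).
  by field; rewrite gt_eqF.
have h1 := integrable_truncate int1.
have h2 : \int[mu]_(x in `[- n%:R, n%:R]) (expR (- (e * `|x|)) * cos (s * x)) @[n --> \oo]
    --> poisson e s.
  have -> : (fun n : nat => \int[mu]_(x in `[- n%:R, n%:R]) (expR (- (e * `|x|)) * cos (s * x)))
     = (fun n : nat => poisson e s + 2 * expR (- (e * n%:R)) * (s * sin (s * n%:R) - e * cos (s * n%:R))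
           / (e ^+ 2 + s ^+ 2)).
    apply/funext => n; rewrite (@Rintegral_cat R _ (- n%:R) n%:R 0) ?oppr_le0//; last first.
      by apply: integrableS int1.
    rewrite Em// Ep// /Fm /Fp /poisson !mulr0 oppr0 !sin0 !cos0 expR0 !mulrN sinN cosN.
    by field; rewrite gt_eqF.
  rewrite -[X in _ --> X]addr0; apply: cvgD; first exact: cvg_cst.
  pose K := 2 * (`|s| + e) / (e ^+ 2 + s ^+ 2).
  have K0 : 0 <= K by rewrite divr_ge0 ?(ltW D0)// mulr_ge0// addr_ge0// ltW.
  have lim0 : K * expR (- (e * n%:R)) @[n --> \oo] --> (0 : R).
    rewrite -(mulr0 K); apply: cvgMr.
    apply: (cvg_comp (fun n : nat => e * n%:R) (fun x => expR (- x)) _ (@cvgr_expR R)).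
    exact: (cvg_comp (fun n : nat => (n%:R : R)) (fun x => e * x) (@cvgr_idn R) (cvgryM e0)).
  apply: (@squeeze_cvgr _ _ _ _ (fun n : nat => - (K * expR (- (e * n%:R))))
    (fun n : nat => K * expR (- (e * n%:R)))) => //; last first.
    by rewrite -oppr0; exact: cvgN.
  apply: nearW => n; rewrite -ler_norml.
  have hb : `|s * sin (s * n%:R) - e * cos (s * n%:R)| <= `|s| + e.
    apply: le_trans (ler_normB _ _) _; rewrite !normrM (gtr0_norm e0); apply: lerD.
      by rewrite ler_piMr// sin_max.
    by rewrite ler_piMr ?cos_max// ltW.
  rewrite !normrM normfV (gtr0_norm D0) (ger0_norm (expR_ge0 _)) (ger0_norm (ler0n _ 2)).
  rewrite /K [leRHS]mulrC mulrA ler_pM2r ?invr_gt0//.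
  by rewrite mulrA [2 * _]mulrC ler_pM2l ?hb// mulr_gt0// expR_gt0.
exact: (cvg_unique _ h1 h2).
Qed.

Lemma poisson_mass e x del : 0 < e -> 0 <= del ->
  \int[mu]_(t in `[x - del, x + del]) poisson e (t - x) = 4 * atan (del / e).
Proof.
move=> e0 del0.
apply: etrans (@Rintegral_FTC R _ (fun t => 2 * atan (e^-1 * (t - x))) (x - del) (x + del) _ _ _) _.
- by rewrite lerD2l; lra.
- by move=> t _; exact: continuous_poisson.
- move=> t _; apply: is_derive_eq; rewrite /GRing.scale/= /poisson.
  have h1 := poisson_den (t - x) e0.
  have h2 : 1 + (e^-1 * (t - x)) ^+ 2 != 0 by rewrite gt_eqF// ltr_pwDl ?sqr_ge0.
  have h3 : e != 0 by rewrite gt_eqF.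
  have E : 1 + (e^-1 * (t - x)) ^+ 2 = (e ^+ 2 + (t - x) ^+ 2) / e ^+ 2.
    by field.
  by rewrite E; field; rewrite h3 gt_eqF.
rewrite [x + del - x]addrAC subrr add0r [x - del - x]addrAC subrr add0r mulrN atanN.
by rewrite [e^-1 * del]mulrC; ring.
Qed.

(** Near x the continuity of g is used; at distance at least del the kernel is at most
    [2 e / del ^ 2], so integrability of g is enough and no bound on g is required. *)
Lemma approx_identity g x : mu.-integrable setT (EFin \o g) ->
  {for x, continuous g} ->
  \int[mu]_t (g t * poisson n.+1%:R^-1 (t - x)) @[n --> \oo] --> 2 * pi * g x.
Proof.
move=> ig cg; apply/cvgrPdist_le => eta eta0.
set N1 := \int[mu]_t `|g t|.
have N10 : 0 <= N1 by apply: Rintegral_ge0.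
have p0 := pi_gt0 R.
have k0 : 0 < eta / (4 * pi * 2) by rewrite divr_gt0// !mulr_gt0.
have [del /= del0 Hdel] : exists2 del : R, 0 < del & forall t, `|x - t| <= del ->
    `|g t - g x| <= eta / (4 * pi * 2).
  have := cg; move/cvgrPdist_le => /(_ _ k0)/nbhs_ballP[d /= d0 Hd].
  exists (d / 2); first by rewrite divr_gt0.
  move=> t xt; rewrite distrC; apply: Hd; rewrite /ball/=.
  by apply: le_lt_trans xt _; rewrite ltr_pdivrMr// ltr_pMr// ltr1n.
have e_lim : (n.+1%:R^-1 : R) @[n --> \oo] --> (0 : R) by exact: cvg_harmonic.
have l1 : 4 * (del^-1 ^+ 2) * N1 * n.+1%:R^-1 @[n --> \oo] --> 4 * (del^-1 ^+ 2) * N1 * (0 : R).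
  by apply: cvgMr.
have l2 : `|g x| * (2 * pi - 4 * atan (del / n.+1%:R^-1)) @[n --> \oo] --> `|g x| * (2 * pi - 4 * (pi / 2)).
  apply: cvgMr; apply: cvgB; first exact: cvg_cst.
  apply: cvgMr; apply: (cvg_comp (fun n : nat => del / n.+1%:R^-1) (@atan R) _ (@cvgy_atan R)).
  under eq_fun do rewrite invrK.
  apply: (cvg_comp (fun n : nat => (n.+1%:R : R)) (fun x => del * x) _ (cvgryM del0)).
  by rewrite (cvg_shiftS (fun n => (n%:R : R))); exact: cvgr_idn.
rewrite mulr0 in l1; rewrite (_ : 2 * pi - 4 * (pi / 2) = 0) ?mulr0 in l2; last by field.
have e4 : 0 < eta / 4 by rewrite divr_gt0.
move/cvgrPdist_le: l1 => /(_ _ e4) q1; move/cvgrPdist_le: l2 => /(_ _ e4) q2.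
near=> n.
have a1 : `|g x| * (2 * pi - 4 * atan (del / n.+1%:R^-1)) <= eta / 4.
  have : `|0 - `|g x| * (2 * pi - 4 * atan (del / n.+1%:R^-1))| <= eta / 4.
    by near: n; exact: q2.
  by rewrite sub0r normrN; apply: le_trans; exact: ler_norm.
have a2 : 4 * del^-1 ^+ 2 * N1 * n.+1%:R^-1 <= eta / 4.
  have : `|0 - 4 * del^-1 ^+ 2 * N1 * n.+1%:R^-1| <= eta / 4.
    by near: n; exact: q1.
  by rewrite sub0r normrN; apply: le_trans; exact: ler_norm.
set e : R := n.+1%:R^-1 in a1 a2 *.
have e0 : 0 < e by rewrite invr_gt0.
pose P t := poisson e (t - x).
have P0 t : 0 <= P t by exact: poisson_ge0.
have mP : measurable_fun setT P.
  by apply: continuous_measurable_fun; exact: continuous_poisson.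
have igP : mu.-integrable setT (EFin \o (fun t => g t * P t)).
  have := @integrable_boundM P g (2 / e) mP.
  under [X in _ -> _ -> mu.-integrable _ (_ \o X)]eq_fun do rewrite mulrC.
  apply => // t; rewrite ger0_norm//; exact: poisson_le.
pose D := [set` `[x - del, x + del]%R] : set R.
have mD : measurable D by rewrite /D; exact: measurable_itv.
have xD : x - del <= x + del by rewrite lerD2l; lra.
have split_int (h : R -> R) : mu.-integrable setT (EFin \o h) ->
   \int[mu]_t h t = \int[mu]_(t in D) h t + \int[mu]_(t in ~` D) h t.
  move=> ih; rewrite -Rintegral_setU ?setUv//.
  - exact: measurableC.
  - by apply/disj_setPS => t [].
rewrite split_int//.
have iPD : mu.-integrable D (EFin \o P).
  by apply: continuous_integrable => t _; exact: continuous_poisson.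
have mass : \int[mu]_(t in D) P t = 4 * atan (del / e) by exact: poisson_mass (ltW del0).
have atan2 : 4 * atan (del / e) <= 2 * pi.
  by have := atan_ltpi2 (del / e); lra.
have E1 : `|\int[mu]_(t in D) (g t * P t) - g x * (4 * atan (del / e))| <= eta / (4 * pi * 2) * (2 * pi).
  rewrite -mass -RintegralZl// -RintegralB//; last 2 first.
  - exact: integrableS igP.
  - exact: integrable_scale.
  apply: le_trans (le_normr_Rintegral _ _) _ => //.
    by apply: integrable_subr => //; [exact: integrableS igP|exact: integrable_scale].
  apply: le_trans (_ : \int[mu]_(t in D) (eta / (4 * pi * 2) * P t) <= _); last first.
    by rewrite RintegralZl// mass ler_pM2l.
  apply: le_Rintegral => //.
  - apply: integrable_abse (_ : mu.-integrable D (EFin \o (fun t => g t * P t - g x * P t))).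
    by apply: integrable_subr => //; [exact: integrableS igP|exact: integrable_scale].
  - exact: integrable_scale.
  - move=> t; rewrite /D /= in_itv/= => /andP[t1 t2].
    rewrite -mulrBl normrM (ger0_norm (P0 _)) ler_wpM2r//.
    by apply: Hdel; rewrite ler_distlC t1 t2.
have E2 : `|\int[mu]_(t in ~` D) (g t * P t)| <= 2 * e * (del^-1 ^+ 2) * N1.
  have mDC : measurable (~` D) by exact: measurableC.
  apply: le_trans (le_normr_Rintegral _ _) _ => //; first exact: integrableS igP.
  rewrite /N1 -RintegralZl//; last exact: integrable_abse ig.
  rewrite [leLHS]Rintegral_mkcond.
  apply: le_Rintegral => //.
  - apply: (le_integrable _ _ _ igP) => //.
      apply/measurable_EFinP; apply/measurable_restrict => //.
      apply: measurable_funS (integrable_measurable (integrable_abse igP)) => //.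
    by move=> t _ /=; rewrite lee_fin patchE; case: ifP => _; rewrite ?normr_id// normr0.
  - by apply: integrable_scale => //; exact: integrable_abse ig.
  - move=> t _; rewrite patchE; case: ifPn => tD; last first.
      by rewrite mulr_ge0// mulr_ge0 ?sqr_ge0// mulr_ge0// ltW.
    rewrite normrM (ger0_norm (P0 _)) mulrC ler_wpM2r//.
    have td : del <= `|t - x|.
      move: tD; rewrite inE /D /= in_itv/= => /negP; rewrite negb_and -!ltNge.
      by case/orP => /ltW h; rewrite ler_normr; apply/orP; [right|left];
        rewrite ?opprB; [rewrite lerBrDr -lerBrDl|rewrite lerBrDl].
    rewrite /P /poisson ler_pM2l ?mulr_gt0// exprVn lef_pV2 ?posrE ?poisson_den ?exprn_gt0//.
    rewrite -[(t - x) ^+ 2]real_normK ?num_real//.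
    apply: le_trans (_ : `|t - x| ^+ 2 <= _); last by rewrite lerDr sqr_ge0.
    by rewrite ler_pXn2r ?nnegrE ?(ltW del0).
have E3 : `|g x * (4 * atan (del / e)) - 2 * pi * g x| <= eta / 4.
  rewrite [X in `|X|](_ : _ = g x * (4 * atan (del / e) - 2 * pi)); last by ring.
  by rewrite normrM (@ler0_norm _ (_ - 2 * pi)) ?subr_le0// opprB.
have E4 (t p : R) : 0 < p -> t / (4 * p * 2) * (2 * p) = t / 4.
  by move=> p1; field; rewrite gt_eqF.
rewrite E4// in E1.
have b0 : 0 <= del^-1 ^+ 2 * N1 * e.
  by apply: mulr_ge0 (ltW e0); apply: mulr_ge0 N10; exact: sqr_ge0.
have two_le4 (b : R) : 0 <= b -> 2 * b <= 4 * b by clear; move=> ?; lra.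
have three4 (t : R) : 0 < t -> t / 4 + t / 4 + t / 4 <= t by clear; move=> ?; lra.
rewrite distrC.
rewrite [X in `|X|](_ : _ = (\int[mu]_(t in D) (g t * P t) - g x * (4 * atan (del / e)))
  + \int[mu]_(t in ~` D) (g t * P t) + (g x * (4 * atan (del / e)) - 2 * pi * g x)); last by ring.
apply: le_trans (ler_normD _ _) _; apply: le_trans (lerD (ler_normD _ _) (lexx _)) _.
have E5 : 2 * e * del^-1 ^+ 2 * N1 <= eta / 4.
  by apply: le_trans a2; rewrite [leLHS](_ : _ = 2 * (del^-1 ^+ 2 * N1 * e)) ?[leRHS](_ : _ = 4 * (del^-1 ^+ 2 * N1 * e)); [exact: two_le4|ring|ring].
exact: le_trans (lerD (lerD E1 (le_trans E2 E5)) E3) (three4 _ eta0).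
Unshelve. all: by end_near. Qed.

(** For an even g, such as u or its multiplied transform [chat], this is the Fourier transform. *)
Definition cosT g (omega : R) : R := \int[mu]_x (g x * cos (omega * x)).

Lemma integrable_cosT g omega : mu.-integrable setT (EFin \o g) ->
  mu.-integrable setT (EFin \o (fun x => g x * cos (omega * x))).
Proof.
move=> ig; have := @integrable_boundM (fun x => cos (omega * x)) g 1
  (measurable_cos_scale omega) (fun x => cos_max _) ig.
by under eq_fun do rewrite mulrC.
Qed.

Lemma cosT_le g omega : mu.-integrable setT (EFin \o g) ->
  `|cosT g omega| <= \int[mu]_x `|g x|.
Proof.
move=> ig; apply: le_trans (le_normr_Rintegral _ (integrable_cosT omega ig)) _ => //.
apply: le_Rintegral => //.
- exact: integrable_abse (integrable_cosT omega ig).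
- exact: integrable_abse ig.
- by move=> x _; rewrite normrM ler_piMr// cos_max.
Qed.

(** The product of the two cosines is expanded, which gives Poisson averages at both x and [- x]; g
    is not assumed even at this stage. *)
Lemma abel_summation g eps x : 0 < eps -> mu.-integrable setT (EFin \o g) ->
  mu.-integrable setT (EFin \o (fun omega => expR (- (eps * `|omega|)) * cos (omega * x) * cosT g omega)) /\
  \int[mu]_omega (expR (- (eps * `|omega|)) * cos (omega * x) * cosT g omega) =
  2^-1 * (\int[mu]_t (g t * poisson eps (t - x)) + \int[mu]_t (g t * poisson eps (t - - x))).
Proof.
move=> e0 ig.
have mg := integrable_measurable ig.
pose E (w : R) := expR (- (eps * `|w|)).
have iE : mu.-integrable setT (EFin \o E) := integrable_expR_abs e0.
pose F (w t : R) := E w * cos (w * x) * (g t * cos (w * t)).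
have mprod : measurable_fun setT (fun p : R * R => p.1 * p.2).
  by apply: measurable_funM; [exact: measurable_fst|exact: measurable_snd].
have mcos : measurable_fun setT (fun p : R * R => cos (p.1 * p.2)).
  apply: (@measurableT_comp _ _ _ _ _ _ (@cos R) _ (fun p : R * R => p.1 * p.2)) => //.
  by apply: continuous_measurable_fun; exact: continuous_cos.
have mEx : measurable_fun setT (fun w : R => E w * cos (w * x)).
  apply: measurable_funM; first exact: integrable_measurable iE.
  by under eq_fun do rewrite mulrC; exact: measurable_cos_scale.
have mF : measurable_fun setT (fun p : R * R => F p.1 p.2).
  apply: measurable_funM; first exact: (measurableT_comp mEx measurable_fst).
  by apply: measurable_funM => //; exact: (measurableT_comp mg measurable_snd).
have F1 w : mu.-integrable setT (EFin \o F w).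
  by apply: integrable_scale => //; exact: integrable_cosT.
have FE w t : `|F w t| <= `|g t| * E w.
  rewrite /F !normrM (ger0_norm (expR_ge0 _)) mulrC -mulrA ler_wpM2l//.
  rewrite mulrCA ler_piMr ?expR_ge0// mulr_ile1 ?cos_max//.
have F2 t : mu.-integrable setT (EFin \o F^~ t).
  apply: (le_integrable _ _ _ (integrable_scale (`|g t|) measurableT iE)) => //.
    apply/measurable_EFinP; apply: measurable_funM => //.
    apply: measurable_funM => //.
    by under eq_fun do rewrite mulrC; exact: measurable_cos_scale.
  by move=> w _ /=; rewrite lee_fin (le_trans (FE w t))// ler_norm.
have iG : mu.-integrable setT (EFin \o (fun t => (\int[mu]_w E w) * `|g t|)).
  by apply: integrable_scale => //; exact: integrable_abse ig.
have [|i1 i2 i3] := @Rintegral_fubini F _ mF F1 F2 iG.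
  move=> t; rewrite [leRHS]mulrC -RintegralZl//.
  apply: le_Rintegral => //.
  - exact: integrable_abse (F2 t).
  - exact: integrable_scale.
have Fy w : \int[mu]_t F w t = E w * cos (w * x) * cosT g w.
  by rewrite /F (RintegralZl _ measurableT (integrable_cosT w ig)).
have -> : (fun omega => E omega * cos (omega * x) * cosT g omega) =
  (fun w => \int[mu]_t F w t) by apply/funext => w; rewrite Fy.
split; [exact: i1|rewrite i3].
have Fx t : \int[mu]_w F w t = 2^-1 * (g t * poisson eps (t - x) + g t * poisson eps (t - - x)).
  have [j1 J1] := poisson_FT (t - x) e0; have [j2 J2] := poisson_FT (t - - x) e0.
  have j3 := integrable_addr measurableT j1 j2.
  have -> : 2^-1 * (g t * poisson eps (t - x) + g t * poisson eps (t - - x)) =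
    2^-1 * g t * (poisson eps (t - x) + poisson eps (t - - x)) by ring.
  rewrite -J1 -J2 -(RintegralD measurableT j1 j2) -(RintegralZl _ measurableT j3).
  apply: eq_Rintegral => w _; rewrite /F /E.
  rewrite opprK mulrBl mulrDl cosB cosD [w * x]mulrC [w * t]mulrC.
  by field.
under eq_Rintegral do rewrite Fx.
have iP y : mu.-integrable setT (EFin \o (fun t => g t * poisson eps (t - y))).
  have := @integrable_boundM (fun t => poisson eps (t - y)) g (2 / eps).
  under [X in _ -> _ -> _ -> mu.-integrable _ (_ \o X)]eq_fun do rewrite mulrC.
  apply; last exact: ig.
    by apply: continuous_measurable_fun; exact: continuous_poisson.
  by move=> t; rewrite (ger0_norm (poisson_ge0 _ e0)) poisson_le.
rewrite (RintegralZl _ measurableT (integrable_addr measurableT (iP x) (iP (- x)))).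
by rewrite (RintegralD measurableT (iP x) (iP (- x))).
Qed.

Lemma expR_abs_lim (w : R) : expR (- (n.+1%:R^-1 * `|w|)) @[n --> \oo] --> (1 : R).
Proof.
have h : - (n.+1%:R^-1 * `|w|) @[n --> \oo] --> (0 : R).
  rewrite -oppr0; apply: cvgN; rewrite -(mul0r `|w|); apply: cvgMl.
  exact: cvg_harmonic.
by have := cvg_comp _ _ h (@continuous_expR R 0); rewrite expR0.
Qed.

Lemma cos_inversion g x : mu.-integrable setT (EFin \o g) -> (forall y, g (- y) = g y) ->
  {for x, continuous g} -> {for - x, continuous g} ->
  mu.-integrable setT (EFin \o cosT g) ->
  \int[mu]_omega (cosT g omega * cos (omega * x)) = 2 * pi * g x.
Proof.
move=> ig eg cx cNx iT.
have e0 n : 0 < n.+1%:R^-1 :> R by rewrite invr_gt0.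
have lim1 : \int[mu]_w (expR (- (n.+1%:R^-1 * `|w|)) * cos (w * x) * cosT g w) @[n --> \oo]
    --> 2 * pi * g x.
  under eq_fun => n do rewrite (abel_summation x (e0 n) ig).2.
  have -> : 2 * pi * g x = 2^-1 * (2 * pi * g x + 2 * pi * g (- x)).
    by rewrite eg; field.
  by apply: cvgMr; apply: cvgD; [exact: (approx_identity ig cx)|exact: (approx_identity ig cNx)].
have [|||||_ lim2] := @Rintegral_dct R setT
  (fun n w => expR (- (n.+1%:R^-1 * `|w|)) * cos (w * x) * cosT g w)
  (fun w => cosT g w * cos (w * x)) (fun w => `|cosT g w|) 0 measurableT.
- by move=> n; exact: integrable_measurable (abel_summation x (e0 n) ig).1.
- apply: measurable_funM; first exact: integrable_measurable iT.
  by under eq_fun do rewrite mulrC; exact: measurable_cos_scale.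
- move=> w _ _; have -> : cosT g w * cos (w * x) = 1 * cos (w * x) * cosT g w by ring.
  by apply: cvgMl; apply: cvgMl; exact: expR_abs_lim.
- move=> n w _; rewrite !normrM (ger0_norm (expR_ge0 _)) ler_piMl//.
  by rewrite mulr_ile1 ?expR_ge0 ?cos_max// -(expR0 R) ler_expR oppr_le0 mulr_ge0// ltW.
- exact: integrable_abse iT.
exact: (cvg_unique _ lim2 lim1).
Qed.

(* By Abel summation at 0. *)
Lemma cosT_mass_le g X : mu.-integrable setT (EFin \o g) -> {for 0, continuous g} ->
  (forall t, 0 <= cosT g t) ->
  \int[mu]_(t in `[- X, X]) cosT g t <= 2 * pi * g 0.
Proof.
move=> ig c0 T0.
have e0 n : 0 < n.+1%:R^-1 :> R by rewrite invr_gt0.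
have lim1 : \int[mu]_w (expR (- (n.+1%:R^-1 * `|w|)) * cos (w * 0) * cosT g w) @[n --> \oo]
    --> 2 * pi * g 0.
  under eq_fun => n do rewrite (abel_summation 0 (e0 n) ig).2.
  have cN0 : {for - 0, continuous g} by rewrite oppr0.
  have -> : 2 * pi * g 0 = 2^-1 * (2 * pi * g 0 + 2 * pi * g (- 0)).
    by rewrite oppr0; field.
  by apply: cvgMr; apply: cvgD; [exact: (approx_identity ig c0)|exact: (approx_identity ig cN0)].
have lim2 : expR (- (n.+1%:R^-1 * `|X|)) * \int[mu]_(t in `[- X, X]) cosT g t @[n --> \oo]
    --> 1 * \int[mu]_(t in `[- X, X]) cosT g t.
  by apply: cvgMl; exact: expR_abs_lim.
rewrite -[leLHS]mul1r; apply: (ler_cvg_to lim2 lim1); apply: nearW => n.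
have [iA _] := abel_summation 0 (e0 n) ig.
pose A w := expR (- (n.+1%:R^-1 * `|w|)) * cos (w * 0) * cosT g w.
have mT : measurable_fun setT (cosT g).
  have mA := integrable_measurable iA.
  have -> : cosT g = (fun w => expR (n.+1%:R^-1 * `|w|) * A w).
    apply/funext => w; rewrite /A mulr0 cos0 mulr1 mulrA -expRD subrr expR0 mul1r//.
  apply: measurable_funM => //.
  apply: continuous_measurable_fun => w.
  have h : {for w, continuous (fun w : R => n.+1%:R^-1 * `|w|)}.
    by apply: cvgMr; exact: norm_continuous.
  exact: (continuous_comp h (@continuous_expR R _)).
have iT : mu.-integrable `[- X, X] (EFin \o cosT g).
  apply: (le_integrable _ _ _ (continuous_integrable (u := fun=> \int[mu]_x `|g x|) _)) => //.
  - by apply/measurable_EFinP; exact: measurable_funS mT.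
  - by move=> t _ /=; rewrite lee_fin (le_trans (cosT_le t ig))// ler_norm.
  - by move=> t _; exact: cvg_cst.
rewrite -RintegralZl//.
apply: le_trans (_ : \int[mu]_(t in `[- X, X]) A t <= _).
  apply: le_Rintegral => //.
  - exact: integrable_scale.
  - exact: integrableS iA.
  - move=> t; rewrite /= in_itv/= => /andP[t1 t2].
    rewrite /A mulr0 cos0 mulr1 ler_wpM2r// ler_expR lerN2 ler_wpM2l ?(ltW (e0 n))//.
    by apply: le_trans (ler_norm X); rewrite ler_norml; apply/andP; split.
rewrite Rintegral_mkcond; apply: le_Rintegral => //.
- apply: (le_integrable _ _ _ iA) => //.
    apply/measurable_EFinP; apply/measurable_restrict => //.
    by apply: measurable_funS (integrable_measurable iA).
  by move=> t _ /=; rewrite lee_fin patchE; case: ifP => _; rewrite ?normr0.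
- move=> t _; rewrite patchE; case: ifP => // _.
  by rewrite mulr_ge0// mulr0 cos0 mulr1 expR_ge0.
Qed.

End Fourier.

(** * The weight and the continuous charge *)

Section Weight.
Variable R : realType.
Implicit Types (f : R -> R) (x y : R).

Lemma is_derive1P f x l : is_derive x 1 f l <->
  forall e : R, 0 < e -> exists2 del : R, 0 < del &
    forall y, `|y - x| < del -> `|f y - f x - l * (y - x)| <= e * `|y - x|.
Proof.
split=> [[df <-] e e0|H].
  move: df => /[dup] df0 /cvg_ex[/= k df]; rewrite /derive (cvg_lim _ df)//.
  move: df => /cvgrPdist_le/(_ _ e0)/nbhs_ballP[/= r r0] Hd.
  exists r => // y hy.
  case: (eqVneq y x) => [->|yx]; first by rewrite !subrr mulr0 subr0 normr0 mulr0.
  have yx' : y - x != 0 by rewrite subr_eq0.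
  have := Hd (y - x); rewrite /ball/= sub0r normrN => /(_ hy yx').
  rewrite /GRing.scale/= mulr1 subrK.
  have -> : k - (y - x)^-1 * (f y - f x) = - ((f y - f x - k * (y - x)) / (y - x)).
    by field.
  by rewrite normrN normrM normfV ler_pdivrMr// normr_gt0.
have L : (fun h => h^-1 *: ((f \o shift x) (h *: (1 : R^o)) - f x)) @ 0^' --> l.
  apply/cvgrPdist_le => e e0.
  have [r r0 Hr] := H e e0.
  apply/nbhs_ballP; exists r => // h /=; rewrite /ball/= sub0r normrN => hr h0.
  have := Hr (x + h); rewrite [x + h - x]addrAC subrr add0r => /(_ hr).
  rewrite /GRing.scale/= mulr1 [h + x]addrC => k.
  have -> : l - h^-1 * (f (x + h) - f x) = - ((f (x + h) - f x - l * h) / h).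
    by field.
  by rewrite normrN normrM normfV ler_pdivrMr// normr_gt0.
apply: DeriveDef; first by apply/cvg_ex; exists l.
exact: cvg_lim L.
Qed.

Lemma hder_real (f : R[i] -> R[i]) x l : hder f x%:C l ->
  is_derive x 1 (fun t => complex.Re (f t%:C)) (complex.Re l).
Proof.
move=> /hderP H; apply/is_derive1P => e e0; have [r r0 Hr] := H e e0.
exists r => // y hy; have := Hr y%:C.
rewrite -rmorphB cabs_real => /(_ hy); apply: le_trans.
apply: le_trans (le_Re_cabs _).
by rewrite Re_addc Re_addc !Re_oppc [l * _]mulrC Re_realM [_ * (y - x)]mulrC.
Qed.

Lemma convex_tangent f x l y : convex_function [set: R^o] (f : R^o -> R^o) ->
  is_derive x 1 f l -> f x + l * (y - x) <= f y.
Proof.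
move=> cf /is_derive1P df; apply/ler_addgt0Pl => e e0.
set h := y - x; case: (eqVneq h 0) => [h0|h0].
  have -> : y = x by apply/eqP; rewrite -subr_eq0 -/h h0.
  by rewrite h0 mulr0 addr0 lerDr ltW.
have nh0 : 0 < `|h| by rewrite normr_gt0.
have [r r0 Hr] := df (e / `|h|) (divr_gt0 e0 nh0).
pose s := Num.min 1 (r / (2 * `|h|)).
have rh : 0 < r / (2 * `|h|) by rewrite divr_gt0// mulr_gt0.
have s0 : 0 < s by rewrite lt_min ltr01.
have s1 : s <= 1 by rewrite ge_min lexx.
have s01 : 0 <= s <= 1 by rewrite ltW.
have sh : `|s * h| < r.
  rewrite normrM gtr0_norm// (@le_lt_trans _ _ (r / (2 * `|h|) * `|h|))//.
    by rewrite ler_wpM2r// ge_min lexx orbT.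
  by rewrite [ltLHS](_ : _ = r / 2); [lra|field; rewrite gt_eqF].
have := cf (Itv01 (ltW s0) s1) y x; rewrite !inE => /(_ I I).
move=> c0; have {c0} : f (s * y + (1 - s) * x) <= s * f y + (1 - s) * f x := c0.
have -> : s * y + (1 - s) * x = x + s * h by rewrite /h; ring.
move=> c1; have := Hr (x + s * h); rewrite [_ + _ - x]addrAC subrr add0r => /(_ sh).
rewrite ler_norml => /andP[c2 _]; move: c2; rewrite normrM (gtr0_norm s0).
have -> : e / `|h| * (s * `|h|) = e * s by field; rewrite gt_eqF.
move=> c2; rewrite -(ler_pM2l s0); lra.
Qed.

(** Three derivatives of q enter the [omega ^ -3] decay of the transform of u; the fourth complex
    derivative of w gives the continuity of [q3]. *)
Lemma weight_regular (d : R) (w : R[i] -> R[i]) : 0 < d -> weight d w ->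
  exists q2 q3 : R -> R,
  [/\ forall x, is_derive x 1 (fun x => - ln (realw w x)) (- dlog w x),
      forall x, is_derive x 1 (fun x => - dlog w x) (q2 x),
      forall x, is_derive x 1 q2 (q3 x) & continuous q3].
Proof.
move=> d0 ww; have wP x := weightP x ww; case: (ww) => [[[an _ _ _] _ _] _ _].
have /choice[W1 H1] : forall z, exists l, strip d z -> hder w z l.
  move=> z; case: (pselect (strip d z)) => [zd|]; last by exists 0.
  by have [l ?] := derivable_hder (an z zd); exists l.
have /choice[W2 H2] : forall z, exists l, strip d z -> hder W1 z l.
  move=> z; case: (pselect (strip d z)) => [zd|]; last by exists 0.
  by have [l ?] := hder_deriv H1 zd; exists l.
have /choice[W3 H3] : forall z, exists l, strip d z -> hder W2 z l.
  move=> z; case: (pselect (strip d z)) => [zd|]; last by exists 0.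
  by have [l ?] := hder_deriv H2 zd; exists l.
have /choice[W4 H4] : forall z, exists l, strip d z -> hder W3 z l.
  move=> z; case: (pselect (strip d z)) => [zd|]; last by exists 0.
  by have [l ?] := hder_deriv H3 zd; exists l.
have sx x : strip d x%:C by rewrite /strip/= normr0.
pose r0 := realw w.
pose r1 x := complex.Re (W1 x%:C); pose r2 x := complex.Re (W2 x%:C).
pose r3 x := complex.Re (W3 x%:C); pose r4 x := complex.Re (W4 x%:C).
have D0 x : is_derive x 1 r0 (r1 x) by exact: (hder_real (H1 _ (sx x))).
have D1 x : is_derive x 1 r1 (r2 x) by exact: (hder_real (H2 _ (sx x))).
have D2 x : is_derive x 1 r2 (r3 x) by exact: (hder_real (H3 _ (sx x))).
have D3 x : is_derive x 1 r3 (r4 x) by exact: (hder_real (H4 _ (sx x))).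
have p0 x : 0 < r0 x by have [_] := wP x.
have dlE : dlog w = fun x => r1 x / r0 x.
  by apply/funext => x; rewrite /dlog derive1E; have [_ ->] := D0 x.
have c0 : continuous r0 by move=> x; exact: is_derive_continuous (D0 x).
have c1 : continuous r1 by move=> x; exact: is_derive_continuous (D1 x).
have c2 : continuous r2 by move=> x; exact: is_derive_continuous (D2 x).
have c3 : continuous r3 by move=> x; exact: is_derive_continuous (D3 x).
pose s1 x := r1 x / r0 x; pose s2 x := r2 x / r0 x - s1 x ^+ 2.
pose s3 x := r3 x / r0 x - s1 x * (r2 x / r0 x) - 2 * s1 x * s2 x.
have nz x : r0 x != 0 by rewrite gt_eqF.
have DV x : is_derive x 1 (fun x => (r0 x)^-1) (- (r1 x) / r0 x ^+ 2).
  by have := nz x => ?; apply: is_derive_eq; rewrite /GRing.scale/=; field.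
have E1 x : is_derive x 1 s1 (s2 x).
  rewrite /s1; apply: is_derive_eq; rewrite /GRing.scale/= /s2 /s1.
  by have := nz x => ?; field.
have E2 x : is_derive x 1 s2 (s3 x).
  rewrite /s2; apply: is_derive_eq; rewrite /GRing.scale/= /s3 /s2 /s1.
  by have := nz x => ?; field.
exists (fun x => - s2 x), (fun x => - s3 x); split.
- move=> x; rewrite dlE.
  have dl := is_derive1_ln (p0 x).
  have -> : - (r1 x / r0 x) = - ((r0 x)^-1 *: r1 x) by rewrite /GRing.scale/= mulrC.
  apply: is_deriveN.
- by move=> x; rewrite dlE; apply: is_deriveN; exact: E1.
- by move=> x; apply: is_deriveN; exact: E2.
- move=> x; apply: cvgN.
  have cs1 := is_derive_continuous (E1 x); have cs2 := is_derive_continuous (E2 x).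
  have cV := is_derive_continuous (DV x).
  apply: cvgB; last by apply: cvgM => //; apply: cvgMr.
  apply: cvgB; first by apply: cvgM => //; exact: c3.
  by apply: cvgM => //; apply: cvgM => //; exact: c2.
Qed.

End Weight.

Section FourierMore.
Variable R : realType.
Local Notation mu := (@lebesgue_measure R).
Implicit Types (f g : R -> R) (x y : R).

Lemma continuous_cosT g : mu.-integrable setT (EFin \o g) -> continuous (cosT g).
Proof.
move=> ig om.
have omI : `](om - 1), (om + 1)[%classic om.
  by rewrite /= in_itv/=; apply/andP; split; lra.
have := @continuity_under_integral R _ _ mu (fun om x => g x * cos (om * x)) setT
  measurableT (om - 1) (om + 1) _ _ (fun x => `|g x|) _ _ om.
apply.
- by move=> w _; exact: integrable_cosT.
- apply: aeW => y _ w _; apply: cvgMr.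
  have h : {for w, continuous (fun w : R => w * y)}.
    by apply: cvgM; [exact: cvg_id|exact: cvg_cst].
  exact: (continuous_comp h (@continuous_cos R _)).
- exact: integrable_abse ig.
- move=> w _; apply: aeW => y _.
  by rewrite normrM ler_piMr// cos_max.
- by rewrite inE.
Qed.

Lemma Rintegral_oppr f (b : R) : 0 <= b -> continuous f ->
  \int[mu]_(x in `[- b, b]) f (- x) = \int[mu]_(x in `[- b, b]) f x.
Proof.
move=> b0 cf; rewrite /Rintegral; congr fine.
have := @integration_by_substitution_oppr R f (- b) b; rewrite opprK => -> //.
- by rewrite lerNl (le_trans _ b0)// oppr_le0.
- exact: continuous_subspaceT.
Qed.

Lemma Rintegral_odd f (b : R) : 0 <= b -> continuous f -> (forall x, f (- x) = - f x) ->
  \int[mu]_(x in `[- b, b]) f x = 0.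
Proof.
move=> b0 cf fN; have := Rintegral_oppr b0 cf.
rewrite (@eq_Rintegral _ _ R mu _ (fun x => -1 * f x)); last by move=> x _; rewrite fN mulN1r.
rewrite RintegralZl//; first lra.
by apply: continuous_integrable => x _; exact: cf.
Qed.

Lemma even_derive_odd f (f1 : R -> R) : (forall x, is_derive x 1 f (f1 x)) ->
  (forall x, f (- x) = f x) -> forall x, f1 (- x) = - f1 x.
Proof.
move=> df ef x.
have h : is_derive x 1 (fun y => f (- 1 * y)) (f1 (- 1 * x) * - 1) by exact: is_derive_scale.
have E : (fun y => f (- 1 * y)) = f by apply/funext => y; rewrite mulN1r ef.
rewrite E in h; have := @derive_val _ _ _ _ _ _ _ h.
by rewrite (@derive_val _ _ _ _ _ _ _ (df x)) mulN1r mulrN1 => ->; rewrite opprK.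
Qed.

Lemma tanh_gt0 x : 0 < x -> 0 < tanh x.
Proof.
move=> x0; rewrite tanhE divr_gt0 ?rcosh_gt0//.
by rewrite /rsinh divr_gt0// subr_gt0 ltr_expR; lra.
Qed.

Lemma tanh_neq0 x : x != 0 -> tanh x != 0.
Proof.
move=> x0; have [xp|xn|/eqP] := ltgtP x 0; last by rewrite (negbTE x0).
  by rewrite -[x]opprK tanhN oppr_eq0 gt_eqF// tanh_gt0// oppr_gt0.
by rewrite gt_eqF// tanh_gt0.
Qed.

Lemma tanh_ge x : 0 <= x -> x <= (1 + x) * tanh x.
Proof.
move=> x0.
have e0 : 0 < expR x + expR (- x) by rewrite addr_gt0// expR_gt0.
rewrite /tanh mulrA ler_pdivlMr//.
have e1 := expR_gt0 (- x); have e2 := expR_ge1Dx (x + x).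
have : expR x = expR (x + x) * expR (- x) by rewrite -expRD addrK.
move=> E; rewrite E -subr_ge0.
rewrite [leRHS](_ : _ = (expR (x + x) - (1 + (x + x))) * expR (- x)); last by ring.
by rewrite mulr_ge0 ?(ltW e1)// subr_ge0.
Qed.

End FourierMore.

(** * The potential u and its transform *)

Section Obstacle.
Variable R : realType.
Local Notation mu := (@lebesgue_measure R).
Implicit Types (x y : R).
Variables (d al : R) (q q1 q2 q3 : R -> R).
Hypotheses (d0 : 0 < d) (al0 : 0 < al).
Hypothesis Dq : forall x, is_derive x 1 q (q1 x).
Hypothesis Dq1 : forall x, is_derive x 1 q1 (q2 x).
Hypothesis Dq2 : forall x, is_derive x 1 q2 (q3 x).
Hypothesis cq3 : continuous q3.
Hypothesis qN : forall x, q (- x) = q x.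
Hypothesis qt : forall x y, q x + q1 x * (y - x) <= q y.
Let a := pi / (2 * d).
Let a0 : 0 < a. Proof. by rewrite divr_gt0 ?pi_gt0// mulr_gt0. Qed.
Let B := q1 al / a.

Let cq : continuous q. Proof. by move=> x; exact: is_derive_continuous (Dq x). Qed.
Let cq1 : continuous q1. Proof. by move=> x; exact: is_derive_continuous (Dq1 x). Qed.
Let q1N x : q1 (- x) = - q1 x. Proof. exact: even_derive_odd Dq qN x. Qed.

Lemma tangent_mono x y : x <= y -> q1 x <= q1 y.
Proof.
rewrite le_eqVlt => /predU1P[->//|xy].
have h1 := qt x y; have h2 := qt y x.
have : 0 <= (q1 y - q1 x) * (y - x) by lra.
by rewrite pmulr_lge0 ?subr_gt0// subr_ge0.
Qed.

Let q10 : q1 0 = 0.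
Proof. by have := q1N 0; rewrite oppr0 => h; lra. Qed.

Let q1_ge0 x : 0 <= x -> 0 <= q1 x.
Proof. by move=> x0; rewrite -q10; exact: tangent_mono. Qed.

Let B0 : 0 <= B. Proof. by rewrite divr_ge0 ?q1_ge0// ltW. Qed.

Let q_norm x : q `|x| = q x.
Proof. by case: (ger0P x) => // _; rewrite qN. Qed.

Lemma q_even_mono x y : `|x| <= `|y| -> q x <= q y.
Proof.
move=> xy; rewrite -(q_norm x) -(q_norm y); apply: le_trans (qt `|x| _).
by rewrite lerDl mulr_ge0 ?q1_ge0// subr_ge0.
Qed.

(* [q al - q + B] on [[- al, al]], continued outside by the exponential of rate
   [a] with the same value and slope at [al]. *)
Definition pot x : R :=
  q al - q (Num.min `|x| al) + B * expR (- (a * Num.max (`|x| - al) 0)).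

Lemma potE_in x : `|x| <= al -> pot x = q al - q x + B.
Proof.
move=> h; rewrite /pot min_l// q_norm max_r ?subr_le0//.
by rewrite mulr0 oppr0 expR0 mulr1.
Qed.

Lemma potE_out x : al <= `|x| -> pot x = B * expR (- (a * (`|x| - al))).
Proof.
by move=> h; rewrite /pot min_r// max_l ?subr_ge0// subrr add0r.
Qed.

Lemma pot_even x : pot (- x) = pot x. Proof. by rewrite /pot normrN. Qed.

Lemma continuous_pot : continuous pot.
Proof.
move=> x.
have h1 : {for x, continuous (fun x : R => Num.min `|x| al)}.
  by apply: continuous_min; [exact: norm_continuous|exact: cvg_cst].
have h2 : {for x, continuous (fun x : R => Num.max (`|x| - al) 0)}.
  apply: continuous_max; last exact: cvg_cst.
  by apply: cvgB; [exact: norm_continuous|exact: cvg_cst].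
have h3 : {for x, continuous (fun x : R => - (a * Num.max (`|x| - al) 0))}.
  by apply: cvgN; apply: cvgMr; exact: h2.
have c1 : {for x, continuous (fun x : R => q (Num.min `|x| al))} :=
  continuous_comp h1 (@cq _).
have c2 : {for x, continuous (fun x : R => expR (- (a * Num.max (`|x| - al) 0)))} :=
  continuous_comp h3 (@continuous_expR R _).
apply: cvgD; last by apply: cvgMr; exact: c2.
by apply: cvgB; [exact: cvg_cst|exact: c1].
Qed.

Lemma pot_ge0 x : 0 <= pot x.
Proof.
apply: addr_ge0; last by rewrite mulr_ge0 ?expR_ge0.
rewrite subr_ge0; apply: q_even_mono.
have m0 : 0 <= Num.min `|x| al by rewrite le_min normr_ge0 ltW.
by rewrite (ger0_norm m0) (ger0_norm (ltW al0)) ge_min lexx orbT.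
Qed.

Let M := (q al - q 0 + B) * expR (a * al).

Lemma pot_le x : pot x <= M * expR (- (a * `|x|)).
Proof.
rewrite /M -mulrA -expRD -mulrBr.
have q0 : q 0 <= q x by apply: q_even_mono; rewrite normr0.
have q0a : q 0 <= q al by apply: q_even_mono; rewrite normr0.
case: (leP `|x| al) => [h|/ltW h].
  rewrite potE_in//.
  apply: le_trans (_ : (q al - q 0 + B) * 1 <= _).
    by rewrite mulr1 lerD2r lerD2l lerN2.
  rewrite ler_wpM2l//; first by rewrite addr_ge0// subr_ge0.
  by rewrite -expR0 ler_expR mulr_ge0 ?(ltW a0)// subr_ge0.
rewrite potE_out// -mulrN opprB ler_wpM2r ?expR_ge0//.
by rewrite lerDr subr_ge0.
Qed.

Lemma integrable_pot : mu.-integrable setT (EFin \o pot).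
Proof.
apply: (le_integrable _ _ _ (integrable_scale M measurableT (integrable_expR_abs a0))) => //.
- by apply/measurable_EFinP; apply: continuous_measurable_fun; exact: continuous_pot.
- by move=> x _ /=; rewrite lee_fin (ger0_norm (pot_ge0 _)) (le_trans (pot_le x))// ler_norm.
Qed.

(** Since [q1] is odd and equals [- dlog w], the integral in [nu_hat] is ['i] times this one. *)
Definition Jint omega : R := \int[mu]_(x in `[- al, al]) (q1 x * sin (omega * x)).

Lemma cosT_pot omega : omega != 0 -> cosT pot omega =
  omega^-1 * (2 * B * sin (omega * al) + Jint omega) +
  2 * B * (a * cos (omega * al) - omega * sin (omega * al)) / (a ^+ 2 + omega ^+ 2).
Proof.
move=> om0.
have D0 : 0 < a ^+ 2 + omega ^+ 2 := poisson_den omega a0.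
have csin : continuous (fun x : R => sin (omega * x)).
  by apply: continuous_scale; exact: continuous_sin.
have ccos : continuous (fun x : R => cos (omega * x)).
  by apply: continuous_scale; exact: continuous_cos.
pose Fin x := (q al - q x + B) * sin (omega * x) / omega.
pose Fout x := B * expR (- (a * (x - al))) * (omega * sin (omega * x) - a * cos (omega * x))
  / (a ^+ 2 + omega ^+ 2).
have cexpo (s : R) : continuous (fun x => B * expR (- (a * (s * x - al)))).
  move=> x; apply: cvgMr.
  have h : {for x, continuous (fun x : R => - (a * (s * x - al)))}.
    apply: cvgN; apply: cvgMr; apply: cvgB; last exact: cvg_cst.
    by apply: cvgMr; exact: cvg_id.
  exact: (continuous_comp h (@continuous_expR R _)).
(* The sign s treats the right tail ([s = 1]) and the left tail ([s = -1]) with one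
   antiderivative. *)
have dout (s : R) x : s ^+ 2 = 1 -> is_derive x 1 (fun x => s * Fout (s * x))
    (B * expR (- (a * (s * x - al))) * cos (omega * (s * x))).
  move=> s2; rewrite /Fout; apply: is_derive_eq; rewrite /GRing.scale/=.
  have := gt_eqF D0 => /negbT ?.
  set E := expR _; set c := cos _; set sn := sin _.
  rewrite [LHS](_ : _ = s ^+ 2 * (B * E * c)); first by rewrite s2 mul1r.
  by field.
have i0 : mu.-integrable setT (EFin \o (fun x => pot x * cos (omega * x))) :=
  integrable_cosT omega integrable_pot.
have Ein : \int[mu]_(x in `[- al, al]) (pot x * cos (omega * x)) =
    omega^-1 * (2 * B * sin (omega * al) + Jint omega).
  have iJ : mu.-integrable `[- al, al] (EFin \o (fun x => q1 x * sin (omega * x))).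
    by apply: continuous_integrable => x _; apply: cvgM; [exact: cq1|exact: csin].
  pose f x := (q al - q x + B) * cos (omega * x) - q1 x * sin (omega * x) / omega.
  have cf : continuous f.
    move=> x; apply: cvgB.
      apply: cvgM; last exact: ccos.
      apply: cvgD; last exact: cvg_cst.
      by apply: cvgB; [exact: cvg_cst|exact: cq].
    by apply: cvgMl; apply: cvgM; [exact: cq1|exact: csin].
  rewrite (@eq_Rintegral _ _ R mu _ (fun x => 1 * f x + omega^-1 * (q1 x * sin (omega * x)))); last first.
    move=> x; rewrite inE /= in_itv/= => /andP[x1 x2].
    rewrite potE_in; last by rewrite ler_norml x1.
    by rewrite /f; field.
  rewrite Rintegral_lin2//; last by apply: continuous_integrable => x _; exact: cf.
  have -> : \int[mu]_(x in `[- al, al]) f x = Fin al - Fin (- al).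
    apply: Rintegral_FTC; first by rewrite lerNl (le_trans _ (ltW al0))// oppr_le0 ltW.
      by move=> x _; exact: cf.
    move=> x _; have dq := Dq x; rewrite /Fin /f; apply: is_derive_eq; rewrite /GRing.scale/=.
    by field.
  rewrite /Fin qN mulrN sinN /Jint; field; exact: om0.
have Eout n : al <= n -> \int[mu]_(x in `[al, n]) (pot x * cos (omega * x)) = Fout n - Fout al.
  move=> an.
  rewrite (@eq_Rintegral _ _ R mu _ (fun x => B * expR (- (a * (1 * x - al))) * cos (omega * (1 * x)))); last first.
    move=> x; rewrite inE /= in_itv/= => /andP[x1 x2].
    have xn : `|x| = x by rewrite ger0_norm// (le_trans (ltW al0)).
    by rewrite potE_out xn// !mul1r.
  rewrite (Rintegral_FTC an _ (fun x _ => dout 1 x (expr1n R 2))); first by rewrite !mul1r.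
  - by move=> x _; apply: cvgM; [exact: cexpo|under eq_fun do rewrite mul1r; rewrite mul1r; exact: ccos].
have Eneg n : al <= n -> \int[mu]_(x in `[- n, - al]) (pot x * cos (omega * x)) = Fout n - Fout al.
  move=> an.
  rewrite (@eq_Rintegral _ _ R mu _ (fun x => B * expR (- (a * (-1 * x - al))) * cos (omega * (-1 * x)))); last first.
    move=> x; rewrite inE /= in_itv/= => /andP[x1 x2].
    have x0 : x <= 0 by rewrite (le_trans x2)// oppr_le0 ltW.
    have xn : `|x| = - x by rewrite ler0_norm.
    have xa : al <= `|x| by rewrite xn lerNr.
    by rewrite (potE_out xa) xn (mulN1r x) (mulrN omega x) (cosN (omega * x)).
  have nn : - n <= - al by rewrite lerN2.
  have s2 : (-1) ^+ 2 = 1 :> R by rewrite sqrrN expr1n.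
  rewrite (Rintegral_FTC nn _ (fun x _ => dout (-1) x s2)).
  - by rewrite !mulN1r !opprK; ring.
  - move=> x _; apply: cvgM; first exact: cexpo.
    have h : {for x, continuous (fun x : R => -1 * x)} by apply: cvgMr; exact: cvg_id.
    exact: (continuous_comp h (ccos _)).
have h1 := integrable_truncate i0.
have limF : Fout n%:R @[n --> \oo] --> (0 : R).
  pose K := B * expR (a * al) * (`|omega| + a) / (a ^+ 2 + omega ^+ 2).
  have K0 : 0 <= K.
    by rewrite divr_ge0 ?(ltW D0)// mulr_ge0 ?addr_ge0 ?(ltW a0)// mulr_ge0 ?expR_ge0.
  have lim0 : K * expR (- (a * n%:R)) @[n --> \oo] --> (0 : R).
    rewrite -(mulr0 K); apply: cvgMr.
    apply: (cvg_comp (fun n : nat => a * n%:R) (fun x => expR (- x)) _ (@cvgr_expR R)).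
    exact: (cvg_comp (fun n : nat => (n%:R : R)) (fun x => a * x) (@cvgr_idn R) (cvgryM a0)).
  apply: (@squeeze_cvgr _ _ _ _ (fun n : nat => - (K * expR (- (a * n%:R))))
    (fun n : nat => K * expR (- (a * n%:R)))) => //; last first.
    by rewrite -oppr0; exact: cvgN.
  apply: nearW => n; rewrite -ler_norml.
  have hb : `|omega * sin (omega * n%:R) - a * cos (omega * n%:R)| <= `|omega| + a.
    apply: le_trans (ler_normB _ _) _; rewrite (normrM omega) (normrM a) (gtr0_norm a0); apply: lerD.
      by rewrite ler_piMr// sin_max.
    by rewrite ler_piMr ?cos_max// ltW.
  rewrite /Fout normrM (normrM (B * _)) (normrM B) normfV (gtr0_norm D0) (ger0_norm (expR_ge0 _)) (ger0_norm B0).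
  have -> : expR (- (a * (n%:R - al))) = expR (a * al) * expR (- (a * n%:R)).
    by rewrite -expRD; congr expR; ring.
  rewrite [leRHS](_ : _ = B * (expR (a * al) * expR (- (a * n%:R))) * (`|omega| + a)
    / (a ^+ 2 + omega ^+ 2)); last by rewrite /K; ring.
  rewrite ler_pM2r ?invr_gt0//; apply: ler_wpM2l => //.
  exact: mulr_ge0 B0 (mulr_ge0 (expR_ge0 _) (expR_ge0 _)).
have h2 : \int[mu]_(x in `[- n%:R, n%:R]) (pot x * cos (omega * x)) @[n --> \oo]
    --> omega^-1 * (2 * B * sin (omega * al) + Jint omega) + 2 * (0 - Fout al).
  have : (omega^-1 * (2 * B * sin (omega * al) + Jint omega) + 2 * (Fout n%:R - Fout al)) @[n --> \oo]
    --> omega^-1 * (2 * B * sin (omega * al) + Jint omega) + 2 * (0 - Fout al).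
    by apply: cvgD; [exact: cvg_cst|apply: cvgMr; apply: cvgB; [exact: limF|exact: cvg_cst]].
  apply: cvg_trans; apply: near_eq_cvg.
  near=> n.
  have an : al <= n%:R by near: n; exact: nbhs_infty_ger.
  have nn : - n%:R <= - al by rewrite lerN2.
  have aa : - al <= al by rewrite lerNl (le_trans _ (ltW al0))// oppr_le0 ltW.
  rewrite (@Rintegral_cat R _ (- n%:R) n%:R (- al))//; last 2 first.
  - exact: le_trans aa an.
  - by apply: integrableS i0.
  rewrite (@Rintegral_cat R _ (- al) n%:R al)//; last by apply: integrableS i0.
  by rewrite Ein Eout// Eneg//; ring.
have -> : cosT pot omega = _ := cvg_unique _ h1 h2.
have -> : Fout al = B * (omega * sin (omega * al) - a * cos (omega * al)) / (a ^+ 2 + omega ^+ 2).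
  by rewrite /Fout subrr mulr0 oppr0 expR0 mulr1.
field.
by rewrite om0 gt_eqF.
Unshelve. all: by end_near. Qed.

End Obstacle.

(** * Cubic decay of the transform of u *)

Section Decay.
Variable R : realType.
Local Notation mu := (@lebesgue_measure R).
Implicit Types (x y : R).
Variables (d al : R) (q q1 q2 q3 : R -> R).
Hypotheses (d0 : 0 < d) (al0 : 0 < al).
Hypothesis Dq : forall x, is_derive x 1 q (q1 x).
Hypothesis Dq1 : forall x, is_derive x 1 q1 (q2 x).
Hypothesis Dq2 : forall x, is_derive x 1 q2 (q3 x).
Hypothesis cq3 : continuous q3.
Hypothesis qN : forall x, q (- x) = q x.
Hypothesis qt : forall x y, q x + q1 x * (y - x) <= q y.
Let a := pi / (2 * d).
Let a0 : 0 < a. Proof. by rewrite divr_gt0 ?pi_gt0// mulr_gt0. Qed.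
Let B := q1 al / a.
Local Notation pot := (pot d al q q1).
Let aal : - al <= al. Proof. by rewrite lerNl (le_trans _ (ltW al0))// oppr_le0 ltW. Qed.

(** Two integrations by parts done at once: [q1 sin + q3 sin / omega ^ 2] is an exact derivative,
    and the oddness of [q1] merges its two endpoint terms. *)
Lemma Jint_parts omega : omega != 0 -> Jint al q1 omega =
  - (2 * q1 al * cos (omega * al)) / omega
  + (q2 al + q2 (- al)) * sin (omega * al) / omega ^+ 2
  - (\int[mu]_(x in `[- al, al]) (q3 x * sin (omega * x))) / omega ^+ 2.
Proof.
move=> om0.
have csin : continuous (fun x : R => sin (omega * x)).
  by apply: continuous_scale; exact: continuous_sin.
have cq1 x : {for x, continuous q1} := is_derive_continuous (Dq1 x).
pose f x := q1 x * sin (omega * x) + q3 x * sin (omega * x) / omega ^+ 2.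
have c3 : continuous (fun x => q3 x * sin (omega * x)).
  by move=> x; apply: cvgM; [exact: cq3|exact: csin].
have c1 : continuous (fun x => q1 x * sin (omega * x)).
  by move=> x; apply: cvgM; [exact: cq1|exact: csin].
have cf : continuous f.
  by move=> x; apply: cvgD; [exact: c1|apply: cvgMl; exact: c3].
pose F x := - (q1 x * cos (omega * x)) / omega + q2 x * sin (omega * x) / omega ^+ 2.
rewrite /Jint (@eq_Rintegral _ _ R mu _ (fun x => 1 * f x + - omega ^- 2 * (q3 x * sin (omega * x)))); last first.
  by move=> x _; rewrite /f; field.
rewrite Rintegral_lin2//; last 2 first.
- by apply: continuous_integrable => x _; exact: cf.
- by apply: continuous_integrable => x _; exact: c3.
have -> : \int[mu]_(x in `[- al, al]) f x = F al - F (- al).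
  apply: Rintegral_FTC; [exact: aal|by move=> x _; exact: cf|].
  move=> x _; have dq1 := Dq1 x; have dq2 := Dq2 x.
  rewrite /F /f; apply: is_derive_eq; rewrite /GRing.scale/=.
  by field.
rewrite /F (even_derive_odd Dq qN) mulrN sinN cosN.
by field.
Qed.

(** The terms of order [1 / omega] cancel because [pot] is continuous at al, and those of order
    [1 / omega ^ 2] because its slopes agree there, that is [q1 al = B * a]. The factor
    [1 + |omega|] is reserved for the growth of [omega / tanh (d omega)]. *)
Lemma cosT_pot_decay : exists2 K, 0 <= K & forall omega,
  (1 + `|omega|) * `|cosT pot omega| <= K * (1 + (1 * omega) ^+ 2)^-1.
Proof.
have B0 : 0 <= B.
  have q10 : q1 0 = 0.
    by have := even_derive_odd Dq qN 0; rewrite oppr0 => h; lra.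
  by rewrite divr_ge0 ?(ltW a0)// -q10 (tangent_mono qt)// ltW.
pose S := q2 al + q2 (- al).
pose Q := \int[mu]_(x in `[- al, al]) `|q3 x|.
pose m := \int[mu]_x `|pot x|.
pose C := 2 * B * a ^+ 2 + 2 * B * a ^+ 3 + `|S| + Q.
have Q0 : 0 <= Q by apply: Rintegral_ge0.
have m0 : 0 <= m by apply: Rintegral_ge0.
have hb n : 0 <= 2 * B * a ^+ n by rewrite mulr_ge0 ?exprn_ge0 ?(ltW a0)// mulr_ge0.
have C0 : 0 <= C.
  by rewrite /C; apply: addr_ge0 => //; apply: addr_ge0 => //; exact: addr_ge0.
have big omega : 1 <= `|omega| -> `|cosT pot omega| <= C / `|omega| ^+ 3.
  move=> om1.
  have om0 : omega != 0 by rewrite -normr_gt0 (lt_le_trans ltr01).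
  have D0 : 0 < a ^+ 2 + omega ^+ 2 := poisson_den omega a0.
  rewrite (cosT_pot d0 al0 Dq Dq1 qN qt om0) (Jint_parts om0) -/B -/a.
  set s := sin (omega * al); set c := cos (omega * al).
  set q3s := \int[mu]_(x in _) _; rewrite -/S.
  have q3sQ : `|q3s| <= Q.
    have i3 : mu.-integrable `[- al, al] (EFin \o (fun x => q3 x * sin (omega * x))).
      apply: continuous_integrable => x _; apply: cvgM; first exact: cq3.
      by apply: continuous_scale; exact: continuous_sin.
    apply: le_trans (le_normr_Rintegral _ i3) _ => //.
    apply: le_Rintegral => //.
    - exact: integrable_abse i3.
    - apply: integrable_abse (_ : mu.-integrable _ (EFin \o q3)).
      by apply: continuous_integrable => x _; exact: cq3.
    - by move=> x _; rewrite normrM ler_piMr// sin_max.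
  have -> : q1 al = B * a by rewrite /B mulfVK// gt_eqF.
  pose X := 2 * B * a ^+ 2 * (s * (omega ^+ 2 / (a ^+ 2 + omega ^+ 2)))
    - 2 * B * a ^+ 3 * (c * (omega / (a ^+ 2 + omega ^+ 2))) + S * s - q3s.
  have -> : omega^-1 * (2 * B * s + (- (2 * (B * a) * c) / omega + S * s / omega ^+ 2 - q3s / omega ^+ 2))
    + 2 * B * (a * c - omega * s) / (a ^+ 2 + omega ^+ 2) = X / omega ^+ 3.
    by rewrite /X; field; rewrite om0 gt_eqF.
  rewrite normrM normfV normrX ler_wpM2r ?invr_ge0 ?exprn_ge0//.
  have s1 : `|s| <= 1 := sin_max _.
  have c1 : `|c| <= 1 := cos_max _.
  have f1 : `|omega ^+ 2 / (a ^+ 2 + omega ^+ 2)| <= 1.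
    rewrite normrM normfV (gtr0_norm D0) (ger0_norm (sqr_ge0 _)) ler_pdivrMr// mul1r.
    by rewrite lerDr sqr_ge0.
  have f2 : `|omega / (a ^+ 2 + omega ^+ 2)| <= 1.
    rewrite normrM normfV (gtr0_norm D0) ler_pdivrMr// mul1r.
    apply: le_trans (_ : omega ^+ 2 <= _); last by rewrite lerDr sqr_ge0.
    by rewrite -real_normK ?num_real// expr2 ler_peMl.
  rewrite /X /C; apply: le_trans (ler_normB _ _) _; apply: lerD => //.
  apply: le_trans (ler_normD _ _) _; apply: lerD.
    apply: le_trans (ler_normB _ _) _; apply: lerD.
      by rewrite (normrM (_ * a ^+ 2)) (ger0_norm (hb 2)) ler_piMr ?hb// normrM mulr_ile1.
    by rewrite (normrM (_ * a ^+ 3)) (ger0_norm (hb 3)) ler_piMr ?hb// normrM mulr_ile1.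
  by rewrite normrM ler_piMr.
(* For [t = |omega|], [(1 + t) * (1 + t ^+ 2)] is at most [4 * t ^+ 3] when [1 <= t], which meets
   the cubic decay, and at most 4 when [t <= 1], where the norm m of [pot] bounds its transform. *)
exists (4 * (C + m)); first by rewrite mulr_ge0 ?addr_ge0.
move=> omega; rewrite mul1r.
have D0 : 0 < 1 + omega ^+ 2 by rewrite ltr_pwDl ?sqr_ge0.
rewrite ler_pdivlMr//.
have sq : omega ^+ 2 = `|omega| ^+ 2 by rewrite real_normK ?num_real.
have poly4 (t : R) : 1 <= t -> (1 + t) * (1 + t ^+ 2) <= 4 * t ^+ 3.
  move=> t1; have : 0 <= (t - 1) * (3 * t ^+ 2 + 2 * t + 1).
    by rewrite mulr_ge0 ?subr_ge0// !addr_ge0// ?mulr_ge0 ?exprn_ge0//; lra.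
  by lra.
case: (leP 1 `|omega|) => [om1|/ltW om1].
  have t0 : 0 < `|omega| by rewrite (lt_le_trans ltr01).
  have := big _ om1; set t := `|omega| in sq om1 t0 *; set U := `|cosT _ _| => bU.
  rewrite ler_pdivlMr ?exprn_gt0// in bU; rewrite sq.
  have U0 : 0 <= U := normr_ge0 _.
  have h := poly4 _ om1.
  rewrite mulrAC [leLHS]mulrC.
  apply: le_trans (_ : U * (4 * t ^+ 3) <= _); first by rewrite ler_wpM2l.
  by rewrite mulrCA ler_pM2l// (le_trans bU)// lerDl.
have U1 : `|cosT pot omega| <= m by apply: cosT_le; exact: integrable_pot.
have h : (1 + `|omega|) * (1 + omega ^+ 2) <= 4.
  rewrite sq (_ : 4 = 2 * 2); last by ring.
  apply: ler_pM; rewrite ?addr_ge0 ?sqr_ge0//; first lra.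
  rewrite (_ : 2 = 1 + 1)// lerD2l exprn_ile1//.
rewrite mulrAC; apply: ler_pM => //.
- by rewrite mulr_ge0 ?addr_ge0 ?sqr_ge0.
- by rewrite (le_trans U1)// lerDr.
Qed.

End Decay.

(** * The charge and the mass of its windows *)

Section Charge.
Variable R : realType.
Local Notation mu := (@lebesgue_measure R).
Implicit Types (x y s : R).

(** Identities obtained after dividing by omega or by [tanh (d * omega)] hold off 0 only, since
    division by 0 returns 0. *)
Lemma eq_Rintegral_except (f g : R -> R) (c : R) : measurable_fun setT f ->
  measurable_fun setT g -> (forall x, x != c -> f x = g x) ->
  \int[mu]_x f x = \int[mu]_x g x.
Proof.
move=> mf mg fg; rewrite /Rintegral; congr fine.
apply: ae_eq_integral => //; [exact/measurable_EFinP|exact/measurable_EFinP|].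
exists [set c]; split => //; first exact: lebesgue_measure_set1.
move=> x /= h; apply: contrapT => /eqP xc; apply: h => _.
by rewrite fg.
Qed.

Lemma Rintegral_indicM (D : set R) (f : R -> R) :
  \int[mu]_t (\1_D t * f t) = \int[mu]_(t in D) f t.
Proof.
rewrite [RHS]Rintegral_mkcond; apply: eq_Rintegral => t _.
by rewrite patchE indicE; case: ifP => _; rewrite ?mul1r ?mul0r.
Qed.

Lemma integrable_indicM (D : set R) (f : R -> R) : measurable D ->
  mu.-integrable D (EFin \o f) ->
  mu.-integrable setT (EFin \o (fun t => \1_D t * f t)).
Proof.
move=> mD iF; have := iffLR (@integrable_mkcond _ _ _ mu D (EFin \o f) mD) iF.
congr (mu.-integrable _ _); apply/funext => t /=.
by rewrite patchE indicE; case: ifP => _; rewrite ?mul1r ?mul0r.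
Qed.

Lemma norm_sin_div_le (s omega : R) : `|sin (omega * s) / omega| <= `|s|.
Proof.
case: (eqVneq omega 0) => [->|om0]; first by rewrite invr0 mulr0 normr0.
rewrite normrM normfV ler_pdivrMr ?normr_gt0//.
by rewrite -normrM mulrC norm_sin_le.
Qed.

Lemma rsinh_eq0 x : (rsinh x == 0) = (x == 0).
Proof.
apply/eqP/eqP => [h|->]; last by rewrite /rsinh oppr0 subrr mul0r.
apply/eqP; apply: contraT => x0; have := tanh_neq0 x0.
by rewrite tanhE h mul0r eqxx.
Qed.

Variable d : R.
Hypothesis d0 : 0 < d.
Let a := pi / (2 * d).
Let a0 : 0 < a. Proof. by rewrite divr_gt0 ?pi_gt0// mulr_gt0. Qed.

Lemma measurable_csch : measurable_fun setT (fun s : R => (rsinh (a * s))^-1).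
Proof.
apply: (@measurable_cont_except _ _ 0) => s s0; apply: cvgV.
  by rewrite rsinh_eq0 mulf_neq0// gt_eqF.
by apply: continuous_scale; exact: continuous_rsinh.
Qed.

Let minv : measurable_fun setT (fun s : R => s^-1).
Proof. by apply: (@measurable_cont_except _ _ 0) => s s0; exact: cvgV. Qed.

Lemma integrable_id_csch : mu.-integrable setT (EFin \o (fun s => `|s| / `|rsinh (a * s)|)).
Proof.
have [i1 _] := integrable_oneDsqr a0.
apply: (le_integrable _ _ _ (integrable_scale (24 / a) measurableT i1)) => //.
  apply/measurable_EFinP; apply: measurable_funM => //.
  under eq_fun do rewrite -normfV.
  by apply: measurableT_comp => //; exact: measurable_csch.
move=> s _ /=; rewrite lee_fin; apply: le_trans (ler_norm _).
rewrite ger0_norm ?divr_ge0//.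
case: (eqVneq s 0) => [->|s0].
  rewrite normr0 mul0r; apply: mulr_ge0; first by rewrite divr_ge0// ltW.
  by rewrite invr_ge0 addr_ge0 ?sqr_ge0.
have h : `|a * s| * (1 + (a * s) ^+ 2) / 24 <= `|rsinh (a * s)|.
  have := rsinh_sqr_ge (a * s); rewrite -[X in _ <= X]real_normK ?num_real//.
  by rewrite ler_pXn2r ?nnegrE// divr_ge0// mulr_ge0// addr_ge0 ?sqr_ge0.
have D0 : 0 < 1 + (a * s) ^+ 2 by rewrite ltr_pwDl ?sqr_ge0.
have r0 : 0 < `|rsinh (a * s)| by rewrite normr_gt0 rsinh_eq0 mulf_neq0// gt_eqF.
rewrite ler_pdivrMr// mulrAC ler_pdivlMr//.
apply: le_trans (_ : 24 / a * (`|a * s| * (1 + (a * s) ^+ 2) / 24) <= _).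
  rewrite normrM (gtr0_norm a0) le_eqVlt; apply/orP; left; apply/eqP; field.
  by rewrite gt_eqF.
by rewrite ler_wpM2l// divr_ge0// ltW.
Qed.

Definition rho (omega : R) : R := if omega == 0 then d^-1 else omega / tanh (d * omega).

Lemma rho_le omega : `|rho omega| <= d^-1 + `|omega|.
Proof.
rewrite /rho; case: eqVneq => [->|om0]; first by rewrite normr0 addr0 ger0_norm// invr_ge0 ltW.
rewrite normrM normfV.
have -> : `|tanh (d * omega)| = tanh (d * `|omega|).
  have [h|h] := ger0P omega.
    case: (eqVneq omega 0) om0 => // om0 _.
    by rewrite gtr0_norm// tanh_gt0// mulr_gt0// lt_neqAle eq_sym om0.
  by rewrite mulrN tanhN ltr0_norm// -[d * omega]opprK tanhN oppr_lt0 tanh_gt0// -mulrN mulr_gt0// oppr_gt0.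
have om : 0 < `|omega| by rewrite normr_gt0.
have t0 : 0 < tanh (d * `|omega|) by rewrite tanh_gt0// mulr_gt0.
have := tanh_ge (mulr_ge0 (ltW d0) (ltW om)).
rewrite ler_pdivrMr// => h.
rewrite -(ler_pM2l d0); apply: le_trans h _.
by rewrite le_eqVlt; apply/orP; left; apply/eqP; field; rewrite gt_eqF.
Qed.

Lemma continuous_rho : continuous rho.
Proof.
have dt (om : R) : is_derive om 1 (fun om => tanh (d * om)) (rcosh (d * om) ^- 2 * d).
  by apply: is_derive_scale; exact: is_derive_tanh.
(* The reciprocal h is [tanh (d w) / w] completed by its derivative at 0; it has no zero, so its
   continuity passes to [rho]. *)
move=> om; pose h (w : R) := if w == 0 then d else tanh (d * w) / w.
have rhoE : rho = fun w => (h w)^-1.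
  apply/funext => w; rewrite /rho /h; case: eqVneq => // w0.
  by rewrite (invf_div (tanh (d * w)) w).
have hne (w : R) : h w != 0.
  rewrite /h; case: (eqVneq w 0) => [_|w0]; first exact: lt0r_neq0.
  by rewrite mulf_neq0 ?invr_eq0// tanh_neq0// mulf_neq0// gt_eqF.
rewrite rhoE; apply: cvgV; first exact: hne.
case: (eqVneq om 0) => [->|om0].
  have /is_derive1P H := dt 0.
  apply/cvgrPdist_le => e e0; have [r r0 Hr] := H e e0.
  apply/nbhs_ballP; exists r => // w /=; rewrite /ball/= sub0r normrN => hw.
  rewrite /h eqxx; case: eqVneq => [_|w0]; first by rewrite subrr normr0 ltW.
  have := Hr w; rewrite subr0 => /(_ hw); rewrite mulr0 tanh0 subr0.
  have -> : rcosh 0 = 1 :> R by rewrite /rcosh oppr0 expR0; field.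
  rewrite expr1n invr1 mul1r => k.
  have -> : d - tanh (d * w) / w = - ((tanh (d * w) - d * w) / w) by field.
  by rewrite normrN normrM normfV ler_pdivrMr ?normr_gt0.
have c1 : {for om, continuous (fun w => tanh (d * w) / w)}.
  apply: cvgM; last exact: cvgV.
  exact: is_derive_continuous (dt om).
have E : \forall w \near om, tanh (d * w) / w = h w.
  have : \forall w \near om, w != 0.
    apply/nbhs_ballP; exists `|om|; first by rewrite /= normr_gt0.
    by move=> w; rewrite /ball/= => hw; apply: contraTneq hw => ->; rewrite subr0 ltxx.
  by apply: filterS => w w0; rewrite /h (negbTE w0).
rewrite (_ : h om = tanh (d * om) / om); last by rewrite /h (negbTE om0).
exact: cvg_trans (near_eq_cvg E) c1.
Qed.

Variables (u : R -> R) (K : R).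
Hypotheses (cu : continuous u) (uN : forall x, u (- x) = u x).
Hypothesis iu : mu.-integrable setT (EFin \o u).
Hypothesis decay : forall omega,
  (1 + `|omega|) * `|cosT u omega| <= K * (1 + (1 * omega) ^+ 2)^-1.

Let U := cosT u.
Let cU : continuous U := continuous_cosT iu.

Lemma cosT_even (g : R -> R) omega : cosT g (- omega) = cosT g omega.
Proof. by apply: eq_Rintegral => x _; rewrite mulNr cosN. Qed.

Let icauchy : mu.-integrable setT (EFin \o (fun x => (1 + (1 * x) ^+ 2)^-1)).
Proof. by have [] := integrable_oneDsqr (@ltr01 R). Qed.

Lemma integrable_decay (f : R -> R) (k : R) : measurable_fun setT f ->
  (forall omega, `|f omega| <= k * ((1 + `|omega|) * `|U omega|)) -> 0 <= k ->
  mu.-integrable setT (EFin \o f).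
Proof.
move=> mf fk k0.
apply: (le_integrable _ _ _ (integrable_scale (k * K) measurableT icauchy)) => //.
  exact/measurable_EFinP.
move=> omega _; rewrite lee_fin; apply: le_trans (ler_norm _).
apply: le_trans (fk omega) _; rewrite -mulrA; exact: ler_wpM2l.
Qed.

Lemma integrable_cosT_decay : mu.-integrable setT (EFin \o U).
Proof.
apply: (@integrable_decay _ 1) => //; first exact: continuous_measurable_fun.
by move=> omega; rewrite mul1r ler_peMl// lerDl.
Qed.

(* The transform [nu_hat] off [0], with its singularity at [0] removed. *)
Definition chat omega := rho omega * cosT u omega / pi.

Lemma continuous_chat : continuous chat.
Proof.
move=> omega; apply: cvgMl; apply: cvgM; [exact: continuous_rho|exact: cU].
Qed.

Let mchat : measurable_fun setT chat.
Proof. by apply: continuous_measurable_fun; exact: continuous_chat. Qed.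

Lemma integrable_chat : mu.-integrable setT (EFin \o chat).
Proof.
have p0 := pi_gt0 R.
apply: (@integrable_decay _ ((d^-1 + 1) / pi)) => //; last first.
  by rewrite divr_ge0 ?(ltW p0)// addr_ge0// invr_ge0 ltW.
move=> omega; rewrite /chat normrM (normrM (rho _)) normfV (gtr0_norm p0).
rewrite [leRHS]mulrAC ler_pM2r ?invr_gt0// mulrA ler_wpM2r//.
apply: le_trans (rho_le omega) _.
have i0 : 0 <= d^-1 by rewrite invr_ge0 ltW.
have := normr_ge0 omega; set t := `|omega| => t0.
by rewrite mulrDr mulr1 mulrDl mul1r; have := mulr_ge0 i0 t0; lra.
Qed.

(** The inverse Fourier transform of [chat], which is even. *)
Definition charge x := cosT chat x / (2 * pi).

Lemma continuous_charge : continuous charge.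
Proof. by move=> x; apply: cvgMl; exact: (continuous_cosT integrable_chat). Qed.

Lemma charge_even x : charge (- x) = charge x.
Proof. by rewrite /charge cosT_even. Qed.

(** The total mass should be [chat 0], and [rho 0 = d^-1] makes it the integral of u over [pi * d].
    Nonnegativity lets [cosT_mass_le] bound truncated masses before the charge is known to be
    integrable. *)
Lemma charge_mass X : (forall t, 0 <= charge t) ->
  \int[mu]_(t in `[- X, X]) charge t <= (\int[mu]_x u x) / (pi * d).
Proof.
move=> c0; have p0 := pi_gt0 R.
have p2 : 0 < 2 * pi :> R by rewrite mulr_gt0.
have T0 t : 0 <= cosT chat t.
  by have := c0 t; rewrite /charge pmulr_lge0 ?invr_gt0.
have := cosT_mass_le X integrable_chat (@continuous_chat 0) T0.
have iT : mu.-integrable `[- X, X] (EFin \o cosT chat).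
  by apply: continuous_integrable => x _; exact: (continuous_cosT integrable_chat).
move=> h; rewrite (@eq_Rintegral _ _ R mu _ (fun t => (2 * pi)^-1 * cosT chat t)); last first.
  by move=> x _; rewrite mulrC.
rewrite RintegralZl//; rewrite ler_pdivrMl//; apply: le_trans h _.
rewrite /chat /rho eqxx /cosT ler_wpM2l ?(ltW p2)//.
under eq_Rintegral do rewrite mul0r cos0 mulr1.
by rewrite invfM [d^-1 * _]mulrC -mulrA [d^-1 / pi]mulrC.
Qed.

(* Odd in [s]; for [0 <= s] it is the charge of [[x - s, x + s]]. *)
Definition window x s := (\int[mu]_omega (chat omega * cos (omega * x) * (sin (omega * s) / omega))) / pi.

Lemma measurable_cos_mul x : measurable_fun setT (fun omega : R => cos (omega * x)).
Proof. by under eq_fun do rewrite mulrC; exact: measurable_cos_scale. Qed.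

Let msin x : measurable_fun setT (fun omega : R => sin (omega * x)).
Proof.
apply: continuous_measurable_fun; under eq_fun do rewrite mulrC.
by apply: continuous_scale; exact: continuous_sin.
Qed.

Lemma measurable_window x s : measurable_fun setT
  (fun omega => chat omega * cos (omega * x) * (sin (omega * s) / omega)).
Proof.
exact: measurable_funM (measurable_funM mchat (measurable_cos_mul x)) (measurable_funM (msin s) minv).
Qed.

Lemma integrable_window x s : mu.-integrable setT
  (EFin \o (fun omega => chat omega * cos (omega * x) * (sin (omega * s) / omega))).
Proof.
apply: (le_integrable _ _ _ (integrable_scale `|s| measurableT (integrable_abse integrable_chat))) => //.
  by apply/measurable_EFinP; exact: measurable_window.
move=> omega _ /=; rewrite lee_fin normrM (normrM (chat _)) [leRHS]ger0_norm; last by rewrite mulr_ge0.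
rewrite mulrC; apply: ler_pM; rewrite ?mulr_ge0//; first exact: norm_sin_div_le.
by rewrite ler_piMr// cos_max.
Qed.

(** Integrating [cos (t * omega)] over the window gives [2 cos (omega x) sin (omega s) / omega];
    Fubini is immediate because [chat] is integrable and the window is bounded. *)
Lemma windowE x s : 0 <= s -> \int[mu]_(t in `[x - s, x + s]) charge t = window x s.
Proof.
move=> s0; have p0 := pi_gt0 R.
have xs : x - s <= x + s by lra.
pose D := [set` `[x - s, x + s]%R] : set R.
have mD : measurable D by rewrite /D; exact: measurable_itv.
pose F (t omega : R) := \1_D t * (chat omega * cos (t * omega)).
have mI : measurable_fun setT (\1_D : R -> R) by exact: measurable_indic.
have mF : measurable_fun setT (fun p : R * R => F p.1 p.2).
  apply: measurable_funM; first exact: (measurableT_comp mI measurable_fst).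
  apply: measurable_funM; first exact: (measurableT_comp mchat measurable_snd).
  apply: (@measurableT_comp _ _ _ _ _ _ (@cos R) _ (fun p : R * R => p.1 * p.2)) => //.
    by apply: continuous_measurable_fun; exact: continuous_cos.
  by apply: measurable_funM; [exact: measurable_fst|exact: measurable_snd].
have F1 t : mu.-integrable setT (EFin \o F t).
  apply: integrable_scale => //; exact: integrable_cosT integrable_chat.
have cc omega : continuous (fun t : R => chat omega * cos (t * omega)).
  move=> t; apply: cvgMr; under eq_fun do rewrite mulrC; rewrite mulrC.
  by apply: continuous_scale; exact: continuous_cos.
have F2 omega : mu.-integrable setT (EFin \o F^~ omega).
  by apply: integrable_indicM => //; apply: continuous_integrable => t _; exact: cc.
have iG : mu.-integrable setT (EFin \o (fun omega => (2 * s) * `|chat omega|)).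
  by apply: integrable_scale => //; exact: integrable_abse integrable_chat.
have [|i1 i2 i3] := @Rintegral_fubini R F _ mF F1 F2 iG.
  move=> omega.
  rewrite (@eq_Rintegral _ _ R mu _ (fun t => \1_D t * `|chat omega * cos (t * omega)|)); last first.
    by move=> t _; rewrite /F normrM ger0_norm// indicE; case: (_ \in _).
  rewrite Rintegral_indicM; apply: le_trans (_ : \int[mu]_(t in D) `|chat omega| <= _).
    apply: le_Rintegral => //.
    - apply: integrable_abse (_ : mu.-integrable D (EFin \o (fun t => chat omega * cos (t * omega)))).
      by apply: continuous_integrable => t _; exact: cc.
    - by apply: continuous_integrable => t _; exact: cvg_cst.
    - by move=> t _; rewrite normrM ler_piMr// cos_max.
  rewrite Rintegral_cst_segment// mulrC; apply: ler_wpM2r => //; lra.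
have Fx t : \int[mu]_omega F t omega = \1_D t * (2 * pi * charge t).
  rewrite /F (RintegralZl _ measurableT (integrable_cosT t integrable_chat)).
  have p20 : 2 * pi != 0 :> R by rewrite mulf_neq0// gt_eqF.
  by rewrite /charge [2 * pi * _]mulrC (divfK p20).
have Fy omega : omega != 0 -> \int[mu]_t F t omega =
    2 * (chat omega * cos (omega * x) * (sin (omega * s) / omega)).
  move=> om0; rewrite /F Rintegral_indicM.
  have -> : \int[mu]_(t in D) (chat omega * cos (t * omega)) =
     chat omega * sin ((x + s) * omega) / omega - chat omega * sin ((x - s) * omega) / omega.
    apply: (@Rintegral_FTC R _ (fun t => chat omega * sin (t * omega) / omega)).
    - exact: xs.
    - by move=> t _; exact: cc.
    - by move=> t _; apply: is_derive_eq; rewrite /GRing.scale/=; field.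
  rewrite mulrDl mulrBl sinD sinB [x * omega]mulrC [s * omega]mulrC.
  by field.
have mG : measurable_fun setT (fun omega => 2 * (chat omega * cos (omega * x) * (sin (omega * s) / omega))).
  exact: measurable_funM (measurable_window x s).
rewrite (eq_Rintegral_except (integrable_measurable i2) mG Fy) in i3.
rewrite (RintegralZl _ measurableT (integrable_window x s)) in i3.
have ic : mu.-integrable D (EFin \o charge).
  by apply: continuous_integrable => t _; exact: continuous_charge.
have : \int[mu]_t (\int[mu]_omega F t omega) = 2 * pi * \int[mu]_(t in D) charge t.
  rewrite (@eq_Rintegral _ _ R mu _ (fun t => \1_D t * (2 * pi * charge t))); last by move=> t _; exact: Fx.
  by rewrite Rintegral_indicM RintegralZl.
rewrite i3 /window => h.
apply: (mulfI (_ : 2 * pi != 0)); first by rewrite mulf_neq0// gt_eqF.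
by rewrite -h -mulrA [pi * _]mulrC divfK// gt_eqF.
Qed.

End Charge.

(** * Potential and second difference formulas for the charge *)

Section ChargeIdentities.
Variable R : realType.
Local Notation mu := (@lebesgue_measure R).
Implicit Types (x y s : R).
Variable d : R.
Hypothesis d0 : 0 < d.
Let a := pi / (2 * d).
Let a0 : 0 < a. Proof. by rewrite divr_gt0 ?pi_gt0// mulr_gt0. Qed.
Variables (u : R -> R) (K : R).
Hypotheses (cu : continuous u) (uN : forall x, u (- x) = u x).
Hypothesis iu : mu.-integrable setT (EFin \o u).
Hypothesis decay : forall omega,
  (1 + `|omega|) * `|cosT u omega| <= K * (1 + (1 * omega) ^+ 2)^-1.
Local Notation chat := (chat d u).
Local Notation charge := (charge d u).
Local Notation window := (window d u).
Let ichat := integrable_chat d0 iu decay.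
Let mchat := integrable_measurable ichat.
Let iU : mu.-integrable setT (EFin \o cosT u) := integrable_cosT_decay iu decay.

Let inversion x : \int[mu]_omega (cosT u omega * cos (omega * x)) = 2 * pi * u x.
Proof. by apply: cos_inversion => //; exact: cu. Qed.

Lemma chatE omega : omega != 0 -> chat omega * (pi * tanh (d * omega)) = omega * cosT u omega.
Proof.
move=> om0; have t0 : tanh (d * omega) != 0.
  by rewrite tanh_neq0// mulf_neq0// gt_eqF.
rewrite /chat /rho (negbTE om0); set T := tanh _ in t0 *; set U := cosT _ _.
by rewrite mulrA divfK ?gt_eqF ?pi_gt0// mulrAC divfK.
Qed.

(* The logarithmic potential of the charge, integrated by parts, is u. *)
Lemma integral_window x :
  mu.-integrable setT (EFin \o (fun s => window x s / rsinh (a * s))) /\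
  \int[mu]_s (window x s / rsinh (a * s)) = 2 * u x / a.
Proof.
have p0 := pi_gt0 R.
pose F (s omega : R) := (rsinh (a * s))^-1 * (chat omega * cos (omega * x) * (sin (omega * s) / omega)).
have msinc : measurable_fun setT (fun p : R * R => sin (p.2 * p.1) / p.2).
  apply: measurable_funM.
    apply: (@measurableT_comp _ _ _ _ _ _ (@sin R) _ (fun p : R * R => p.2 * p.1)) => //.
      by apply: continuous_measurable_fun; exact: continuous_sin.
    by apply: measurable_funM; [exact: measurable_snd|exact: measurable_fst].
  have minv : measurable_fun setT (fun s : R => s^-1).
    by apply: (@measurable_cont_except _ _ 0) => s s0; exact: cvgV.
  exact: (measurableT_comp minv measurable_snd).
have mcc : measurable_fun setT (fun omega => chat omega * cos (omega * x)).
  exact: measurable_funM mchat (measurable_cos_mul x).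
have mF : measurable_fun setT (fun p : R * R => F p.1 p.2).
  apply: measurable_funM; first exact: (measurableT_comp (measurable_csch d0) measurable_fst).
  by apply: measurable_funM msinc; exact: (measurableT_comp mcc measurable_snd).
have F1 s : mu.-integrable setT (EFin \o F s).
  by apply: integrable_scale => //; exact: (integrable_window d0 iu decay).
have FE s omega : F s omega = (chat omega * cos (omega * x) / omega) * (sin (omega * s) / rsinh (a * s)).
  by rewrite /F; ring.
have F2 omega : mu.-integrable setT (EFin \o F^~ omega).
  have [i1 _] := integral_sin_csch d0 omega.
  have := integrable_scale (chat omega * cos (omega * x) / omega) measurableT i1.
  by congr (mu.-integrable _ _); apply/funext => s /=; rewrite FE.
(* Fubini is justified by [|sin (omega s) / omega| <= |s|]: the factor [|s|] absorbs the pole of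
   [1 / sinh] at 0. *)
pose k := \int[mu]_s (`|s| / `|rsinh (a * s)|).
have ik := integrable_id_csch d0.
have iG : mu.-integrable setT (EFin \o (fun omega => k * `|chat omega|)).
  by apply: integrable_scale => //; exact: integrable_abse ichat.
have [|i1 i2 i3] := @Rintegral_fubini R F _ mF F1 F2 iG.
  move=> omega; rewrite mulrC /k -RintegralZl//.
  apply: le_Rintegral => //.
  - exact: integrable_abse (F2 omega).
  - exact: integrable_scale.
  - move=> s _; rewrite /F normrM mulrC normrM (normrM (chat _)) normfV mulrA.
    rewrite ler_wpM2r ?invr_ge0//; apply: ler_pM; rewrite ?mulr_ge0//.
      by rewrite ler_piMr// cos_max.
    exact: norm_sin_div_le.
have Fs s : \int[mu]_omega F s omega = pi * (window x s / rsinh (a * s)).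
  rewrite /F (RintegralZl _ measurableT (integrable_window d0 iu decay x s)).
  by rewrite /window mulrA [RHS]mulrC [pi * _]mulrC divfK ?gt_eqF.
have Fo omega : omega != 0 -> \int[mu]_s F s omega = a^-1 * (cosT u omega * cos (omega * x)).
  move=> om0; have [j1 J1] := integral_sin_csch d0 omega.
  rewrite (@eq_Rintegral _ _ R mu _ (fun s => (chat omega * cos (omega * x) / omega) * (sin (omega * s) / rsinh (a * s)))); last first.
    by move=> s _; exact: FE.
  rewrite (RintegralZl _ measurableT j1) J1 -/a.
  have -> : chat omega * cos (omega * x) / omega * (pi / a * tanh (d * omega)) =
    chat omega * (pi * tanh (d * omega)) * (cos (omega * x) / omega / a) by ring.
  rewrite (chatE om0); set U := cosT _ _; set c := cos _.
  rewrite (_ : _ * _ = omega / omega * (a^-1 * (U * c))); last by ring.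
  by rewrite (mulfV om0) mul1r.
have mc : measurable_fun setT (fun omega => cosT u omega * cos (omega * x)).
  exact: measurable_funM (integrable_measurable iU) (measurable_cos_mul x).
have ic : mu.-integrable setT (EFin \o (fun omega => cosT u omega * cos (omega * x))).
  have := @integrable_boundM R (fun w => cos (w * x)) _ 1 (measurable_cos_mul x)
    (fun w => cos_max _) iU.
  by congr (mu.-integrable _ _); apply/funext => w /=; rewrite mulrC.
have E : \int[mu]_omega (\int[mu]_s F s omega) = a^-1 * (2 * pi * u x).
  rewrite (eq_Rintegral_except (integrable_measurable i2) _ Fo); last exact: measurable_funM.
  by rewrite (RintegralZl _ measurableT ic) inversion.
have iw : mu.-integrable setT (EFin \o (fun s => window x s / rsinh (a * s))).
  have := integrable_scale pi^-1 measurableT i1.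
  congr (mu.-integrable _ _); apply/funext => s /=; congr EFin.
  by rewrite Fs (mulKf (lt0r_neq0 p0)).
split; first exact: iw.
rewrite E (@eq_Rintegral _ _ R mu _ (fun s => pi * (window x s / rsinh (a * s)))) in i3; last first.
  by move=> s _; exact: Fs.
rewrite (RintegralZl _ measurableT iw) in i3.
apply: (mulfI (lt0r_neq0 p0)); rewrite i3.
by set ux := u x; rewrite mulrC; ring.
Qed.

(** Superpose [integral_cos_csch2] over omega with the weight [cosT u omega * cos (omega * x)]: by
    inversion the factor [1 - cos (omega * s)] turns into a second difference of u, and [d * rho]
    into [pi * d] times the charge. *)
Lemma integral_second_difference x :
  mu.-integrable setT (EFin \o (fun s => (u x - (u (x + s) + u (x - s)) / 2) / rsinh (a * s) ^+ 2)) /\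
  pi * d * charge x = u x + a / 2 * \int[mu]_s ((u x - (u (x + s) + u (x - s)) / 2) / rsinh (a * s) ^+ 2).
Proof.
have p0 := pi_gt0 R.
have p20 : 2 * pi != 0 :> R by rewrite mulf_neq0// gt_eqF.
pose F (s omega : R) := (rsinh (a * s) ^+ 2)^-1 * (cosT u omega * cos (omega * x) * (1 - cos (omega * s))).
have mU := integrable_measurable iU.
have mcs2 : measurable_fun setT (fun s : R => (rsinh (a * s) ^+ 2)^-1).
  under eq_fun do rewrite -exprVn expr2.
  by apply: measurable_funM; exact: measurable_csch.
have mcc : measurable_fun setT (fun omega => cosT u omega * cos (omega * x)).
  exact: measurable_funM mU (measurable_cos_mul x).
have mF : measurable_fun setT (fun p : R * R => F p.1 p.2).
  apply: measurable_funM; first exact: (measurableT_comp mcs2 measurable_fst).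
  apply: measurable_funM; first exact: (measurableT_comp mcc measurable_snd).
  apply: measurable_funB => //.
  apply: (@measurableT_comp _ _ _ _ _ _ (@cos R) _ (fun p : R * R => p.2 * p.1)) => //.
    by apply: continuous_measurable_fun; exact: continuous_cos.
  by apply: measurable_funM; [exact: measurable_snd|exact: measurable_fst].
have icos y : mu.-integrable setT (EFin \o (fun omega => cosT u omega * cos (omega * y))).
  have := @integrable_boundM R (fun w => cos (w * y)) _ 1 (measurable_cos_mul y)
    (fun w => cos_max _) iU.
  by congr (mu.-integrable _ _); apply/funext => w /=; rewrite mulrC.
have cosE omega s : cosT u omega * cos (omega * x) * (1 - cos (omega * s)) =
    1 * (cosT u omega * cos (omega * x)) + - 2^-1 * (cosT u omega * cos (omega * (x + s)) + cosT u omega * cos (omega * (x - s))).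
  by rewrite (mulrDr omega) (mulrBr omega) cosD cosB; field.
have Fs s : mu.-integrable setT (EFin \o F s) /\
    \int[mu]_omega F s omega = 2 * pi * ((u x - (u (x + s) + u (x - s)) / 2) / rsinh (a * s) ^+ 2).
  have isum := integrable_addr measurableT (icos (x + s)) (icos (x - s)).
  have icc : mu.-integrable setT (EFin \o (fun omega => cosT u omega * cos (omega * x) * (1 - cos (omega * s)))).
    have := integrable_lin2 1 (- 2^-1) measurableT (icos x) isum.
    by congr (mu.-integrable _ _); apply/funext => w /=; rewrite cosE.
  split; first exact: integrable_scale.
  rewrite /F (RintegralZl _ measurableT icc).
  rewrite (@eq_Rintegral _ _ R mu _ (fun omega => 1 * (cosT u omega * cos (omega * x)) + - 2^-1 * (cosT u omega * cos (omega * (x + s)) + cosT u omega * cos (omega * (x - s))))); last first.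
    by move=> w _; exact: cosE.
  rewrite (Rintegral_lin2 _ _ measurableT (icos x) isum).
  rewrite (RintegralD measurableT (icos (x + s)) (icos (x - s))) !inversion.
  set A := u x; set B := u (x + s); set C := u (x - s); set r := _ ^+ 2.
  by move: r^-1 => k; field.
have F1 s := (Fs s).1.
have F0 s : F s 0 = 0 by rewrite /F !mul0r cos0 subrr !mulr0.
have FE s omega : F s omega = (cosT u omega * cos (omega * x)) * ((1 - cos (omega * s)) / rsinh (a * s) ^+ 2).
  by rewrite /F; ring.
have Fo omega : omega != 0 -> mu.-integrable setT (EFin \o F^~ omega) /\
    \int[mu]_s F s omega = (cosT u omega * cos (omega * x)) * (2 / a * (d * rho d omega - 1)).
  move=> om0; have [j1 J1] := integral_cos_csch2 d0 om0.
  split.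
    have := integrable_scale (cosT u omega * cos (omega * x)) measurableT j1.
    by congr (mu.-integrable _ _); apply/funext => s /=; rewrite FE.
  rewrite (@eq_Rintegral _ _ R mu _ (fun s => (cosT u omega * cos (omega * x)) * ((1 - cos (omega * s)) / rsinh (a * s) ^+ 2))); last first.
    by move=> s _; exact: FE.
  rewrite (RintegralZl _ measurableT j1) J1 /rho (negbTE om0) -/a.
  by rewrite mulrA.
have i0 : mu.-integrable setT (EFin \o (fun=> 0 : R)) by exact: integrable0.
have F2 omega : mu.-integrable setT (EFin \o F^~ omega).
  case: (eqVneq omega 0) => [->|om0]; last by have [] := Fo _ om0.
  by move: i0; congr (mu.-integrable _ _); apply/funext => s /=; rewrite F0.
have iG : mu.-integrable setT (EFin \o (fun omega => 2 / a * d * (`|omega| * `|cosT u omega|))).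
  apply: integrable_scale => //; apply: (integrable_decay decay (k := 1)) => //.
    apply: measurable_funM.
      by apply: continuous_measurable_fun; exact: norm_continuous.
    exact: integrable_measurable (integrable_abse iU).
  move=> omega; rewrite mul1r ger0_norm ?mulr_ge0//.
  by rewrite ler_wpM2r// lerDr.
have [|i1 i2 i3] := @Rintegral_fubini R F _ mF F1 F2 iG.
  move=> omega; case: (eqVneq omega 0) => [->|om0].
    rewrite (@eq_Rintegral _ _ R mu _ (fun s => 0 * 0)); last by move=> s _; rewrite F0 normr0 mulr0.
    by rewrite RintegralZl// mul0r normr0 mul0r mulr0.
  have [j1 J1] := integral_cos_csch2 d0 om0.
  rewrite (@eq_Rintegral _ _ R mu _ (fun s => `|cosT u omega * cos (omega * x)| * ((1 - cos (omega * s)) / rsinh (a * s) ^+ 2))); last first.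
    move=> s _; rewrite FE normrM; congr (_ * _).
    have c1 : cos (omega * s) <= 1 := le_trans (ler_norm _) (cos_max _).
    by apply: ger0_norm; apply: divr_ge0; [rewrite subr_ge0|exact: sqr_ge0].
  rewrite (RintegralZl _ measurableT j1) J1 -/a normrM.
  have rE : omega / tanh (d * omega) = rho d omega by rewrite /rho (negbTE om0).
  have r1 : d * omega / tanh (d * omega) - 1 <= d * `|omega|.
    rewrite -mulrA rE lerBlDr -[X in _ <= _ + X](mulfV (lt0r_neq0 d0)) -mulrDr ler_pM2l// addrC.
    by apply: le_trans (rho_le d0 omega); exact: ler_norm.
  have r2 : 0 <= 2 / a by rewrite divr_ge0// ltW.
  apply: le_trans (_ : `|cosT u omega| * (2 / a * (d * `|omega|)) <= _); last first.
    by rewrite le_eqVlt; apply/orP; left; apply/eqP; ring.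
  apply: le_trans (_ : `|cosT u omega| * `|cos (omega * x)| * (2 / a * (d * `|omega|)) <= _).
    by apply: ler_wpM2l; [rewrite mulr_ge0|exact: ler_wpM2l].
  apply: ler_wpM2r; first by rewrite mulr_ge0// mulr_ge0// ltW.
  by rewrite ler_piMr// cos_max.
have i4 : mu.-integrable setT (EFin \o (fun omega => chat omega * cos (omega * x))).
  have := @integrable_boundM R (fun w => cos (w * x)) _ 1 (measurable_cos_mul x)
    (fun w => cos_max _) ichat.
  by congr (mu.-integrable _ _); apply/funext => w /=; rewrite mulrC.
have Fo2 omega : omega != 0 -> \int[mu]_s F s omega =
    (2 / a * d * pi) * (chat omega * cos (omega * x)) + - (2 / a) * (cosT u omega * cos (omega * x)).
  move=> om0; rewrite (Fo _ om0).2 /chat.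
  have : chat omega = rho d omega * cosT u omega / pi by [].
  rewrite /chat => _; set r := rho d omega; set U := cosT u omega.
  have -> : 2 / a * d * pi * (r * U / pi * cos (omega * x)) = 2 / a * d * (r * U * cos (omega * x)) * (pi / pi).
    by ring.
  by rewrite (mulfV (lt0r_neq0 p0)) mulr1; ring.
have m4 : measurable_fun setT (fun omega => (2 / a * d * pi) * (chat omega * cos (omega * x)) + - (2 / a) * (cosT u omega * cos (omega * x))).
  exact: integrable_measurable (integrable_lin2 _ _ measurableT i4 (icos x)).
rewrite (eq_Rintegral_except (integrable_measurable i2) m4 Fo2) in i3.
rewrite (Rintegral_lin2 _ _ measurableT i4 (icos x)) inversion in i3.
have iw : mu.-integrable setT (EFin \o (fun s => (u x - (u (x + s) + u (x - s)) / 2) / rsinh (a * s) ^+ 2)).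
  have := integrable_scale (2 * pi)^-1 measurableT i1.
  congr (mu.-integrable _ _); apply/funext => s /=; congr EFin.
  by rewrite (Fs s).2 (mulKf p20).
split; first exact: iw.
rewrite (@eq_Rintegral _ _ R mu _ (fun s => 2 * pi * ((u x - (u (x + s) + u (x - s)) / 2) / rsinh (a * s) ^+ 2))) in i3; last first.
  by move=> s _; exact: (Fs s).2.
rewrite (RintegralZl _ measurableT iw) in i3.
have cE : \int[mu]_omega (chat omega * cos (omega * x)) = 2 * pi * charge x.
  rewrite /charge [2 * pi * _]mulrC divfK; last by rewrite mulf_neq0// gt_eqF.
  by apply: eq_Rintegral => w _; rewrite [x * w]mulrC.
rewrite cE in i3; move: i3.
set c := charge x; set I := \int[mu]_s _; set A := u x => i3.
have a20 : 2 / a != 0 by rewrite mulf_neq0// invr_neq0// gt_eqF.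
apply: (mulfI p20); apply: (mulfI a20).
have -> : 2 / a * (2 * pi * (A + a / 2 * I)) = 2 * pi * (2 / a * A) + a / a * (2 * pi * I) by field; exact: lt0r_neq0.
rewrite i3 mulfV ?gt_eqF// mul1r; ring.
Qed.

End ChargeIdentities.

(** * Primitives and the sign of the density *)

Section Primitive.
Variable R : realType.
Local Notation mu := (@lebesgue_measure R).
Implicit Types (f : R -> R) (x y : R).

Lemma primitive0_sub f x y : continuous f -> x <= y ->
  primitive0 f y - primitive0 f x = \int[mu]_(t in `[x, y]) f t.
Proof.
move=> cf xy; have ci z t : mu.-integrable `[z, t] (EFin \o f).
  by apply: continuous_integrable => s _; exact: cf.
rewrite /primitive0; case: (leP 0 x) => x0.
  rewrite (le_trans x0 xy) (@Rintegral_cat _ f 0 y x)//.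
  by rewrite addrAC subrr add0r.
case: (leP 0 y) => y0; first by rewrite opprK addrC -Rintegral_cat// ltW.
rewrite opprK addrC (@Rintegral_cat _ f x 0 y)//; last exact: ltW.
by rewrite addrK.
Qed.

(** The procedure gives the sign of the density through the monotonicity of its primitive: a
    negative value would make the primitive decrease on a neighbouring interval, taken to the left
    of x when x is the right endpoint. *)
Lemma increasing_primitive0_ge0 f (b : R) : 0 < b -> continuous f ->
  {in `[- b, b] &, {homo primitive0 f : x y / x < y}} ->
  forall x, `|x| <= b -> 0 <= f x.
Proof.
move=> b0 cf inc x; rewrite ler_norml => /andP[x1 x2]; rewrite leNgt; apply/negP => fx.
have e0 : 0 < - f x / 2 by rewrite divr_gt0// oppr_gt0.
have /cvgrPdist_le/(_ _ e0)/nbhs_ballP[r /= r0 Hr] := cf x.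
have neg y z : - b <= y -> y < z -> z <= b -> (forall t, y <= t <= z -> `|x - t| < r) -> False.
  move=> y1 yz z1 near_x.
  have : primitive0 f y < primitive0 f z.
    by apply: inc => //; rewrite in_itv/=; apply/andP; split => //;
      [exact: le_trans (ltW yz) z1|exact: le_trans y1 (ltW yz)].
  rewrite -subr_gt0 primitive0_sub ?(ltW yz)// ltNge => /negP; apply.
  have ci : mu.-integrable `[y, z] (EFin \o f).
    by apply: continuous_integrable => s _; exact: cf.
  apply: le_trans (_ : \int[mu]_(t in `[y, z]) (f x / 2) <= _).
    apply: le_Rintegral => //.
      by apply: continuous_integrable => s _; exact: cvg_cst.
    move=> t; rewrite /= in_itv/= => /near_x/Hr; rewrite ler_norml => /andP[h _].
    lra.
  rewrite Rintegral_cst_segment ?(ltW yz)// mulr_le0_ge0//; last by rewrite subr_ge0 ltW.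
  by rewrite ler_pdivrMr// mul0r ltW.
case: (ltP x b) => [xb|bx].
  pose z := Num.min b (x + r / 2).
  have zb : z <= b by rewrite ge_min lexx.
  have zx : z <= x + r / 2 by rewrite ge_min lexx orbT.
  have xz : x < z by rewrite lt_min xb ltrDl divr_gt0.
  apply: (neg x z) => // t /andP[t1 t2].
  by rewrite distrC ger0_norm ?subr_ge0//; lra.
pose z := Num.max (- b) (x - r / 2).
have zb : - b <= z by rewrite le_max lexx.
have zx : x - r / 2 <= z by rewrite le_max lexx orbT.
have xz : z < x.
  rewrite gt_max; apply/andP; split; last by rewrite ltrBlDr ltrDl divr_gt0.
  by apply: lt_le_trans bx; rewrite -subr_gt0 opprK addr_gt0.
apply: (neg z x) => // t /andP[t1 t2].
by rewrite ger0_norm ?subr_ge0//; lra.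
Qed.

Lemma primitive0_even_half f x : continuous f -> (forall x, f (- x) = f x) -> 0 <= x ->
  [/\ \int[mu]_(t in `[0, x]) f t = (\int[mu]_(t in `[- x, x]) f t) / 2,
      primitive0 f x = (\int[mu]_(t in `[- x, x]) f t) / 2
    & primitive0 f (- x) = - ((\int[mu]_(t in `[- x, x]) f t) / 2)].
Proof.
move=> cf ef x0; have ci z t : mu.-integrable `[z, t] (EFin \o f).
  by apply: continuous_integrable => s _; exact: cf.
have nx : - x <= 0 by rewrite oppr_le0.
have E : \int[mu]_(t in `[- x, 0]) f t = \int[mu]_(t in `[0, x]) f t.
  rewrite /Rintegral; congr fine.
  have := @integration_by_substitution_oppr R f 0 x x0; rewrite oppr0 => ->.
    by apply: eq_integral => t _ /=; rewrite ef.
  exact: continuous_subspaceT.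
have H : \int[mu]_(t in `[0, x]) f t = (\int[mu]_(t in `[- x, x]) f t) / 2.
  rewrite (@Rintegral_cat _ f (- x) x 0)// E; set I := Rintegral _ _ _.
  by field.
split => //; first by rewrite /primitive0 x0.
have P0 : primitive0 f 0 = 0.
  by rewrite /primitive0 lexx -(primitive0_sub cf (lexx 0)) subrr.
have := primitive0_sub cf nx; rewrite P0 sub0r E H => h.
by rewrite -h opprK.
Qed.

End Primitive.

(** * The charge beyond the interval of the nodes *)

Section Tail.
Variable R : realType.
Local Notation mu := (@lebesgue_measure R).
Implicit Types (x y s : R).
Variables (d al : R) (q q1 q2 q3 : R -> R).
Hypotheses (d0 : 0 < d) (al0 : 0 < al).
Hypothesis Dq : forall x, is_derive x 1 q (q1 x).
Hypothesis qN : forall x, q (- x) = q x.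
Hypothesis qt : forall x y, q x + q1 x * (y - x) <= q y.
Let a := pi / (2 * d).
Let a0 : 0 < a. Proof. by rewrite divr_gt0 ?pi_gt0// mulr_gt0. Qed.
Let B := q1 al / a.
Local Notation u := (pot d al q q1).

Let q10 : q1 0 = 0.
Proof. by have := even_derive_odd Dq qN 0; rewrite oppr0 => h; lra. Qed.

Let B0 : 0 <= B.
Proof. by rewrite divr_ge0 ?(ltW a0)// -q10 (tangent_mono qt)// ltW. Qed.

Let q1E : q1 al = a * B. Proof. by rewrite /B mulrC divfK// gt_eqF. Qed.

(** Equality holds on [[- al, al]]. Outside, q lies above its tangent at al and the exponential
    above its tangent at the same point; the two slopes cancel since [q1 al = a * B]. *)
Lemma pot_add_ge x : q al + B <= u x + q x.
Proof.
case: (leP `|x| al) => h; first by rewrite (potE_in d q1 qN h) -/a -/B; lra.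
have h' := ltW h.
rewrite (potE_out d q q1 h') -/a -/B.
have e1 := expR_ge1Dx (- (a * (`|x| - al))).
have e2 := qt al `|x|.
have q_norm : q `|x| = q x by case: (ger0P x) => // _; rewrite qN.
rewrite q_norm q1E in e2.
have := ler_wpM2l B0 e1; rewrite mulrDr mulr1 mulrN [B * (a * _)]mulrA [B * a]mulrC.
lra.
Qed.

Let E x := B * expR (- (a * (x - al))).
Let D x := E x - u x.

(** On [[- al, al]] E is at least B, so it decreases at rate at least [a * B], while u decreases at
    rate [q1], which is at most [q1 al = a * B]. To the left E decreases and u increases; to the
    right D is zero. This one fact yields both bounds on the outer charge. *)
Let D_mono x y : x <= y -> D y <= D x.
Proof.
have E_mono x' y' : x' <= y' -> E y' <= E x'.
  by move=> xy; rewrite ler_wpM2l// ler_expR lerN2 ler_wpM2l ?(ltW a0)// lerB.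
have Dout z : al <= z -> D z = 0.
  move=> az; have z0 : 0 <= z := le_trans (ltW al0) az.
  by rewrite /D potE_out ger0_norm// -/a -/B /E subrr.
have Dneg z : z <= - al -> D z = B * expR (- (a * (z - al))) - B * expR (a * (z + al)).
  move=> az; have z0 : z <= 0 by rewrite (le_trans az)// oppr_le0 ltW.
  have zn : `|z| = - z by rewrite ler0_norm.
  have za : al <= `|z| by rewrite zn lerNr.
  rewrite /D (potE_out d q q1 za) zn -/a -/B /E.
  by have -> : - (a * (- z - al)) = a * (z + al) by ring.
have Dmid z : `|z| <= al -> D z = E z - (q al - q z + B).
  by move=> h; rewrite /D (potE_in d q1 qN h).
have m1 x' y' : al <= x' -> x' <= y' -> D y' <= D x'.
  by move=> h1 h2; rewrite !Dout// (le_trans h1).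
have m3 x' y' : y' <= - al -> x' <= y' -> D y' <= D x'.
  move=> h1 h2; rewrite !Dneg ?(le_trans h2)//; apply: lerB; first exact: E_mono.
  by rewrite ler_wpM2l// ler_expR ler_wpM2l ?(ltW a0)// lerD2r.
have m2 x' y' : - al <= x' -> y' <= al -> x' <= y' -> D y' <= D x'.
  move=> h1 h2 h3.
  rewrite !Dmid; last 2 first.
  - by rewrite ler_norml h1 (le_trans h3).
  - by rewrite ler_norml h2 (le_trans h1).
  have t1 := qt y' x'.
  have t2 : q1 y' <= a * B by rewrite -q1E (tangent_mono qt).
  have t3 : a * B * (y' - x') <= E x' - E y'.
    have e1 := expR_ge1Dx (- (a * (x' - y'))).
    have Ey : B <= E y'.
      rewrite /E ler_peMr// -expR0 ler_expR -mulrN mulr_ge0 ?(ltW a0)//.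
      by rewrite opprB subr_ge0.
    have Ex : E x' = E y' * expR (- (a * (x' - y'))).
      by rewrite /E -mulrA -expRD; congr (_ * expR _); ring.
    have Ey0 : 0 <= E y' := le_trans B0 Ey.
    have := ler_wpM2l Ey0 e1; rewrite -Ex => h.
    have : a * B * (y' - x') <= a * E y' * (y' - x').
      by rewrite ler_wpM2r ?subr_ge0// ler_wpM2l// ltW.
    lra.
  have : q1 y' * (y' - x') <= a * B * (y' - x') by rewrite ler_wpM2r// subr_ge0.
  lra.
move=> xy.
case: (leP al x) => ax; first exact: m1.
case: (leP y (- al)) => ya; first exact: m3.
(* Clamping both points to [[- al, al]] breaks the comparison into the three ranges already
   treated. *)
pose x' := Num.max x (- al); pose y' := Num.min y al.
have aal : - al <= al by rewrite lerNl (le_trans _ (ltW al0))// oppr_le0 ltW.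
have xx' : x <= x' by rewrite le_max lexx.
have yy' : y' <= y by rewrite ge_min lexx.
have x'y' : x' <= y'.
  rewrite ge_max !le_min xy (ltW ax) (ltW ya) aal//.
apply: le_trans (_ : D y' <= _).
  case: (leP y al) => h; first by rewrite /y' min_l.
  by rewrite /y' min_r ?(ltW h)// m1// ltW.
apply: le_trans (_ : D x' <= _).
  by apply: m2 => //; rewrite /x' /y' ?le_max ?ge_min ?lexx ?orbT.
case: (leP x (- al)) => h; first by rewrite /x' max_r// m3.
by rewrite /x' max_l// ltW.
Qed.

Let D_ge0 x : 0 <= D x.
Proof.
have D0 : D (Num.max x al) = 0.
  have h : al <= Num.max x al by rewrite le_max lexx orbT.
  have z0 : 0 <= Num.max x al := le_trans (ltW al0) h.
  by rewrite /D potE_out ger0_norm// -/a -/B /E subrr.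
by rewrite -D0; apply: D_mono; rewrite le_max lexx.
Qed.

Lemma rcosh_double x : rcosh x + 1 = 2 * rcosh (x / 2) ^+ 2.
Proof.
rewrite {1}(_ : x = x / 2 + x / 2); last by field.
rewrite /rcosh opprD !expRD; have := expRN (x / 2) => e.
have : expR (x / 2) * expR (- (x / 2)) = 1 by rewrite -expRD subrr expR0.
by move: (expR _) (expR _) => X Y XY; field: XY.
Qed.

(** [1 / (cosh + 1)] is [(cosh - 1) / sinh ^ 2], up to sign the second difference integrand of an
    exponential of rate a. *)
Lemma integral_rcosh_add1 :
  mu.-integrable setT (EFin \o (fun s => (rcosh (a * s) + 1)^-1)) /\
  \int[mu]_s (rcosh (a * s) + 1)^-1 = 2 / a.
Proof.
have c0 s : 0 < rcosh (a * s) + 1 by rewrite ltr_wpDl// ltW// rcosh_gt0.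
have a2 : 0 < a / 2 by rewrite divr_gt0.
have [||||||i1 i2] := @even_FTC R (fun s => (rcosh (a * s) + 1)^-1)
    (fun s => a^-1 * tanh (a / 2 * s)) (a^-1 * 1).
- by move=> s; rewrite invr_ge0 ltW.
- move=> s; apply: cvgV; first by rewrite gt_eqF.
  apply: cvgD; last exact: cvg_cst.
  by apply: continuous_scale; exact: continuous_rcosh.
- by move=> s; rewrite mulrN rcoshN.
- move=> s s0; have h : is_derive s 1 (fun s => tanh (a / 2 * s)) (rcosh (a / 2 * s) ^- 2 * (a / 2)).
    by apply: is_derive_scale; exact: is_derive_tanh.
  apply: is_derive_eq; rewrite /GRing.scale/= rcosh_double.
  have -> : a * s / 2 = a / 2 * s by ring.
  have := rcosh_gt0 (a / 2 * s); set r := rcosh _ => r0.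
  have an0 : a != 0 := lt0r_neq0 a0.
  by move: an0; move: a => b b0; field; rewrite b0 gt_eqF.
- apply: cvgr_at_right_continuous; apply: cvgMr.
  have h : is_derive (0 : R) 1 (fun s => tanh (a / 2 * s)) (rcosh (a / 2 * 0) ^- 2 * (a / 2)).
    by apply: is_derive_scale; exact: is_derive_tanh.
  exact: is_derive_continuous h.
- apply: cvgMr.
  exact: (cvg_comp (fun x => a / 2 * x) (@tanh R) (cvgryM a2) (@tanh_y R)).
by split => //; rewrite i2 mulr0 tanh0 mulr0 subr0 mulr1.
Qed.

Hypothesis (Dq1 : forall x, is_derive x 1 q1 (q2 x)).
Hypothesis Dq2 : forall x, is_derive x 1 q2 (q3 x).
Hypothesis cq3 : continuous q3.

Local Notation nu := (charge d u).

Lemma pot_decay : exists K, forall omega,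
  (1 + `|omega|) * `|cosT u omega| <= K * (1 + (1 * omega) ^+ 2)^-1.
Proof.
by have [K _ h] := cosT_pot_decay d0 al0 Dq Dq1 Dq2 cq3 qN qt; exists K.
Qed.

Let cu : continuous u. Proof. by move=> x; exact: (continuous_pot Dq). Qed.
Let iu := integrable_pot d0 al0 Dq qN qt.

Let cD : continuous D.
Proof.
move=> x; apply: cvgB; last exact: cu.
apply: cvgMr.
have h : {for x, continuous (fun x : R => - (a * (x - al)))}.
  by apply: cvgN; apply: cvgMr; apply: cvgB; [exact: cvg_id|exact: cvg_cst].
exact: (continuous_comp h (@continuous_expR R _)).
Qed.

(* Beyond [al] the function u agrees with the exponential E, whose contribution
   to the second difference formula vanishes; only D = E - u remains. *)
Lemma charge_tail x : al <= x ->
  mu.-integrable setT (EFin \o (fun s => (D (x + s) + D (x - s)) / rsinh (a * s) ^+ 2)) /\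
  pi * d * nu x = a / 4 * \int[mu]_s ((D (x + s) + D (x - s)) / rsinh (a * s) ^+ 2).
Proof.
move=> ax; have [K decay] := pot_decay.
have [i1 I1] := integral_second_difference d0 cu (pot_even d al q q1) iu decay x.
have [i2 I2] := integral_rcosh_add1.
have uE : u x = E x.
  have x0 : 0 <= x := le_trans (ltW al0) ax.
  by rewrite potE_out ger0_norm.
pose f1 s := (u x - (u (x + s) + u (x - s)) / 2) / rsinh (a * s) ^+ 2.
pose f2 s := (rcosh (a * s) + 1)^-1.
pose f3 s := (D (x + s) + D (x - s)) / rsinh (a * s) ^+ 2.
have m3 : measurable_fun setT f3.
  apply: measurable_funM.
    apply: continuous_measurable_fun => s; apply: cvgD.
      have h : {for s, continuous (fun s => x + s)} by apply: cvgD; [exact: cvg_cst|exact: cvg_id].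
      exact: (continuous_comp h (@cD _)).
    have h : {for s, continuous (fun s => x - s)} by apply: cvgB; [exact: cvg_cst|exact: cvg_id].
    exact: (continuous_comp h (@cD _)).
  under eq_fun do rewrite -exprVn expr2.
  by apply: measurable_funM; exact: measurable_csch.
(* As [E (x + s) + E (x - s) = 2 * E x * rcosh (a * s)], the exponential contributes [- E x * f2] to
   [f1]; multiplied by [a / 2] and integrated, this cancels the leading term [u x = E x]. *)
have f13 s : s != 0 -> f3 s = 2 * f1 s + (2 * E x) * f2 s.
  move=> s0.
  have r0 : rsinh (a * s) != 0 by rewrite rsinh_eq0 mulf_neq0// gt_eqF.
  have c0 : rcosh (a * s) + 1 != 0 by rewrite gt_eqF// ltr_wpDl// ltW// rcosh_gt0.
  have EE : E (x + s) + E (x - s) = 2 * E x * rcosh (a * s).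
    rewrite /E /rcosh.
    have -> : - (a * (x + s - al)) = - (a * (x - al)) + - (a * s) by ring.
    have -> : - (a * (x - s - al)) = - (a * (x - al)) + a * s by ring.
    by rewrite !expRD; field.
  have sh : rsinh (a * s) ^+ 2 = (rcosh (a * s) + 1) * (rcosh (a * s) - 1).
    by rewrite mulrDl mulrBr mulr1 mul1r -expr2 rcosh2; ring.
  have c1 : rcosh (a * s) - 1 != 0.
    by apply: contraNneq r0 => h; have := sh; rewrite h mulr0 => /eqP; rewrite sqrf_eq0.
  rewrite /f3 /f1 /f2 /D uE.
  have -> : E (x + s) - u (x + s) + (E (x - s) - u (x - s)) = E (x + s) + E (x - s) - (u (x + s) + u (x - s)) by ring.
  rewrite EE sh; move: c0 c1; move: (rcosh _) (E x) (u _) (u _) => c e v w c0 c1.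
  by field; rewrite c0 c1.
have i12 := integrable_lin2 2 (2 * E x) measurableT i1 i2.
have i3 : mu.-integrable setT (EFin \o f3).
  apply: (le_integrable _ _ _ i12) => //; first exact/measurable_EFinP.
  move=> s _ /=; rewrite lee_fin.
  case: (eqVneq s 0) => [->|s0]; last by rewrite f13.
  by rewrite /f3 mulr0 /rsinh oppr0 subrr mul0r expr0n/= invr0 mulr0 normr0.
split => //.
rewrite -/f3 (eq_Rintegral_except m3 (integrable_measurable i12) f13).
rewrite Rintegral_lin2// I2 I1 -/a uE.
set I := Rintegral _ _ _; have an0 : a != 0 := lt0r_neq0 a0.
by move: an0; move: a => b b0; field.
Qed.

(** In the formula of [charge_tail] the integrand is nonnegative and, for each s, nonincreasing in
    x, because D is both. *)
Lemma charge_tail_bounds x : al <= x -> 0 <= nu x <= nu al.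
Proof.
move=> ax; have [i1 I1] := charge_tail ax; have [i2 I2] := charge_tail (lexx al).
have pd : 0 < pi * d by rewrite mulr_gt0// pi_gt0.
have a4 : 0 < a / 4 by rewrite divr_gt0.
apply/andP; split.
  rewrite -(pmulr_rge0 _ pd) I1 pmulr_rge0//; apply: Rintegral_ge0 => // s _.
  by rewrite divr_ge0 ?sqr_ge0// addr_ge0// D_ge0.
rewrite -(ler_pM2l pd) I1 I2 (ler_pM2l a4).
apply: (le_Rintegral measurableT i1 i2) => s _.
rewrite ler_wpM2r ?invr_ge0 ?sqr_ge0//; apply: lerD; apply: D_mono.
  by rewrite lerD2r.
by rewrite lerD2r.
Qed.

Lemma charge_bounds M : {in `[- al, al] &, {homo primitive0 nu : x y / x < y}} ->
  (forall x, `|x| <= al -> `|nu x| <= M) -> forall x, 0 <= nu x <= M.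
Proof.
move=> inc nuM; have [K decay] := pot_decay.
have cnu : continuous nu := continuous_charge d0 iu decay.
have pos x : 0 <= x -> 0 <= nu x <= M.
  move=> x0; case: (leP x al) => xa.
    have xal : `|x| <= al by rewrite ger0_norm.
    rewrite (increasing_primitive0_ge0 al0 cnu inc)//=.
    by rewrite (le_trans (ler_norm _))// nuM.
  have /andP[-> /le_trans->//] := charge_tail_bounds (ltW xa).
  by rewrite (le_trans (ler_norm _))// nuM// ger0_norm// ltW.
move=> x; case: (ger0P x) => [/pos//|x0].
by rewrite -(charge_even d u x) pos// oppr_ge0 ltW.
Qed.

End Tail.

(** * Discretization of the charge *)

Section Discretization.
Variable R : realType.
Local Notation mu := (@lebesgue_measure R).
Implicit Types (x y s : R).

(** An open interval of length L contains at least [L - 1] integers. The bounds 0 and [n + 1] force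
    these among 1, ..., n; with total mass [2 (N + 1)] this is exactly the number [2 N + 1] of
    nodes. *)
Lemma count_integers (n : nat) (A B : R) : 0 <= A -> B <= n.+1%:R ->
  B - A <= 1 + \sum_(k < n) ((A < k.+1%:R < B)%R%:R : R).
Proof.
move=> A0; elim: n B => [|n IH] B Bn; first by rewrite big_ord0; lra.
pose S (z : R) : R := \sum_(k < n) (A < k.+1%:R < z)%R%:R.
rewrite big_ord_recr /=; case: (leP B n.+1%:R) => Bn1.
  by rewrite andbF addr0; exact: IH.
rewrite andbT; case: (ltP A n.+1%:R) => An /=.
  have h := IH _ (lexx _).
  suff : S n.+1%:R <= S B by move: Bn; rewrite -[n.+2]addn1 natrD /S; lra.
  apply: ler_sum => k _; rewrite ler_nat; case: (A < _) => //=.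
  by case: (ltP _ n.+1%:R) => // h1; rewrite (lt_trans h1 Bn1).
have : 0 <= S B by apply: sumr_ge0.
by move: Bn; rewrite -[n.+2]addn1 natrD /S; lra.
Qed.

Lemma integrable_sum_fun (n : nat) (f : 'I_n -> R -> R) (D : set R) : measurable D ->
  (forall i, mu.-integrable D (EFin \o f i)) ->
  mu.-integrable D (EFin \o (fun s => \sum_(i < n) f i s)) /\
  \int[mu]_(s in D) (\sum_(i < n) f i s) = \sum_(i < n) \int[mu]_(s in D) f i s.
Proof.
move=> mD; elim: n f => [|n IH] f fi.
  have E : (fun s => \sum_(i < 0) f i s) = (fun=> 0) by apply/funext => s; rewrite big_ord0.
  rewrite E big_ord0; split; first exact: integrable0.
  by rewrite /Rintegral integral0.
have [i1 I1] := IH (fun i => f (widen_ord (leqnSn n) i)) (fun i => fi _).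
have E : (fun s => \sum_(i < n.+1) f i s) =
  (fun s => \sum_(i < n) f (widen_ord (leqnSn n) i) s + f ord_max s).
  by apply/funext => s; rewrite big_ord_recr.
rewrite E big_ord_recr -I1; split; first exact: integrable_addr.
exact: RintegralD.
Qed.

Variable d : R.
Hypothesis d0 : 0 < d.
Let a := pi / (2 * d).
Let a0 : 0 < a. Proof. by rewrite divr_gt0 ?pi_gt0// mulr_gt0. Qed.

Definition outer (r : R) : set R := [set s | r <= `|s|].

Lemma measurable_outer r : measurable (outer r).
Proof.
have -> : outer r = (fun s : R => `|s|) @^-1` `[r, +oo[%classic.
  by apply/seteqP; split => s /=; rewrite /outer /= in_itv/= andbT.
rewrite -[X in measurable X]setTI.
have m : measurable_fun setT (fun s : R => `|s|).
  by apply: continuous_measurable_fun; exact: norm_continuous.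
by apply: m.
Qed.

Let h s := (rsinh (a * `|s|))^-1.

Lemma rsinh_gt0 x : 0 < x -> 0 < rsinh x.
Proof. by move=> x0; rewrite /rsinh divr_gt0// subr_gt0 ltr_expR; lra. Qed.

Lemma rsinh_ge_id x : 0 <= x -> x <= rsinh x.
Proof.
move=> x0; have : rsinh 0 - 0 <= rsinh x - x.
  have dr (y : R) : is_derive y 1 (fun y => rsinh y - y) (rcosh y - 1).
    by apply: is_deriveB; exact: is_derive_rsinh.
  apply: (@ger0_derive1_le_cc _ (fun y => rsinh y - y) 0 x) => //.
  - move=> y _; rewrite derive1E (@derive_val _ _ _ _ _ _ _ (dr y)).
    by rewrite subr_ge0 rcosh_ge1.
  - by apply: continuous_subspaceT => y; exact: is_derive_continuous (dr y).
  - by rewrite in_itv/= lexx.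
  - by rewrite in_itv/= lexx x0.
by rewrite {1}/rsinh oppr0 (subrr (expR 0)) mul0r addr0 subr_ge0.
Qed.

Let h_ge0 s : 0 <= h s.
Proof.
rewrite /h; case: (eqVneq s 0) => [->|s0].
  by rewrite normr0 mulr0 /rsinh oppr0 subrr mul0r invr0.
by rewrite invr_ge0 ltW// rsinh_gt0// mulr_gt0// normr_gt0.
Qed.

(** For a unit point charge at distance r the window mass is the indicator of [r <= |s|]: this is
    its logarithmic potential in the form of [integral_window], with the same factor [2 / a]. *)
Lemma integral_csch_outer r : 0 < r ->
  mu.-integrable setT (EFin \o (fun s => \1_(outer r) s * h s)) /\
  \int[mu]_s (\1_(outer r) s * h s) = - (2 / a) * ln (tanh (a / 2 * r)).
Proof.
move=> r0; have a20 : 0 < a / 2 by rewrite divr_gt0.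
pose F s := a^-1 * ln (tanh (a / 2 * s)).
have dF s : 0 < s -> is_derive s 1 F (h s).
  move=> s0; have t0 : 0 < tanh (a / 2 * s) by rewrite tanh_gt0// mulr_gt0.
  have h1 : is_derive s 1 (fun s => tanh (a / 2 * s)) (rcosh (a / 2 * s) ^- 2 * (a / 2)).
    by apply: is_derive_scale; exact: is_derive_tanh.
  have h2 := is_derive1_ln t0.
  have h3 : is_derive s 1 (fun s => ln (tanh (a / 2 * s))) ((tanh (a / 2 * s))^-1 * (rcosh (a / 2 * s) ^- 2 * (a / 2))).
    exact: (@is_derive1_comp R (@ln R) (fun s => tanh (a / 2 * s)) s _ _ h2 h1).
  rewrite /F; apply: is_derive_eq; rewrite /GRing.scale/= /h gtr0_norm//.
  have -> : a * s = a / 2 * s + a / 2 * s by field.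
  rewrite tanhE; have s1 := rsinh_gt0 (mulr_gt0 a20 s0); have c0 := rcosh_gt0 (a / 2 * s).
  have -> : rsinh (a / 2 * s + a / 2 * s) = 2 * rsinh (a / 2 * s) * rcosh (a / 2 * s).
    by rewrite /rsinh /rcosh opprD !expRD; field.
  have an0 : a != 0 := lt0r_neq0 a0.
  move: c0 s1 an0; move: (rcosh _) (rsinh _) => c sn c0 s1; move: a => b b0.
  by field; rewrite ?b0 ?gt_eqF.
have ch s : s != 0 -> {for s, continuous h}.
  move=> s0; apply: cvgV; first by rewrite gt_eqF// rsinh_gt0// mulr_gt0// normr_gt0.
  have h1 : {for s, continuous (fun s : R => a * `|s|)} by apply: cvgMr; exact: norm_continuous.
  exact: (continuous_comp h1 (@continuous_rsinh R _)).
have limF : F x @[x --> +oo] --> (0 : R).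
  rewrite -(mulr0 a^-1) -(ln1 R); apply: cvgMr.
  have h1 : tanh (a / 2 * x) @[x --> +oo] --> (1 : R).
    exact: (cvg_comp (fun x => a / 2 * x) (@tanh R) (cvgryM a20) (@tanh_y R)).
  exact: (cvg_comp _ _ h1 (@continuous_ln R 1 ltr01)).
have cw : {within `[r, +oo[, continuous h}.
  apply: continuous_in_subspaceT => x; rewrite inE /= in_itv/= andbT => rx.
  by apply: ch; rewrite gt_eqF// (lt_le_trans r0).
have E1 : (\int[mu]_(x in `[r, +oo[) (h x)%:E = 0%:E - (F r)%:E)%E.
  apply: ge0_continuous_FTC2y => //.
  - by move=> x rx; have := dF x (lt_trans r0 rx) => -[].
  - by apply: cvgr_at_right_continuous; exact: is_derive_continuous (dF r r0).
  - move=> x; rewrite in_itv/= andbT => rx.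
    have dx := dF x (lt_trans r0 rx).
    by rewrite derive1E; exact: derive_val.
have E2 : (\int[mu]_(x in `]-oo, (- r)%R]) (h x)%:E = 0%:E - (F r)%:E)%E.
  rewrite ge0_integration_by_substitutionNy; last by move=> x _; exact: h_ge0.
  - by rewrite -E1; apply: eq_integral => x _ /=; rewrite /h normrN.
  - apply: continuous_in_subspaceT => x; rewrite inE /= in_itv/= => rx.
    by apply: ch; rewrite lt_eqF// (le_lt_trans rx)// oppr_lt0.
have outE : outer r = `]-oo, (- r)%R]%classic `|` `[r, +oo[%classic.
  apply/seteqP; split => s /=; rewrite /outer /= !in_itv/= andbT ler_normr.
    by case/orP => k; [right|left; rewrite lerNr].
  by case=> k; apply/orP; [right; rewrite lerNr|left].
have mh : measurable_fun setT h by apply: (@measurable_cont_except _ _ 0) => s s0; exact: ch.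
have E : (\int[mu]_(x in outer r) (h x)%:E = (- (2 / a) * ln (tanh (a / 2 * r)))%:E)%E.
  rewrite outE ge0_integral_setU//=.
  - rewrite E1 E2 /F; rewrite -!EFinB -EFinD; congr EFin.
    by rewrite sub0r; set l := ln _; ring.
  - by apply/measurable_EFinP; exact: measurable_funS mh.
  - by move=> x _; rewrite lee_fin.
  - apply/disj_setPS => s [] /=; rewrite !in_itv/= andbT => k1 k2.
    by have := lt_le_trans r0 (le_trans k2 k1); rewrite oppr_gt0 ltNge (ltW r0).
split; last by rewrite Rintegral_indicM /Rintegral E.
apply: integrable_indicM; first exact: measurable_outer.
apply/integrableP; split; first by apply/measurable_EFinP; exact: measurable_funS mh.
rewrite (_ : (\int[mu]_(x in _) _)%E = (- (2 / a) * ln (tanh (a / 2 * r)))%:E) ?ltry//.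
by rewrite -E; apply: eq_integral => x _ /=; rewrite ger0_norm.
Qed.

Variables (u : R -> R) (K M : R) (N : nat) (p : 'I_N.*2.+1 -> R).
Hypotheses (cu : continuous u) (uN : forall x, u (- x) = u x).
Hypothesis iu : mu.-integrable setT (EFin \o u).
Hypothesis decay : forall omega,
  (1 + `|omega|) * `|cosT u omega| <= K * (1 + (1 * omega) ^+ 2)^-1.
Local Notation nu := (charge d u).
Hypothesis nu_bounds : forall x, 0 <= nu x <= M.
Hypothesis mass : \int[mu]_x u x <= pi * d * (2 * N.+1%:R).
Hypothesis pE : forall k, primitive0 nu (p k) = k%:R - N%:R.

Let cnu : continuous nu := continuous_charge d0 iu decay.
Let I := primitive0 nu.
Let nu_ge0 x : 0 <= nu x. Proof. by case/andP: (nu_bounds x). Qed.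
Let M0 : 0 <= M. Proof. by case/andP: (nu_bounds 0) => /le_trans k /k. Qed.

Let I_mono x y : x <= y -> I x <= I y.
Proof.
move=> xy; rewrite -subr_ge0 primitive0_sub//.
by apply: Rintegral_ge0 => // t _.
Qed.

(** The charge is even with total mass at most [2 (N + 1)], so each half-line carries at most
    [N + 1]. *)
Let I_bound x : - N.+1%:R <= I x <= N.+1%:R.
Proof.
have pd : 0 < pi * d by rewrite mulr_gt0// pi_gt0.
have X0 := normr_ge0 x.
have [_ h1 h2] := primitive0_even_half cnu (charge_even d u) X0.
have mX := charge_mass d0 iu decay `|x| nu_ge0.
have half : (\int[mu]_(t in `[- `|x|, `|x|]) nu t) / 2 <= N.+1%:R.
  rewrite ler_pdivrMr// mulrC; apply: le_trans mX _.
  by rewrite ler_pdivrMr// [leRHS]mulrC.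
apply/andP; split.
  apply: le_trans (_ : I (- `|x|) <= _); first by rewrite /I h2 lerN2.
  by apply: I_mono; rewrite lerNl ler_normr lexx orbT.
by apply: le_trans half; rewrite -h1; apply: I_mono; exact: ler_norm.
Qed.

(** Adding [N + 1] to the primitive puts its values in [[0, 2 N + 2]] and the node of index k at the
    integer [k + 1], as [count_integers] wants. Monotonicity of the primitive then places the
    counted nodes in the window. *)
Let window_count x s : 0 <= s ->
  window d u x s <= 1 + \sum_(k < N.*2.+1) \1_(outer `|x - p k|) s.
Proof.
move=> s0; rewrite -(windowE d0 iu decay x s0) -primitive0_sub//; last lra.
have /andP[l1 _] := I_bound (x - s); have /andP[_ l2] := I_bound (x + s).
have := @count_integers N.*2.+1 (I (x - s) + N.+1%:R) (I (x + s) + N.+1%:R).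
rewrite -lerBlDr sub0r => /(_ l1).
have -> : N.*2.+2%:R = N.+1%:R + N.+1%:R :> R by rewrite -natrD; congr (_%:R); lia.
rewrite lerD2r => /(_ l2) H.
rewrite -/I; have -> : I (x + s) - I (x - s) = I (x + s) + N.+1%:R - (I (x - s) + N.+1%:R) by ring.
apply: le_trans H _; rewrite lerD2l; apply: ler_sum => k _.
rewrite indicE ler_nat; case: (boolP (_ < _ < _)) => //= /andP[k1 k2].
rewrite mem_set// /outer /= (ger0_norm s0).
have E : k.+1%:R = I (p k) + N.+1%:R :> R.
  by rewrite /I pE -[k.+1]addn1 -[N.+1]addn1 !natrD; ring.
rewrite E ltrD2r in k1; rewrite E ltrD2r in k2.
rewrite ler_norml; apply/andP; split; rewrite leNgt; apply/negP => c.
  have : I (x + s) <= I (p k).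
    by apply: I_mono; rewrite -lerBrDl ltW// -ltrN2 opprB.
  by rewrite leNgt k2.
have : I (p k) <= I (x - s) by apply: I_mono; rewrite lerBrDr -lerBrDl ltW.
by rewrite leNgt k1.
Qed.

Let window_small x s : 0 <= s -> window d u x s <= 2 * M * s.
Proof.
move=> s0; rewrite -(windowE d0 iu decay x s0).
have xs : x - s <= x + s by lra.
have := @abs_Rintegral_le R (x - s) (x + s) nu M xs.
have -> : M * (x + s - (x - s)) = 2 * M * s by ring.
move=> H; apply: le_trans (ler_norm _) _; apply: H.
  by apply: continuous_integrable => t _; exact: cnu.
by move=> t _; rewrite ger0_norm//; case/andP: (nu_bounds t).
Qed.

Let window_abs x s : window d u x s / rsinh (a * s) = window d u x `|s| * h s.
Proof.
case: (ger0P s) => s0; first by rewrite /h ger0_norm.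
rewrite /h ltr0_norm// mulrN rsinhN invrN mulrN.
have -> : window d u x (- s) = - window d u x s; last by rewrite mulNr opprK.
rewrite /window -mulNr; congr (_ / _); rewrite -[RHS]mulN1r -RintegralZl//.
  by apply: eq_Rintegral => w _; rewrite mulrN sinN; ring.
exact: (integrable_window d0 iu decay).
Qed.

(** The 1 lost in [window_count] cannot be integrated against [1 / sinh] at 0. For [|s| <= del] the
    density bound M is used instead, and [x <= sinh x] turns it into the constant [2 * M / a]. *)
Let pointwise x s del : 0 <= del -> window d u x s / rsinh (a * s) <=
  2 * M / a * (\1_(`[- del, del]%classic) s) + (\1_(outer del) s * h s + \sum_(k < N.*2.+1) (\1_(outer `|x - p k|) s * h s)).
Proof.
move=> del0; rewrite window_abs.
have t0 := normr_ge0 s.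
have cst0 : 0 <= 2 * M / a by rewrite divr_ge0 ?(ltW a0)// mulr_ge0.
have out0 r : 0 <= \1_(outer r) s * h s by rewrite mulr_ge0// indicE.
have sum0 : 0 <= \sum_(k < N.*2.+1) (\1_(outer `|x - p k|) s * h s).
  by apply: sumr_ge0 => k _; exact: out0.
case: (leP `|s| del) => sd.
  apply: le_trans (_ : 2 * M / a <= _).
    case: (eqVneq s 0) => [->|s0].
      by rewrite /h normr0 mulr0 /rsinh oppr0 subrr mul0r invr0 mulr0.
    have at0 : 0 < a * `|s| by rewrite mulr_gt0// normr_gt0.
    rewrite /h ler_pdivrMr ?rsinh_gt0//.
    apply: le_trans (window_small _ t0) _.
    apply: le_trans (_ : 2 * M / a * (a * `|s|) <= _); last first.
      by rewrite ler_wpM2l// rsinh_ge_id// ltW.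
    by rewrite mulrA divfK// gt_eqF.
  rewrite indicE mem_set; last by rewrite /= in_itv/= -ler_norml.
  by rewrite mulr1 lerDl addr_ge0.
have dE : \1_(outer del) s = 1 :> R by rewrite indicE mem_set// /outer /= ltW.
rewrite dE -mulr_suml -mulrDl.
apply: le_trans (_ : (1 + \sum_(k < N.*2.+1) \1_(outer `|x - p k|) `|s|) * h s <= _).
  by rewrite ler_wpM2r// window_count.
have -> : \sum_(k < N.*2.+1) \1_(outer `|x - p k|) `|s| = \sum_(k < N.*2.+1) \1_(outer `|x - p k|) s :> R.
  apply: eq_bigr => k _; rewrite !indicE; congr (_%:R).
  by congr nat_of_bool; apply/idP/idP; rewrite !inE /outer /= normr_id.
by rewrite lerDr mulr_ge0// indicE.
Qed.

Lemma potential_discretized x del : 0 < del -> (forall k, x != p k) ->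
  u x <= 2 * M * del - ln (tanh (a / 2 * del))
         - \sum_(k < N.*2.+1) ln (tanh (a / 2 * `|x - p k|)).
Proof.
move=> del0 xp.
have [iw Iw] := integral_window d0 cu uN iu decay x.
have [i1 I1] := integral_csch_outer del0.
have xp0 k : 0 < `|x - p k| by rewrite normr_gt0 subr_eq0.
have ik k := (integral_csch_outer (xp0 k)).1.
have [i2 I2] := integrable_sum_fun measurableT ik.
have mD : measurable (`[- del, del]%classic : set R) by exact: measurable_itv.
have i0 : mu.-integrable setT (EFin \o (fun s => (\1_(`[- del, del]%classic) s : R))).
  have : mu.-integrable setT (EFin \o (fun s => \1_(`[- del, del]%classic) s * (1 : R))).
    by apply: integrable_indicM => //; apply: continuous_integrable => t _; exact: cvg_cst.
  by congr (mu.-integrable _ _); apply/funext => s /=; rewrite mulr1.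
have I0 : \int[mu]_s (\1_(`[- del, del]%classic) s : R) = 2 * del.
  rewrite (@eq_Rintegral _ _ R mu _ (fun s => \1_(`[- del, del]%classic) s * 1)); last by move=> s _; rewrite mulr1.
  rewrite Rintegral_indicM Rintegral_cst_segment; last by rewrite (ge0_cp (ltW del0)).
  by ring.
have i12 := integrable_addr measurableT i1 i2.
have i012 := integrable_addr measurableT (integrable_scale (2 * M / a) measurableT i0) i12.
have := le_Rintegral measurableT iw i012 (fun s _ => pointwise x s (ltW del0)).
rewrite Iw RintegralD//; last exact: integrable_scale.
rewrite RintegralZl// I0 RintegralD// I1 I2.
under eq_bigr do rewrite (integral_csch_outer (xp0 _)).2.
rewrite -mulr_sumr -/a.
set S := \sum_(k < _) _; set L := ln _ => H.
have : 2 / a * u x <= 2 / a * (2 * M * del - L - S).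
  by apply: le_trans (_ : _ <= 2 * u x / a) _; [rewrite mulrAC|apply: le_trans H _; rewrite le_eqVlt; apply/orP; left; apply/eqP; ring].
by rewrite ler_pM2l// divr_gt0.
Qed.

End Discretization.

(** * Interpolation error *)

Section DerivableComplex.
Variable R : realType.
Implicit Types (f g : R[i] -> R[i]) (z w : R[i]).

Definition cdiff f z : Prop := exists l, hder f z l.

Lemma cdiff_cst k z : cdiff (fun=> k) z. Proof. by exists 0; exact: hder_cst. Qed.

Lemma cdiffD f g z : cdiff f z -> cdiff g z -> cdiff (fun w => f w + g w) z.
Proof. by move=> [k hf] [l hg]; exists (k + l); exact: hderD. Qed.

Lemma cdiffB f g z : cdiff f z -> cdiff g z -> cdiff (fun w => f w - g w) z.
Proof. by move=> [k hf] [l hg]; exists (k - l); exact: hderB. Qed.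

Lemma cdiffM f g z : cdiff f z -> cdiff g z -> cdiff (fun w => f w * g w) z.
Proof. by move=> [k hf] [l hg]; exists (k * g z + f z * l); exact: hderM. Qed.

Lemma cdiffV f z : f z != 0 -> cdiff f z -> cdiff (fun w => (f w)^-1) z.
Proof. by move=> fz [k hf]; exists (- k / f z ^+ 2); exact: hderV. Qed.

Lemma cdiff_cexp f z : cdiff f z -> cdiff (fun w => cexp (f w)) z.
Proof. by move=> [k hf]; exists (cexp (f z) * k); exact: hder_comp hf (hder_cexp _). Qed.

Lemma cdiff_prod (I : finType) (P : pred I) (F : I -> R[i] -> R[i]) z :
  (forall i, P i -> cdiff (F i) z) -> cdiff (fun w => \prod_(i | P i) F i w) z.
Proof.
move=> dF; elim: (index_enum I) => [|i s IH].
  have -> : (fun w => \prod_(i <- [::] | P i) F i w) = (fun=> 1).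
    by apply/funext => w; rewrite big_nil.
  exact: cdiff_cst.
have -> : (fun w => \prod_(i <- i :: s | P i) F i w) =
   (fun w => (if P i then F i w else 1) * \prod_(i <- s | P i) F i w).
  by apply/funext => w; rewrite big_cons; case: ifP; rewrite ?mul1r.
apply: cdiffM IH; case: (boolP (P i)) => Pi; first exact: dF.
exact: cdiff_cst.
Qed.

Lemma cdiff_sum (I : finType) (P : pred I) (F : I -> R[i] -> R[i]) z :
  (forall i, P i -> cdiff (F i) z) -> cdiff (fun w => \sum_(i | P i) F i w) z.
Proof.
move=> dF; elim: (index_enum I) => [|i s IH].
  have -> : (fun w => \sum_(i <- [::] | P i) F i w) = (fun=> 0).
    by apply/funext => w; rewrite big_nil.
  exact: cdiff_cst.
have -> : (fun w => \sum_(i <- i :: s | P i) F i w) =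
   (fun w => (if P i then F i w else 0) + \sum_(i <- s | P i) F i w).
  by apply/funext => w; rewrite big_cons; case: ifP; rewrite ?add0r.
apply: cdiffD IH; case: (boolP (P i)) => Pi; first exact: dF.
exact: cdiff_cst.
Qed.

Lemma cdiff_cont f z : cdiff f z -> ccont f z.
Proof. by case=> l /hder_cont. Qed.

Lemma ccont_neq0 f z : ccont f z -> f z != 0 ->
  exists2 del : R, 0 < del & forall w, cabs (w - z) < del -> f w != 0.
Proof.
move=> cf fz; have [|del del0 H] := cf (cabs (f z)); first by rewrite cabs_gt0.
exists del => // w /H h; apply: contraTneq h => ->.
by rewrite sub0r cabsN ltxx.
Qed.

Lemma Re_conjM (z w : R[i]) : complex.Re (conjc z * w) = complex.Re (z * conjc w).
Proof. by case: z => x y; case: w => x' y'; rewrite !Re_mulc /=; ring. Qed.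

Lemma mulc_conj (z : R[i]) : z * conjc z = (cabs z ^+ 2)%:C.
Proof. by apply: complex_ext; rewrite ?Re_mulc ?Im_mulc; case: z => x y /=; rewrite ?(sqr_cabs (x +i* y)%C) /=; ring. Qed.

Lemma cabs_conj (z : R[i]) : cabs (conjc z) = cabs z.
Proof. by case: z => x y; rewrite /cabs /= sqrrN. Qed.

Lemma cabs_prod (I : finType) (P : pred I) (F : I -> R[i]) :
  cabs (\prod_(i | P i) F i) = \prod_(i | P i) cabs (F i).
Proof.
by apply: (big_morph (@cabs R)); [move=> z w; exact: cabsM|exact: cabs1].
Qed.

Lemma cabs_sum (I : finType) (P : pred I) (F : I -> R[i]) :
  cabs (\sum_(i | P i) F i) <= \sum_(i | P i) cabs (F i).
Proof.
elim/big_ind2: _ => [|x1 x2 y1 y2 h1 h2|//]; first by rewrite cabs0.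
by apply: le_trans (cabsD _ _) _; exact: lerD.
Qed.

Lemma real_prod (I : finType) (P : pred I) (F : I -> R) :
  (\prod_(i | P i) F i)%:C = \prod_(i | P i) (F i)%:C :> R[i].
Proof. exact: rmorph_prod. Qed.

End DerivableComplex.

(** * Conformal map of the strip onto the unit disc *)

Section Blaschke.
Variable R : realType.
Implicit Types (x y : R) (z w : R[i]).
Variable d : R.
Hypothesis d0 : 0 < d.
Let a := pi / (2 * d).
Let a0 : 0 < a. Proof. by rewrite divr_gt0 ?pi_gt0// mulr_gt0. Qed.
Let ad : a * d = pi / 2. Proof. by rewrite /a; field; rewrite gt_eqF. Qed.

(** This is [tanh (a z / 2)], written with one exponential; it maps the strip conformally onto the
    unit disc. *)
Definition ctanh z : R[i] := (cexp (a%:C * z) - 1) / (cexp (a%:C * z) + 1).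

Let cos_gt0 y : `|y| < d -> 0 < cos (a * y).
Proof.
rewrite ltr_norml => /andP[y1 y2]; apply: cos_gt0_pihalf; rewrite -ad -mulrN.
by rewrite !ltr_pM2l// y1 y2.
Qed.

Let den_neq0 z : strip d z -> cexp (a%:C * z) + 1 != 0.
Proof.
move=> zd; apply/eqP => /(congr1 (@complex.Re R)).
rewrite Re_addc Re_cexp Re_realM Im_realM => h.
have := mulr_gt0 (expR_gt0 (a * complex.Re z)) (cos_gt0 zd).
by move: h; rewrite /=; lra.
Qed.

Lemma sqr_cabs_ctanh z : strip d z ->
  1 - cabs (ctanh z) ^+ 2 = 4 * expR (a * complex.Re z) * cos (a * complex.Im z) /
   (expR (a * complex.Re z) ^+ 2 + 2 * expR (a * complex.Re z) * cos (a * complex.Im z) + 1).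
Proof.
move=> zd; have c0 := cos_gt0 zd.
have e0 := expR_gt0 (a * complex.Re z).
have D0 : 0 < expR (a * complex.Re z) ^+ 2 + 2 * expR (a * complex.Re z) * cos (a * complex.Im z) + 1.
  by rewrite addr_gt0// addr_gt0 ?exprn_gt0// mulr_gt0// mulr_gt0.
have sq k : cabs (cexp (a%:C * z) + k%:C) ^+ 2 =
    expR (a * complex.Re z) ^+ 2 + 2 * k * expR (a * complex.Re z) * cos (a * complex.Im z) + k ^+ 2.
  rewrite sqr_cabs Re_addc Im_addc Re_cexp Im_cexp Re_realM Im_realM /=.
  have := cos2Dsin2 (a * complex.Im z).
  move: (cos _) (sin _) (expR _) => c s e cs.
  rewrite addr0 [RHS](_ : _ = e ^+ 2 * (c ^+ 2 + s ^+ 2) + 2 * k * e * c + k ^+ 2); first by ring.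
  by rewrite cs; ring.
have e1 := sq 1; have e2 := sq (-1).
rewrite /ctanh cabsM cabsV exprMn exprVn.
rewrite -[cexp (a%:C * z) - 1]/(cexp (a%:C * z) + - 1%:C) -rmorphN e1 e2.
move: D0; move: (expR _) (cos _) => e c D0.
by field; rewrite gt_eqF//; move: D0; rewrite !mulr1 expr1n.
Qed.

Lemma cabs_ctanh_le1 z : strip d z -> cabs (ctanh z) <= 1.
Proof.
move=> zd; have e0 := expR_gt0 (a * complex.Re z).
have : 0 <= 1 - cabs (ctanh z) ^+ 2.
  rewrite sqr_cabs_ctanh//; have c0 := ltW (cos_gt0 zd).
  by rewrite divr_ge0// ?addr_ge0 ?sqr_ge0// !mulr_ge0// ltW.
rewrite subr_ge0 => h; rewrite leNgt; apply/negP => h1.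
by move: h; rewrite leNgt => /negP; apply; rewrite expr_gt1 ?cabs_ge0.
Qed.

(** Together with [ctanh_far_le], a quantitative form of [|ctanh| -> 1] at the boundary of the strip
    and at infinity: estimates are made near the boundary and boundary values are never taken. *)
Lemma ctanh_top_le z : strip d z -> 1 - cabs (ctanh z) ^+ 2 <= 2 * (a * (d - `|complex.Im z|)).
Proof.
move=> zd; have e0 := expR_gt0 (a * complex.Re z); have c0 := cos_gt0 zd.
rewrite sqr_cabs_ctanh//; set e := expR _ in e0 *; set c := cos _ in c0 *.
have D0 : 0 < e ^+ 2 + 2 * e * c + 1.
  by rewrite addr_gt0// addr_gt0 ?exprn_gt0// mulr_gt0// mulr_gt0.
apply: le_trans (_ : 2 * c <= _).
  rewrite ler_pdivrMr// -subr_ge0.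
  have -> : 2 * c * (e ^+ 2 + 2 * e * c + 1) - 4 * e * c = 2 * c * ((e - 1) ^+ 2 + 2 * e * c) by ring.
  by rewrite mulr_ge0// ?mulr_ge0 ?(ltW c0)// addr_ge0 ?sqr_ge0// mulr_ge0 ?(ltW c0)// mulr_ge0// ltW.
rewrite ler_pM2l//.
have -> : c = sin (a * (d - `|complex.Im z|)).
  rewrite /c mulrBr ad; have [_|_] := ger0P (complex.Im z).
    by rewrite sinB sin_pihalf cos_pihalf mul0r subr0 mul1r.
  by rewrite mulrN opprK sinD sin_pihalf cos_pihalf mul0r addr0 mul1r.
have h : 0 <= a * (d - `|complex.Im z|) by rewrite mulr_ge0 ?(ltW a0)// subr_ge0 ltW.
by apply: le_trans (ler_norm _) _; rewrite -[leRHS]ger0_norm//; exact: norm_sin_le.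
Qed.

Lemma ctanh_far_le z : strip d z -> z != 0 -> complex.Re z != 0 ->
  1 - cabs (ctanh z) ^+ 2 <= 4 / (a * `|complex.Re z|).
Proof.
move=> zd _ x0; have e0 := expR_gt0 (a * complex.Re z); have c0 := cos_gt0 zd.
have ax : 0 < a * `|complex.Re z| by rewrite mulr_gt0// normr_gt0.
rewrite sqr_cabs_ctanh//.
have Eabs : a * `|complex.Re z| = `|a * complex.Re z| by rewrite normrM (gtr0_norm a0).
rewrite ler_pdivlMr// mulrAC ler_pdivrMr; last first.
  by rewrite addr_gt0// addr_gt0 ?exprn_gt0// mulr_gt0// mulr_gt0.
have h1 : `|a * complex.Re z| * expR (a * complex.Re z) <= expR (a * complex.Re z) ^+ 2 + 1.
  set t := a * _.
  have [t0|t0] := ger0P t.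
    have := expR_ge1Dx t; have := expR_gt0 t; move: (expR t) => E E0 h.
    apply: le_trans (_ : E * E <= _); last by rewrite expr2 lerDl.
    by rewrite ler_wpM2r ?(ltW E0)//; lra.
  have := expR_ge1Dx (- t); have := expR_gt0 t; rewrite expRN; move: (expR t) => E E0 h.
  apply: le_trans (_ : 1 <= _); last by rewrite lerDr sqr_ge0.
  by rewrite -ler_pdivlMr// mul1r; lra.
rewrite Eabs; move: h1; set e := expR _ in e0 *; set c := cos _ in c0 *.
move: (normr_ge0 (a * complex.Re z)); move: `|a * complex.Re z| => t t00 h1.
have c1 : c <= 1 := le_trans (ler_norm _) (cos_max _).
have t0 : 0 <= t * e := mulr_ge0 t00 (ltW e0).
apply: le_trans (_ : 4 * (t * e) <= _).
  have -> : 4 * e * c * t = 4 * (t * e) * c by ring.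
  by rewrite ler_piMr// mulr_ge0.
rewrite ler_pM2l// (le_trans h1)//.
have : 0 <= 2 * e * c by rewrite mulr_ge0 ?(ltW c0)// mulr_ge0// ltW.
lra.
Qed.

Lemma cdiff_ctanh z (p : R) : strip d z -> cdiff (fun w => ctanh (w - p%:C)) z.
Proof.
move=> zd; have zpd : strip d (z - p%:C).
  by rewrite /strip /= Im_addc Im_oppc /= oppr0 addr0.
have dl : cdiff (fun w => a%:C * (w - p%:C)) z.
  apply: cdiffM; first exact: cdiff_cst.
  by apply: cdiffB; [exists 1; exact: hder_id|exact: cdiff_cst].
apply: cdiffM.
  by apply: cdiffB; [exact: cdiff_cexp|exact: cdiff_cst].
apply: cdiffV; first exact: den_neq0.
by apply: cdiffD; [exact: cdiff_cexp|exact: cdiff_cst].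
Qed.

Lemma strip_subr z (p : R) : strip d z -> strip d (z - p%:C).
Proof. by move=> zd; rewrite /strip /= Im_addc Im_oppc /= oppr0 addr0. Qed.

Lemma ctanh_real x : ctanh x%:C = (tanh (pi / (4 * d) * x))%:C.
Proof.
have E : a * x = pi / (4 * d) * x + pi / (4 * d) * x by rewrite /a; field; rewrite gt_eqF.
have ce : cexp (a%:C * x%:C) = (expR (a * x))%:C.
  apply: complex_ext; rewrite ?Re_cexp ?Im_cexp Re_realM Im_realM /= mulr0.
    by rewrite cos0 mulr1.
  by rewrite sin0 mulr0.
rewrite /ctanh ce -[1]/(1%:C : R[i]) -rmorphB -rmorphD -fmorphV -rmorphM; congr (_%:C).
rewrite E expRD /tanh expRN; have := expR_gt0 (pi / (4 * d) * x).
move: (expR _) => e e0.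
have h1 : e * e + 1 != 0 by rewrite gt_eqF// addr_gt0// mulr_gt0.
have h2 : e != 0 by rewrite gt_eqF.
have h3 : e ^+ 2 + 1 != 0 by rewrite expr2.
by field; rewrite ?h1 ?h2 ?h3.
Qed.

Lemma ctanh_eq0 z : strip d z -> ctanh z = 0 -> z = 0.
Proof.
move=> zd /eqP; rewrite mulf_eq0 invr_eq0 (negbTE (den_neq0 zd)) orbF subr_eq0 => /eqP h.
have hR : expR (a * complex.Re z) = 1 by have := congr1 (@cabs R) h; rewrite cabs_cexp Re_realM cabs1.
have x0 : complex.Re z = 0.
  have : a * complex.Re z = 0 by apply: expR_inj; rewrite expR0.
  by move/eqP; rewrite mulf_eq0 gt_eqF//= => /eqP.
have s0 : sin (a * complex.Im z) = 0.
  by have := congr1 (@complex.Im R) h; rewrite Im_cexp Re_realM Im_realM hR mul1r.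
apply: complex_ext => //=; apply/eqP; apply: contraT => y0.
have : 0 < `|sin (a * complex.Im z)|.
  have pos y : 0 < y < d -> 0 < sin (a * y).
    move=> /andP[y1 y2]; apply: sin_gt0_pi; apply/andP; split; first by rewrite mulr_gt0.
    have := pi_gt0 R => p0.
    by apply: lt_trans (_ : pi / 2 < _); [rewrite -ad ltr_pM2l|lra].
  have := zd; rewrite /strip /=; have [yp|yn] := ger0P (complex.Im z) => yd.
    by rewrite normr_gt0 gt_eqF// pos// yd andbT lt_neqAle eq_sym y0.
  by rewrite -normrN -sinN -mulrN normr_gt0 gt_eqF// pos// yd andbT oppr_gt0.
by rewrite s0 normr0 ltxx.
Qed.

(** The simple zero is split off with a cofactor that is merely continuous at p, which is all that
    derivatives in Caratheodory's form ask for. *)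
Lemma ctanh_factor (p : R) : exists psi : R[i] -> R[i],
  [/\ forall w, ctanh (w - p%:C) = psi w * (w - p%:C), psi p%:C != 0 & ccont psi p%:C].
Proof.
have sp : strip d p%:C by rewrite /strip /= normr0.
have h1 : hder (fun w => cexp (a%:C * (w - p%:C)) - 1) p%:C (a%:C).
  have hl : hder (fun w => a%:C * (w - p%:C)) p%:C (a%:C * (1 - 0)).
    by apply: hderZ; apply: hderB; [exact: hder_id|exact: hder_cst].
  have := hderB (hder_comp hl (hder_cexp _)) (hder_cst 1 _).
  by rewrite subrr mulr0 cexp0 !subr0 mulr1 mul1r.
case: h1 => phi [phiE phip cphi].
exists (fun w => phi w / (cexp (a%:C * (w - p%:C)) + 1)); split.
- move=> w; rewrite /ctanh phiE !subrr mulr0 cexp0 subrr add0r; ring.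
- rewrite phip mulf_neq0// ?invr_eq0; first by rewrite -(rmorph0 (real_complex R)) (inj_eq (@complexI _)) gt_eqF.
  by apply: den_neq0; exact: strip_subr.
- apply: ccontM => //; apply: ccontV; first by apply: den_neq0; exact: strip_subr.
  apply: cdiff_cont; apply: cdiffD; last exact: cdiff_cst.
  apply: cdiff_cexp; apply: cdiffM; first exact: cdiff_cst.
  by apply: cdiffB; [exists 1; exact: hder_id|exact: cdiff_cst].
Qed.

End Blaschke.

(** * Interpolation error in the strip *)

Section Interpolation.
Variable R : realType.
Implicit Types (x y : R) (z w : R[i]).

(** A term with [conjc t] is not analytic when t is; conjugating the whole term keeps its real part
    and restores analyticity. *)
Lemma Re_split (th k t : R[i]) :
  - complex.Re (th * k / t) + complex.Re (conjc (th * k) * t) =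
  - complex.Re (th * (k * (t^-1 - conjc t))).
Proof. by rewrite Re_conjM mulrA mulrBr Re_addc Re_oppc opprD opprK. Qed.

Variable d : R.
Hypothesis d0 : 0 < d.
Let a := pi / (2 * d).
Let a0 : 0 < a. Proof. by rewrite divr_gt0 ?pi_gt0// mulr_gt0. Qed.
Variables (n : nat) (p : 'I_n -> R) (g : R[i] -> R[i]) (B : R).
Hypothesis p_inj : injective p.
Hypothesis gd : forall z, strip d z -> cdiff g z.
Hypothesis gB : forall z, strip d z -> cabs (g z) <= B.

Let T j z := ctanh d (z - (p j)%:C).
Let b z := \prod_j T j z.
Let bj j z := \prod_(i | i != j) T i z.
Let c j := g (p j)%:C / bj j (p j)%:C.
Let S := \sum_j cabs (c j).

Let real_strip x : strip d x%:C.
Proof. by rewrite /strip /= normr0. Qed.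

Let bE j z : b z = T j z * bj j z.
Proof. by rewrite /b (bigD1 j). Qed.

Let T_neq0 j z : strip d z -> z != (p j)%:C -> T j z != 0.
Proof.
move=> zd; apply: contra_neq => /(ctanh_eq0 d0 (strip_subr (p j) zd)) /eqP.
by rewrite subr_eq0 => /eqP.
Qed.

Let bj_neq0 j z : strip d z -> (forall i, i != j -> z != (p i)%:C) -> bj j z != 0.
Proof.
by move=> zd h; apply/prodf_neq0 => i ij; apply: T_neq0 => //; exact: h.
Qed.

Let p_neq i j : i != j -> (p j)%:C != (p i)%:C :> R[i].
Proof. by move=> ij; rewrite (inj_eq (@complexI _)) (inj_eq p_inj) eq_sym. Qed.

Let T_cdiff j z : strip d z -> cdiff (T j) z.
Proof. exact: cdiff_ctanh. Qed.

Let T_le1 j z : strip d z -> cabs (T j z) <= 1.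
Proof. by move=> zd; apply: cabs_ctanh_le1 => //; exact: strip_subr. Qed.

Let B0 : 0 <= B.
Proof. exact: le_trans (cabs_ge0 _) (gB (real_strip 0)). Qed.

Let S0 : 0 <= S.
Proof. by apply: sumr_ge0 => j _; exact: cabs_ge0. Qed.

Section Rotation.
Variable theta : R[i].
Hypothesis theta1 : cabs theta = 1.

(* On the real line Re (A) is the real part of theta times the normalized error,
   and A is analytic off the nodes where it stays bounded, so that b ^ 2 cancels
   the singularities of exp (m A) for every m. *)
Let A z := theta * (g z / b z) - \sum_j theta * c j / T j z
  + \sum_j conjc (theta * c j) * T j z.
Let G (m : nat) z := cexp (m%:R * A z) * b z ^+ 2.

Let cdiff_A z : strip d z -> (forall j, z != (p j)%:C) -> cdiff A z.
Proof.
move=> zd h; apply: cdiffD.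
  apply: cdiffB.
    apply: cdiffM; first exact: cdiff_cst.
    apply: cdiffM; first exact: gd.
    apply: cdiffV; last by apply: cdiff_prod => j _; exact: T_cdiff.
    by apply/prodf_neq0 => j _; exact: T_neq0.
  apply: cdiff_sum => j _; apply: cdiffM; first exact: cdiff_cst.
  by apply: cdiffV; [exact: T_neq0|exact: T_cdiff].
by apply: cdiff_sum => j _; apply: cdiffM; [exact: cdiff_cst|exact: T_cdiff].
Qed.

Let ccont_sum (P : pred 'I_n) (F : 'I_n -> R[i] -> R[i]) z :
  (forall i, P i -> cdiff (F i) z) -> ccont (fun w => \sum_(i | P i) F i w) z.
Proof. by move=> h; apply: cdiff_cont; exact: cdiff_sum. Qed.

(** Near a node the poles of [theta * g / b] and of [theta * c j / T j] cancel by the choice of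
    [c j], and A agrees with a continuous A'. Since [b ^+ 2] has a double zero, G is [w - z] times a
    continuous function, hence differentiable at the node without any differentiability of A'. *)
Let cdiff_G m z : strip d z -> cdiff (G m) z.
Proof.
move=> zd; case: (pselect (exists j, z = (p j)%:C)) => [[j zj]|h]; last first.
  have h' j : z != (p j)%:C by apply/eqP => zj; apply: h; exists j.
  apply: cdiffM.
    by apply: cdiff_cexp; apply: cdiffM; [exact: cdiff_cst|exact: cdiff_A].
  have cb : cdiff b z by apply: cdiff_prod => j _; exact: T_cdiff.
  by have -> : (fun w => b w ^+ 2) = (fun w => b w * b w) by []; exact: cdiffM.
subst z; set z := (p j)%:C in zd *.
have [psi [psiE psi0 cpsi]] := ctanh_factor d0 (p j).
have cbj : cdiff (bj j) z by apply: cdiff_prod => i _; exact: T_cdiff.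
have bj0 : bj j z != 0 by apply: bj_neq0 => // i; exact: p_neq.
have : cdiff (fun w => g w - c j * bj j w) z.
  by apply: cdiffB; [exact: gd|apply: cdiffM; [exact: cdiff_cst|exact: cbj]].
case=> l [phi [phiE _ cphi]].
have phi0 w : g w - c j * bj j w = phi w * (w - z).
  by rewrite phiE /c divfK// subrr add0r.
pose A' w := theta * (phi w / (psi w * bj j w)) - \sum_(i | i != j) theta * c i / T i w
  + \sum_i conjc (theta * c i) * T i w.
have cA' : ccont A' z.
  apply: ccontD; last first.
    by apply: ccont_sum => i _; apply: cdiffM; [exact: cdiff_cst|exact: T_cdiff].
  apply: ccontD.
    apply: ccontM; first exact: ccont_cst.
    apply: ccontM => //; apply: ccontV; first by rewrite mulf_neq0.
    by apply: ccontM => //; exact: cdiff_cont.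
  have -> : (fun w => - \sum_(i | i != j) theta * c i / T i w) =
      (fun w => -1 * \sum_(i | i != j) theta * c i / T i w).
    by apply/funext => w; rewrite mulN1r.
  apply: ccontM; first exact: ccont_cst.
  apply: ccont_sum => i ij; apply: cdiffM; first exact: cdiff_cst.
  by apply: cdiffV; [apply: T_neq0 => //; exact: p_neq|exact: T_cdiff].
(* One of the two factors [w - z] of [b ^+ 2] stays in Phi, the other plays the increment in
   Caratheodory's form. *)
pose Phi w := cexp (m%:R * A' w) * (psi w * psi w * (w - z) * (bj j w * bj j w)).
have cPhi : ccont Phi z.
  apply: ccontM.
    apply: (@ccont_comp _ (fun w => m%:R * A' w) (@cexp R)).
      by apply: ccontM; [exact: ccont_cst|].
    exact: hder_cont (hder_cexp _).
  apply: ccontM; last by apply: ccontM; exact: cdiff_cont.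
  apply: ccontM; first exact: ccontM.
  by apply: cdiff_cont; apply: cdiffB; [exists 1; exact: hder_id|exact: cdiff_cst].
have hPhi : hder (fun w => Phi w * (w - z)) z (Phi z).
  by exists Phi; split => // w; rewrite subrr mulr0 add0r.
have [del1 del10 H1] := ccont_neq0 cpsi psi0.
have [del2 del20 H2] := ccont_neq0 (cdiff_cont cbj) bj0.
have dm : 0 < Num.min del1 del2 by rewrite lt_min del10.
exists (Phi z); apply: (near_hder dm) hPhi => w; rewrite lt_min => /andP[/H1 w1 /H2 w2].
have TE : T j w = psi w * (w - z) by exact: psiE.
rewrite /Phi /G (bE j) TE.
(* At the node itself A has a meaningless default value, but b vanishes there and so does G. *)
case: (eqVneq w z) => [->|wz]; first by rewrite subrr !(mulr0, mul0r) expr0n/= mulr0.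
have wz0 : w - z != 0 by rewrite subr_eq0.
have -> : A w = A' w.
  rewrite /A /A' (bE j) TE; congr (_ + _).
  rewrite (bigD1 j)//= opprD addrA; congr (_ - _).
  have -> : g w = phi w * (w - z) + c j * bj j w by rewrite -phi0 subrK.
  by rewrite TE; field; rewrite w1 w2 wz0.
by rewrite exprMn exprMn !expr2; ring.
Qed.

Let Re_A z : complex.Re (A z) =
  complex.Re (theta * (g z / b z - \sum_j c j * ((T j z)^-1 - conjc (T j z)))).
Proof.
rewrite /A mulrBr mulr_sumr !Re_addc !Re_oppc -addrA; congr (_ + _).
have ReS (F : 'I_n -> R[i]) : complex.Re (\sum_j F j) = \sum_j complex.Re (F j).
  by apply: (big_morph (@complex.Re R)) => // u v; rewrite Re_addc.
rewrite !ReS -!sumrN -big_split /=; apply: eq_bigr => j _.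
exact: Re_split.
Qed.

(** If every [T j] has modulus at least [1 / t], then [1 / |b| <= t ^+ n], and [1 / T - conjc T] has
    modulus [1 / |T| - |T|], which tends to 0 as t tends to 1: this is how the interpolant
    disappears at the boundary. *)
Let Re_A_le z t : strip d z -> 1 < t -> (forall j, T j z != 0) ->
  (forall j, (cabs (T j z))^-1 <= t) -> complex.Re (A z) <= B * t ^+ n + S * (t - t^-1).
Proof.
move=> zd t1 T0 Tt; rewrite Re_A.
apply: le_trans (ler_norm _) _; apply: le_trans (le_Re_cabs _) _.
rewrite cabsM theta1 mul1r; apply: le_trans (cabsBD _ _) _; apply: lerD.
  rewrite cabsM cabsV; apply: ler_pM; rewrite ?cabs_ge0 ?invr_ge0 ?cabs_ge0//; first exact: gB.
  rewrite /b cabs_prod -prodfV.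
  have -> : t ^+ n = \prod_(j < n) t by rewrite prodr_const card_ord.
  by apply: ler_prod => j _; rewrite invr_ge0 cabs_ge0 Tt.
apply: le_trans (cabs_sum _ _) _; rewrite /S mulr_suml; apply: ler_sum => j _.
rewrite cabsM ler_wpM2l ?cabs_ge0//.
have r0 : 0 < cabs (T j z) by rewrite cabs_gt0.
have -> : (T j z)^-1 - conjc (T j z) = (1 - cabs (T j z) ^+ 2)%:C / T j z.
  have -> : (1 - cabs (T j z) ^+ 2)%:C = 1 - T j z * conjc (T j z).
    by rewrite mulc_conj rmorphB.
  by rewrite mulrBl mul1r [T j z * _]mulrC mulfK.
rewrite cabsM cabs_real cabsV.
have r1 := T_le1 j zd; have rt := Tt j; move: r0 r1 rt; move: (cabs _) => r r0 r1 rt.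
rewrite ger0_norm; last by rewrite subr_ge0 expr_le1// ltW.
have -> : (1 - r ^+ 2) / r = r^-1 - r by field; rewrite gt_eqF.
apply: lerB => //; rewrite -[leRHS]invrK lef_pV2 ?posrE ?invr_gt0//.
exact: lt_trans t1.
Qed.

Variable x : R.
Hypothesis xp : forall j, x != p j.

(** On the boundary of a large rectangle filling almost the whole height of the strip, every factor
    satisfies [1 - |T| ^ 2 <= eta], where [eta = 1 - t ^ -2], equivalently [|T| >= 1 / t]. *)
Let rectangle t : 1 < t -> exists X y0, [/\ `|x| < X, 0 < y0 < d &
  forall x' y', - X <= x' <= X -> - y0 <= y' <= y0 ->
    (x' = - X \/ x' = X \/ y' = - y0 \/ y' = y0) ->
    forall j, T j (x' +i* y')%C != 0 /\ (cabs (T j (x' +i* y')%C))^-1 <= t].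
Proof.
move=> t1; have t0 : 0 < t := lt_trans ltr01 t1.
pose eta := 1 - t^-1 ^+ 2.
have ti1 : t^-1 < 1 by rewrite invf_lt1.
have ti0 : 0 < t^-1 by rewrite invr_gt0.
have eta0 : 0 < eta by rewrite subr_gt0 expr_lt1// ltW.
pose P := \sum_j `|p j|.
have P0 : 0 <= P by apply: sumr_ge0.
have pP j : `|p j| <= P by rewrite /P (bigD1 j)//= lerDl sumr_ge0.
(* P bounds all nodes, so the vertical sides are at distance at least [4 / (a * eta)] from each of
   them, which [ctanh_far_le] converts into eta. *)
pose X := P + `|x| + 1 + 4 / (a * eta).
have ae : 0 < a * eta by rewrite mulr_gt0.
have q0 : 0 < 4 / (a * eta) by rewrite divr_gt0.
(* The gap [d - y0] is at most [eta / (2 * a)], which is what [ctanh_top_le] needs on the horizontal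
   sides; the other term of the minimum keeps y0 positive. *)
pose y0 := d - Num.min (d / 2) (eta / (2 * a)).
have e0 : 0 < eta / (2 * a) by rewrite divr_gt0// mulr_gt0.
have m0 : 0 < Num.min (d / 2) (eta / (2 * a)) by rewrite lt_min e0 divr_gt0.
have md : Num.min (d / 2) (eta / (2 * a)) <= d / 2 by rewrite ge_min lexx.
have me : Num.min (d / 2) (eta / (2 * a)) <= eta / (2 * a) by rewrite ge_min lexx orbT.
have y00 : 0 < y0 < d.
  rewrite /y0 subr_gt0 (le_lt_trans md) ?gtrDl ?oppr_lt0//=.
  by rewrite ltr_pdivrMr// ltr_pMr// ltr1n.
have ltX : `|x| < X.
  apply: lt_le_trans (_ : P + `|x| + 1 <= _); last by rewrite lerDl ltW.
  by rewrite -addrA ltr_wpDl// ltrDl.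
exists X, y0; split => //.
move=> x' y' hx hy bd j; set z := (x' +i* y')%C.
have zd : strip d z.
  rewrite /strip /= ltr_norml; move: hy y00; clear => /andP[k1 k2] /andP[k3 k4].
  by rewrite (le_lt_trans k2 k4) andbT (lt_le_trans _ k1)// ltrN2.
have zpd := strip_subr (p j) zd.
have ReE : complex.Re (z - (p j)%:C) = x' - p j by rewrite Re_addc Re_oppc.
have ImE : complex.Im (z - (p j)%:C) = y' by rewrite Im_addc Im_oppc /= oppr0 addr0.
have far : `|x'| = X -> 1 - cabs (T j z) ^+ 2 <= eta.
  move=> xX.
  have h : 4 / (a * eta) <= `|x' - p j|.
    have := ler_normB (x' - p j) (- p j); rewrite opprK subrK xX normrN => k.
    apply: le_trans (_ : X - P <= _).
      by rewrite /X lerBrDl -!addrA lerD2l addrA lerDr addr_ge0.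
    by rewrite lerBlDr (le_trans k)// lerD2l.
  have n0 : 0 < `|x' - p j| by apply: lt_le_trans h.
  apply: le_trans (ctanh_far_le d0 zpd _ _) _; rewrite ?ReE -?normr_gt0//.
    by rewrite normr_gt0; apply: contraTneq n0 => h0; rewrite -ReE h0 normr0 ltxx.
  suff : 4 / (a * `|x' - p j|) <= eta by [].
  have swap (r s t' : R) : 0 < r -> 0 < s -> 0 < t' -> 4 / (r * s) <= t' -> 4 / (r * t') <= s.
    move=> ? ? ?; rewrite !ler_pdivrMr ?mulr_gt0// => k; apply: le_trans k _.
    by rewrite le_eqVlt; apply/orP; left; apply/eqP; ring.
  exact: swap.
have top : `|y'| = y0 -> 1 - cabs (T j z) ^+ 2 <= eta.
  move=> yy; apply: le_trans (ctanh_top_le d0 zpd) _.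
  rewrite ImE yy -/a /y0 opprB addrCA subrr addr0.
  have eE : 2 * (a * (eta / (2 * a))) = eta by field; exact: lt0r_neq0.
  by rewrite -[leRHS]eE ler_pM2l// ler_pM2l.
have X0 : 0 <= X := ltW (le_lt_trans (normr_ge0 x) ltX).
have y0' : 0 <= y0 by case/andP: y00 => /ltW.
have key : 1 - cabs (T j z) ^+ 2 <= eta.
  by case: bd => [e|[e|[e|e]]]; [apply: far|apply: far|apply: top|apply: top];
    rewrite e ?normrN ger0_norm.
have Tge : t^-1 <= cabs (T j z).
  rewrite -(ler_pXn2r (ltn0Sn 1)) ?nnegrE ?cabs_ge0 ?(ltW ti0)//.
  by move: key; rewrite /eta lerBlDl addrC -lerBlDl opprB addrC subrK.
have T0 : 0 < cabs (T j z) := lt_le_trans ti0 Tge.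
split; first by rewrite -cabs_gt0.
by rewrite -[leRHS]invrK lef_pV2 ?posrE.
Qed.

(** Stands in for the maximum principle: on the rectangle [|G m| <= exp (m V)], and the Cauchy
    constant C does not depend on m. If Re A exceeded V at x by eps, then
    [exp (m eps) |b x| ^ 2 <= C] for all m, which is absurd. *)
Let Re_A_real_le t : 1 < t -> complex.Re (A x%:C) <= B * t ^+ n + S * (t - t^-1).
Proof.
move=> t1; have [X [y0 [xX /andP[y00 y0d] bd]]] := rectangle t1.
set V := B * t ^+ n + _; rewrite leNgt; apply/negP => VA.
have xX' : - X < x < X by move: xX; rewrite ltr_norml.
have yy : - y0 < 0 < y0 by rewrite oppr_lt0 y00.
have [C C0 HC] := cauchy_estimate xX' yy.
have inst x' y' : - y0 <= y' <= y0 -> strip d (x' +i* y')%C.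
  by move=> /andP[k1 k2]; rewrite /strip /= ltr_norml; apply/andP; split; lra.
have est m : cabs (G m x%:C) <= C * expR (m%:R * V).
  apply: HC => [x' y' _ hy|x' y' hx hy hb]; first exact: cdiff_G (inst _ _ hy).
  have zd := inst x' y' hy; have Tb := bd x' y' hx hy hb.
  rewrite /G cabsM cabs_cexp cabsX.
  have ReE : complex.Re (m%:R * A (x' +i* y')%C) = m%:R * complex.Re (A (x' +i* y')%C).
    by rewrite -[m%:R]/(m%:R : R[i]) -(rmorph_nat (real_complex R)) Re_realM.
  rewrite ReE; apply: le_trans (_ : expR (m%:R * V) * 1 <= _); last by rewrite mulr1.
  apply: ler_pM; rewrite ?expR_ge0 ?exprn_ge0 ?cabs_ge0//.
    rewrite ler_expR ler_wpM2l//; apply: Re_A_le => // j; by have [] := Tb j.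
  rewrite expr_le1 ?cabs_ge0// /b cabs_prod; apply: prodr_ile1 => j _.
  by rewrite cabs_ge0 T_le1.
have b0 : 0 < cabs (b x%:C) ^+ 2.
  rewrite exprn_gt0// cabs_gt0; apply/prodf_neq0 => j _; apply: T_neq0 => //.
  by rewrite (inj_eq (@complexI _)).
set eps := complex.Re (A x%:C) - V.
have eps0 : 0 < eps by rewrite subr_gt0.
have est2 (m : nat) : (1 + m%:R * eps) * cabs (b x%:C) ^+ 2 <= C.
  have := est m; rewrite /G cabsM cabs_cexp cabsX.
  rewrite -(rmorph_nat (real_complex R)) Re_realM => h.
  apply: le_trans (_ : expR (m%:R * eps) * cabs (b x%:C) ^+ 2 <= _).
    by rewrite ler_pM2r// expR_ge1Dx.
  rewrite -(ler_pM2r (expR_gt0 (m%:R * V))); apply: le_trans h.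
  by rewrite mulrAC -expRD /eps mulrBr subrK.
(* The lower bound [1 + m * eps] of the exponential already exceeds the limit for this m. *)
have := est2 (Num.trunc (C / (eps * cabs (b x%:C) ^+ 2))).+1.
apply/negP; rewrite -ltNge.
have eb : 0 < eps * cabs (b x%:C) ^+ 2 by rewrite mulr_gt0.
have := truncnS_gt (C / (eps * cabs (b x%:C) ^+ 2)).
rewrite ltr_pdivrMr// mulrA => h; apply: lt_le_trans h _.
by rewrite ler_pM2r// lerDr.
Qed.

Lemma rotated_error_le : complex.Re (theta * (g x%:C / b x%:C
   - \sum_j c j * ((T j x%:C)^-1 - conjc (T j x%:C)))) <= B.
Proof.
rewrite -Re_A.
have lim : B * t ^+ n + S * (t - t^-1) @[t --> 1^'+] --> B * 1 ^+ n + S * (1 - 1^-1).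
  apply: cvgr_at_right_continuous; apply: cvgD.
    by apply: cvgMr; exact: exprn_continuous.
  by apply: cvgMr; apply: cvgB; [exact: cvg_id|apply: cvgV; [exact: oner_neq0|exact: cvg_id]].
rewrite expr1n mulr1 invr1 subrr mulr0 addr0 in lim.
apply: (cvgr_to_ge lim); near=> t; apply: Re_A_real_le.
near: t; exact: nbhs_right_gt.
Unshelve. all: by end_near. Qed.

End Rotation.

Let t j x := tanh (pi / (4 * d) * (x - p j)).

Let T_real j x : T j x%:C = (t j x)%:C.
Proof. by rewrite /T -rmorphB ctanh_real. Qed.

Lemma interpolation_error_off_nodes x : (forall j, x != p j) ->
  cabs (g x%:C - \sum_j g (p j)%:C *
     ((\prod_(i | i != j) t i x) / \prod_(i | i != j) t i (p j))%:C * (1 - t j x ^+ 2)%:C)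
  <= B * \prod_j `|t j x|.
Proof.
move=> xp.
pose h := g x%:C / b x%:C - \sum_j c j * ((T j x%:C)^-1 - conjc (T j x%:C)).
have T0 j : T j x%:C != 0.
  by apply: T_neq0 => //; rewrite (inj_eq (@complexI _)).
have b0 : b x%:C != 0 by apply/prodf_neq0 => j _; exact: T0.
have hB : cabs h <= B.
  case: (eqVneq h 0) => [->|h0]; first by rewrite cabs0.
  have ch0 : cabs h != 0 by rewrite cabs_eq0.
  (* This rotation makes the bounded real part equal to the modulus of h. *)
  have th1 : cabs (conjc h / (cabs h)%:C) = 1.
    by rewrite cabsM cabsV cabs_conj cabs_real ger0_norm ?cabs_ge0// divff.
  have := rotated_error_le th1 xp; rewrite -/h mulrAC [conjc h * h]mulrC mulc_conj.
  by rewrite -fmorphV -rmorphM expr2 mulfK.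
have bE' : cabs (b x%:C) = \prod_j `|t j x|.
  by rewrite /b cabs_prod; apply: eq_bigr => j _; rewrite T_real cabs_real.
rewrite -bE'.
have -> : g x%:C - \sum_j g (p j)%:C *
     ((\prod_(i | i != j) t i x) / \prod_(i | i != j) t i (p j))%:C * (1 - t j x ^+ 2)%:C = h * b x%:C.
  rewrite mulrBl divfK//; congr (_ - _); rewrite mulr_suml; apply: eq_bigr => j _.
  have bjr y : bj j y%:C = (\prod_(i | i != j) t i y)%:C.
    by rewrite real_prod; apply: eq_bigr => i _; exact: T_real.
  have cT : conjc (T j x%:C) = T j x%:C by rewrite T_real; apply: complex_ext => //=; rewrite oppr0.
  have E1 : (1 - t j x ^+ 2)%:C = 1 - T j x%:C * T j x%:C.
    by rewrite T_real -rmorphM -expr2 rmorphB.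
  have E2 : (\prod_(i | i != j) t i x / \prod_(i | i != j) t i (p j))%:C =
      bj j x%:C / bj j (p j)%:C.
    by rewrite !bjr -fmorphV -rmorphM.
  rewrite E1 E2 cT /c (bE j); have := T0 j.
  move: (T j x%:C) (bj j x%:C) (bj j (p j)%:C)^-1 (g (p j)%:C) => Tj P Q H Tj0.
  rewrite (_ : _ * (Tj * P) = H * Q * P * (Tj^-1 * Tj - Tj * Tj)); last by ring.
  by rewrite mulVf//; ring.
by rewrite cabsM ler_wpM2r ?cabs_ge0.
Qed.

(** The argument off the nodes divides by b; at a node interpolation is exact and both sides
    vanish. *)
Lemma interpolation_error x :
  cabs (g x%:C - \sum_j g (p j)%:C *
     ((\prod_(i | i != j) t i x) / \prod_(i | i != j) t i (p j))%:C * (1 - t j x ^+ 2)%:C)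
  <= B * \prod_j `|t j x|.
Proof.
case: (pselect (exists k, x = p k)) => [[k ->]|h]; last first.
  by apply: interpolation_error_off_nodes => j; apply/eqP => xj; apply: h; exists j.
have tkk i : t i (p i) = 0 by rewrite /t subrr mulr0 tanh0.
rewrite (bigD1 k)//= [\sum_(i | _) _]big1 => [|j jk]; last first.
  have -> : \prod_(i | i != j) t i (p k) = 0.
    by apply/eqP; rewrite prodf_seq_eq0; apply/hasP; exists k; rewrite ?mem_index_enum//= eq_sym jk tkk eqxx.
  by rewrite !(mulr0, mul0r).
have p0 : \prod_(i | i != k) t i (p k) != 0.
  apply/prodf_neq0 => i ik; rewrite /t tanh_neq0// mulf_neq0//.
    by rewrite gt_eqF// divr_gt0 ?pi_gt0// mulr_gt0.
  by rewrite subr_eq0 (inj_eq p_inj) eq_sym.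
rewrite divff// tkk expr0n/= subr0 !mulr1 addr0 subrr cabs0.
by rewrite mulr_ge0// prodr_ge0.
Qed.
End Interpolation.

(** * Error of the approximant *)

Section Link.
Variable R : realType.
Local Notation mu := (@lebesgue_measure R).
Implicit Types (x y : R).

Lemma measurable_off (f g : R -> R) (c : R) : measurable_fun setT g ->
  (forall x, x != c -> f x = g x) -> measurable_fun setT f.
Proof.
move=> mg fg.
have -> : f = (fun x => g x + (f c - g c) * \1_[set c] x).
  apply/funext => x; rewrite indicE; case: (eqVneq x c) => [->|xc].
    by rewrite mem_set// mulr1 addrC subrK.
  by rewrite memNset ?mulr0 ?addr0 ?fg// => /eqP; apply/negP.
by apply: measurable_funD => //; apply: measurable_funM.
Qed.

Variables (d al : R) (q q1 q2 q3 : R -> R).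
Hypotheses (d0 : 0 < d) (al0 : 0 < al).
Hypothesis Dq : forall x, is_derive x 1 q (q1 x).
Hypothesis Dq1 : forall x, is_derive x 1 q1 (q2 x).
Hypothesis Dq2 : forall x, is_derive x 1 q2 (q3 x).
Hypothesis cq3 : continuous q3.
Hypothesis qN : forall x, q (- x) = q x.
Hypothesis qt : forall x y, q x + q1 x * (y - x) <= q y.
Let a := pi / (2 * d).
Let a0 : 0 < a. Proof. by rewrite divr_gt0 ?pi_gt0// mulr_gt0. Qed.
Let B := q1 al / a.
Local Notation u := (pot d al q q1).
Let q1E : q1 al = a * B. Proof. by rewrite /B mulrC divfK// gt_eqF. Qed.
Let cq1 : continuous q1. Proof. by move=> x; exact: is_derive_continuous (Dq1 x). Qed.
Let cq : continuous q. Proof. by move=> x; exact: is_derive_continuous (Dq x). Qed.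
Let cu : continuous u. Proof. by move=> x; exact: (continuous_pot Dq). Qed.
Let iu := integrable_pot d0 al0 Dq qN qt.
Let aal : - al <= al. Proof. by rewrite lerNl (le_trans _ (ltW al0))// oppr_le0 ltW. Qed.

Lemma integral_pot : \int[mu]_x u x =
  \int[mu]_(x in `[- al, al]) (x * q1 x) + 2 * B * (al + a^-1).
Proof.
have an0 : a != 0 := lt0r_neq0 a0.
pose F x := - (B / a) * expR (- (a * (x - al))).
have ci x y : mu.-integrable `[x, y] (EFin \o u).
  by apply: continuous_integrable => s _; exact: cu.
have c1 : continuous (fun x => x * q1 x).
  by move=> x; apply: cvgM; [exact: cvg_id|exact: cq1].
have Ein : \int[mu]_(x in `[- al, al]) u x =
    \int[mu]_(x in `[- al, al]) (x * q1 x) + 2 * B * al.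
  pose f x := (q al - q x + B) - x * q1 x.
  have cf : continuous f.
    move=> x; apply: cvgB; last exact: c1.
    by apply: cvgD; [apply: cvgB; [exact: cvg_cst|exact: cq]|exact: cvg_cst].
  rewrite (@eq_Rintegral _ _ R mu _ (fun x => 1 * f x + 1 * (x * q1 x))); last first.
    move=> x; rewrite inE /= in_itv/= -ler_norml => xa.
    by rewrite (potE_in d q1 qN xa) -/a -/B /f; ring.
  rewrite Rintegral_lin2//; last 2 first.
  - by apply: continuous_integrable => x _; exact: cf.
  - by apply: continuous_integrable => x _; exact: c1.
  have -> : \int[mu]_(x in `[- al, al]) f x =
     al * (q al - q al + B) - (- al) * (q al - q (- al) + B).
    apply: (@Rintegral_FTC R f (fun x => x * (q al - q x + B)));
      [exact: aal|by move=> x _; exact: cf|].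
    move=> x _; have dq := Dq x; apply: is_derive_eq; rewrite /GRing.scale/= /f; ring.
  by rewrite qN; ring.
have Eout n : al <= n -> \int[mu]_(x in `[al, n]) u x = F n - F al.
  move=> an.
  have cE : continuous (fun x => B * expR (- (a * (x - al)))).
    move=> x; apply: cvgMr.
    have h : {for x, continuous (fun x : R => - (a * (x - al)))}.
      by apply: cvgN; apply: cvgMr; apply: cvgB; [exact: cvg_id|exact: cvg_cst].
    exact: (continuous_comp h (@continuous_expR R _)).
  rewrite (@eq_Rintegral _ _ R mu _ (fun x => B * expR (- (a * (x - al))))); last first.
    move=> x; rewrite inE /= in_itv/= => /andP[x1 x2].
    have xn : `|x| = x by rewrite ger0_norm// (le_trans (ltW al0)).
    by rewrite potE_out xn.
  apply: Rintegral_FTC; [exact: an|by move=> x _; exact: cE|].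
  move=> x _; rewrite /F; apply: is_derive_eq; rewrite /GRing.scale/=.
  by move: an0; move: a (B) => b B' b0; field.
have h1 := integrable_truncate iu.
have limF : F n%:R @[n --> \oo] --> - (B / a) * 0.
  apply: cvgMr.
  have E : (fun n : nat => expR (- (a * (n%:R - al)))) = (fun n : nat => expR (a * al) * expR (- (a * n%:R))).
    by apply/funext => n; rewrite -expRD; congr expR; ring.
  rewrite E -(mulr0 (expR (a * al))); apply: cvgMr.
  apply: (cvg_comp (fun n : nat => a * n%:R) (fun x => expR (- x)) _ (@cvgr_expR R)).
  exact: (cvg_comp (fun n : nat => (n%:R : R)) (fun x => a * x) (@cvgr_idn R) (cvgryM a0)).
have h2 : \int[mu]_(x in `[- n%:R, n%:R]) u x @[n --> \oo]
    --> \int[mu]_(x in `[- al, al]) u x + 2 * (- (B / a) * 0 - F al).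
  have : (\int[mu]_(x in `[- al, al]) u x + 2 * (F n%:R - F al)) @[n --> \oo]
    --> \int[mu]_(x in `[- al, al]) u x + 2 * (- (B / a) * 0 - F al).
    by apply: cvgD; [exact: cvg_cst|apply: cvgMr; apply: cvgB; [exact: limF|exact: cvg_cst]].
  apply: cvg_trans; apply: near_eq_cvg; near=> n.
  have an : al <= n%:R by near: n; exact: nbhs_infty_ger.
  have [H1 _ _] := primitive0_even_half cu (pot_even d al q q1) (le_trans (ltW al0) an).
  have [H2 _ _] := primitive0_even_half cu (pot_even d al q q1) (ltW al0).
  have H3 := @Rintegral_cat _ u 0 n%:R al (ltW al0) an (ci _ _).
  rewrite H1 H2 (Eout _ an) in H3; lra.
have -> : \int[mu]_x u x = _ := cvg_unique _ h1 h2.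
rewrite Ein.
have -> : F al = - (B / a) by rewrite /F subrr mulr0 oppr0 expR0 mulr1.
by field.
Unshelve. all: by end_near. Qed.

(** Recovers the explicit second term of [nu_hat]: it is the joint contribution of the level B
    inside [[- al, al]] and of the two exponential tails of [pot]. *)
Lemma chat_pot (omega : R) : omega != 0 -> chat d u omega =
  (pi * tanh (d * omega))^-1 * (Jint al q1 omega + 4 * d * q1 al *
     ((pi * sin (al * omega) + 2 * d * omega * cos (al * omega)) / (pi ^+ 2 + 4 * d ^+ 2 * omega ^+ 2))).
Proof.
move=> om0; have p0 := pi_gt0 R.
have t0 : tanh (d * omega) != 0 by rewrite tanh_neq0// mulf_neq0// gt_eqF.
have pt0 : pi * tanh (d * omega) != 0 by rewrite mulf_neq0// gt_eqF.
apply: (mulIf pt0); rewrite chatE// [RHS]mulrC mulVKf//.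
rewrite (cosT_pot d0 al0 Dq Dq1 qN qt om0) [al * omega]mulrC.
have D0 := poisson_den omega a0.
set s := sin _; set c := cos _; set J := Jint _ _ _.
have D1 : 0 < pi ^+ 2 + 4 * d ^+ 2 * omega ^+ 2.
  have D2 : 0 <= 4 * d ^+ 2 * omega ^+ 2 by rewrite mulr_ge0 ?sqr_ge0// mulr_ge0 ?sqr_ge0.
  by rewrite ltr_pwDl// exprn_gt0.
have pn0 : pi != 0 :> R := lt0r_neq0 p0.
have dn0 : d != 0 := lt0r_neq0 d0.
move: D0; rewrite /a; move: pn0 D1; move: (pi : R) (q1 al) => p Q pn0 D1 D0.
field; rewrite om0 dn0 pn0 gt_eqF//=.
Qed.

Variable w : R[i] -> R[i].
Hypothesis q1w : forall x, q1 x = - dlog w x.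

Lemma nu_hatE (omega : R) : omega != 0 -> nu_hat d w al omega = (chat d u omega)%:C.
Proof.
move=> om0; rewrite chat_pot//.
have cc (f : R -> R) : continuous f -> continuous (fun x => q1 x * f (omega * x)).
  by move=> cf x; apply: cvgM; [exact: cq1|exact: continuous_scale].
have CE : Cintegral `[- al, al] (fun x => (dlog w x)%:C * expi (- (omega * x))) =
    'i%C * (Jint al q1 omega)%:C.
  apply: complex_ext; rewrite ?Re_mulc ?Im_mulc /= ?(mul0r, mulr0, mul1r, subr0, add0r, addr0).
  - rewrite (@eq_Rintegral _ _ R mu _ (fun x => -1 * (q1 x * cos (omega * x)))); last first.
      by move=> x _; rewrite cosN q1w; ring.
    have cqc := cc _ (@continuous_cos R).
    rewrite RintegralZl//; last by apply: continuous_integrable => x _; exact: cqc.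
    rewrite (Rintegral_odd (ltW al0) cqc) ?mulr0 ?oppr0// => x.
    by rewrite (even_derive_odd Dq qN) mulrN cosN mulNr.
  - apply: eq_Rintegral => x _.
    by rewrite sinN q1w; ring.
rewrite /nu_hat CE.
set T := tanh _; set J := Jint _ _ _; set Z := (_ / (_ * T)).
have ->: ('i%C * (pi * T)%:C)^-1 * ('i%C * J%:C) = ((pi * T)^-1 * J)%:C :> R[i].
  have i0 : 'i%C != 0 :> R[i] by rewrite -cabs_eq0 cabs_i oner_eq0.
  by rewrite invfM mulrACA mulVf// mul1r -fmorphV -rmorphM.
rewrite -rmorphB; congr (_%:C).
rewrite q1w /Z; set Y := pi ^+ 2 + _; rewrite (invfM Y T) (invfM pi T).
by move: (pi : R)^-1 T^-1 Y^-1 => pi' T' Y'; ring.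
Qed.

(** At [omega = 0] the function [nu_hat] has the default value of its divisions, so the integrands
    agree off this point only, which leaves the integral unchanged. *)
Lemma charge_inv_fourier (nu : R -> R) x : (nu x)%:C = inv_fourier (nu_hat d w al) x ->
  nu x = charge d u x.
Proof.
have [K decay] := pot_decay d0 al0 Dq qN qt Dq1 Dq2 cq3.
have ichat := integrable_chat d0 iu decay.
move=> /(congr1 (@complex.Re R)); rewrite /inv_fourier Re_realM /= => ->.
rewrite /charge mulrC; congr (_ / _).
have mg := integrable_measurable (integrable_cosT x ichat).
have fg omega : omega != 0 -> complex.Re (nu_hat d w al omega * expi (omega * x)) =
    chat d u omega * cos (x * omega).
  by move=> om0; rewrite nu_hatE// Re_realM /= [x * _]mulrC.
exact: eq_Rintegral_except (measurable_off mg fg) mg fg.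
Qed.

Lemma integral_pot_alpha (N : nat) : alpha_equation d w N al ->
  \int[mu]_x u x = pi * d * (2 * N.+1%:R).
Proof.
rewrite /alpha_equation => <-; rewrite integral_pot; have p0 := pi_gt0 R.
have pn0 : pi != 0 :> R := lt0r_neq0 p0.
have dn0 : d != 0 := lt0r_neq0 d0.
have -> : \int[mu]_(x in `[- al, al]) (x * dlog w x) = - \int[mu]_(x in `[- al, al]) (x * q1 x).
  rewrite (@eq_Rintegral _ _ R mu _ (fun x => -1 * (x * q1 x))); last first.
    by move=> x _; rewrite q1w; ring.
  rewrite RintegralZl ?mulN1r//.
  by apply: continuous_integrable => x _; apply: cvgM; [exact: cvg_id|exact: cq1].
have -> : dlog w al = - q1 al by rewrite q1w opprK.
rewrite /B /a; set J := \int[mu]_(x in _) _; set Q := q1 al.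
by move: pn0; move: (pi : R) J => p J pn0; field; rewrite pn0 dn0.
Qed.

End Link.

Section Approximation.
Variables (R : realType) (d : R) (w : R[i] -> R[i]).
Lemma sampling_primitive N alpha nu a (k : 'I_N.*2.+1) : procedure d w N alpha nu a ->
  primitive0 nu (sampling_point a k) = k%:R - N%:R.
Proof.
case=> _ _ _ _ pts; have := pts (k%:Z - N%:Z).
have -> : - N%:Z <= k%:Z - N%:Z <= N%:Z by have := ltn_ord k; lia.
by case=> // _; rewrite rmorphB.
Qed.

Lemma sampling_point_inj N alpha nu a : procedure d w N alpha nu a ->
  injective (@sampling_point R N a).
Proof.
move=> pr i j /(congr1 (primitive0 nu)).
rewrite !(sampling_primitive _ pr) => /addIr/eqP; rewrite eqr_nat => /eqP.
exact: val_inj.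
Qed.

Hypotheses (d0 : 0 < d) (ww : weight d w).

Lemma weighted_product_le N alpha nu a (M del x : R) : procedure d w N alpha nu a ->
  (forall x, `|x| <= alpha -> `|nu x| <= M) -> 0 < del ->
  realw w x * \prod_(j < N.*2.+1) `|tanh (pi / (4 * d) * (x - sampling_point a j))| <=
  expR (2 * M * del) / tanh (pi / (4 * d) * del) * expR (- Kstar d w alpha).
Proof.
move=> pr nuM del0; have p0 := pi_gt0 R.
have a4 : 0 < pi / (4 * d) by rewrite divr_gt0// mulr_gt0.
have wx : 0 < realw w x by have [] := weightP x ww.
have rhs0 : 0 <= expR (2 * M * del) / tanh (pi / (4 * d) * del) * expR (- Kstar d w alpha).
  by rewrite mulr_ge0 ?expR_ge0// divr_ge0 ?expR_ge0// ltW// tanh_gt0// mulr_gt0.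
case: (pselect (exists k : 'I_N.*2.+1, x = sampling_point a k)) => [[k xk]|h].
  by rewrite (bigD1 k)//= {2}xk subrr mulr0 tanh0 normr0 mul0r mulr0.
have xp (k : 'I_N.*2.+1) : x != sampling_point a k.
  by apply/eqP => xk; apply: h; exists k.
have [[[al0 alE] _] nuE inc _ _] := pr.
have [q2 [q3 [Dq Dq1 Dq2 cq3]]] := weight_regular d0 ww.
pose q y := - ln (realw w y); pose q1 y := - dlog w y.
have qN y : q (- y) = q y.
  by case: ww => _ ev _; rewrite /q /realw ev.
have qt y z : q y + q1 y * (z - y) <= q z.
  by case: ww => _ _ cvx; exact: convex_tangent.
have q1w y : q1 y = - dlog w y by [].
have [K decay] := pot_decay d0 al0 Dq qN qt Dq1 Dq2 cq3.
have cu : continuous (pot d alpha q q1) by move=> y; exact: (continuous_pot Dq).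
have iu := integrable_pot d0 al0 Dq qN qt.
have nuC : nu = charge d (pot d alpha q q1).
  apply/funext => y; exact: (charge_inv_fourier d0 al0 Dq Dq1 Dq2 cq3 qN qt q1w).
have bnd := charge_bounds d0 al0 Dq qN qt Dq1 Dq2 cq3.
rewrite -nuC in bnd; have {}bnd := bnd _ inc nuM; rewrite nuC in bnd.
have mass : \int[@lebesgue_measure R]_y pot d alpha q q1 y <= pi * d * (2 * N.+1%:R).
  by rewrite (integral_pot_alpha d0 al0 Dq Dq1 qN qt q1w alE).
have pE (k : 'I_N.*2.+1) : primitive0 (charge d (pot d alpha q q1)) (sampling_point a k) = k%:R - N%:R.
  by rewrite -nuC; exact: sampling_primitive pr.
have := potential_discretized d0 cu (pot_even d alpha q q1) iu decay bnd mass pE del0 xp.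
have a2 : pi / (2 * d) / 2 = pi / (4 * d) by field; rewrite gt_eqF.
rewrite a2; set S := \sum_(k < _) _ => H.
have tx (k : 'I_N.*2.+1) : 0 < tanh (pi / (4 * d) * `|x - sampling_point a k|).
  by rewrite tanh_gt0// mulr_gt0// normr_gt0 subr_eq0.
have prodE : \prod_(j < N.*2.+1) `|tanh (pi / (4 * d) * (x - sampling_point a j))| = expR S.
  rewrite /S expR_sum; apply: eq_bigr => k _; rewrite lnK ?posrE//.
  have [t0|t0] := ger0P (x - sampling_point a k).
    by rewrite ger0_norm// -(ger0_norm t0) ltW.
  by rewrite -normrN -tanhN -mulrN ger0_norm// -(ltr0_norm t0) ltW.
have wE : realw w x = expR (- q x) by rewrite /q opprK lnK ?posrE.
have tE : tanh (pi / (4 * d) * del) = expR (ln (tanh (pi / (4 * d) * del))).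
  by rewrite lnK// posrE tanh_gt0// mulr_gt0.
rewrite prodE wE -expRD tE -expRN -expRD -expRD ler_expR.
(* The constant [Kstar] is the level [q alpha + B] of [pot_add_ge]. *)
have KE : Kstar d w alpha = q alpha + q1 alpha / (pi / (2 * d)).
  rewrite /Kstar /q /q1; congr (_ + _).
  by move: (dlog w alpha) (lt0r_neq0 p0) => L; move: (pi : R) => p pn0; field; rewrite pn0 gt_eqF.
have : Kstar d w alpha <= pot d alpha q q1 x + q x.
  by rewrite KE; exact: (pot_add_ge d0 al0 Dq qN qt).
lra.
Qed.

Lemma approximant_error N (a : int -> R) (f : R[i] -> R[i]) (B x : R) :
  injective (@sampling_point R N a) -> analytic_on (strip d) f ->
  (forall z, strip d z -> cabs (f z / w z) <= B) ->
  cabs (f x%:C - approximant d w N a f x) <=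
  B * (realw w x * \prod_(j < N.*2.+1) `|tanh (pi / (4 * d) * (x - sampling_point a j))|).
Proof.
move=> inj_p af fB; case: (ww) => [[[aw _ _ _] wn0 _] _ _].
have gd z : strip d z -> cdiff (fun z => f z / w z) z.
  move=> zd; have [l hf] := derivable_hder (af z zd); have [k hw] := derivable_hder (aw z zd).
  by apply: cdiffM; [exists l|apply: cdiffV; [exact: wn0|exists k]].
have := interpolation_error d0 inj_p gd fB x.
have sx y : strip d y%:C by rewrite /strip /= normr0.
have wC y : w y%:C = (realw w y)%:C by have [] := weightP y ww.
have wx : 0 < realw w x by have [] := weightP x ww.
set P := \prod_(j < _) _; set Sm := \sum_(j < _) _ => H.
have -> : f x%:C - approximant d w N a f x = w x%:C * (f x%:C / w x%:C - Sm).
  rewrite mulrBr mulrCA mulfV ?mulr1; last exact: wn0.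
  congr (_ - _); rewrite /approximant /Sm mulr_sumr; apply: eq_bigr => j _.
  set pj := sampling_point a j; set Pj := \prod_(i < _ | _) _; set Qj := \prod_(i < _ | _) _.
  (* The identity [sech ^ 2 = 1 - tanh ^ 2] turns the basis function of the approximant into the
     factor [1 - t j x ^+ 2] of the interpolation formula. *)
  have -> : sech (pi / (4 * d) * (pj - x)) ^+ 2 = 1 - tanh (pi / (4 * d) * (x - pj)) ^+ 2.
    have -> : pi / (4 * d) * (pj - x) = - (pi / (4 * d) * (x - pj)) by ring.
    rewrite /sech /tanh opprK expRN.
    have := expR_gt0 (pi / (4 * d) * (x - pj)); move: (expR _) => e e0.
    have h1 : e ^+ 2 + 1 != 0 by rewrite gt_eqF// addr_gt0// exprn_gt0.
    have h2 : e != 0 by rewrite gt_eqF.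
    have h3 : 1 + e ^+ 2 != 0 by rewrite addrC.
    by field; rewrite ?h1 ?h2 ?h3.
  rewrite rmorphM fmorphV /= invfM; move: (w x%:C) (w pj%:C)^-1 (Qj%:C)^-1 => W V Q.
  by ring.
have wE : cabs (w x%:C) = realw w x by rewrite wC cabs_real gtr0_norm.
by rewrite cabsM wE mulrCA ler_pM2l.
Qed.

End Approximation.

Theorem theorem5p2 (R : realType) (d : R) (w : R[i] -> R[i])
    (alpha : nat -> R) (nu : nat -> R -> R) (a : nat -> int -> R)
    (c lam : R) :
  0 < d ->
  weight d w ->
  (forall N, (0 < N)%N -> procedure d w N (alpha N) (nu N) (a N)) ->
  0 < c -> 0 < lam ->
  (forall N, (0 < N)%N ->
    (ereal_sup [set (`|nu N x|)%:E | x in `[(- alpha N)%R, alpha N]]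
      <= (c * N%:R `^ lam)%:E)%E) ->
  exists C c' : R,
    \forall N \near \oo, forall f : R[i] -> R[i], hardy_space d w f ->
      (ereal_sup [set (cabs (f x%:C%C - approximant d w N (a N) f x))%:E
                 | x in [set: R]]
        <= C%:E * hardy_norm d w f
           * (N%:R `^ c' * expR (- Kstar d w (alpha N)))%:E)%E.
Proof.
move=> d0 ww proc c0 lam0 nu_le; have p0 := pi_gt0 R.
pose b := pi / (4 * d); have b0 : 0 < b by rewrite divr_gt0// mulr_gt0.
(* With [M = c N ^ lam] and the cut [del = N ^ - lam], the term [exp (2 M del)] is [exp (2 c)], and
   [y <= (1 + y) tanh y] gives [1 / tanh (b del) <= (1 + b) / b * N ^ lam]; hence the exponent
   [c' = lam]. *)
exists (expR (2 * c) * ((1 + b) / b)), lam.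
exists 1%N => // N /= N1 f [af fB].
have pr := proc N N1.
have sx : strip d (0 : R[i]) by rewrite /strip /= normr0.
have Hub z : strip d z -> ((cabs (f z / w z))%:E <= hardy_norm d w f)%E.
  by move=> zd; apply: ereal_sup_ubound; exists z.
have H0 : (0 <= hardy_norm d w f)%E.
  by apply: le_trans (Hub _ sx); rewrite lee_fin cabs_ge0.
have fin : hardy_norm d w f \is a fin_num by rewrite ge0_fin_numE.
set B := fine (hardy_norm d w f).
have BE : hardy_norm d w f = B%:E by rewrite /B fineK.
have B0 : 0 <= B by rewrite -lee_fin -BE.
have fBz z : strip d z -> cabs (f z / w z) <= B by move=> /Hub; rewrite BE lee_fin.
have nuM x : `|x| <= alpha N -> `|nu N x| <= c * N%:R `^ lam.
  move=> xa; rewrite -lee_fin; apply: le_trans (nu_le N N1); apply: ereal_sup_ubound.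
  by exists x => //=; rewrite in_itv/= -ler_norml.
have n1 : 1 <= N%:R `^ lam :> R.
  have N1R : 1 <= N%:R :> R by rewrite ler1n.
  by have := ler_powR N1R (ltW lam0); rewrite powRr0.
have n0 : 0 < N%:R `^ lam :> R := lt_le_trans ltr01 n1.
rewrite BE -!EFinM; apply: ge_ereal_sup => _ [x _ <-]; rewrite lee_fin.
apply: le_trans (@approximant_error R d w d0 ww N (a N) f B x (sampling_point_inj pr) af fBz) _.
have del0 : 0 < (N%:R `^ lam)^-1 :> R by rewrite invr_gt0.
have := @weighted_product_le R d w d0 ww N _ _ _ _ _ x pr nuM del0; rewrite -/b.
set P := realw w x * _; set E := expR (- _); set n := N%:R `^ lam in n0 n1 del0 * => H.
have E0 : 0 <= E := expR_ge0 _.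
have cE : 2 * (c * n) * n^-1 = 2 * c by field; rewrite gt_eqF.
rewrite cE in H.
have tb : (tanh (b * n^-1))^-1 <= (1 + b) / b * n.
  have y0 : 0 < b * n^-1 by rewrite mulr_gt0.
  have t0 := tanh_gt0 y0; have tg := tanh_ge (ltW y0).
  have bn : b * n^-1 <= b by rewrite ler_piMr ?(ltW b0)// invf_le1.
  rewrite -[leLHS]mul1r ler_pdivrMr//.
  have -> : (1 + b) / b * n * tanh (b / n) = ((1 + b) * tanh (b / n)) / (b * n^-1).
    by field; rewrite !gt_eqF.
  rewrite ler_pdivlMr// mul1r; apply: le_trans tg _.
  by rewrite ler_pM2r// lerD2l.
have PE : P <= expR (2 * c) * ((1 + b) / b) * (n * E).
  apply: le_trans H _; rewrite [leRHS]mulrA ler_wpM2r// -mulrA ler_wpM2l ?expR_ge0//.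
rewrite [leRHS](_ : _ = B * (expR (2 * c) * ((1 + b) / b) * (n * E))); last by ring.
exact: ler_wpM2l.
Qed.
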